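(* Let $\alpha\ge1$, let $q:\mathbb{R}\to\mathbb{R}$ satisfy $\int_{-\infty}^\infty|q(x)|(1+|x|)^\alpha dx<\infty$, and let $R$ be the reflection coefficient of $q$. Suppose $R(\rho)=T_+(\rho)G_-(\rho)$, where $T_+\in H_\infty^+(\mathbb{R})$ and $$G_-(\rho)=\frac{1}{2i\rho}\int_0^\infty q(s)e^{-2is\rho}ds+\frac{1}{(2i\rho)^2}\int_0^\infty Q'(s)e^{-2is\rho}ds,$$ with $Q$ an absolutely continuous function satisfying $|Q'(s)|\le C_1|q(s)|+C_2\int_s^\infty|q(u)|du$ with constants $C_1,C_2$ independent of $s$. Let $t>0$ and, for $x\in\mathbb{R}$, let $\varphi(\rho)=\varphi(\rho,x)=R(\rho)e^{8it\rho^3+2ix\rho}$. Then the solution $y(\rho,x)$ of the equation $$\left((I+\mathbf{H}(\varphi))y\right)(\rho)=-\mathbf{H}(\varphi)(1)(\rho)$$ satisfies $$\frac{\partial^ky(\rho,x)}{\partial x^k}\in L_2^+(\mathbb{R})\quad\text{(as a function of }\rho\text{)}\qquad\text{for }k=0,1,\ldots,\lfloor2\alpha\rfloor.$$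
   Context: $H_\infty^+(\mathbb{R})$ is the set of (boundary values of) bounded analytic functions in the upper half-plane; $L_2^+(\mathbb{R})$ is the Hardy space of $L_2(\mathbb{R})$ boundary values of functions analytic in the upper half-plane; $\lfloor\cdot\rfloor$ is the integer part. Reflection coefficient: for real $\rho$ let $e(\rho,x)$, $g(\rho,x)$ be the Jost solutions of $-y''+q(x)y=\rho^2y$, i.e. the solutions with $e(\rho,x)=e^{i\rho x}(1+o(1))$, $e'(\rho,x)=i\rho e^{i\rho x}(1+o(1))$ as $x\to+\infty$ and $g(\rho,x)=e^{-i\rho x}(1+o(1))$, $g'(\rho,x)=-i\rho e^{-i\rho x}(1+o(1))$ as $x\to-\infty$. With $W[f,h]=fh'-f'h$ set $a(\rho)=-\frac{1}{2i\rho}W[e(\rho,\cdot),g(\rho,\cdot)]$ and $b(\rho)=\frac{1}{2i\rho}W[e(\rho,\cdot),g(-\rho,\cdot)]$. Then $R(\rho)=s^+(\rho)=-\frac{b(-\rho)}{a(\rho)}$. The Hankel operator with symbol $\varphi$ is $$(\mathbf{H}(\varphi)y)(\rho)=\lim_{\varepsilon\to0+}\frac{1}{2\pi i}\int_{-\infty}^\infty\frac{\varphi(\tau)y(\tau)}{\tau+\rho+i\varepsilon}\,d\tau,\qquad\rho\in\mathbb{R},$$ and $\mathbf{H}(\varphi)(1)$ is given by the same formula with $y\equiv1$. Under these conditions it is known that the equation is uniquely solvable in $L_2^+(\mathbb{R})$; $y(\cdot,x)$ denotes this unique solution. *)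

(* Defs.v *)
From HB Require Import structures.
From mathcomp Require Import all_boot all_order all_algebra.
From mathcomp Require Import complex.
From mathcomp Require Import all_classical all_reals all_analysis.

Set Implicit Arguments.
Unset Strict Implicit.
Unset Printing Implicit Defensive.

Import Order.TTheory GRing.Theory Num.Theory.
Import numFieldNormedType.Exports.

Local Open Scope classical_set_scope.
Local Open Scope ring_scope.
Local Open Scope complex_scope.

(* The topology of C = R[i] is reached through R[i]^o; R[i] itself carries no
   topological structure. *)

(* Num also defines Re and Im; these are the R-valued ones. *)
Local Notation Re := complex.Re.
Local Notation Im := complex.Im.

Section complex_valued_functions.
Variable R : realType.
Implicit Types (f : R -> R[i]) (A : set R).

Let mu := @lebesgue_measure R.

Definition expi (theta : R) : R[i] := cos theta +i* sin theta.

Definition cmod (z : R[i]) : R := ComplexField.Normc.normc z.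

(* Derivatives of functions of a real variable are taken componentwise. *)
Definition cderivable f (x : R) : Prop :=
  derivable (fun u => Re (f u)) x 1 /\ derivable (fun u => Im (f u)) x 1.

Definition cderive f (x : R) : R[i] :=
  derive1 (fun u => Re (f u)) x +i* derive1 (fun u => Im (f u)) x.

Definition cintegral A f : R[i] :=
  Rintegral mu A (fun u => Re (f u)) +i* Rintegral mu A (fun u => Im (f u)).

(* The intervals [u i, v i], i < n, are listed from left to right and do not
   overlap. *)
Definition absolutely_continuous (a b : R) f : Prop :=
  forall eps : R, 0 < eps -> exists2 delta : R, 0 < delta &
    forall (n : nat) (u v : nat -> R),
      (forall i, (i < n)%N -> a <= u i /\ u i <= v i /\ v i <= b) ->
      (forall i, (i.+1 < n)%N -> v i <= u i.+1) ->
      \sum_(i < n) (v i - u i) < delta ->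
      \sum_(i < n) cmod (f (v i) - f (u i)) < eps.

Definition L2 f : Prop :=
  (fun u => Re (f u)) \in Lfun mu 2%:E /\ (fun u => Im (f u)) \in Lfun mu 2%:E.

Definition L2norm f : \bar R := 'N[mu]_2%:E[EFin \o (fun u => cmod (f u))].

End complex_valued_functions.

Section hardy_spaces.
Variable R : realType.
Implicit Types (f : R -> R[i]) (F : R[i] -> R[i]).

Let mu := @lebesgue_measure R.

Definition analytic_upper F : Prop :=
  forall z : R[i], 0 < Im z -> derivable (F : R[i]^o -> R[i]^o) z 1.

(* Almost every vertical limit; for bounded and for square-integrable analytic
   functions these agree almost everywhere with the nontangential limits. *)
Definition boundary_value F f : Prop :=
  {ae mu, forall rho,
    (F (rho +i* eta) : R[i]^o) @[eta --> (0 : R)^'+] --> (f rho : R[i]^o)}.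

Definition Hinf_plus f : Prop :=
  exists F, [/\ analytic_upper F,
    exists M : R, forall z, 0 < Im z -> cmod (F z) <= M &
    boundary_value F f].

Definition L2_plus f : Prop :=
  L2 f /\
  exists F, [/\ analytic_upper F,
    exists M : R, forall eta : R, 0 < eta ->
      (L2norm (fun xi => F (xi +i* eta)) <= M%:E)%E &
    boundary_value F f].

End hardy_spaces.

Section scattering.
Variable R : realType.
Implicit Types (q : R -> R) (f h : R -> R[i]) (e g : R -> R -> R[i]).

Let mu := @lebesgue_measure R.

(* Since q is only locally integrable, solutions of -f'' + q f = rho^2 f are
   understood in the sense of Caratheodory. *)
Definition schrodinger_solution q (rho : R) f : Prop :=
  [/\ forall x, cderivable f x,
      forall a b, absolutely_continuous a b (cderive f) &
      {ae mu, forall x, cderivable (cderive f) x /\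
        - cderive (cderive f) x + (q x)%:C * f x = (rho ^+ 2)%:C * f x}].

(* f(x) = A(x) (1 + o(1)) is written f(x) / A(x) --> 1. *)
Definition jost_right q e : Prop :=
  forall rho : R, rho != 0 ->
  [/\ schrodinger_solution q rho (e rho),
      (e rho x / expi (rho * x) : R[i]^o) @[x --> +oo] --> (1 : R[i]^o) &
      (cderive (e rho) x / ((0 +i* rho) * expi (rho * x)) : R[i]^o)
        @[x --> +oo] --> (1 : R[i]^o)].

Definition jost_left q g : Prop :=
  forall rho : R, rho != 0 ->
  [/\ schrodinger_solution q rho (g rho),
      (g rho x / expi (- (rho * x)) : R[i]^o) @[x --> -oo] --> (1 : R[i]^o) &
      (cderive (g rho) x / (- (0 +i* rho) * expi (- (rho * x))) : R[i]^o)
        @[x --> -oo] --> (1 : R[i]^o)].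

Definition wronskian f h (x : R) : R[i] := f x * cderive h x - cderive f x * h x.

(* The Wronskian of two solutions for the same energy does not depend on x; it
   is evaluated at x = 0. *)
Definition scat_a e g (rho : R) : R[i] :=
  - (0 +i* (2 * rho))^-1 * wronskian (e rho) (g rho) 0.

Definition scat_b e g (rho : R) : R[i] :=
  (0 +i* (2 * rho))^-1 * wronskian (e rho) (g (- rho)) 0.

Definition reflection e g (rho : R) : R[i] :=
  - scat_b e g (- rho) / scat_a e g rho.

Definition G_minus q (Q : R -> R[i]) (rho : R) : R[i] :=
  (0 +i* (2 * rho))^-1 *
    cintegral `[0, +oo[ (fun s => (q s)%:C * expi (- (2 * s * rho))) +
  ((0 +i* (2 * rho)) ^+ 2)^-1 *
    cintegral `[0, +oo[ (fun s => cderive Q s * expi (- (2 * s * rho))).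

End scattering.

Section hankel.
Variable R : realType.
Implicit Types phi y : R -> R[i].

Let mu := @lebesgue_measure R.

Definition hankel phi y (rho : R) : R[i] :=
  lim (((0 +i* (2 * pi))^-1 *
        cintegral setT (fun tau => phi tau * y tau / ((tau + rho) +i* eps))
        : R[i]^o) @[eps --> (0 : R)^'+]).

Definition hankel_equation phi y : Prop :=
  {ae mu, forall rho,
    y rho + hankel phi y rho = - hankel phi (fun=> 1) rho}.

End hankel.

Section parameter_derivatives.
Variable R : realType.
Implicit Types Y Z : R -> R -> R[i].

(* For each x the function y(., x) is only an element of L2, i.e. it is defined
   up to equality almost everywhere, so the partial derivatives in x are those
   of the L2-valued map x |-> y(., x). *)
Definition partial_x Y Z : Prop :=
  forall x : R, L2 (Z ^~ x) /\
    L2norm (fun rho => (Y rho (x + h) - Y rho x) / h%:C - Z rho x)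
      @[h --> (0 : R)^'] --> 0%E.

Fixpoint partial_x_iter (k : nat) Y Z : Prop :=
  if k is k'.+1 then exists2 W, partial_x_iter k' Y W & partial_x W Z
  else Z = Y.

End parameter_derivatives.

(* Main.v *)
Require Import Defs.
(* The potential is cut into dyadic blocks [4^(j-1), 4^j).  On the j-th block
   the contour is moved to Im z = 4^-j, where the cubic phase is Gaussian: each
   x-derivative of the block operator costs a factor 2^j, which the moment of
   order alpha pays for up to order 2 alpha.  As |R| <= 1, with equality at most
   at 0 and then R(0) = -1, the Hankel operator is a strict contraction, so the
   equation can be solved by Neumann series and differentiated in x. *)
From HB Require Import structures.
From mathcomp Require Import all_boot all_order all_algebra.
From mathcomp Require Import complex.
From mathcomp Require Import all_classical all_reals all_analysis.
From mathcomp Require Import measurable_realfun ring lra.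

Set Implicit Arguments.
Unset Strict Implicit.
Unset Printing Implicit Defensive.

Import Order.TTheory GRing.Theory Num.Theory.
Import numFieldNormedType.Exports.

Local Open Scope classical_set_scope.
Local Open Scope ring_scope.
Local Open Scope complex_scope.

(** The height 4^-j matches the support: for s <= 4^j the kernel exp (-2isz) stays below exp 2 on Im
    z = 4^-j. The blocks of G_- cannot be used as they stand: each has a pole at 0, where only R
    itself is known to be bounded. So 1 is written as (1 - w0^M) + w0^M, where 1 - w0^M has a double
    zero at 0 and w0 = O(1/|z|). The part R (1 - w0^M) is cut into blocks; the part R w0^M, with M =
    k + 2, stays on the real line and absorbs up to k + 1 factors rho. The block of the term with Q'
    has a transform as large as 4^j tau_j, with tau_j the integral of |q| beyond the block's left
    end, but it carries one more factor 1/z than the others; the l-th derivative of block j thus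
    costs 2^(j max(l, 2)) tau_j, which is summable because max(k, 2) <= 2 alpha. For l >= 1 the
    operators are defined as sums over blocks, since rho^l R need not be bounded; only for l = 0 is
    the sum identified with the Hankel operator. *)

Local Notation Re := complex.Re.
Local Notation Im := complex.Im.
Local Notation mu := (@lebesgue_measure _).
Local Notation meas := (measurable_fun setT).
Local Notation ae_cvg F f := {ae mu, forall x, cmod (F n x - f x) @[n --> \oo] --> 0}.
Local Notation abs_cont := absolutely_continuous.

(** * Modulus, conjugation and the unit exponential in [R[i]] *)

Section complex_modulus.
Variable R : realType.
Implicit Types (z w : R[i]) (x y : R).

Lemma eq_ler d (T : porderType d) (a b : T) : a = b -> (a <= b)%O. Proof. by move=> ->. Qed.

Lemma cx_ext z w : Re z = Re w -> Im z = Im w -> z = w.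
Proof. by case: z w => [a b] [c d] /= -> ->. Qed.

Lemma ReD z w : Re (z + w) = Re z + Re w. Proof. by case: z w => [? ?] []. Qed.
Lemma ImD z w : Im (z + w) = Im z + Im w. Proof. by case: z w => [? ?] []. Qed.
Lemma ReN z : Re (- z) = - Re z. Proof. by case: z. Qed.
Lemma ImN z : Im (- z) = - Im z. Proof. by case: z. Qed.
Lemma ReB z w : Re (z - w) = Re z - Re w. Proof. by rewrite ReD ReN. Qed.
Lemma ImB z w : Im (z - w) = Im z - Im w. Proof. by rewrite ImD ImN. Qed.
Lemma ReM z w : Re (z * w) = Re z * Re w - Im z * Im w.
Proof. by case: z w => [? ?] []. Qed.
Lemma ImM z w : Im (z * w) = Re z * Im w + Im z * Re w.
Proof. by case: z w => [? ?] []. Qed.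
Lemma ReC x : Re x%:C = x. Proof. by []. Qed.
Lemma ImC x : Im x%:C = 0. Proof. by []. Qed.
Lemma Re_conj z : Re (conjc z) = Re z. Proof. by case: z. Qed.
Lemma Im_conj z : Im (conjc z) = - Im z. Proof. by case: z. Qed.
Lemma ReZ x z : Re (x%:C * z) = x * Re z.
Proof. by rewrite ReM /= mul0r subr0. Qed.
Lemma ImZ x z : Im (x%:C * z) = x * Im z.
Proof. by rewrite ImM /= mul0r addr0. Qed.
Lemma Re0 : Re (0 : R[i]) = 0. Proof. by []. Qed.
Lemma Im0 : Im (0 : R[i]) = 0. Proof. by []. Qed.
Lemma Re1 : Re (1 : R[i]) = 1. Proof. by []. Qed.
Lemma Im1 : Im (1 : R[i]) = 0. Proof. by []. Qed.
Definition ReImE := (ReB, ImB, ReD, ImD, ReN, ImN, ReZ, ImZ, ReM, ImM, Re_conj, Im_conj,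
  Re1, Im1, Re0, Im0, ReC, ImC).

Lemma cmod_sqr z : cmod z ^+ 2 = Re z ^+ 2 + Im z ^+ 2.
Proof. by case: z => a b; rewrite /cmod /= sqr_sqrtr// addr_ge0 ?sqr_ge0. Qed.

Lemma cmod_ge0 z : 0 <= cmod z.
Proof. by case: z => a b; rewrite /cmod /= sqrtr_ge0. Qed.
Hint Resolve cmod_ge0 : core.

Lemma cmodM z w : cmod (z * w) = cmod z * cmod w.
Proof. exact: ComplexField.Normc.normcM. Qed.
Lemma cmodD z w : cmod (z + w) <= cmod z + cmod w.
Proof. exact: complex.le_normcD. Qed.
Lemma cmodN z : cmod (- z) = cmod z.
Proof. by case: z => a b; rewrite /cmod /= !sqrrN. Qed.
Lemma cmodB z w : cmod (z - w) <= cmod z + cmod w.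
Proof. by rewrite (le_trans (cmodD _ _))// cmodN. Qed.
Lemma cmod0 : cmod (0 : R[i]) = 0. Proof. exact: ComplexField.Normc.normc0. Qed.
Lemma cmod1 : cmod (1 : R[i]) = 1. Proof. exact: ComplexField.Normc.normc1. Qed.
Lemma cmodV z : cmod z^-1 = (cmod z)^-1.
Proof. exact: ComplexField.Normc.normcV. Qed.
Lemma cmod_div z w : cmod (z / w) = cmod z / cmod w.
Proof. by rewrite cmodM cmodV. Qed.
Lemma cmod_eq0 z : (cmod z == 0) = (z == 0).
Proof.
apply/eqP/eqP => [|->]; last exact: cmod0.
exact: ComplexField.Normc.eq0_normc.
Qed.
Lemma cmod_gt0 z : (0 < cmod z) = (z != 0).
Proof. by rewrite lt_neqAle cmod_ge0 andbT eq_sym cmod_eq0. Qed.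
Lemma cmodX z n : cmod (z ^+ n) = cmod z ^+ n.
Proof. by elim: n => [|n IH]; rewrite ?expr0 ?cmod1// !exprS cmodM IH. Qed.
Lemma cmod_real x : cmod x%:C = `|x|.
Proof. by rewrite /cmod /= expr0n /= addr0 sqrtr_sqr. Qed.
Lemma cmod_imag x : cmod (0 +i* x) = `|x|.
Proof. by rewrite /cmod /= expr0n /= add0r sqrtr_sqr. Qed.
Lemma cmodC z w : cmod (z - w) = cmod (w - z).
Proof. by rewrite -cmodN opprB. Qed.
Lemma cmod_conj z : cmod (conjc z) = cmod z.
Proof. by case: z => a b; rewrite /cmod /= sqrrN. Qed.

Lemma abs_le_sqr x y : 0 <= y -> x ^+ 2 <= y ^+ 2 -> `|x| <= y.
Proof.
by move=> y0 h; rewrite -(ler_pXn2r (n := 2))// ?nnegrE// real_normK// num_real.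
Qed.
Lemma Re_le z : `|Re z| <= cmod z.
Proof. by apply: abs_le_sqr => //; rewrite cmod_sqr lerDl sqr_ge0. Qed.
Lemma Im_le z : `|Im z| <= cmod z.
Proof. by apply: abs_le_sqr => //; rewrite cmod_sqr lerDr sqr_ge0. Qed.
Lemma cmod_le_ReIm z : cmod z <= `|Re z| + `|Im z|.
Proof.
have {1}-> : z = (Re z)%:C + (0 +i* Im z) by apply: cx_ext; rewrite !ReImE /= ?addr0 ?add0r.
by apply: le_trans (cmodD _ _) _; rewrite cmod_real cmod_imag.
Qed.
Lemma cmod_ge_Re z : Re z <= cmod z.
Proof. exact: le_trans (ler_norm _) (Re_le z). Qed.
Lemma cmod_ge_Im z : Im z <= cmod z.
Proof. exact: le_trans (ler_norm _) (Im_le z). Qed.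
Lemma cmod_dist z w : `|cmod z - cmod w| <= cmod (z - w).
Proof.
rewrite ler_norml; have h1 := cmodD (z - w) w; have h2 := cmodD (w - z) z.
rewrite !subrK in h1 h2; rewrite (cmodC w z) in h2.
by apply/andP; split; lra.
Qed.
Lemma cmodB_ge z w : cmod z - cmod w <= cmod (z - w).
Proof. exact: le_trans (ler_norm _) (cmod_dist z w). Qed.
Lemma cmod_tri (u z w : R[i]) : cmod (z - w) <= cmod (z - u) + cmod (u - w).
Proof. by rewrite (le_trans _ (cmodD _ _))// addrA subrK. Qed.
Lemma cmod_sum (I : Type) (s : seq I) (P : pred I) (F : I -> R[i]) :
  cmod (\sum_(i <- s | P i) F i) <= \sum_(i <- s | P i) cmod (F i).
Proof.
elim/big_rec2 : _ => [|i y1 y2 _ h]; first by rewrite cmod0.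
by rewrite (le_trans (cmodD _ _))// lerD2l.
Qed.
Lemma cmod_small z : (forall e, 0 < e -> cmod z <= e) -> z = 0.
Proof.
move=> h; apply/eqP; rewrite -cmod_eq0 eq_le cmod_ge0 andbT.
by apply/ler_addgt0Pr => e e0; rewrite add0r h.
Qed.
Lemma mul_conj z : z * conjc z = (cmod z ^+ 2)%:C.
Proof.
case: z => a b; apply: cx_ext; rewrite ?cmod_sqr !ReImE /=; ring.
Qed.
Lemma complexE z : z = (Re z) +i* (Im z). Proof. by case: z. Qed.
Lemma conjcM z w : conjc (z * w) = conjc z * conjc w.
Proof. by apply: cx_ext; rewrite !ReImE; ring. Qed.
Lemma conjcD z w : conjc (z + w) = conjc z + conjc w.
Proof. by apply: cx_ext; rewrite !ReImE; ring. Qed.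
Lemma conjcN z : conjc (- z) = - conjc z.
Proof. by apply: cx_ext; rewrite !ReImE; ring. Qed.
Lemma conjcB z w : conjc (z - w) = conjc z - conjc w.
Proof. by rewrite conjcD conjcN. Qed.
Lemma conjcK2 z : conjc (conjc z) = z.
Proof. by apply: cx_ext; rewrite !ReImE ?opprK. Qed.
Lemma conjcV z : conjc z^-1 = (conjc z)^-1.
Proof.
have [->|z0] := eqVneq z 0; first by rewrite invr0 (_ : conjc 0 = 0) ?invr0//; apply: cx_ext; rewrite !ReImE ?oppr0.
have c0 : conjc z != 0 by rewrite -cmod_eq0 cmod_conj cmod_eq0.
apply: (mulIf c0); rewrite mulVf// -conjcM mulVf//.
by apply: cx_ext; rewrite !ReImE ?oppr0.
Qed.
Lemma Cinj x y : x%:C = y%:C -> x = y. Proof. by case. Qed.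
Lemma CD x y : (x + y)%:C = x%:C + y%:C. Proof. by apply: cx_ext; rewrite !ReImE ?addr0. Qed.
Lemma CN x : (- x)%:C = - x%:C. Proof. by apply: cx_ext; rewrite !ReImE ?oppr0. Qed.
Lemma CB x y : (x - y)%:C = x%:C - y%:C. Proof. by rewrite CD CN. Qed.
Lemma CM x y : (x * y)%:C = x%:C * y%:C.
Proof. by apply: cx_ext; rewrite !ReImE ?mulr0. Qed.
Lemma C_neq0 x : x != 0 -> x%:C != 0.
Proof. by rewrite -[x%:C == 0]cmod_eq0 cmod_real normr_eq0. Qed.
Lemma CV x : (x^-1)%:C = (x%:C)^-1.
Proof.
have [->|x0] := eqVneq x 0; first by rewrite !invr0.
by apply: (mulIf (C_neq0 x0)); rewrite -CM !mulVf// C_neq0.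
Qed.
Lemma C_nat n : (n%:R : R)%:C = n%:R.
Proof. by elim: n => [//|n IH]; rewrite -addn1 !natrD CD IH. Qed.
Lemma Im_neq0 z : Im z != 0 -> z != 0.
Proof. by apply: contra_neq => ->. Qed.

Lemma cmod_expi x : cmod (expi x) = 1.
Proof. by rewrite /cmod /expi /= cos2Dsin2 sqrtr1. Qed.
Lemma expiD x y : expi (x + y) = expi x * expi y.
Proof.
by apply: cx_ext; rewrite !ReImE /= ?cosD ?sinD//; ring.
Qed.
Lemma expi0 : expi (0 : R) = 1.
Proof. by rewrite /expi cos0 sin0. Qed.
Lemma expiN x : expi (- x) = conjc (expi x).
Proof. by rewrite /expi cosN sinN. Qed.
Lemma expi_neq0 x : expi x != 0.
Proof. by rewrite -cmod_gt0 cmod_expi. Qed.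

Lemma cx_gt0 (eps : R[i]) : 0 < eps -> exists2 e : R, 0 < e & eps = e%:C.
Proof.
case: eps => a b; rewrite ltcE /= => /andP[/eqP b0 a0].
by exists a => //; rewrite b0.
Qed.
Lemma normcE (z : R[i]^o) : `|z| = (cmod z)%:C.
Proof. by []. Qed.

Lemma cvg_cmodP (T : Type) (F : set_system T) (FF : Filter F) (f : T -> R[i]) (l : R[i]) :
  (f x : R[i]^o) @[x --> F] --> (l : R[i]^o) <->
  cmod (f x - l) @[x --> F] --> (0 : R).
Proof.
split => h.
  apply/cvgrPdist_lt => e e0.
  have e0' : (0 : R[i]) < e%:C by rewrite ltcE /= eqxx.
  move/cvgrPdist_lt : h => /(_ _ e0'); apply: filterS => x.
  by rewrite normcE ltcE /= eqxx /= sub0r normrN ger0_norm// cmodC.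
apply/cvgrPdist_lt => e /cx_gt0[r r0 ->].
move/cvgrPdist_lt : h => /(_ _ r0); apply: filterS => x.
by rewrite normcE ltcE /= eqxx /= sub0r normrN ger0_norm// cmodC.
Qed.

End complex_modulus.

Ltac cx_eq := apply: cx_ext; rewrite !ReImE /=.
Ltac cx_ring := cx_eq; ring.
#[global] Hint Extern 0 (is_true (0 <= cmod _)) => exact: cmod_ge0 : core.

(** * Complex differentiability in epsilon-delta form *)

Section complex_derivative.
Variable R : realType.
Implicit Types (F G : R[i] -> R[i]) (z D : R[i]).

Definition cder F z D := forall e : R, 0 < e -> exists2 d : R, 0 < d &
  forall h, cmod h < d -> cmod (F (z + h) - F z - D * h) <= e * cmod h.

Lemma derivable_cder F z : derivable (F : R[i]^o -> R[i]^o) z 1 ->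
  exists D, cder F z D.
Proof.
move=> dF; exists ('D_1 (F : R[i]^o -> R[i]^o) z) => e e0.
have e0' : (0 : R[i]) < e%:C by rewrite ltcE /= eqxx.
move/cvgrPdist_lt : (dF) => /(_ _ e0') [/= d /cx_gt0[r r0 ->] H].
exists r => // h hr.
have [->|h0] := eqVneq h 0; first by rewrite addr0 subrr mulr0 subr0 cmod0 mulr0.
have := H h; rewrite /ball_ /= sub0r normrN normcE ltcE /= eqxx /= hr h0 => /(_ isT isT).
rewrite normcE ltcE /= eqxx /= => K.
set L := 'D_1 (F : R[i]^o -> R[i]^o) z in K *.
have hp : 0 < cmod h by rewrite cmod_gt0.
have -> : F (z + h) - F z - L * h = - (h * (L - h^-1 * (F (h + z) - F z))).
  by rewrite (addrC z h); field.
rewrite cmodN cmodM mulrC ler_pM2r//; apply: ltW; move: K.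
suff -> : h^-1 *: ((F : R[i]^o -> R[i]^o) (h *: (1 : R[i]^o) + z) - F z) = h^-1 * (F (h + z) - F z) by [].
by rewrite /GRing.scale /= mulr1.
Qed.

Lemma cder_derivable F z D : cder F z D -> derivable (F : R[i]^o -> R[i]^o) z 1.
Proof.
move=> H; apply/cvg_ex; exists (D : R[i]^o).
apply/cvgrPdist_le => e /cx_gt0[r r0 ->].
have [d d0 K] := H _ r0.
exists d%:C => /=; first by rewrite ltcE /= eqxx.
move=> h /=; rewrite sub0r normrN normcE ltcE /= eqxx /= => hd h0.
rewrite normcE lecE /= eqxx /=.
have hp : 0 < cmod h by rewrite cmod_gt0.
rewrite -(ler_pM2r hp) -cmodM.
apply: le_trans (K h hd); apply: eq_ler.
rewrite -[in RHS]cmodN; congr cmod.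
have -> : h^-1 *: ((F : R[i]^o -> R[i]^o) (h *: (1 : R[i]^o) + z) - F z) = h^-1 * (F (h + z) - F z).
  by rewrite /GRing.scale /= mulr1.
by rewrite (addrC z h); field.
Qed.

Lemma cder_cst (c : R[i]) z : cder (fun=> c) z 0.
Proof. by move=> e e0; exists 1 => // h _; rewrite subrr mul0r subrr cmod0 mulr_ge0// ltW. Qed.
Lemma cder_id z : cder id z 1.
Proof.
move=> e e0; exists 1 => // h _; rewrite mul1r (_ : _ - _ = 0) ?cmod0; first by rewrite mulr_ge0// ltW.
by ring.
Qed.
Lemma cderD F G z D E : cder F z D -> cder G z E -> cder (fun x => F x + G x) z (D + E).
Proof.
move=> HF HG e e0; have e2 : 0 < e / 2 by rewrite divr_gt0.
have [d d0 K] := HF _ e2; have [d' d0' K'] := HG _ e2.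
exists (Num.min d d'); first by rewrite lt_min d0.
move=> h; rewrite lt_min => /andP[/K{}K /K'{}K'].
have -> : F (z + h) + G (z + h) - (F z + G z) - (D + E) * h
  = (F (z + h) - F z - D * h) + (G (z + h) - G z - E * h) by ring.
by apply: le_trans (cmodD _ _) _; lra.
Qed.
Lemma cder_cont F z D : cder F z D -> forall e : R, 0 < e -> exists2 d : R, 0 < d &
  forall h, cmod h < d -> cmod (F (z + h) - F z) < e.
Proof.
move=> H e e0; have [d d0 K] := H _ ltr01.
have m0 : 0 < 2 + cmod D by rewrite ltr_wpDr.
exists (Num.min d (e / (2 + cmod D))); first by rewrite lt_min d0 divr_gt0.
move=> h; rewrite lt_min => /andP[/K{}K]; rewrite ltr_pdivlMr// => he.
have -> : F (z + h) - F z = (F (z + h) - F z - D * h) + D * h by ring.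
apply: le_lt_trans (cmodD _ _) _; rewrite cmodM; have := cmod_ge0 h.
by have := cmod_ge0 D; move=> *; nra.
Qed.
Lemma cder_quad (a b w : R[i]) : cder (fun x => a * (x * x) + b * x) w (a * (2 * w) + b).
Proof.
move=> e e0; have c1 : 0 < cmod a + 1 by rewrite ltr_wpDl.
exists (e / (cmod a + 1)); first by rewrite divr_gt0.
move=> h; rewrite ltr_pdivlMr// => hd; rewrite [X in cmod X](_ : _ = a * h * h); last by ring.
rewrite cmodM ler_wpM2r// cmodM mulrC; apply: le_trans (ltW hd); rewrite ler_wpM2l// lerDl//.
Qed.

Definition holo (P : R[i] -> Prop) F := forall z, P z -> exists D, cder F z D.

Lemma holoM (P : R[i] -> Prop) F G : holo P F -> holo P G -> holo P (fun x => F x * G x).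
Proof.
by move=> hF hG z Pz; have [D HD] := hF z Pz; have [E HE] := hG z Pz; apply: derivable_cder;
exact: derivableM (cder_derivable HD) (cder_derivable HE).
Qed.
Lemma holoD (P : R[i] -> Prop) F G : holo P F -> holo P G -> holo P (fun x => F x + G x).
Proof.
by move=> hF hG z Pz; have [D HD] := hF z Pz; have [E HE] := hG z Pz; eexists; exact: cderD HD HE.
Qed.
Lemma holo_cst (P : R[i] -> Prop) (c : R[i]) : holo P (fun=> c).
Proof. by move=> z _; exists 0; exact: cder_cst. Qed.
Lemma holo_id (P : R[i] -> Prop) : holo P id.
Proof. by move=> z _; exists 1; exact: cder_id. Qed.
Lemma holoX (P : R[i] -> Prop) F n : holo P F -> holo P (fun x => F x ^+ n).
Proof.
move=> hF; elim: n => [|n IH]; first by move=> z _; exists 0; under [X in cder X]funext do rewrite expr0; exact: cder_cst.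
by under [X in holo _ X]funext do rewrite exprS; exact: holoM.
Qed.
Lemma holoV (P : R[i] -> Prop) F : (forall z, P z -> F z != 0) -> holo P F ->
  holo P (fun x => (F x)^-1).
Proof. by move=> h hF z Pz; have [D HD] := hF z Pz; apply: derivable_cder;
apply: derivableV (cder_derivable HD); exact: h. Qed.

End complex_derivative.

Import HBNNSimple.

(** * Integrals of almost everywhere equal functions *)

Section ae_integral.
Context d (T : measurableType d) (R : realType).
Variable m : {measure set T -> \bar R}.

(** F and G may be non-measurable, as [cderive Q] can be in the application. The integral is a
    supremum over simple functions below F, and such a function, set to 0 on the exceptional null
    set, lies below G with the same integral. *)
Local Lemma le_integral_ae (F G : T -> \bar R) :
  (forall x, (0 <= F x)%E) -> (forall x, (0 <= G x)%E) ->
  {ae m, forall x, F x = G x} -> (\int[m]_x F x <= \int[m]_x G x)%E.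
Proof.
move=> F0 G0 [N [mN N0 sub]].
rewrite ge0_integralTE// [leRHS]ge0_integralTE//.
apply: ge_ereal_sup => _ [h /= hF <-].
have mNc : measurable (~` N) by exact: measurableC.
pose h' := proj_nnsfun h mNc.
have -> : sintegral m h = sintegral m (h' : T -> R).
  rewrite -!integralT_nnsfun; apply: ge0_ae_eq_integral => //.
  - by apply/measurable_EFinP.
  - by apply/measurable_EFinP.
  - by move=> x _; rewrite lee_fin.
  - by move=> x _; rewrite lee_fin.
  exists N; split => // x /= nx; apply: contrapT => nN; apply: nx => _.
  by rewrite /= /mindic indicE mem_set// mulr1.
apply: ereal_sup_ubound; exists h' => //= x.
rewrite /mindic indicE; case: (boolP (x \in ~` N)) => xN; last by rewrite mulr0.
rewrite mulr1; apply: le_trans (hF x) _.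
have /contrapT <- // : ~ ~ (F x = G x).
by move=> nFG; have := set_mem xN; apply; apply: sub.
Qed.

Lemma ae_integral_eq (F G : T -> \bar R) :
  {ae m, forall x, F x = G x} -> (\int[m]_x F x = \int[m]_x G x)%E.
Proof.
move=> FG; have FG' : {ae m, forall x, G x = F x} by apply: filterS FG => x ->.
rewrite integralE [RHS]integralE; congr (_ - _)%E; apply/eqP; rewrite eq_le.
  apply/andP; split; apply: le_integral_ae => //; [apply: filterS FG|apply: filterS FG'];
  by move=> x; rewrite !funeposE => ->.
apply/andP; split; apply: le_integral_ae => //; [apply: filterS FG|apply: filterS FG'];
by move=> x; rewrite !funenegE => ->.
Qed.

Lemma ae_Rintegral_eq (D : set T) (f g : T -> R) :
  {ae m, forall x, D x -> f x = g x} -> Rintegral m D f = Rintegral m D g.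
Proof.
move=> fg; rewrite /Rintegral integral_mkcond [in RHS]integral_mkcond; congr fine.
apply: ae_integral_eq; apply: filterS fg => x h.
by rewrite /patch; case: ifPn => // /set_mem /h ->.
Qed.

Lemma ae_integrable (f g : T -> R) : meas f ->
  {ae m, forall x, f x = g x} -> m.-integrable setT (EFin \o g) ->
  m.-integrable setT (EFin \o f).
Proof.
move=> mf fg /integrableP[mg ig]; apply/integrableP; split; first exact/measurable_EFinP.
apply: le_lt_trans ig; apply: eq_ler.
by apply: ae_integral_eq; apply: filterS fg => x /= ->.
Qed.

End ae_integral.

(** * Real integrals over the line, as real and as extended numbers *)

Section real_integrals.
Variable R : realType.
Implicit Types (f g h : R -> R) (a b : R).

Definition intg f : R := Rintegral mu setT f.
Definition rI f := mu.-integrable setT (EFin \o f).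

Lemma rI_meas f : rI f -> meas f.
Proof. by move=> /measurable_int /measurable_EFinP. Qed.

Lemma measurable_EFin_comp f : meas f -> meas (fun x => (f x)%:E).
Proof. by move/measurable_EFinP. Qed.

Lemma rI_le f g : meas f -> rI g -> (forall x, `|f x| <= g x) -> rI f.
Proof.
move=> mf ig fg; apply: (le_integrable measurableT _ _ ig); first exact/measurable_EFinP.
by move=> x _; rewrite /= lee_fin (le_trans (fg x))// ler_norm.
Qed.

Lemma rID f g : rI f -> rI g -> rI (fun x => f x + g x).
Proof. by move=> hf hg; have := integrableD measurableT hf hg; apply: eq_integrable. Qed.
Lemma rIZ a f : rI f -> rI (fun x => a * f x).
Proof. by move=> hf; have := integrableZl measurableT a hf; apply: eq_integrable. Qed.
Lemma rIN f : rI f -> rI (fun x => - f x).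
Proof. by move=> /(rIZ (-1)); under eq_fun do rewrite mulN1r. Qed.
Lemma rIB f g : rI f -> rI g -> rI (fun x => f x - g x).
Proof. by move=> hf hg; apply: rID => //; exact: rIN. Qed.
Lemma rI_norm f : rI f -> rI (fun x => `|f x|).
Proof. exact: integrable_norm. Qed.
Lemma rI0 : rI (fun=> 0).
Proof. exact: integrable0. Qed.
Lemma eq_rI f g : f =1 g -> rI f -> rI g.
Proof. by move=> /funext ->. Qed.

Lemma intgD f g : rI f -> rI g -> intg (fun x => f x + g x) = intg f + intg g.
Proof. exact: RintegralD. Qed.
Lemma intgB f g : rI f -> rI g -> intg (fun x => f x - g x) = intg f - intg g.
Proof. exact: RintegralB. Qed.
Lemma intgZ a f : rI f -> intg (fun x => a * f x) = a * intg f.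
Proof. exact: RintegralZl. Qed.
Lemma intgN f : rI f -> intg (fun x => - f x) = - intg f.
Proof.
by move=> hf; rewrite -[RHS]mulN1r -intgZ//; congr intg; apply: funext => x; rewrite mulN1r.
Qed.
Lemma intg0 : intg (fun=> 0) = 0.
Proof. by rewrite /intg /Rintegral integral0. Qed.
Lemma eq_intg f g : f =1 g -> intg f = intg g.
Proof. by move=> /funext ->. Qed.
Lemma le_intg f g : rI f -> rI g -> (forall x, f x <= g x) -> intg f <= intg g.
Proof. by move=> hf hg fg; apply: le_Rintegral. Qed.
Lemma intg_ge0 f : (forall x, 0 <= f x) -> 0 <= intg f.
Proof. by move=> f0; apply: Rintegral_ge0. Qed.
Lemma norm_intg f : rI f -> `|intg f| <= intg (fun x => `|f x|).
Proof. exact: le_normr_Rintegral. Qed.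

Definition eint f : \bar R := (\int[mu]_x (f x)%:E)%E.

Lemma eint_intg f : rI f -> eint f = (intg f)%:E.
Proof. by move=> hf; rewrite /intg /Rintegral fineK//; exact: integrable_fin_num. Qed.
Lemma rI_ge0 f : meas f -> (forall x, 0 <= f x) -> (eint f < +oo)%E -> rI f.
Proof.
move=> mf f0 h; apply/integrableP; split; first exact/measurable_EFinP.
apply: le_lt_trans h; apply: eq_ler.
by apply: eq_integral => x _ /=; rewrite ger0_norm.
Qed.
Lemma eint_ge0 f : (forall x, 0 <= f x) -> (0 <= eint f)%E.
Proof. by move=> f0; apply: integral_ge0 => x _; rewrite lee_fin. Qed.
Lemma le_eint f g : (forall x, 0 <= f x) -> meas f -> meas g ->
  (forall x, f x <= g x) -> (eint f <= eint g)%E.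
Proof.
move=> f0 mf mg fg; apply: ge0_le_integral => //=.
- by move=> x _; rewrite lee_fin.
- exact/measurable_EFinP.
- exact/measurable_EFinP.
- by move=> x _; rewrite lee_fin.
Qed.
Lemma eintD f g : (forall x, 0 <= f x) -> (forall x, 0 <= g x) ->
  meas f -> meas g ->
  eint (fun x => f x + g x) = (eint f + eint g)%E.
Proof.
move=> f0 g0 mf mg; rewrite /eint -ge0_integralD//.
- by move=> x _; rewrite lee_fin.
- exact/measurable_EFinP.
- by move=> x _; rewrite lee_fin.
- exact/measurable_EFinP.
Qed.
Lemma eintZ a f : 0 <= a -> (forall x, 0 <= f x) -> meas f ->
  eint (fun x => a * f x) = (a%:E * eint f)%E.
Proof.
move=> a0 f0 mf; rewrite /eint -ge0_integralZl//; first exact/measurable_EFinP.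
by move=> x _; rewrite lee_fin.
Qed.
Lemma eint_le_intg f a : rI f -> (eint f <= a%:E)%E -> intg f <= a.
Proof. by move=> hf; rewrite eint_intg// lee_fin. Qed.

End real_integrals.

(** * Dominated convergence and Fatou's lemma for sequences converging almost everywhere *)

Section convergence_theorems.
Variable R : realType.
Implicit Types (f g h : R -> R) (a b : R).

Lemma aeS (P Q : R -> Prop) : {ae mu, forall x, P x} -> (forall x, P x -> Q x) ->
  {ae mu, forall x, Q x}.
Proof. by move=> h PQ; apply: (@filterS _ _ (ae_filter_ringOfSetsType mu)) h. Qed.
Lemma aeI (P Q : R -> Prop) : {ae mu, forall x, P x} -> {ae mu, forall x, Q x} ->
  {ae mu, forall x, P x /\ Q x}.
Proof. by move=> h h'; exact: (@filterI _ _ (ae_filter_ringOfSetsType mu)) h h'. Qed.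
Lemma aeT (P : R -> Prop) : (forall x, P x) -> {ae mu, forall x, P x}.
Proof. by move=> h; apply: (@filterS _ _ (ae_filter_ringOfSetsType mu) setT) => [x _|]; [exact: h|exact: (@filterT _ _ (ae_filter_ringOfSetsType mu))]. Qed.
Lemma intg_ae f g : {ae mu, forall x, f x = g x} -> intg f = intg g.
Proof. by move=> fg; apply: ae_Rintegral_eq; apply: aeS fg _ => x h _. Qed.
Lemma rI_ae f g : meas f -> {ae mu, forall x, f x = g x} -> rI g -> rI f.
Proof. by move=> mf fg ig; apply: (@ae_integrable _ _ _ mu f g mf fg ig). Qed.

Lemma dct (f_ : nat -> R -> R) f g : (forall n, meas (f_ n)) -> meas f ->
  rI g -> {ae mu, forall x, f_ n x @[n --> \oo] --> f x} ->
  {ae mu, forall x, forall n, `|f_ n x| <= g x} ->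
  rI f /\ intg (f_ n) @[n --> \oo] --> intg f.
Proof.
move=> mf_ mf ig fc fg.
have [] := @dominated_convergence _ _ _ mu setT measurableT (fun n x => (f_ n x)%:E)
   (fun x => (f x)%:E) (fun x => (g x)%:E).
- by move=> n; exact: (measurable_EFin_comp (mf_ n)).
- exact/measurable_EFinP.
- by apply: aeS fc _ => x h _; apply: cvg_EFin => //; exact: nearW.
- exact: ig.
- by apply: aeS fg _ => x h n _; rewrite lee_fin.
move=> h1 _ h2; split=> //.
have e := @eint_intg _ f h1.
by rewrite /eint in e; rewrite e in h2; exact: fine_cvg h2.
Qed.

Lemma fatou_le (f_ : nat -> R -> R) f (M : \bar R) : (forall n, meas (f_ n)) ->
  (forall n x, 0 <= f_ n x) ->
  {ae mu, forall x, f_ n x @[n --> \oo] --> f x} ->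
  (forall n, eint (f_ n) <= M)%E -> (eint f <= M)%E.
Proof.
move=> mf_ f0 fc fM.
have -> : eint f = (\int[mu]_x limn_einf (fun n => (f_ n x)%:E))%E.
  apply: ae_integral_eq; apply: aeS fc _ => x h; apply/esym.
  have hc : (f_ n x)%:E @[n --> \oo] --> (f x)%:E by apply: cvg_EFin => //; exact: nearW.
  by rewrite (is_cvg_limn_einfE (cvgP _ hc)); apply/cvg_lim.
apply: le_trans (_ : limn_einf (fun n => eint (f_ n)) <= M)%E.
  apply: fatou => // [n|n x _]; first exact: (measurable_EFin_comp (mf_ n)).
  by rewrite lee_fin.
rewrite limn_einf_lim; apply: lime_le; first exact: is_cvg_einfs.
apply: nearW => n; apply: ereal_inf_le; exists (eint (f_ n)); last exact: fM.
by exists n => /=.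
Qed.

End convergence_theorems.

(** * Affine changes of variable *)

Section affine_change.
Variable R : realType.
Implicit Types (f : R -> R) (k b : R).

Lemma measurable_affine k b : meas (fun x : R => k * x + b).
Proof. by apply: measurable_funD => //; apply: measurable_funM. Qed.

Let measurable_affineR k b :
    @measurable_fun _ _ (measurableTypeR R) (measurableTypeR R) setT (fun x : R => k * x + b).
Proof. exact: measurable_affine. Qed.

(** Uniqueness of Lebesgue measure: |k| times the pushforward agrees with it on half-open intervals.
    For k < 0 the preimage is half-open at the other end, with the same measure. *)
Lemma affine_measure k b (A : set R) : k != 0 -> measurable A ->
  mu ((fun x => k * x + b) @^-1` A) = (`|k|^-1%:E * mu A)%E.
Proof.
move=> k0 mA.
have mphi := measurable_affineR k b.
pose phi : {mfun measurableTypeR R >-> measurableTypeR R} :=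
  HB.pack (fun x => k * x + b) (isMeasurableFun.Build _ _ _ _ _ mphi).
have nk : 0 <= `|k| by [].
pose m := mscale (NngNum nk) (pushforward mu phi).
suff -> : mu A = m mphi A.
  by rewrite /m /mscale /= muleA -EFinM mulVf ?mul1e// normr_eq0.
rewrite /m; apply: lebesgue_measure_unique => // _ [[u v] /= uv <-].
rewrite /mscale /= /pushforward lebesgue_measure_itv /=.
have [k0'|k0'] := ltP 0 k.
  have -> : (fun x : R => k * x + b) @^-1` `]u, v]%classic = `](u - b) / k, (v - b) / k]%classic :> set R.
    by apply/seteqP; split => x /=; rewrite !in_itv /= ltr_pdivrMr// ler_pdivlMr//
      ltrBlDr lerBrDr mulrC.
  rewrite lebesgue_measure_itv /= !lte_fin ltr_pM2r ?invr_gt0// ltrD2r.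
  case: ifPn => _; last by rewrite mule0.
  by rewrite -!EFinB -EFinM gtr0_norm//; congr EFin; field.
have kn : k < 0 by rewrite lt_neqAle k0.
have -> : (fun x : R => k * x + b) @^-1` `]u, v]%classic = `[(v - b) / k, (u - b) / k[%classic :> set R.
  apply/seteqP; split => x /=; rewrite !in_itv /= ltr_ndivlMr// ler_ndivrMr//
      ltrBlDr lerBrDr mulrC => /andP[? ?]; exact/andP.
rewrite lebesgue_measure_itv /= !lte_fin ltr_nM2r ?invr_lt0// ltrD2r.
case: ifPn => _; last by rewrite mule0.
by rewrite -!EFinB -EFinM ltr0_norm//; congr EFin; field.
Qed.

Lemma eint_affine k b f : k != 0 -> meas f -> (forall x, 0 <= f x) ->
  eint (fun x => f (k * x + b)) = (`|k|^-1%:E * eint f)%E.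
Proof.
move=> k0 mf f0.
have nk : 0 <= `|k|^-1 by [].
rewrite /eint -(ge0_integral_pushforward (measurable_affineR k b) mu (D := setT) (f := EFin \o f))//; last 2 first.
- exact: measurable_EFin_comp.
- by move=> y _; rewrite lee_fin.
rewrite (eq_measure_integral (mscale (NngNum nk) mu)) => [|A mA _]; last first.
  by rewrite /mscale /=; exact: affine_measure.
rewrite ge0_integral_mscale// => [|x _]; last by rewrite lee_fin.
exact: measurable_EFin_comp.
Qed.

Lemma rI_affine k b f : k != 0 -> rI f -> rI (fun x => f (k * x + b)).
Proof.
move=> k0 hf; have mf := rI_meas hf.
have mff : meas (fun x => f (k * x + b)).
  exact: (measurableT_comp mf (measurable_affine k b)).
apply: (rI_le (g := fun x => `|f (k * x + b)|)) => //.
apply: rI_ge0 => //; first exact: measurableT_comp.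
rewrite (@eint_affine k b (fun x => `|f x|))//; last exact: measurableT_comp.
by rewrite (eint_intg (rI_norm hf)) -EFinM ltry.
Qed.

Lemma intg_affine k b f : k != 0 -> rI f ->
  intg (fun x => f (k * x + b)) = `|k|^-1 * intg f.
Proof.
move=> k0 hf; have mf := rI_meas hf.
have pos g : rI g -> (forall x, 0 <= g x) -> intg (fun x => g (k * x + b)) = `|k|^-1 * intg g.
  move=> hg g0; apply: EFin_inj; rewrite EFinM -!eint_intg ?eint_affine//.
  - exact: rI_meas.
  - exact: rI_affine.
pose p x := Num.max (f x) 0; pose n x := Num.max (- f x) 0.
have ip : rI p.
  apply: (rI_le (g := fun x => `|f x|)); [exact: measurable_maxr|exact: rI_norm|].
  by move=> x; rewrite /p; case: (leP (f x) 0); rewrite ?normr0.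
have ineg : rI n.
  apply: (rI_le (g := fun x => `|f x|)); [apply: measurable_maxr => //; exact: measurableT_comp|exact: rI_norm|].
  by move=> x; rewrite /n; case: (leP (- f x) 0); rewrite ?normr0// normrN.
have e x : f x = p x - n x.
  rewrite /p /n; case: (leP (f x) 0) => h.
    by rewrite max_l ?oppr_ge0// opprK add0r.
  by rewrite max_r ?subr0// oppr_le0 ltW.
rewrite (eq_intg e) (eq_intg (f := fun x => f (k * x + b)) (fun x => e (k * x + b))).
rewrite !intgB//; try exact: rI_affine.
rewrite !pos ?mulrBr// => x; rewrite /p /n le_max lexx orbT //.
Qed.

Lemma intg_refl f : rI f -> intg (fun x => f (- x)) = intg f.
Proof.
move=> hf; have n1 : (-1 : R) != 0 by rewrite oppr_eq0 oner_eq0.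
rewrite -[RHS]mul1r -[X in X * _]invr1 -[X in X^-1]normr1 -[X in X^-1]normrN -(intg_affine 0 n1)//.
by apply: eq_intg => x; rewrite mulN1r addr0.
Qed.
Lemma rI_refl f : rI f -> rI (fun x => f (- x)).
Proof.
move=> hf; have n1 : (-1 : R) != 0 by rewrite oppr_eq0 oner_eq0.
by have := rI_affine 0 n1 hf; apply: eq_rI => x; rewrite mulN1r addr0.
Qed.

End affine_change.

(** * Limits equal to zero *)

Section real_limits.
Variable R : realType.
Lemma cvg_dist0 (T : Type) (F : set_system T) {FF : Filter F} (u : T -> R) (l : R) :
  u x @[x --> F] --> l -> `|u x - l| @[x --> F] --> 0.
Proof.
move=> h; apply/cvgrPdist_lt => e e0; move/cvgrPdist_lt: h => /(_ e e0).
by apply: filterS => x; rewrite sub0r normrN normr_id distrC.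
Qed.
Lemma cvg0_le (T : Type) (F : set_system T) {FF : Filter F} (u v : T -> R) :
  (forall x, 0 <= u x <= v x) -> v x @[x --> F] --> 0 -> u x @[x --> F] --> 0.
Proof.
move=> h hv; apply/cvgrPdist_lt => e e0; move/cvgrPdist_lt: hv => /(_ e e0).
apply: filterS => x; have /andP[u0 uv] := h x.
by rewrite !sub0r !normrN !ger0_norm ?(le_trans u0)//; exact: le_lt_trans.
Qed.
Lemma cvgD0 (T : Type) (F : set_system T) {FF : Filter F} (u v : T -> R) :
  u x @[x --> F] --> 0 -> v x @[x --> F] --> 0 ->
  (u x + v x) @[x --> F] --> 0.
Proof. by move=> hu hv; have := cvgD hu hv; rewrite addr0; exact. Qed.
Lemma cvgZ0 (T : Type) (F : set_system T) {FF : Filter F} (c : R) (u : T -> R) :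
  u x @[x --> F] --> 0 -> (c * u x) @[x --> F] --> 0.
Proof. by move=> hu; have := cvgM (cvg_cst c) hu; rewrite mulr0; exact. Qed.
Lemma cvgM0 (T : Type) (F : set_system T) {FF : Filter F} (u v : T -> R) :
  u x @[x --> F] --> 0 -> v x @[x --> F] --> 0 ->
  (u x * v x) @[x --> F] --> 0.
Proof. by move=> hu hv; have := cvgM hu hv; rewrite mulr0; exact. Qed.
Lemma seq_cvg0P (u : nat -> R) : (forall n, 0 <= u n) ->
  (u n @[n --> \oo] --> 0) <->
  (forall e, 0 < e -> exists N, forall n, (N <= n)%N -> u n < e).
Proof.
move=> u0; split.
  move=> /cvgrPdist_lt h e /h [N _ H]; exists N => n Nn.
  by have := H n Nn; rewrite sub0r normrN ger0_norm.
move=> h; apply/cvgrPdist_lt => e /h[N H]; exists N => // n /= Nn.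
by rewrite sub0r normrN ger0_norm ?H.
Qed.
End real_limits.

(** * Measurability of complex-valued functions *)

Section complex_measurability.
Context d (T : measurableType d) (R : realType).
Implicit Types (f g : T -> R[i]) (u v : T -> R).

Definition cmeas f := meas (fun x => Re (f x)) /\
  meas (fun x => Im (f x)).

Lemma measurable_funV u : meas u -> (forall x, 0 <= u x) ->
  meas (fun x => (u x)^-1).
Proof.
move=> mu u0; under eq_fun do rewrite -powR_inv1//.
exact: (measurableT_comp (measurable_powR _) mu).
Qed.
Lemma cmeasD f g : cmeas f -> cmeas g -> cmeas (fun x => f x + g x).
Proof.
move=> [a b] [c e]; split.
  by under eq_fun do rewrite ReD; exact: measurable_funD.
by under eq_fun do rewrite ImD; exact: measurable_funD.
Qed.
Lemma cmeasM f g : cmeas f -> cmeas g -> cmeas (fun x => f x * g x).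
Proof.
move=> [a b] [c e]; split.
  by under eq_fun do rewrite ReM; apply: measurable_funB; exact: measurable_funM.
by under eq_fun do rewrite ImM; apply: measurable_funD; exact: measurable_funM.
Qed.
Lemma cmeas_cst c : cmeas (fun=> c).
Proof. by split; exact: measurable_cst. Qed.
Lemma cmeasN f : cmeas f -> cmeas (fun x => - f x).
Proof.
by move=> h; under eq_fun do rewrite -mulN1r; apply: cmeasM => //; exact: cmeas_cst.
Qed.
Lemma cmeasB f g : cmeas f -> cmeas g -> cmeas (fun x => f x - g x).
Proof. by move=> hf hg; apply: cmeasD => //; exact: cmeasN. Qed.
Lemma cmeasC u : meas u -> cmeas (fun x => (u x)%:C).
Proof. by move=> h; split => //=; exact: measurable_cst. Qed.
Lemma cmeas_ReIm u v : meas u -> meas v ->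
  cmeas (fun x => u x +i* v x).
Proof. by []. Qed.
Lemma cmeas_conj f : cmeas f -> cmeas (fun x => conjc (f x)).
Proof.
move=> [a b]; split; first by under eq_fun do rewrite Re_conj.
by under eq_fun do rewrite Im_conj; exact: measurableT_comp.
Qed.
Lemma meas_sqr f : cmeas f -> meas (fun x => cmod (f x) ^+ 2).
Proof.
move=> [a b]; under eq_fun do rewrite cmod_sqr.
by apply: measurable_funD; exact: measurable_funX.
Qed.
Lemma meas_cmod f : cmeas f -> meas (fun x => cmod (f x)).
Proof.
move=> h; rewrite (_ : (fun x => _) = (fun x => (cmod (f x) ^+ 2) `^ 2^-1)).
  exact: (measurableT_comp (measurable_powR _) (meas_sqr h)).
by apply/funext => x; rewrite powR12_sqrt ?sqr_ge0// sqrtr_sqr ger0_norm.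
Qed.
Lemma cmeasV f : cmeas f -> cmeas (fun x => (f x)^-1).
Proof.
move=> h; rewrite (_ : (fun x => _) = (fun x => conjc (f x) * ((cmod (f x) ^+ 2)^-1)%:C)).
  apply: cmeasM; first exact: cmeas_conj.
  apply: cmeasC; apply: measurable_funV; first exact: meas_sqr.
  by move=> x; rewrite sqr_ge0.
apply/funext => x; have [->|n0] := eqVneq (f x) 0.
  by rewrite invr0 cmod0 expr0n /= invr0 mulr0.
rewrite CV -mul_conj; field; rewrite n0 andbT.
by rewrite -cmod_eq0 cmod_conj cmod_eq0.
Qed.
Lemma cmeasX f n : cmeas f -> cmeas (fun x => f x ^+ n).
Proof.
move=> h; elim: n => [|n IH]; first exact: cmeas_cst.
by under eq_fun do rewrite exprS; exact: cmeasM.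
Qed.
Lemma cmeas_expi u : meas u -> cmeas (fun x => expi (u x)).
Proof.
move=> h; split; rewrite /expi /=.
  exact: (measurableT_comp (continuous_measurable_fun (@continuous_cos R)) h).
exact: (measurableT_comp (continuous_measurable_fun (@continuous_sin R)) h).
Qed.

End complex_measurability.

Lemma cmeas_comp d d' (T : measurableType d) (T' : measurableType d') (R : realType)
    (f : T -> R[i]) (g : T' -> T) : cmeas f -> meas g -> cmeas (fun x => f (g x)).
Proof.
move=> [a b] mg; split; first exact: (measurableT_comp a mg).
exact: (measurableT_comp b mg).
Qed.

(** * Integrals of complex-valued functions *)

Section complex_integrals.
Variable R : realType.
Implicit Types (f g : R -> R[i]) (u v : R -> R) (c : R[i]).

Definition ccont f := forall x (e : R), 0 < e -> exists2 dl : R, 0 < dl &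
  forall y, `|y - x| < dl -> cmod (f y - f x) < e.

Lemma ccont_cmeas f : ccont f -> cmeas f.
Proof.
move=> h; have aux (p : R[i] -> R) (pd : forall z w, `|p z - p w| <= cmod (z - w)) :
    meas (fun x => p (f x)).
  apply: continuous_measurable_fun => x; apply/cvgrPdist_lt => e e0.
  have [dl dl0 H] := h x e e0; exists dl => //= y /= yx.
  by rewrite distrC; apply: le_lt_trans (pd _ _) _; apply: H; rewrite distrC.
split.
  by apply: aux => z w; rewrite -ReB Re_le.
by apply: aux => z w; rewrite -ImB Im_le.
Qed.

Lemma Re_lip (z w : R[i]) : `|Re z - Re w| <= cmod (z - w).
Proof. by rewrite -ReB Re_le. Qed.
Lemma Im_lip (z w : R[i]) : `|Im z - Im w| <= cmod (z - w).
Proof. by rewrite -ImB Im_le. Qed.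

Definition cI f := rI (fun x => Re (f x)) /\ rI (fun x => Im (f x)).
Definition cint f : R[i] := cintegral setT f.

Lemma cintE f : cint f = intg (fun x => Re (f x)) +i* intg (fun x => Im (f x)).
Proof. by []. Qed.
Lemma Re_cint f : Re (cint f) = intg (fun x => Re (f x)). Proof. by []. Qed.
Lemma Im_cint f : Im (cint f) = intg (fun x => Im (f x)). Proof. by []. Qed.

Lemma cI_meas f : cI f -> cmeas f.
Proof. by move=> [a b]; split; exact: rI_meas. Qed.
Lemma cI_le f u : cmeas f -> rI u -> (forall x, cmod (f x) <= u x) -> cI f.
Proof.
move=> [a b] iu h; split; apply: (rI_le _ iu) => // x; apply: le_trans (h x).
  exact: Re_le.
exact: Im_le.
Qed.
Lemma cI_cmod f : cI f -> rI (fun x => cmod (f x)).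
Proof.
move=> h; have [a b] := h.
apply: (rI_le (g := fun x => `|Re (f x)| + `|Im (f x)|)).
- exact: meas_cmod (cI_meas h).
- by apply: rID; exact: rI_norm.
by move=> x; rewrite ger0_norm// cmod_le_ReIm.
Qed.
Lemma cI_of_cmod f : cmeas f -> rI (fun x => cmod (f x)) -> cI f.
Proof. by move=> mf h; apply: (cI_le mf h). Qed.
Lemma eq_cI f g : f =1 g -> cI f -> cI g.
Proof. by move=> /funext ->. Qed.
Lemma eq_cint f g : f =1 g -> cint f = cint g.
Proof. by move=> /funext ->. Qed.
Lemma cID f g : cI f -> cI g -> cI (fun x => f x + g x).
Proof.
move=> [a b] [c d]; split; [under eq_fun do rewrite ReD|under eq_fun do rewrite ImD]; exact: rID.
Qed.
Lemma cIZ c f : cI f -> cI (fun x => c * f x).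
Proof.
move=> [a b]; split; [under eq_fun do rewrite ReM|under eq_fun do rewrite ImM].
  by apply: rIB; exact: rIZ.
by apply: rID; exact: rIZ.
Qed.
Lemma cIN f : cI f -> cI (fun x => - f x).
Proof. by move=> h; under eq_fun do rewrite -mulN1r; exact: cIZ. Qed.
Lemma cIB f g : cI f -> cI g -> cI (fun x => f x - g x).
Proof. by move=> hf hg; apply: cID => //; exact: cIN. Qed.
Lemma cI0 : cI (fun=> 0).
Proof. by split; exact: rI0. Qed.
Lemma cIC u : rI u -> cI (fun x => (u x)%:C).
Proof. by move=> h; split => //=; exact: rI0. Qed.
Lemma cI_conj f : cI f -> cI (fun x => conjc (f x)).
Proof.
move=> [a b]; split; first by under eq_fun do rewrite Re_conj.
by under eq_fun do rewrite Im_conj; exact: rIN.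
Qed.
Lemma cI_bounded_mul f g (B : R) : cmeas f -> cI g -> (forall x, cmod (f x) <= B) ->
  cI (fun x => f x * g x).
Proof.
move=> mf hg fB; apply: (cI_le (u := fun x => B * cmod (g x))).
- by apply: cmeasM => //; exact: cI_meas.
- by apply: rIZ; exact: cI_cmod.
by move=> x; rewrite cmodM ler_wpM2r.
Qed.
Lemma cintD f g : cI f -> cI g -> cint (fun x => f x + g x) = cint f + cint g.
Proof.
move=> [a b] [c d]; apply: cx_ext; rewrite ?ReD ?ImD ?Re_cint ?Im_cint -intgD//; apply: eq_intg => x.
  by rewrite ReD.
by rewrite ImD.
Qed.
Lemma cintZ c f : cI f -> cint (fun x => c * f x) = c * cint f.
Proof.
move=> [a b]; apply: cx_ext; rewrite ?ReM ?ImM ?Re_cint ?Im_cint -!intgZ//.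
  rewrite -intgB; [|exact: rIZ|exact: rIZ]; by apply: eq_intg => x; rewrite ReM.
rewrite -intgD; [|exact: rIZ|exact: rIZ]; by apply: eq_intg => x; rewrite ImM.
Qed.
Lemma cintN f : cI f -> cint (fun x => - f x) = - cint f.
Proof.
by move=> h; rewrite -[RHS]mulN1r -cintZ//; apply: eq_cint => x; rewrite mulN1r.
Qed.
Lemma cintB f g : cI f -> cI g -> cint (fun x => f x - g x) = cint f - cint g.
Proof. by move=> hf hg; rewrite -cintN// -cintD//; exact: cIN. Qed.
Lemma cint0 : cint (fun=> 0) = 0.
Proof. by rewrite cintE /= intg0. Qed.
Lemma cintC u : cint (fun x => (u x)%:C) = (intg u)%:C.
Proof. by apply: cx_ext; rewrite ?Re_cint ?Im_cint //= intg0. Qed.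
Lemma cint_conj f : cI f -> cint (fun x => conjc (f x)) = conjc (cint f).
Proof.
move=> [a b]; apply: cx_ext; rewrite ?Re_conj ?Im_conj ?Re_cint ?Im_cint.
  by apply: eq_intg => x; rewrite Re_conj.
by rewrite -intgN//; apply: eq_intg => x; rewrite Im_conj.
Qed.
Lemma cI_sum (I : Type) (s : seq I) (F : I -> R -> R[i]) :
  (forall i, cI (F i)) -> cI (fun x => \sum_(i <- s) F i x).
Proof.
move=> h; elim: s => [|i s IH]; first by under eq_fun do rewrite big_nil; exact: cI0.
by under eq_fun do rewrite big_cons; exact: cID.
Qed.
Lemma cint_sum (I : Type) (s : seq I) (F : I -> R -> R[i]) : (forall i, cI (F i)) ->
  cint (fun x => \sum_(i <- s) F i x) = \sum_(i <- s) cint (F i).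
Proof.
move=> h; elim: s => [|i s IH].
  by rewrite big_nil; under eq_fun do rewrite big_nil; exact: cint0.
by rewrite big_cons -IH -cintD//; [under eq_fun do rewrite big_cons|exact: cI_sum].
Qed.

(* Rotating so that the integral becomes real and positive reduces the complex
   triangle inequality to the real one. *)
Lemma cmod_cint f : cI f -> cmod (cint f) <= intg (fun x => cmod (f x)).
Proof.
move=> h; set c := cint f; have [c0|c0] := eqVneq c 0.
  by rewrite c0 cmod0; apply: intg_ge0.
have hc : 0 < cmod c by rewrite cmod_gt0.
rewrite -(ler_pM2l hc) -expr2.
have -> : cmod c ^+ 2 = Re (cint (fun x => conjc c * f x)).
  by rewrite cintZ// -/c mulrC mul_conj.
rewrite Re_cint -intgZ; last exact: cI_cmod.
apply: le_intg; first by case: (cIZ (conjc c) h).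
  by apply: rIZ; exact: cI_cmod.
by move=> x; rewrite (le_trans (cmod_ge_Re _))// cmodM cmod_conj.
Qed.
Lemma cmod_cint_le f u : cI f -> rI u -> (forall x, cmod (f x) <= u x) ->
  cmod (cint f) <= intg u.
Proof.
move=> hf hu fu; apply: le_trans (cmod_cint hf) _.
by apply: le_intg => //; exact: cI_cmod.
Qed.

Lemma cintegral_ae (D : set R) f g : {ae mu, forall x, D x -> f x = g x} ->
  cintegral D f = cintegral D g.
Proof.
move=> fg; rewrite /cintegral; congr (_ +i* _); apply: ae_Rintegral_eq;
by apply: aeS fg _ => x h Dx; rewrite h.
Qed.
Lemma cint_ae f g : {ae mu, forall x, f x = g x} -> cint f = cint g.
Proof. by move=> fg; apply: cintegral_ae; apply: aeS fg _ => x h _. Qed.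
Lemma cI_ae f g : cmeas f -> {ae mu, forall x, f x = g x} -> cI g -> cI f.
Proof.
move=> [a b] fg [c d]; split; [apply: rI_ae c => //|apply: rI_ae d => //];
by apply: aeS fg _ => x ->.
Qed.

Lemma cint_affine (k b : R) f : k != 0 -> cI f ->
  cint (fun x => f (k * x + b)) = (`|k|^-1)%:C * cint f.
Proof.
move=> k0 [a c]; apply: cx_ext; rewrite ?ReZ ?ImZ ?Re_cint ?Im_cint.
  exact: (intg_affine b k0 a).
exact: (intg_affine b k0 c).
Qed.
Lemma cI_refl f : cI f -> cI (fun x => f (- x)).
Proof. by move=> [a c]; split; [exact: (rI_refl a)|exact: (rI_refl c)]. Qed.
Lemma cint_refl f : cI f -> cint (fun x => f (- x)) = cint f.
Proof.
move=> [a c]; apply: cx_ext; rewrite ?Re_cint ?Im_cint.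
  exact: (intg_refl a).
exact: (intg_refl c).
Qed.

Lemma cdct (F : nat -> R -> R[i]) f u : (forall n, cmeas (F n)) -> cmeas f -> rI u ->
  ae_cvg F f ->
  {ae mu, forall x, forall n, cmod (F n x) <= u x} ->
  cI f /\ cmod (cint (F n) - cint f) @[n --> \oo] --> 0.
Proof.
move=> mF mf iu Fc Fu.
have aux (p : R[i] -> R) (pd : forall z w, `|p z - p w| <= cmod (z - w))
    (p0 : forall z, `|p z| <= cmod z)
    (mp : forall g, cmeas g -> meas (fun x => p (g x))) :
    rI (fun x => p (f x)) /\ intg (fun x => p (F n x)) @[n --> \oo] --> intg (fun x => p (f x)).
  apply: (dct _ _ iu) => [n|||]; [exact: mp|exact: mp| |].
    apply: aeS Fc _ => x hx; apply/cvgrPdist_lt => e e0.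
    move/cvgrPdist_lt: hx => /(_ e e0); apply: filterS => n.
    rewrite sub0r normrN ger0_norm// => hn.
    by apply: le_lt_trans hn; rewrite distrC.
  by apply: aeS Fu _ => x h n; apply: le_trans (h n).
have [i1 c1] := aux (@Re R) Re_lip (@Re_le R) (fun g mg => proj1 mg).
have [i2 c2] := aux (@Im R) Im_lip (@Im_le R) (fun g mg => proj2 mg).
split; first by [].
apply: (cvg0_le _ (cvgD0 (cvg_dist0 c1) (cvg_dist0 c2))) => n.
by apply/andP; split => //; apply: le_trans (cmod_le_ReIm _) _; rewrite ReB ImB !Re_cint !Im_cint.
Qed.

End complex_integrals.

(** * Square-integrable functions and their norm *)

Section square_integrable.
Variable R : realType.
Implicit Types (f g h : R -> R[i]) (u v : R -> R) (c : R[i]).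

(** Real-valued counterparts of [L2] and [L2norm], connected to them by [L2P] and [L2normE]; [nrm f]
    is meaningful only for f in [l2]. *)
Definition l2 f := cmeas f /\ rI (fun x => cmod (f x) ^+ 2).
Definition nsq f : R := intg (fun x => cmod (f x) ^+ 2).
Definition nrm f : R := Num.sqrt (nsq f).

Lemma nsq_ge0 f : 0 <= nsq f. Proof. by apply: intg_ge0 => x; rewrite sqr_ge0. Qed.
Lemma nrm_ge0 f : 0 <= nrm f. Proof. exact: sqrtr_ge0. Qed.
Hint Resolve nrm_ge0 : core.
Lemma nrm_sqr f : nrm f ^+ 2 = nsq f. Proof. by rewrite sqr_sqrtr// nsq_ge0. Qed.
Lemma nrm_leP f (M : R) : 0 <= M -> (nrm f <= M) = (nsq f <= M ^+ 2).
Proof. by move=> M0; rewrite -nrm_sqr ler_pXn2r// nnegrE. Qed.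
Lemma eq_nrm f g : f =1 g -> nrm f = nrm g.
Proof. by move=> /funext ->. Qed.
Lemma eq_l2 f g : f =1 g -> l2 f -> l2 g.
Proof. by move=> /funext ->. Qed.
Lemma nrm_ae f g : {ae mu, forall x, f x = g x} -> nrm f = nrm g.
Proof. by move=> fg; congr Num.sqrt; apply: intg_ae; apply: aeS fg _ => x ->. Qed.
Lemma l2_ae f g : cmeas f -> {ae mu, forall x, f x = g x} -> l2 g -> l2 f.
Proof.
move=> mf fg [mg ig]; split => //; apply: rI_ae ig; first exact: meas_sqr.
by apply: aeS fg _ => x ->.
Qed.
Lemma l2_le f u : cmeas f -> rI (fun x => u x ^+ 2) -> (forall x, cmod (f x) <= u x) -> l2 f.
Proof.
move=> mf iu h; split => //; apply: rI_le iu _; first exact: meas_sqr.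
by move=> x; rewrite ger0_norm ?sqr_ge0// ler_pXn2r ?nnegrE// (le_trans _ (h x)).
Qed.
Lemma l2_dom f g : cmeas f -> l2 g -> (forall x, cmod (f x) <= cmod (g x)) -> l2 f.
Proof. by move=> mf [_ ig]; exact: l2_le. Qed.
Lemma nrm_dom f g : l2 f -> l2 g -> (forall x, cmod (f x) <= cmod (g x)) -> nrm f <= nrm g.
Proof.
move=> [_ hf] [_ hg] fg; rewrite ler_wsqrtr// le_intg// => x.
by rewrite ler_pXn2r ?nnegrE.
Qed.
Lemma l2_0 : l2 (fun=> 0).
Proof.
split; first exact: cmeas_cst.
by under eq_fun do rewrite cmod0 expr0n /=; exact: rI0.
Qed.
Lemma nrm0 : nrm (fun=> 0) = 0.
Proof.
by rewrite /nrm /nsq; under eq_intg do rewrite cmod0 expr0n /=; rewrite intg0 sqrtr0.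
Qed.
Lemma l2Z c f : l2 f -> l2 (fun x => c * f x).
Proof.
move=> [mf hf]; split; first by apply: cmeasM => //; exact: cmeas_cst.
by under eq_fun do rewrite cmodM exprMn; exact: rIZ.
Qed.
Lemma nrmZ c f : l2 f -> nrm (fun x => c * f x) = cmod c * nrm f.
Proof.
move=> [_ hf]; rewrite /nrm /nsq; under eq_intg do rewrite cmodM exprMn.
by rewrite intgZ// sqrtrM ?sqr_ge0// sqrtr_sqr ger0_norm.
Qed.
Lemma l2N f : l2 f -> l2 (fun x => - f x).
Proof. by move=> h; under eq_fun do rewrite -mulN1r; exact: l2Z. Qed.
Lemma nrmN f : nrm (fun x => - f x) = nrm f.
Proof. by rewrite /nrm /nsq; under eq_intg do rewrite cmodN. Qed.
Lemma nrm_sym f g : nrm (fun x => f x - g x) = nrm (fun x => g x - f x).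
Proof. by rewrite -nrmN; apply: eq_nrm => x; rewrite opprB. Qed.
Lemma sqr_le_sum (a b d : R) : 0 <= a -> a <= b + d -> a ^+ 2 <= 2 * b ^+ 2 + 2 * d ^+ 2.
Proof.
move=> a0 h; apply: (@le_trans _ _ ((b + d) ^+ 2)).
  by rewrite ler_pXn2r// nnegrE ?(le_trans a0).
by have := sqr_ge0 (b - d); rewrite !expr2; lra.
Qed.
Lemma l2D f g : l2 f -> l2 g -> l2 (fun x => f x + g x).
Proof.
move=> [mf hf] [mg hg]; split; first exact: cmeasD.
apply: (rI_le (g := fun x => 2 * cmod (f x) ^+ 2 + 2 * cmod (g x) ^+ 2)).
- by apply: meas_sqr; exact: cmeasD.
- by apply: rID; exact: rIZ.
move=> x; rewrite ger0_norm ?sqr_ge0//.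
by apply: sqr_le_sum => //; exact: cmodD.
Qed.
Lemma l2B f g : l2 f -> l2 g -> l2 (fun x => f x - g x).
Proof. by move=> hf hg; apply: l2D => //; exact: l2N. Qed.
Lemma l2_bmul f g (B : R) : cmeas f -> (forall x, cmod (f x) <= B) -> l2 g ->
  l2 (fun x => f x * g x).
Proof.
move=> mf fB hg; apply: (@l2_le _ (fun x => B * cmod (g x))).
- by apply: cmeasM => //; case: hg.
- by under eq_fun do rewrite exprMn; apply: rIZ; case: hg.
by move=> x; rewrite cmodM ler_wpM2r.
Qed.
Lemma nrm_le_mul f g (B : R) : 0 <= B -> l2 f -> l2 g ->
  (forall x, cmod (f x) <= B * cmod (g x)) -> nrm f <= B * nrm g.
Proof.
move=> B0 hf hg fg; have -> : B * nrm g = nrm (fun x => B%:C * g x) by rewrite nrmZ// cmod_real ger0_norm.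
apply: nrm_dom => //; first exact: l2Z.
by move=> x; rewrite cmodM cmod_real ger0_norm.
Qed.
Lemma nrm_bmul f g (B : R) : cmeas f -> (forall x, cmod (f x) <= B) -> l2 g ->
  nrm (fun x => f x * g x) <= B * nrm g.
Proof.
move=> mf fB hg; apply: nrm_le_mul => //.
- by apply: le_trans (fB 0).
- exact: l2_bmul hg.
by move=> x; rewrite cmodM ler_wpM2r.
Qed.
Lemma l2_conj f : l2 f -> l2 (fun x => conjc (f x)).
Proof.
move=> [mf hf]; split; first exact: cmeas_conj.
by under eq_fun do rewrite cmod_conj.
Qed.
Lemma nrm_conj f : nrm (fun x => conjc (f x)) = nrm f.
Proof. by rewrite /nrm /nsq; under eq_intg do rewrite cmod_conj. Qed.
Lemma l2_refl f : l2 f -> l2 (fun x => f (- x)).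
Proof.
move=> [mf hf]; split; last exact: (rI_refl hf).
by apply: (cmeas_comp mf).
Qed.
Lemma nrm_refl f : l2 f -> nrm (fun x => f (- x)) = nrm f.
Proof. by move=> [mf hf]; rewrite /nrm /nsq -[in RHS](intg_refl hf). Qed.
Lemma nrm_eint f : cmeas f -> forall M : R, 0 <= M ->
  (eint (fun x => (cmod (f x) ^+ 2)%R) <= (M ^+ 2)%:E)%E -> l2 f /\ nrm f <= M.
Proof.
move=> mf M M0 h; have hl : l2 f.
  split => //; apply: rI_ge0; [exact: meas_sqr|by move=> x; rewrite sqr_ge0|].
  by apply: le_lt_trans h _; rewrite ltry.
by split => //; rewrite nrm_leP// /nsq -lee_fin -eint_intg//; case: hl.
Qed.
Lemma eint_nrm f : l2 f -> eint (fun x => (cmod (f x) ^+ 2)%R) = (nrm f ^+ 2)%:E.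
Proof. by move=> [_ hf]; rewrite nrm_sqr eint_intg. Qed.

Lemma rI_mul f g : l2 f -> l2 g -> rI (fun x => cmod (f x) * cmod (g x)).
Proof.
move=> [mf hf] [mg hg]; apply: (rI_le (g := fun x => cmod (f x) ^+ 2 + cmod (g x) ^+ 2)).
- by apply: measurable_funM; exact: meas_cmod.
- exact: rID.
move=> x; rewrite ger0_norm ?mulr_ge0//; have := cmod_ge0 (f x); have := cmod_ge0 (g x).
move: (cmod _) (cmod _) => a b a0 b0; nra.
Qed.
Lemma cI_mul f g : l2 f -> l2 g -> cI (fun x => f x * g x).
Proof.
move=> hf hg; apply: (cI_le (u := fun x => cmod (f x) * cmod (g x))).
- by apply: cmeasM; [case: hf|case: hg].
- exact: rI_mul.
by move=> x; rewrite cmodM.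
Qed.

(** Pointwise s t <= B/(2A) s^2 + A/(2B) t^2, with A and B the two norms. Either norm may vanish, so
    both are enlarged by d, chosen so that A B exceeds the product of the norms by at most e. *)
Lemma cauchy_schwarz f g : l2 f -> l2 g ->
  intg (fun x => cmod (f x) * cmod (g x)) <= nrm f * nrm g.
Proof.
move=> hf hg; apply/ler_addgt0Pr => e e0.
have [a0 b0] : 0 <= nrm f /\ 0 <= nrm g by [].
set S := nrm f + nrm g + 1.
have S0 : 0 < S by rewrite ltr_wpDl// addr_ge0.
pose d := Num.min 1 (e / S).
have d0 : 0 < d by rewrite lt_min ltr01 divr_gt0.
have dS : d * S <= e by rewrite -ler_pdivlMr// ge_min lexx orbT.
have d1 : d <= 1 by rewrite ge_min lexx.
set A := nrm f + d; set B := nrm g + d.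
have A0 : 0 < A by rewrite ltr_wpDl.
have B0 : 0 < B by rewrite ltr_wpDl.

apply: (@le_trans _ _ (B / A / 2 * nsq f + A / B / 2 * nsq g)).
  rewrite /nsq -!intgZ; [|by case: hg|by case: hf].
  rewrite -intgD; [|by apply: rIZ; case: hf|by apply: rIZ; case: hg].
  apply: le_intg; first exact: rI_mul.
    by apply: rID; apply: rIZ; [case: hf|case: hg].
  move=> x; set s := cmod (f x); set t := cmod (g x).
  rewrite -subr_ge0.
  have -> : B / A / 2 * s ^+ 2 + A / B / 2 * t ^+ 2 - s * t = (B * s - A * t) ^+ 2 / (2 * A * B).
    by field; rewrite !gt_eqF.
  by rewrite divr_ge0 ?sqr_ge0// ltW// !mulr_gt0.
rewrite -!nrm_sqr.
have hA : nrm f ^+ 2 <= A ^+ 2 by rewrite /A; nra.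
have hB : nrm g ^+ 2 <= B ^+ 2 by rewrite /B; nra.
apply: (@le_trans _ _ (B / A / 2 * A ^+ 2 + A / B / 2 * B ^+ 2)).
  by apply: lerD; rewrite ler_wpM2l// ?divr_ge0// ltW// divr_gt0.
have -> : B / A / 2 * A ^+ 2 + A / B / 2 * B ^+ 2 = A * B by field; rewrite !gt_eqF.
apply: le_trans (lerD (lexx _) dS).
rewrite /A /B /S; have : d * d <= d by rewrite ler_piMr// ltW.
have := ltW d0; lra.
Qed.
Lemma cmod_cint_mul f g : l2 f -> l2 g -> cmod (cint (fun x => f x * g x)) <= nrm f * nrm g.
Proof.
move=> hf hg; apply: le_trans (cauchy_schwarz hf hg).
apply: cmod_cint_le; [exact: cI_mul|exact: rI_mul|by move=> x; rewrite cmodM].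
Qed.
Lemma nrmD f g : l2 f -> l2 g -> nrm (fun x => f x + g x) <= nrm f + nrm g.
Proof.
move=> hf hg; rewrite nrm_leP ?addr_ge0//.
apply: (@le_trans _ _ (nsq f + nsq g + 2 * intg (fun x => cmod (f x) * cmod (g x)))).
  have [[_ hf2] [_ hg2]] := (hf, hg).
  rewrite /nsq -intgD// -intgZ; last exact: rI_mul.
  rewrite -intgD; [|exact: rID|apply: rIZ; exact: rI_mul].
  apply: le_intg; first by case: (l2D hf hg).
    by apply: rID; [exact: rID|apply: rIZ; exact: rI_mul].
  move=> x; have -> : cmod (f x) ^+ 2 + cmod (g x) ^+ 2 + 2 * (cmod (f x) * cmod (g x))
    = (cmod (f x) + cmod (g x)) ^+ 2 by ring.
  by rewrite ler_pXn2r ?nnegrE ?addr_ge0// cmodD.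
have := cauchy_schwarz hf hg; rewrite -!nrm_sqr => h.
have -> : (nrm f + nrm g) ^+ 2 = nrm f ^+ 2 + nrm g ^+ 2 + 2 * (nrm f * nrm g) by ring.
lra.
Qed.
Lemma nrmB f g : l2 f -> l2 g -> nrm (fun x => f x - g x) <= nrm f + nrm g.
Proof. by move=> hf hg; rewrite -(nrmN g); apply: nrmD => //; exact: l2N. Qed.
Lemma nrm_tri h f g : l2 f -> l2 g -> l2 h ->
  nrm (fun x => f x - g x) <= nrm (fun x => f x - h x) + nrm (fun x => h x - g x).
Proof.
move=> hf hg hh; apply: le_trans (nrmD (l2B hf hh) (l2B hh hg)).
by rewrite (eq_nrm (f := fun x => f x - g x) (g := fun x => f x - h x + (h x - g x)))// => x; ring.
Qed.
Lemma nrm_dist f g : l2 f -> l2 g -> `|nrm f - nrm g| <= nrm (fun x => f x - g x).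
Proof.
move=> hf hg; rewrite ler_norml.
have h1 := nrmD (l2B hf hg) hg; have h2 := nrmD (l2B hg hf) hf.
rewrite (eq_nrm (f := fun x => f x - g x + g x) (g := f)) in h1; last by move=> x; rewrite subrK.
rewrite (eq_nrm (f := fun x => g x - f x + f x) (g := g)) in h2; last by move=> x; rewrite subrK.
rewrite (nrm_sym g) in h2; apply/andP; split; lra.
Qed.
Lemma l2_sum (I : Type) (s : seq I) (F : I -> R -> R[i]) :
  (forall i, l2 (F i)) -> l2 (fun x => \sum_(i <- s) F i x).
Proof.
move=> h; elim: s => [|i s IH]; first by under eq_fun do rewrite big_nil; exact: l2_0.
by under eq_fun do rewrite big_cons; exact: l2D.
Qed.
Lemma nrm_sum (I : Type) (s : seq I) (F : I -> R -> R[i]) : (forall i, l2 (F i)) ->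
  nrm (fun x => \sum_(i <- s) F i x) <= \sum_(i <- s) nrm (F i).
Proof.
move=> h; elim: s => [|i s IH].
  by rewrite big_nil; under eq_fun do rewrite big_nil; rewrite nrm0.
rewrite big_cons; under eq_fun do rewrite big_cons.
by apply: le_trans (nrmD (h i) (l2_sum _ h)) _; rewrite lerD2l.
Qed.

Lemma l2_fatou (F : nat -> R -> R[i]) f (M : R) : cmeas f -> (forall n, l2 (F n)) ->
  ae_cvg F f ->
  (forall n, nrm (F n) <= M) -> l2 f /\ nrm f <= M.
Proof.
move=> mf hF Fc FM; have M0 : 0 <= M by exact: le_trans (FM 0%N).
apply: nrm_eint => //.
apply: (@fatou_le _ (fun n x => cmod (F n x) ^+ 2)).
- by move=> n; apply: meas_sqr; case: (hF n).
- by move=> n x; rewrite sqr_ge0.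
- apply: aeS Fc _ => x hx.
  have h : cmod (F n x) @[n --> \oo] --> cmod (f x).
    apply/cvgrPdist_lt => e e0; move/cvgrPdist_lt: hx => /(_ e e0); apply: filterS => n.
    rewrite sub0r normrN ger0_norm// => hn.
    by rewrite distrC; apply: le_lt_trans hn; exact: cmod_dist.
  by rewrite expr2; under eq_fun do rewrite expr2; exact: cvgM.
- by move=> n; rewrite eint_nrm// lee_fin ler_pXn2r ?nnegrE.
Qed.

Lemma l2_dct (F : nat -> R -> R[i]) f g : (forall n, cmeas (F n)) -> cmeas f -> l2 g ->
  ae_cvg F f ->
  (forall n x, cmod (F n x) <= cmod (g x)) -> l2 f ->
  nrm (fun x => F n x - f x) @[n --> \oo] --> 0.
Proof.
move=> mF mf hg Fc Fg hf.
have [|||||_ h] := @dct R (fun n x => cmod (F n x - f x) ^+ 2) (fun=> 0)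
   (fun x => 2 * cmod (g x) ^+ 2 + 2 * cmod (f x) ^+ 2).
- by move=> n; apply: meas_sqr; exact: cmeasB.
- exact: measurable_cst.
- by apply: rID; apply: rIZ; [case: hg|case: hf].
- by apply: aeS Fc _ => x hx; apply: (cvg0_le _ (cvgM0 hx hx)) => n; rewrite sqr_ge0 expr2 /=.
- apply: aeT => x n; rewrite ger0_norm ?sqr_ge0//.
  by apply: sqr_le_sum => //; apply: le_trans (cmodB _ _) _; rewrite lerD2r.
rewrite intg0 in h; have := cvg_comp _ _ h (@sqrt_continuous R 0).
by rewrite sqrtr0.
Qed.

End square_integrable.
#[global] Hint Extern 0 (is_true (0 <= nrm _)) => exact: nrm_ge0 : core.

(** * Completeness of L2 and weak convergence *)

Section completeness.
Variable R : realType.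
Implicit Types (f g h : R -> R[i]) (u v : R -> R) (c : R[i]).

Lemma half_pow_gt0 n : (0 : R) < 2^-1 ^+ n.
Proof. by rewrite exprn_gt0// invr_gt0. Qed.
Lemma half_pow_sum n : \sum_(k < n) (2^-1 : R) ^+ k = 2 - 2 * 2^-1 ^+ n.
Proof.
elim: n => [|n IH]; first by rewrite big_ord0 expr0 mulr1 subrr.
by rewrite big_ord_recr /= IH exprS; field.
Qed.
Lemma half_pow_small (e : R) : 0 < e -> exists n, 2^-1 ^+ n < e.
Proof.
move=> e0; have h : `|2^-1 : R| < 1 by rewrite ger0_norm ?invf_lt1 ?ltr1n.
have /cvgrPdist_lt /(_ e e0) [N _ H] := cvg_expr h.
exists N; have := H N (leqnn N).
by rewrite sub0r normrN ger0_norm// ltW// half_pow_gt0.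
Qed.

Lemma cvg_of_summable (u : nat -> R) (M : R) :
  (forall n, \sum_(k < n) `|u k.+1 - u k| <= M) -> cvgn u.
Proof.
move=> h; pose v k := u k.+1 - u k.
have cv : cvgn (series v).
  apply: normed_cvg; apply: nondecreasing_is_cvgn.
    apply/nondecreasing_seqP => n; change (series (fun k => `|v k|) n <= series (fun k => `|v k|) n.+1).
    by rewrite /series /= !big_mkord big_ord_recr /= lerDl.
  exists M => _ [n _ <-]; change (series (fun k => `|v k|) n <= M).
  by rewrite /series /= big_mkord; exact: h.
have -> : u = (fun n => series v n + u 0%N).
  by apply/funext => n; rewrite /series /= telescope_sumr// subrK.
by apply: is_cvgD => //; exact: is_cvg_cst.
Qed.

(** The limit superior is measurable on the whole line, also where the sequence diverges, and so
    provides a version of a possibly non-measurable v. *)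
Lemma meas_ae_lim (u : nat -> R -> R) (v : R -> R) : (forall n, meas (u n)) ->
  {ae mu, forall x, u n x @[n --> \oo] --> v x} ->
  exists2 w, meas w & {ae mu, forall x, w x = v x}.
Proof.
move=> mu' h; exists (fun x => fine (limn_esup (fun n => (u n x)%:E))).
  apply: measurableT_comp => //; apply: measurable_fun_limn_esup => n; exact/measurable_EFinP.
apply: (aeS h) => x hx; have hE : (u n x)%:E @[n --> \oo] --> (v x)%:E by apply: cvg_EFin => //; near=> n.
by rewrite is_cvg_limn_esupE; [rewrite (cvg_lim _ hE)|apply/cvg_ex; exists (v x)%:E].
Unshelve. all: by end_near. Qed.

Lemma cmeas_ae_lim F f : (forall n, cmeas (F n)) ->
  ae_cvg F f ->
  exists2 g, cmeas g & {ae mu, forall x, g x = f x}.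
Proof.
move=> mF h; have aux (p : R[i] -> R) : (forall z w, `|p z - p w| <= cmod (z - w)) ->
    {ae mu, forall x, p (F n x) @[n --> \oo] --> p (f x)}.
  move=> pl; apply: (aeS h) => x /cvgrPdist_le hx; apply/cvgrPdist_le => e /hx.
  apply: filterS => n; rewrite sub0r normrN ger0_norm// => le.
  by rewrite (le_trans (pl _ _))// cmodC.
have [a ma ha] := meas_ae_lim (fun n => (mF n).1) (aux _ (@Re_lip R)).
have [b mb hb] := meas_ae_lim (fun n => (mF n).2) (aux _ (@Im_lip R)).
exists (fun x => a x +i* b x); first exact: cmeas_ReIm.
by apply: (aeS (aeI ha hb)) => x [-> ->]; rewrite -complexE.
Qed.

(** Riesz-Fischer: the partial sums of |F (k+1) - F k| have norm at most 2, so by monotone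
    convergence the full sum is finite almost everywhere and F converges there; Fatou applied to the
    tails gives the rate. *)
Lemma fast_complete (F : nat -> R -> R[i]) : (forall n, l2 (F n)) ->
  (forall n, nrm (fun x => F n.+1 x - F n x) <= 2^-1 ^+ n) ->
  exists f, [/\ l2 f, ae_cvg F f &
    forall n, nrm (fun x => F n x - f x) <= 2 * 2^-1 ^+ n].
Proof.
move=> hF dF.
pose G N x : R := \sum_(k < N) cmod (F k.+1 x - F k x).
have GE N : (fun x => (G N x)%:C) = (fun x => \sum_(k <- index_enum 'I_N) (cmod (F k.+1 x - F k x))%:C).
  apply/funext => x; rewrite /G; elim/big_rec2 : _ => // i a b _ <-.
  by rewrite CD.
have lk k : l2 (fun x => (cmod (F k.+1 x - F k x))%:C).
  apply: (l2_dom _ (l2B (hF k.+1) (hF k))) => [|x]; last by rewrite cmod_real ger0_norm.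
  by apply: cmeasC; apply: meas_cmod; apply: cmeasB; [case: (hF k.+1)|case: (hF k)].
have lG N : l2 (fun x => (G N x)%:C) by rewrite GE; apply: l2_sum => k.
have nG N : nrm (fun x => (G N x)%:C) <= 2.
  rewrite GE; apply: le_trans (nrm_sum _ (fun k : 'I_N => lk k)) _.
  apply: (@le_trans _ _ (\sum_(k < N) (2^-1 : R) ^+ k)); last first.
    by rewrite half_pow_sum gerBl mulr_ge0// ltW// half_pow_gt0.
  apply: ler_sum => k _; apply: le_trans (dF k).
  by rewrite /nrm /nsq; under eq_intg do rewrite cmod_real ger0_norm//.
have mG N : meas (G N).
  by have [[m _] _] := lG N.
have G0 N x : 0 <= G N x by apply: sumr_ge0.
have Gnd x : nondecreasing_seq (fun N => (G N x ^+ 2)%:E).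
  apply/nondecreasing_seqP => n; rewrite lee_fin ler_pXn2r ?nnegrE//.
  by rewrite /G big_ord_recr /= lerDl.
pose H x : \bar R := limn (fun N => (G N x ^+ 2)%:E).
have mG2 N : meas (fun x => (G N x ^+ 2)%:E).
  by apply: measurable_EFin_comp; exact: measurable_funX.
have mH : meas H.
  apply: (emeasurable_fun_cvg (fun N x => (G N x ^+ 2)%:E)) => // x _.
  by apply: ereal_nondecreasing_is_cvgn; exact: Gnd.
have iH : mu.-integrable setT H.
  apply/integrableP; split => //.
  have -> : (\int[mu]_x `|H x| = \int[mu]_x H x)%E.
    apply: eq_integral => x _; rewrite gee0_abs// /H; apply: lime_ge.
      by apply: ereal_nondecreasing_is_cvgn; exact: Gnd.
    by apply: nearW => n; rewrite lee_fin sqr_ge0.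
  rewrite /H monotone_convergence//.
  - apply: (@le_lt_trans _ _ (2 ^+ 2)%:E); last by rewrite ltry.
    apply: lime_le.
      apply: ereal_nondecreasing_is_cvgn => m n mn.
      apply: (@le_eint R (fun x => G m x ^+ 2) (fun x => G n x ^+ 2)).
      - by move=> x; rewrite sqr_ge0.
      - exact: measurable_funX.
      - exact: measurable_funX.
      - by move=> x; have := Gnd x m n mn; rewrite lee_fin.
    apply: nearW => n; have := eint_nrm (lG n); rewrite /eint.
    have -> : (fun x => (cmod (G n x)%:C ^+ 2)%:E) = (fun x => (G n x ^+ 2)%:E).
      by apply/funext => x; rewrite cmod_real real_normK ?num_real.
    by move=> ->; rewrite lee_fin ler_pXn2r ?nnegrE.
  - by move=> n x _; rewrite lee_fin sqr_ge0.
have [N [mN N0 sub]] := integrable_ae measurableT iH.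
have bd x : ~ N x -> exists M, forall n, G n x <= M.
  move=> Nx; have fH : H x \is a fin_num.
    by apply: contrapT => nf; apply: Nx; apply: sub => /(_ I).
  exists (1 + fine (H x)) => n.
  have : ((G n x ^+ 2)%:E <= (fine (H x))%:E)%E.
    rewrite fineK// /H (cvg_lim _ (ereal_nondecreasing_cvgn (Gnd x)))//.
    by apply: ereal_sup_ubound; exists n.
  by rewrite lee_fin; have := G0 n x; move: (G n x) (fine _) => a b; nra.
have cF x (p : R[i] -> R) (pd : forall z w, `|p z - p w| <= cmod (z - w)) : ~ N x ->
    cvgn (fun n => p (F n x)).
  move=> /bd[M hM]; apply: (@cvg_of_summable _ M) => n; apply: le_trans (hM n).
  by apply: ler_sum => k _.
have Fl : {ae mu, forall x, cmod (F n x - (limn (fun n => Re (F n x)) +i* limn (fun n => Im (F n x)))) @[n --> \oo] --> 0}.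
  exists N; split => // x /=; apply: contra_notP => Nx.
  apply: (cvg0_le _ (cvgD0 (cvg_dist0 (cF x (@Re R) (@Re_lip R) Nx)) (cvg_dist0 (cF x (@Im R) (@Im_lip R) Nx)))) => n.
  by apply/andP; split => //; apply: le_trans (cmod_le_ReIm _) _; rewrite ReB ImB.
have [f mf ef] := cmeas_ae_lim (fun n => proj1 (hF n)) Fl.
have Ff : ae_cvg F f by apply: (aeS (aeI Fl ef)) => x [h ->].
have tail n m : nrm (fun x => F (m + n)%N x - F n x) <= 2 * 2^-1 ^+ n - 2 * 2^-1 ^+ (m + n).
  elim: m => [|m IH].
    by rewrite add0n subrr; under eq_nrm do rewrite subrr; rewrite nrm0.
  apply: le_trans (nrm_tri (hF _) (hF _) (hF (m + n)%N)) _.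
  apply: le_trans (lerD (dF _) IH) _.
  by rewrite addSn exprS; move: (2^-1 ^+ (m + n)) => a; lra.
have ff n : l2 (fun x => F n x - f x) /\ nrm (fun x => F n x - f x) <= 2 * 2^-1 ^+ n.
  apply: (@l2_fatou _ (fun m x => F n x - F (m + n)%N x)).
  - by apply: cmeasB => //; case: (hF n).
  - by move=> m; exact: l2B.
  - apply: aeS Ff _ => x hx; have := hx; rewrite -(cvg_shiftn n) /=.
    apply: cvg0_le => m; rewrite cmod_ge0 /=.
    by rewrite (_ : F n x - F (m + n)%N x - (F n x - f x) = - (F (m + n)%N x - f x)) ?cmodN//; ring.
  - move=> m; rewrite nrm_sym; apply: le_trans (tail n m) _.
    by rewrite gerBl mulr_ge0// ltW// half_pow_gt0.
exists f; split => // [|n]; last by case: (ff n).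
have := l2B (hF 0%N) (proj1 (ff 0%N)); apply: eq_l2 => x; ring.
Qed.

Lemma l2_complete (F : nat -> R -> R[i]) : (forall n, l2 (F n)) ->
  (forall e, 0 < e -> exists N, forall m n, (N <= m)%N -> (N <= n)%N ->
     nrm (fun x => F m x - F n x) < e) ->
  exists2 f, l2 f & nrm (fun x => F n x - f x) @[n --> \oo] --> 0.
Proof.
move=> hF cF.
have /choice[N hN] : forall k, exists N, forall m n, (N <= m)%N -> (N <= n)%N ->
     nrm (fun x => F m x - F n x) < 2^-1 ^+ k.
  by move=> k; apply: cF; exact: half_pow_gt0.
(* Summing makes [phi] monotone while keeping [N k <= phi k]. *)
pose phi k := (\sum_(j < k.+1) N j)%N.
have phiN k : (N k <= phi k)%N by rewrite /phi big_ord_recr /= leq_addl.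
have phiS k : (phi k <= phi k.+1)%N by rewrite /phi [leqRHS]big_ord_recr /= leq_addr.
have [f [lf _ h]] : exists f, [/\ l2 f, {ae mu, forall x, cmod (F (phi n) x - f x) @[n --> \oo] --> 0} &
    forall n, nrm (fun x => F (phi n) x - f x) <= 2 * 2^-1 ^+ n].
  apply: fast_complete => // n; apply: ltW; apply: hN => //.
  exact: leq_trans (phiN n) (phiS n).
exists f => //; apply/seq_cvg0P => // e e0.
have [k hk] := @half_pow_small (e / 3) (divr_gt0 e0 (ltr0Sn _ 2)).
exists (N k) => n Nn; apply: le_lt_trans (nrm_tri (hF n) lf (hF (phi k))) _.
have := hN k n (phi k) Nn (phiN k); have := h k; lra.
Qed.

(** Put a = |F n - f| and b = |g|. Either a b <= b^2/d, and then a b is the minimum [m], to which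
    dominated convergence applies; or b <= d a, and a b <= d a^2 has integral at most 4 M^2 d. The 8
    in K makes this less than e/2. *)
Lemma weak_limit (F : nat -> R -> R[i]) f g (M : R) : cmeas f -> (forall n, l2 (F n)) ->
  ae_cvg F f ->
  (forall n, nrm (F n) <= M) -> l2 g ->
  cmod (cint (fun x => F n x * g x) - cint (fun x => f x * g x)) @[n --> \oo] --> 0.
Proof.
move=> mf hF Fc FM hg.
have [hf nf] := l2_fatou mf hF Fc FM.
have M0 : 0 <= M by exact: le_trans nf.
apply/seq_cvg0P => // e e0.
pose K := 8 * M ^+ 2 + 1; have K0 : 0 < K by rewrite ltr_wpDl// mulr_ge0// sqr_ge0.
pose d := e / K; have d0 : 0 < d by rewrite divr_gt0.
pose m n x : R := Num.min (cmod (F n x - f x) * cmod (g x)) (cmod (g x) ^+ 2 / d).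
have m0 n x : 0 <= m n x by rewrite le_min mulr_ge0//= divr_ge0 ?sqr_ge0// ltW.
have mm n : meas (m n).
  apply: measurable_minr.
    by apply: measurable_funM; apply: meas_cmod; [apply: cmeasB => //; case: (hF n)|case: hg].
  by apply: measurable_funM => //; apply: meas_sqr; case: hg.
have ig : rI (fun x => cmod (g x) ^+ 2 / d).
  by under eq_fun do rewrite mulrC; apply: rIZ; case: hg.
have im n : rI (m n).
  apply: rI_le ig _ => // x; by rewrite ger0_norm// ge_min lexx orbT.
have [||||| _ mc] := @dct R m (fun=> 0) (fun x => cmod (g x) ^+ 2 / d).
- exact: mm.
- exact: measurable_cst.
- exact: ig.
- apply: aeS Fc _ => x hx.
  apply: (cvg0_le _ (cvgZ0 (cmod (g x)) hx)) => n.
  by rewrite m0 /= ge_min mulrC lexx.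
- by apply: aeT => x n; rewrite ger0_norm// ge_min lexx orbT.
rewrite intg0 in mc; move/cvgrPdist_lt: mc => /(_ (e / 2)) []; first by rewrite divr_gt0.
move=> N _ hN; exists N => n Nn.
have := hN n Nn; rewrite sub0r normrN => /(le_lt_trans (ler_norm _)) hm.
rewrite -cintB; [|exact: cI_mul|exact: cI_mul].
have hB := l2B (hF n) hf.
have -> : cint (fun x => F n x * g x - f x * g x) = cint (fun x => (F n x - f x) * g x).
  by apply: eq_cint => x; rewrite mulrBl.
apply: le_lt_trans (cmod_cint_le (u := fun x => m n x + d * cmod (F n x - f x) ^+ 2) _ _ _) _.
- exact: cI_mul.
- by apply: rID => //; apply: rIZ; case: hB.
- move=> x; rewrite cmodM /m; set a := cmod _; set b := cmod _.
  have a0 : 0 <= a by exact: cmod_ge0.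
  have b0 : 0 <= b by exact: cmod_ge0.
  have da : 0 <= d * a ^+ 2 by rewrite mulr_ge0 ?sqr_ge0// ltW.
  case: (leP (a * b) (b ^+ 2 / d)) => h; first by rewrite lerDl.
  have : b <= d * a.
    rewrite leNgt; apply/negP => dab; move: h; rewrite ltNge => /negP; apply.
    rewrite ler_pdivlMr// expr2 mulrAC ler_wpM2r//.
    by apply: ltW; rewrite mulrC.
  have := divr_ge0 (sqr_ge0 b) (ltW d0); move: (b ^+ 2 / d) => q q0 bda.
  by rewrite expr2 mulrA; apply: le_trans (_ : a * (d * a) <= _); [rewrite ler_wpM2l|lra].
rewrite intgD//; last by apply: rIZ; case: hB.
rewrite intgZ; last by case: hB.
have nB : nrm (fun x => F n x - f x) <= 2 * M.
  by apply: le_trans (nrmB (hF n) hf) _; have := FM n; lra.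
have : d * nsq (fun x => F n x - f x) < e / 2.
  rewrite -nrm_sqr; apply: (@le_lt_trans _ _ (d * (2 * M) ^+ 2)).
    by rewrite ler_wpM2l ?(ltW d0)// ler_pXn2r// nnegrE ?mulr_ge0.
  rewrite /d mulrAC ltr_pdivrMr// /K exprMn; nra.
rewrite /nsq; lra.
Qed.

End completeness.

(** * Fubini's theorem with a sectionwise majorant *)

Section fubini.
Variable R : realType.
Implicit Types (f g : R -> R[i]) (u v : R -> R).

Local Notation RR := (measurableTypeR R * measurableTypeR R)%type.

Lemma tonelli (F : RR -> R) : meas F -> (forall p, 0 <= F p) ->
  (\int[mu]_x \int[mu]_y (F (x, y))%:E = \int[mu]_y \int[mu]_x (F (x, y))%:E)%E.
Proof.
move=> mF F0; apply: (fubini_tonelli (EFin \o F)).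
  exact/measurable_EFinP.
by move=> p; rewrite lee_fin.
Qed.

(** Integrability on the plane is obtained from sections in one order only; in the other order the
    sections are integrable for almost every y, and [intg] takes a default value elsewhere. *)
Lemma real_fubini (F G : RR -> R) u : meas F ->
  meas G -> (forall p, `|F p| <= G p) ->
  rI u -> (forall x, (eint (fun y => G (x, y)) <= (u x)%:E)%E) ->
  rI (fun x => intg (fun y => F (x, y))) /\
  intg (fun x => intg (fun y => F (x, y))) = intg (fun y => intg (fun x => F (x, y))).
Proof.
move=> mF mG FG iu h.
have u0 x : 0 <= u x.
  rewrite -lee_fin; apply: le_trans (h x); apply: eint_ge0 => y.
  exact: le_trans (FG _).
have iF : (mu \x mu)%E.-integrable setT (EFin \o F).
  apply/integrable12ltyP; first exact/measurable_EFinP.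
  apply: (@le_lt_trans _ _ (\int[mu]_x (u x)%:E)%E); last first.
    by have := eint_intg iu; rewrite /eint => ->; rewrite ltry.
  apply: ge0_le_integral => //.
  - by move=> x _; apply: integral_ge0.
  - apply: (measurable_fun_fubini_tonelli_F (fun p : RR => `|(F p)%:E|%E)) => //.
    by apply: measurableT_comp => //; exact/measurable_EFinP.
  - by apply: measurable_EFin_comp; exact: rI_meas.
  - move=> x _; apply: le_trans (h x); apply: ge0_le_integral => //.
    + apply: measurableT_comp => //; apply: measurable_EFin_comp.
      exact: (measurableT_comp mF (measurable_pair1 x)).
    + apply: measurable_EFin_comp.
      exact: (measurableT_comp mG (measurable_pair1 x)).
    + by move=> y _; rewrite lee_fin.
have iFF := integrable_fubini_F iF; have eqF := Fubini iF; have iG := ae_integrable2 iF.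
have fin1 x : (\int[mu]_y (F (x, y))%:E)%E = (intg (fun y => F (x, y)))%:E.
  rewrite -eint_intg//; apply: (rI_le (g := fun y => G (x, y))) => //.
    exact: (measurableT_comp mF (measurable_pair1 x)).
  apply: rI_ge0; first exact: (measurableT_comp mG (measurable_pair1 x)).
    by move=> y; apply: le_trans (FG _).
  by apply: le_lt_trans (h x) _; rewrite ltry.
have iI : rI (fun x => intg (fun y => F (x, y))).
  rewrite /rI (_ : EFin \o _ = fubini_F mu (EFin \o F)); first exact: iFF.
  by apply/funext => x; exact/esym/fin1.
split; first exact: iI.
have aeG : {ae mu, forall y, (\int[mu]_x (F (x, y))%:E)%E = (intg (fun x => F (x, y)))%:E}.
  by apply: (aeS iG) => y iy; rewrite /intg /Rintegral fineK//; exact: integrable_fin_num.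
have e1 : (intg (fun x => intg (fun y => F (x, y))))%:E =
    (\int[mu]_y (intg (fun x => F (x, y)))%:E)%E.
  rewrite -(ae_integral_eq aeG) -eint_intg// /eint -(eqF : _ = (\int[mu]_y \int[mu]_x (F (x, y))%:E)%E).
  by apply: eq_integral => x _; exact/esym/fin1.
by rewrite [RHS]/intg /Rintegral -e1.
Qed.

Lemma cfubini (F : RR -> R[i]) u : cmeas F -> rI u ->
  (forall x, (eint (fun y => cmod (F (x, y))) <= (u x)%:E)%E) ->
  cI (fun x => cint (fun y => F (x, y))) /\
  cint (fun x => cint (fun y => F (x, y))) = cint (fun y => cint (fun x => F (x, y))).
Proof.
move=> mF iu h; have [mR mI] := mF.
have [i1 e1] := real_fubini mR (meas_cmod mF) (fun p => Re_le (F p)) iu h.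
have [i2 e2] := real_fubini mI (meas_cmod mF) (fun p => Im_le (F p)) iu h.
split; first exact: (conj i1 i2).
by apply: cx_ext; [exact: e1|exact: e2].
Qed.

End fubini.

(** * Agreement with the Lebesgue space of the statement *)

Section square_integrable_spec.
Variable R : realType.
Implicit Types (f g : R -> R[i]) (u v : R -> R).

Lemma integral_poweR2 u :
  (\int[mu]_x (`|(EFin \o u) x| `^ 2) = eint (fun x => (u x ^+ 2)%R))%E.
Proof.
apply: eq_integral => x _; rewrite [`|_|%E]/= poweR_EFin; congr EFin.
by rewrite -[2]/(2%:R) powR_mulrn// real_normK ?num_real.
Qed.

Lemma Lfun2P u : u \in Lfun mu 2%:E <-> meas u /\ rI (fun x => u x ^+ 2).
Proof.
split.
  move=> h; have := Lfun2_integrable_sqr h.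
  have mu' : meas u by have := sub_Lfun_mfun h; rewrite inE.
  by move=> iu; split.
move=> [mu' iu]; rewrite inE; apply/andP; split; rewrite inE//=.
rewrite /finite_norm unlock integral_poweR2 eint_intg//.
by rewrite poweR_EFin ltry.
Qed.

Lemma L2P f : L2 f <-> l2 f.
Proof.
split.
  move=> [/Lfun2P[a b] /Lfun2P[c d]]; split => //.
  by under eq_fun do rewrite cmod_sqr; exact: rID.
move=> [mf hf]; have [a b] := mf; split; apply/Lfun2P; split => //.
  apply: rI_le hf _; first exact: measurable_funX.
  by move=> x; rewrite ger0_norm ?sqr_ge0// cmod_sqr lerDl sqr_ge0.
apply: rI_le hf _; first exact: measurable_funX.
by move=> x; rewrite ger0_norm ?sqr_ge0// cmod_sqr lerDr sqr_ge0.
Qed.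

Lemma L2normE f : l2 f -> L2norm f = (nrm f)%:E.
Proof.
move=> hf; rewrite /L2norm unlock integral_poweR2 eint_nrm// poweR_EFin; congr EFin.
by rewrite powR12_sqrt ?sqr_ge0// sqrtr_sqr ger0_norm.
Qed.

Lemma L2norm_le f (M : R) : cmeas f -> (L2norm f <= M%:E)%E -> l2 f /\ nrm f <= M.
Proof.
move=> mf h.
suff hf : l2 f by split => //; rewrite -lee_fin -L2normE.
split => //; apply: rI_ge0; [exact: meas_sqr|by move=> x; rewrite sqr_ge0|].
move: h; rewrite /L2norm unlock integral_poweR2.
case: (eint _) => [r||] //=; first by rewrite ltry.
by rewrite invr_eq0 pnatr_eq0 /= leye_eq.
Qed.

Lemma ae_nrm0 f : l2 f -> nrm f = 0 -> {ae mu, forall x, f x = 0}.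
Proof.
move=> hf n0; have := eint_nrm hf; rewrite n0 expr0n /= => h.
have : ae_eq mu setT (fun x => (cmod (f x) ^+ 2)%:E) (cst 0%E).
  apply/(ae_eq_integral_abs mu measurableT).
    by apply: measurable_EFin_comp; apply: meas_sqr; case: hf.
  rewrite -[RHS]h; apply: eq_integral => x _ /=.
  by rewrite ger0_norm ?sqr_ge0.
move=> k; apply: (aeS k) => x /(_ I) [] /eqP; rewrite sqrf_eq0 cmod_eq0 => /eqP; exact.
Qed.

End square_integrable_spec.

(** * Derivatives of complex functions of a real variable *)

Section real_variable_derivative.
Variable R : realType.
Implicit Types (f g : R -> R[i]) (x : R) (D : R[i]).

Definition rder f x D := forall e : R, 0 < e -> exists2 d : R, 0 < d &
  forall h : R, `|h| < d -> cmod (f (x + h) - f x - D * h%:C) <= e * `|h|.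

Lemma rderD f g x D E : rder f x D -> rder g x E -> rder (fun t => f t + g t) x (D + E).
Proof.
move=> HF HG e e0; have e2 : 0 < e / 2 by rewrite divr_gt0.
have [d d0 K] := HF _ e2; have [d' d0' K'] := HG _ e2.
exists (Num.min d d'); first by rewrite lt_min d0.
move=> h; rewrite lt_min => /andP[/K{}K /K'{}K'].
have -> : f (x + h) + g (x + h) - (f x + g x) - (D + E) * h%:C
  = (f (x + h) - f x - D * h%:C) + (g (x + h) - g x - E * h%:C) by ring.
by apply: le_trans (cmodD _ _) _; lra.
Qed.
Lemma rderZ c f x D : rder f x D -> rder (fun t => c * f t) x (c * D).
Proof.
move=> HF e e0; have c1 : 0 < cmod c + 1 by rewrite ltr_wpDl.
have [d d0 K] := HF _ (divr_gt0 e0 c1); exists d => // h /K{}K.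
have -> : c * f (x + h) - c * f x - c * D * h%:C = c * (f (x + h) - f x - D * h%:C) by ring.
rewrite cmodM; apply: le_trans (ler_wpM2l (cmod_ge0 c) K) _.
have -> : cmod c * (e / (cmod c + 1) * `|h|) = cmod c / (cmod c + 1) * (e * `|h|).
  by field; rewrite gt_eqF.
rewrite ler_piMl ?mulr_ge0 ?(ltW e0)// ler_pdivrMr// mul1r lerDl//.
Qed.
Lemma rder_real x : rder (fun t => t%:C) x 1.
Proof.
move=> e e0; exists 1 => // h _; rewrite CD mul1r (_ : _ - _ = 0) ?cmod0; last by ring.
by rewrite mulr_ge0// ltW.
Qed.
Lemma rder_line F z v x D : cder F (z + v * x%:C) D -> rder (fun t => F (z + v * t%:C)) x (D * v).
Proof.
move=> H e e0; have v1 : 0 < cmod v + 1 by rewrite ltr_wpDl.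
have [d d0 K] := H _ (divr_gt0 e0 v1); exists (d / (cmod v + 1)); first by rewrite divr_gt0.
move=> h; rewrite ltr_pdivlMr// => hd.
have vh : cmod (v * h%:C) <= `|h| * (cmod v + 1).
  by rewrite cmodM cmod_real mulrC ler_wpM2l// lerDl.
have := K (v * h%:C) (le_lt_trans vh hd); rewrite CD mulrDr addrA mulrA => K'.
apply: le_trans K' _; apply: le_trans (ler_wpM2l _ vh) _; first by rewrite divr_ge0// ltW.
by rewrite mulrCA mulrVK ?unitfE ?gt_eqF// mulrC.
Qed.
Lemma rder_lineE F (u : R -> R[i]) z v x D : (forall t, u t = z + v * t%:C) ->
  cder F (u x) D -> rder (fun t => F (u t)) x (D * v).
Proof.
move=> uE H; have -> : (fun t => F (u t)) = (fun t => F (z + v * t%:C)).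
  by apply/funext => t; rewrite uE.
by apply: rder_line; rewrite -uE.
Qed.

Lemma rder_is_derive f x D (p : R[i] -> R) : (forall z w, p (z - w) = p z - p w) ->
  (forall z, `|p z| <= cmod z) -> (forall z (h : R), p (z * h%:C) = p z * h) ->
  rder f x D -> is_derive x (1 : R) (fun t => p (f t) : R) (p D).
Proof.
move=> pB pn pZ H.
suff h : (h^-1 *: (p (f (h *: (1 : R) + x)) - p (f x))) @[h --> 0^'] --> p D.
  by split; [apply/cvg_ex; exists (p D)|apply/cvg_lim].
apply/cvgrPdist_le => e e0; have [d d0 K] := H e e0.
exists d => //= h /=; rewrite sub0r normrN => hd h0.
rewrite distrC -(ler_pM2r (_ : 0 < `|h|)) ?normr_gt0// -normrM.
apply: le_trans (K h hd); apply: le_trans (pn _).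
rewrite !pB pZ le_eqVlt; apply/orP; left; apply/eqP; congr (`|_|).
by rewrite [h *: 1]mulr1 (addrC h x) mulrBl mulrAC /GRing.scale /= mulVf// mul1r.
Qed.
Lemma rder_Re f x D : rder f x D -> is_derive x (1 : R) (fun t => Re (f t)) (Re D).
Proof.
apply: rder_is_derive => [z w|z|z h]; [exact: ReB|exact: Re_le|].
by rewrite ReM /= mulr0 subr0.
Qed.
Lemma rder_Im f x D : rder f x D -> is_derive x (1 : R) (fun t => Im (f t)) (Im D).
Proof.
apply: rder_is_derive => [z w|z|z h]; [exact: ImB|exact: Im_le|].
by rewrite ImM /= mulr0 add0r.
Qed.

(** The real mean value theorem is applied to Re (conj c f) with c = f b - f a, whose increment over
    [a, b] is |c|^2. *)
Lemma mean_value_ineq f (D : R -> R[i]) (a b M : R) : a <= b ->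
  (forall x, a <= x <= b -> rder f x (D x)) ->
  (forall x, a <= x <= b -> cmod (D x) <= M) -> cmod (f b - f a) <= M * (b - a).
Proof.
rewrite le_eqVlt => /predU1P[<- _ _|ab hf hD]; first by rewrite !subrr cmod0 mulr0.
set c := f b - f a; have [->|c0] := eqVneq c 0.
  rewrite cmod0 mulr_ge0 ?subr_ge0 ?(ltW ab)//.
  by apply: le_trans (hD a _) => //; rewrite lexx ltW.
have hc : 0 < cmod c by rewrite cmod_gt0.
pose p z := Re (conjc c * z).
have dp x : a <= x <= b -> is_derive x (1 : R) (fun t => p (f t)) (p (D x)).
  by move=> xab; apply: rder_Re; apply: rderZ; exact: hf.
have [x xab E] : exists2 x, x \in `]a, b[%R & p (f b) - p (f a) = p (D x) * (b - a).
  apply: (@MVT R (fun t => p (f t)) (fun t => p (D t)) a b ab) => [x xab|].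
    by apply: dp; move: xab; rewrite in_itv /= => /andP[/ltW -> /ltW ->].
  apply: derivable_within_continuous => x; rewrite in_itv /= => xab.
  by have [] := dp x xab.
rewrite -(ler_pM2l hc) -expr2.
have -> : cmod c ^+ 2 = p (f b) - p (f a).
  by rewrite /p -ReB -mulrBr -/c mulrC mul_conj.
rewrite E mulrA ler_wpM2r ?subr_ge0 ?(ltW ab)//.
apply: le_trans (cmod_ge_Re _) _; rewrite cmodM cmod_conj ler_wpM2l//.
by apply: hD; move: xab; rewrite in_itv /= => /andP[/ltW -> /ltW ->].
Qed.

Lemma rder_ccont f (D : R -> R[i]) : (forall x, rder f x (D x)) -> ccont f.
Proof.
move=> h x e e0; have [d d0 K] := h x 1 ltr01.
have m0 : 0 < cmod (D x) + 1 by rewrite ltr_wpDl.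
exists (Num.min d (e / (cmod (D x) + 1))); first by rewrite lt_min d0 divr_gt0.
move=> y; rewrite lt_min => /andP[/K]; rewrite (_ : x + (y - x) = y); last by ring.
rewrite mul1r ltr_pdivlMr// => h1 h2.
have -> : f y - f x = (f y - f x - D x * (y - x)%:C) + D x * (y - x)%:C by rewrite subrK.
apply: le_lt_trans (cmodD _ _) _; apply: le_lt_trans h2; rewrite cmodM cmod_real mulrDr mulr1 addrC.
by rewrite mulrC lerD2l.
Qed.

End real_variable_derivative.

(** * Integrals over segments of the real line *)

Section interval_integral.
Variable R : realType.
Implicit Types (f g : R -> R[i]) (a b : R).

Definition itg a b f : R[i] := cint (fun s => (\1_`[a, b]%classic s)%:C * f s).

Lemma ccont_Re f : ccont f -> continuous (fun x => Re (f x) : R^o).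
Proof.
move=> h x; apply/cvgrPdist_lt => e e0; have [d d0 K] := h x e e0.
exists d => //= y; rewrite /= distrC => /K; apply: le_lt_trans.
by rewrite distrC Re_lip.
Qed.
Lemma ccont_Im f : ccont f -> continuous (fun x => Im (f x) : R^o).
Proof.
move=> h x; apply/cvgrPdist_lt => e e0; have [d d0 K] := h x e e0.
exists d => //= y; rewrite /= distrC => /K; apply: le_lt_trans.
by rewrite distrC Im_lip.
Qed.

Lemma rI_indic_cont (u : R -> R) a b : continuous (u : R -> R^o) ->
  rI (fun s => \1_`[a, b]%classic s * u s).
Proof.
move=> cu; have i1 : mu.-integrable `[a, b]%classic (EFin \o u).
  apply: continuous_compact_integrable; first exact: segment_compact.
  by apply: continuous_subspaceT => x; exact: cu.
have := i1; rewrite integrable_mkcond//; apply: eq_integrable => // x _.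
by rewrite /= patchE indicE; case: ifPn => _; rewrite ?mul1r ?mul0r.
Qed.

Lemma cI_itg a b f : ccont f -> cI (fun s => (\1_`[a, b]%classic s)%:C * f s).
Proof.
move=> h; split.
  by under eq_fun do rewrite ReZ; exact: rI_indic_cont (ccont_Re h).
by under eq_fun do rewrite ImZ; exact: rI_indic_cont (ccont_Im h).
Qed.

Lemma itgD a b f g : ccont f -> ccont g -> itg a b (fun s => f s + g s) = itg a b f + itg a b g.
Proof.
move=> hf hg; rewrite /itg -cintD; [|exact: cI_itg|exact: cI_itg].
by apply: eq_cint => s; rewrite mulrDr.
Qed.
Lemma itgZ c a b f : ccont f -> itg a b (fun s => c * f s) = c * itg a b f.
Proof.
move=> hf; rewrite /itg -cintZ; last exact: cI_itg.
by apply: eq_cint => s; rewrite mulrCA.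
Qed.

Lemma itg_FTC f (D : R -> R[i]) a b : a < b -> (forall x, rder f x (D x)) -> ccont D ->
  itg a b D = f b - f a.
Proof.
move=> ab hf cD.
have aux (p : R[i] -> R) : continuous (fun x => p (D x) : R^o) ->
    (forall x, is_derive x (1 : R) (fun t => p (f t)) (p (D x))) ->
    intg (fun s => \1_`[a, b]%classic s * p (D s)) = p (f b) - p (f a).
  move=> cp dp; have -> : p (f b) - p (f a) = fine (\int[mu]_(x in `[a, b]%classic) (p (D x))%:E)%E.
    rewrite (@continuous_FTC2 R (fun x => p (D x)) (fun x => p (f x)) a b ab)//.
    - by apply: continuous_subspaceT => x; exact: cp.
    - split => [x _||]; first by have [] := dp x.
        apply: cvg_at_right_filter; apply: differentiable_continuous.
        by apply/derivable1_diffP; have [] := dp a.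
      apply: cvg_at_left_filter; apply: differentiable_continuous.
      by apply/derivable1_diffP; have [] := dp b.
    - by move=> x _; rewrite derive1E; have [_ ->] := dp x.
  rewrite /intg /Rintegral [in RHS]integral_mkcond; congr fine; apply: eq_integral => x _.
  by rewrite /= patchE indicE; case: ifPn => _; rewrite ?mul1r ?mul0r.
apply: cx_ext.
  rewrite ReB Re_cint; have := aux (@Re R) (ccont_Re cD) (fun x => rder_Re (hf x)) => <-.
  by apply: eq_intg => x; rewrite ReZ.
rewrite ImB Im_cint; have := aux (@Im R) (ccont_Im cD) (fun x => rder_Im (hf x)) => <-.
by apply: eq_intg => x; rewrite ImZ.
Qed.

Lemma intg_indic a b : a <= b -> rI (\1_`[a, b]%classic : R -> R) /\ intg (\1_`[a, b]%classic) = b - a.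
Proof.
move=> ab; split.
  have := @rI_indic_cont (fun=> 1) a b (@cst_continuous _ _ (1 : R^o)).
  by apply: eq_rI => x; rewrite mulr1.
rewrite /intg /Rintegral integral_indic// setIT.
transitivity (fine (lebesgue_measure (`[a, b]%classic : set R))); first by [].
rewrite lebesgue_measure_itv /= lte_fin; case: ltP => //=.
by move=> ba; rewrite (@le_anti _ _ a b) ?ab// subrr.
Qed.

Lemma cmod_itg a b f M : a <= b -> ccont f -> (forall s, a <= s <= b -> cmod (f s) <= M) ->
  cmod (itg a b f) <= M * (b - a).
Proof.
move=> ab cf hf; have [i1 e1] := intg_indic ab.
rewrite -e1 -intgZ//; apply: cmod_cint_le; [exact: cI_itg|exact: rIZ|move=> s].
rewrite cmodM cmod_real indicE; case: (boolP (s \in _)) => [|_].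
  by rewrite inE /= in_itv /= normr1 mul1r mulr1 => /hf.
by rewrite normr0 mul0r mulr0.
Qed.

Lemma itg_halves f : ccont f ->
  itg 0 1 f = (2^-1)%:C * itg 0 1 (fun s => f (2^-1 * s)) + (2^-1)%:C * itg 0 1 (fun s => f (2^-1 * s + 2^-1)).
Proof.
move=> cf.
have h0 : (2^-1 : R) != 0 by rewrite invr_eq0.
have hp : (0 : R) < 2^-1 by rewrite invr_gt0.
have ha : `|(2^-1 : R)|^-1 = 2 by rewrite ger0_norm ?invrK// ltW.
have i1 := cI_itg 0 2^-1 cf; have i2 := cI_itg 2^-1 1 cf.
have e1 : itg 0 1 (fun s => f (2^-1 * s)) = 2%:C * itg 0 2^-1 f.
  have := cint_affine 0 h0 i1; rewrite ha /itg => <-; apply: eq_cint => s.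
  rewrite addr0 !indicE; congr (((_ : bool)%:R)%:C * _).
  apply/idP/idP; rewrite !inE /= !in_itv /= => /andP[s1 s2]; apply/andP; split; lra.
have e2 : itg 0 1 (fun s => f (2^-1 * s + 2^-1)) = 2%:C * itg 2^-1 1 f.
  have := cint_affine 2^-1 h0 i2; rewrite ha /itg => <-; apply: eq_cint => s.
  rewrite !indicE; congr (((_ : bool)%:R)%:C * _).
  apply/idP/idP; rewrite !inE /= !in_itv /= => /andP[s1 s2]; apply/andP; split; lra.
have h2 : (2^-1)%:C * 2%:C = 1 :> R[i] by rewrite -CM mulVf.
rewrite e1 e2 !mulrA h2 !mul1r /itg -cintD//; apply: cint_ae.
(* At the midpoint both indicators equal 1, so the identity holds only off this point. *)
exists [set 2^-1]; split => //; first by rewrite lebesgue_measure_set1.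
move=> s /=; apply: contra_notP => ne; rewrite -mulrDl; congr (_ * _).
rewrite -CD !indicE; congr (_%:C).
have ne' : s != 2^-1 by apply/eqP.
have [sl|sl] := ltP s 2^-1.
  rewrite [s \in `[2^-1, 1]%classic](_ : _ = false) ?addr0; last first.
    by apply/negbTE; rewrite notin_setE /= in_itv /= => /andP[]; lra.
  congr ((_ : bool)%:R); apply/idP/idP; rewrite !inE /= !in_itv /= => /andP[s1 s2]; apply/andP; split; lra.
have sl' : 2^-1 < s by rewrite lt_neqAle eq_sym ne'.
rewrite [s \in `[0, 2^-1]%classic](_ : _ = false) ?add0r; last first.
  by apply/negbTE; rewrite notin_setE /= in_itv /= => /andP[]; lra.
congr ((_ : bool)%:R); apply/idP/idP; rewrite !inE /= !in_itv /= => /andP[s1 s2]; apply/andP; split; lra.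
Qed.

Lemma itg_rev f : ccont f -> itg 0 1 (fun s => f (1 - s)) = itg 0 1 f.
Proof.
move=> cf; have n1 : (-1 : R) != 0 by rewrite oppr_eq0 oner_eq0.
rewrite -[RHS]mul1r; have <- : (`|-1 : R|^-1)%:C = 1 :> R[i] by rewrite normrN1 invr1.
rewrite /itg -(cint_affine 1 n1 (cI_itg 0 1 cf)); apply: eq_cint => s.
have -> : -1 * s + 1 = 1 - s :> R by ring.
rewrite !indicE; congr (((_ : bool)%:R)%:C * _).
apply/idP/idP; rewrite !inE /= !in_itv /= => /andP[s1 s2]; apply/andP; split; lra.
Qed.

End interval_integral.

(** * Goursat's theorem on triangles and primitives *)

Section goursat.
Variable R : realType.
Implicit Types (F G : R[i] -> R[i]) (a b w z : R[i]).

Definition ccont2 F := forall z (e : R), 0 < e -> exists2 d : R, 0 < d &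
  forall w, cmod (w - z) < d -> cmod (F w - F z) < e.

Definition seg F a b : R[i] := (b - a) * itg 0 1 (fun s => F (a + (b - a) * s%:C)).
Definition tri F a b z : R[i] := seg F a b + seg F b z + seg F z a.

Lemma ccont_line F a v : ccont2 F -> ccont (fun s : R => F (a + v * s%:C)).
Proof.
move=> h x e e0; have [d d0 K] := h (a + v * x%:C) e e0.
have v1 : 0 < cmod v + 1 by rewrite ltr_wpDl.
exists (d / (cmod v + 1)); first by rewrite divr_gt0.
move=> y; rewrite ltr_pdivlMr// => yx; apply: K.
have -> : a + v * y%:C - (a + v * x%:C) = v * (y - x)%:C by rewrite CB; ring.
apply: le_lt_trans yx; rewrite cmodM cmod_real mulrC ler_wpM2l// lerDl//.
Qed.

Lemma seg_rev F a b : ccont2 F -> seg F b a = - seg F a b.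
Proof.
move=> h; rewrite /seg -(itg_rev (ccont_line b (a - b) h)) -mulNr opprB; congr (_ * _).
by congr itg; apply/funext => s; congr F; rewrite CB; ring.
Qed.

Lemma seg_mid F a b : ccont2 F ->
  seg F a b = seg F a (2^-1%:C * (a + b)) + seg F (2^-1%:C * (a + b)) b.
Proof.
move=> h; have h2 : (2^-1 : R)%:C = 2^-1 :> R[i] by rewrite CV C_nat.
rewrite /seg itg_halves; last exact: ccont_line.
have n2 : 2 != 0 :> R[i] by rewrite pnatr_eq0.
have -> : (fun s => F (a + (b - a) * (2^-1 * s)%:C)) =
    (fun s => F (a + (2^-1%:C * (a + b) - a) * s%:C)).
  by apply/funext => s; congr F; rewrite CM h2; field.
have -> : (fun s => F (a + (b - a) * (2^-1 * s + 2^-1)%:C)) =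
    (fun s => F (2^-1%:C * (a + b) + (b - 2^-1%:C * (a + b)) * s%:C)).
  by apply/funext => s; congr F; rewrite CD CM h2; field.
by rewrite h2; field.
Qed.

Lemma cmod_seg F a b M : ccont2 F ->
  (forall s : R, 0 <= s <= 1 -> cmod (F (a + (b - a) * s%:C)) <= M) ->
  cmod (seg F a b) <= cmod (b - a) * M.
Proof.
move=> h hM; rewrite cmodM ler_wpM2l//.
have := cmod_itg (@ler01 R) (ccont_line a (b - a) h) hM.
by rewrite subr0 mulr1.
Qed.

Lemma segB F G a b : ccont2 F -> ccont2 G -> seg (fun w => F w - G w) a b = seg F a b - seg G a b.
Proof.
move=> hF hG; rewrite /seg -mulrBr; congr (_ * _).
rewrite -[in RHS]mulN1r -itgZ; last exact: ccont_line.
rewrite -itgD; [|exact: ccont_line|].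
  by congr itg; apply/funext => s; rewrite mulN1r.
move=> x e e0; have [d d0 K] := ccont_line a (b - a) hG x e0.
by exists d => // y /K; rewrite -mulrBr cmodM cmodN cmod1 mul1r.
Qed.

Lemma seg_FTC (P F : R[i] -> R[i]) a b : ccont2 F -> (forall w, cder P w (F w)) ->
  seg F a b = P b - P a.
Proof.
move=> cF h; rewrite /seg -itgZ; last exact: ccont_line.
rewrite (@itg_FTC R (fun s => P (a + (b - a) * s%:C)) _ 0 1) ?ltr01//.
- by congr (P _ - P _); [rewrite mulr1; ring|rewrite mulr0 addr0].
- by move=> x; rewrite mulrC; exact: rder_line.
- move=> x e e0; have v1 : 0 < cmod (b - a) + 1 by rewrite ltr_wpDl.
  have [d d0 K] := ccont_line a (b - a) cF x (divr_gt0 e0 v1).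
  exists d => // y /K; rewrite -mulrBr cmodM ltr_pdivlMr// => h1.
  by apply: le_lt_trans h1; rewrite mulrC ler_wpM2l// lerDl.
Qed.

Lemma cont2_affine (al be : R[i]) : ccont2 (fun w => al * w + be).
Proof.
move=> z e e0; have v1 : 0 < cmod al + 1 by rewrite ltr_wpDl.
exists (e / (cmod al + 1)); first by rewrite divr_gt0.
move=> w; rewrite ltr_pdivlMr// => h.
have -> : al * w + be - (al * z + be) = al * (w - z) by ring.
by apply: le_lt_trans h; rewrite cmodM mulrC ler_wpM2l// lerDl.
Qed.

Lemma tri_affine (al be a b z : R[i]) : tri (fun w => al * w + be) a b z = 0.
Proof.
have P w : cder (fun w => 2^-1%:C * al * (w * w) + be * w) w (al * w + be).
  rewrite (_ : al * w + be = 2^-1%:C * al * (2 * w) + be); first exact: cder_quad.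
  by rewrite CV C_nat; field.
rewrite /tri !(seg_FTC _ _ (cont2_affine al be) P); ring.
Qed.

Definition perim (t : R[i] * R[i] * R[i]) : R :=
  cmod (t.1.2 - t.1.1) + cmod (t.2 - t.1.2) + cmod (t.1.1 - t.2).

Lemma tri_split F a b z : ccont2 F -> let m u v := 2^-1%:C * (u + v) in
  tri F a b z = tri F a (m a b) (m z a) + tri F (m a b) b (m b z) +
    tri F (m b z) z (m z a) + tri F (m a b) (m b z) (m z a).
Proof.
move=> h m; rewrite /tri (seg_mid a b h) (seg_mid b z h) (seg_mid z a h) -!/(m _ _).
rewrite (seg_rev (m z a) (m a b) h) (seg_rev (m a b) (m b z) h) (seg_rev (m b z) (m z a) h).
ring.
Qed.

Let mid (u v : R[i]) := 2^-1%:C * (u + v).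

Lemma cmod_half (u v : R[i]) : 2%:R * u = v -> cmod u = 2^-1 * cmod v.
Proof.
by move=> <-; rewrite cmodM -C_nat cmod_real ger0_norm// mulKf.
Qed.

Lemma Im_mid (u v : R[i]) (m : R) : m <= Im u -> m <= Im v -> m <= Im (mid u v).
Proof. by move=> hu hv; rewrite /mid ImZ ImD; lra. Qed.

(** One of the four midpoint triangles carries at least a quarter of the integral. The bound on the
    drift of the first vertex makes the vertices converge under iteration; the last clause keeps the
    triangles inside a half-plane. *)
Lemma tri_step F (t : R[i] * R[i] * R[i]) : ccont2 F -> exists t' : R[i] * R[i] * R[i],
  [/\ cmod (tri F t.1.1 t.1.2 t.2) <= 4 * cmod (tri F t'.1.1 t'.1.2 t'.2),
      perim t' <= 2^-1 * perim t, cmod (t'.1.1 - t.1.1) <= perim t &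
      forall m, m <= Im t.1.1 -> m <= Im t.1.2 -> m <= Im t.2 ->
        [/\ m <= Im t'.1.1, m <= Im t'.1.2 & m <= Im t'.2]].
Proof.
case: t => [[a b] z] h /=; rewrite (tri_split a b z h) -!/(mid _ _) /perim /=.
have h2 : (2^-1 : R)%:C = 2^-1 :> R[i] by rewrite CV C_nat.
have n2 : 2 != 0 :> R[i] by rewrite pnatr_eq0.
set T1 := tri F a _ _; set T2 := tri F _ b _; set T3 := tri F _ z _; set T4 := tri F _ _ _.
have n1 : cmod (T1 + T2 + T3 + T4) <= cmod T1 + cmod T2 + cmod T3 + cmod T4.
  apply: le_trans (cmodD _ _) _; rewrite lerD2r; apply: le_trans (cmodD _ _) _.
  by rewrite lerD2r cmodD.
have M1 x y : cmod (mid x y - x) = 2^-1 * cmod (y - x) by apply: cmod_half; rewrite /mid h2; field.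
have M2 x y : cmod (mid x y - y) = 2^-1 * cmod (x - y) by apply: cmod_half; rewrite /mid h2; field.
have M3 x y w : cmod (mid x y - mid y w) = 2^-1 * cmod (x - w) by apply: cmod_half; rewrite /mid h2; field.
have mE := (M1, M2, M3, fun x y => etrans (cmodC x (mid x y)) (M1 x y),
  fun x y => etrans (cmodC y (mid x y)) (M2 x y),
  fun x y w => etrans (cmodC (mid y w) (mid x y)) (M3 x y w), cmodC z b, cmodC b a, cmodC a z).
have p0 : 0 <= cmod (a - b) by []. have p1 : 0 <= cmod (b - z) by []. have p2 : 0 <= cmod (z - a) by [].
have [c1|c1] := leP (cmod (T1 + T2 + T3 + T4)) (4 * cmod T1).
  exists (a, mid a b, mid z a); split => //=; first by rewrite !mE; lra.
  - by rewrite subrr cmod0 !mE; lra.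
  - by move=> m ma mb mz; split => //; exact: Im_mid.
have [c2|c2] := leP (cmod (T1 + T2 + T3 + T4)) (4 * cmod T2).
  exists (mid a b, b, mid b z); split => //=; try by rewrite !mE; lra.
  by move=> m ma mb mz; split => //; exact: Im_mid.
have [c3|c3] := leP (cmod (T1 + T2 + T3 + T4)) (4 * cmod T3).
  exists (mid b z, z, mid z a); split => //=; first by rewrite !mE; lra.
  - have -> : mid b z - a = mid (b - a) (z - a) by rewrite /mid h2; field.
    rewrite /mid cmodM cmod_real ger0_norm ?invr_ge0// !mE.
    by have := cmodD (b - a) (z - a); rewrite !mE; lra.
  - by move=> m ma mb mz; split => //; exact: Im_mid.
exists (mid a b, mid b z, mid z a); split => //=; first by rewrite -/T4; lra.
- by rewrite !mE; lra.
- by rewrite !mE; lra.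
- by move=> m ma mb mz; split => //; exact: Im_mid.
Qed.

(** The nested triangles shrink to a point zs above height c, where F is differentiable; 4^n
    triangles of perimeter at most L 2^-n with first-order error on each leave a total of order
    e. *)
Lemma goursat F (c : R) a b z : ccont2 F -> (forall w, c < Im w -> exists D, cder F w D) ->
  c < Im a -> c < Im b -> c < Im z -> tri F a b z = 0.
Proof.
move=> cF hF ca cb cz.
have /choice[st hst] := fun t => tri_step t cF.
pose t n := iter n st (a, b, z).
pose m := Num.min (Im a) (Num.min (Im b) (Im z)).
have mc : c < m by rewrite !lt_min ca cb cz.
have mt n : [/\ m <= Im (t n).1.1, m <= Im (t n).1.2 & m <= Im (t n).2].
  elim: n => [|n [h1 h2 h3]]; first by rewrite /= /m !ge_min !lexx !orbT.
  by have [_ _ _ K] := hst (t n); exact: K.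
set L := perim (a, b, z).
have L0 : 0 <= L by rewrite /L /perim !addr_ge0.
have hp n : perim (t n) <= L * 2^-1 ^+ n.
  elim: n => [|n IH]; first by rewrite expr0 mulr1.
  have [_ K _ _] := hst (t n); apply: le_trans K _.
  by rewrite exprS; move: IH; move: (perim _) (_ ^+ n) => p x; lra.
have hT n : cmod (tri F a b z) <= 4 ^+ n * cmod (tri F (t n).1.1 (t n).1.2 (t n).2).
  elim: n => [|n IH]; first by rewrite expr0 mul1r.
  have [K _ _ _] := hst (t n); apply: le_trans IH _.
  by rewrite exprSr -mulrA ler_wpM2l// exprn_ge0.
pose u n := (t n).1.1.
have du n : cmod (u n.+1 - u n) <= L * 2^-1 ^+ n.
  by have [_ _ K _] := hst (t n); apply: le_trans K (hp n).
have sm n : \sum_(k < n) cmod (u k.+1 - u k) <= 2 * L.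
  apply: (@le_trans _ _ (\sum_(k < n) L * 2^-1 ^+ k)); first by apply: ler_sum => k _.
  by rewrite -mulr_sumr half_pow_sum mulrC ler_wpM2r// gerBl mulr_ge0// ltW// half_pow_gt0.
have cR : cvgn (fun n => Re (u n)).
  apply: (@cvg_of_summable _ _ (2 * L)) => n; apply: le_trans (sm n).
  by apply: ler_sum => k _; exact: Re_lip.
have cI : cvgn (fun n => Im (u n)).
  apply: (@cvg_of_summable _ _ (2 * L)) => n; apply: le_trans (sm n).
  by apply: ler_sum => k _; exact: Im_lip.
pose zs := limn (fun n => Re (u n)) +i* limn (fun n => Im (u n)).
have uz : cmod (u n - zs) @[n --> \oo] --> 0.
  apply: (cvg0_le _ (cvgD0 (cvg_dist0 cR) (cvg_dist0 cI))) => n.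
  by apply/andP; split => //; apply: le_trans (cmod_le_ReIm _) _; rewrite ReB ImB.
have /seq_cvg0P - /(_ (fun n => cmod_ge0 _)) uz' := uz.
have tail n k : cmod (u (k + n)%N - u n) <= L * (2 * 2^-1 ^+ n - 2 * 2^-1 ^+ (k + n)).
  elim: k => [|k IH]; first by rewrite add0n !subrr cmod0 mulr0.
  apply: le_trans (cmod_tri (u (k + n)%N) _ _) _.
  apply: le_trans (lerD (du _) IH) _.
  by rewrite addSn exprS -mulrDr; apply: ler_wpM2l => //; lra.
have uzn n : cmod (u n - zs) <= 2 * L * 2^-1 ^+ n.
  apply/ler_addgt0Pr => e e0; have [N hN] := uz' e e0.
  apply: le_trans (cmod_tri (u (N + n)%N) _ _) _; rewrite cmodC.
  apply: lerD; last by apply: ltW; apply: hN; exact: leq_addr.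
  apply: le_trans (tail n N) _; rewrite (mulrC 2 L) -mulrA ler_wpM2l// gerBl.
  by rewrite mulr_ge0// ltW// half_pow_gt0.
have mz : m <= Im zs.
  rewrite leNgt; apply/negP => lt.
  have lt' : 0 < m - Im zs by rewrite subr_gt0.
  have [N hN] := uz' _ lt'.
  have := hN N (leqnn _); have := Im_lip (u N) zs.
  have [h1 _ _] := mt N; have := ler_norm (Im (u N) - Im zs); rewrite -/(u N) in h1; lra.
have [D hD] := hF zs (lt_le_trans mc mz).
apply: cmod_small => e e0.
(* At step n the perimeter is at most L 2^-n and every point of the triangle is within 3 L 2^-n of
   zs; the product of the two, times 4^n, is 3 L^2. *)
pose K := 3 * L ^+ 2 + 1; have K0 : 0 < K by rewrite ltr_wpDl// mulr_ge0// sqr_ge0.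
have [d d0 hd] := hD _ (divr_gt0 e0 K0).
have L1 : 0 < 3 * L + 1 by rewrite ltr_wpDl// mulr_ge0.
have [n hn] := half_pow_small (divr_gt0 d0 L1).
have hn' : 3 * L * 2^-1 ^+ n < d.
  move: hn; rewrite ltr_pdivlMr//; have := half_pow_gt0 R n; move: (_ ^+ n) => x; lra.
move: (hT n) (mt n) (hp n) (uzn n); rewrite /u; case: (t n) => [[p q] r] /=.
rewrite /perim /= => hTn _ hper hpz.
(* Affine functions integrate to zero over a triangle, so the first-order expansion of F at zs can
   be subtracted. *)
have Tsub : tri F p q r = tri (fun w => F w - (D * w + (F zs - D * zs))) p q r.
  have := tri_affine D (F zs - D * zs) p q r; rewrite /tri.
  rewrite !segB//; try exact: cont2_affine.
  by move=> h; rewrite -[LHS]subr0 -h; ring.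
have segbd (v w : R[i]) : cmod (v - zs) + cmod (w - v) <= 3 * L * 2^-1 ^+ n ->
    cmod (seg (fun w => F w - (D * w + (F zs - D * zs))) v w) <=
    cmod (w - v) * (e / K * (3 * L * 2^-1 ^+ n)).
  move=> vw; apply: cmod_seg.
    move=> x e1 e10; have e2 : 0 < e1 / 2 by rewrite divr_gt0.
    have [d1 d10 k1] := cF x _ e2; have [d2 d20 k2] := @cont2_affine D (F zs - D * zs) x _ e2.
    exists (Num.min d1 d2); first by rewrite lt_min d10.
    move=> y; rewrite lt_min => /andP[/k1 g1 /k2 g2].
    set A := D * y + _ in g2 *; set B := D * x + _ in g2 *.
    have -> : F y - A - (F x - B) = (F y - F x) - (A - B) by ring.
    by apply: le_lt_trans (cmodB _ _) _; lra.
  move=> s /andP[s0 s1].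
  have hs : cmod (v + (w - v) * s%:C - zs) <= 3 * L * 2^-1 ^+ n.
    rewrite addrAC; apply: le_trans (cmodD _ _) _; apply: le_trans vw; rewrite lerD2l.
    by rewrite cmodM cmod_real ger0_norm// ler_piMr.
  have := hd (v + (w - v) * s%:C - zs) (le_lt_trans hs hn').
  rewrite [zs + _]addrC subrK => g.
  set x := v + _ in g hs *.
  have -> : F x - (D * x + (F zs - D * zs)) = F x - F zs - D * (x - zs) by ring.
  by apply: le_trans g _; rewrite ler_wpM2l// divr_ge0// ltW.
have x0 := half_pow_gt0 R n.
have per : cmod (q - p) + cmod (r - q) + cmod (p - r) <= L * 2^-1 ^+ n by [].
have g1 := cmod_ge0 (q - p); have g2 := cmod_ge0 (r - q); have g3 := cmod_ge0 (p - r).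
have s1 : cmod (p - zs) + cmod (q - p) <= 3 * L * 2^-1 ^+ n by lra.
have s2 : cmod (q - zs) + cmod (r - q) <= 3 * L * 2^-1 ^+ n.
  by have := cmod_tri p q zs; lra.
have s3 : cmod (r - zs) + cmod (p - r) <= 3 * L * 2^-1 ^+ n.
  by have := cmod_tri p r zs; have := cmod_tri q r p; rewrite (cmodC r p); lra.
have bd : cmod (tri F p q r) <= L * 2^-1 ^+ n * (e / K * (3 * L * 2^-1 ^+ n)).
  rewrite Tsub /tri; apply: le_trans (cmodD _ _) _; apply: le_trans (lerD (cmodD _ _) (lexx _)) _.
  apply: le_trans (lerD (lerD (segbd _ _ s1) (segbd _ _ s2)) (segbd _ _ s3)) _.
  rewrite -!mulrDl ler_wpM2r// mulr_ge0//; first by rewrite divr_ge0// ltW.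
  by rewrite !mulr_ge0// ltW.
apply: le_trans hTn _; apply: le_trans (ler_wpM2l _ bd) _; first exact: exprn_ge0.
have x4 : 4 ^+ n * (2^-1 ^+ n * 2^-1 ^+ n) = 1 :> R.
  by rewrite -!exprMn (_ : 4 * (2^-1 * 2^-1) = 1) ?expr1n//; field.
set x := 2^-1 ^+ n in x4 *; rewrite (_ : _ * _ = (4 ^+ n * (x * x)) * (3 * L ^+ 2 * (e / K))); last by ring.
rewrite x4 mul1r mulrA ler_pdivrMr// mulrC ler_wpM2l ?(ltW e0)// /K lerDl//.
Qed.

Lemma holo_primitive F (c : R) : ccont2 F -> (forall w, c < Im w -> exists D, cder F w D) ->
  exists P : R[i] -> R[i], forall w, c < Im w -> cder P w (F w).
Proof.
move=> cF hF; pose z0 : R[i] := 0 +i* (c + 1).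
exists (seg F z0) => w cw e e0.
have [d d0 K] := cF w e e0.
exists (Num.min d (Im w - c)); first by rewrite lt_min d0 subr_gt0.
move=> h; rewrite lt_min => /andP[hd hc].
have cwh : c < Im (w + h).
  by rewrite ImD; have := Im_le h; rewrite ler_norml => /andP[+ _]; lra.
have cz0 : c < Im z0 by rewrite /=; lra.
have := goursat cF hF cz0 cw cwh; rewrite /tri (seg_rev z0 (w + h) cF).
move=> /eqP; rewrite subr_eq0 => /eqP <-.
have -> : seg F z0 w + seg F w (w + h) - seg F z0 w - F w * h = seg (fun x => F x - (0 * x + F w)) w (w + h).
  rewrite segB//; last exact: cont2_affine.
  have P x : cder (fun x => 0 * (x * x) + F w * x) x (0 * x + F w).
    by rewrite mul0r; have := cder_quad 0 (F w) x; rewrite mul0r.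
  by rewrite (seg_FTC _ _ (cont2_affine 0 (F w)) P); ring.
rewrite mulrC.
have -> : cmod h = cmod (w + h - w) by congr cmod; ring.
apply: cmod_seg.
  move=> x e1 e10; have [d1 d10 k1] := cF x _ e10; exists d1 => // y /k1.
  by rewrite !mul0r !add0r opprB addrA subrK.
move=> s /andP[s0 s1]; rewrite mul0r add0r; apply: ltW; apply: K.
have -> : w + (w + h - w) * s%:C - w = h * s%:C by ring.
by rewrite cmodM cmod_real ger0_norm//; apply: le_lt_trans hd; rewrite ler_piMr.
Qed.

End goursat.

(** * Moving a horizontal contour *)

Section contour_shift.
Variable R : realType.
Implicit Types (F G H : R[i] -> R[i]) (w z : R[i]).

(** Composition with the 1-Lipschitz projection onto Im w >= c gives a function that is continuous
    on the whole plane, as [holo_primitive] requires, and equals G above c. *)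
Lemma primitive_halfplane G (c0 c : R) : c0 < c ->
  (forall w, c0 < Im w -> exists D, cder G w D) ->
  exists P : R[i] -> R[i], forall w, c < Im w -> cder P w (G w).
Proof.
move=> cc hG; pose cl w := Re w +i* Num.max (Im w) c; pose F w := G (cl w).
have clE w : c <= Im w -> cl w = w by move=> h; rewrite /cl max_l//; case: w h.
have Imcl w : c0 < Im (cl w) by rewrite /= lt_max cc orbT.
have clip w z : cmod (cl w - cl z) <= cmod (w - z).
  rewrite -(ler_pXn2r (n := 2)) ?nnegrE// !cmod_sqr !ReB !ImB /= lerD2l.
  rewrite -[X in X <= _]real_normK ?num_real// -[X in _ <= X]real_normK ?num_real//.
  rewrite ler_pXn2r ?nnegrE//; move: (Im w) (Im z) => a b.
  by case: (leP a c) => ac; case: (leP b c) => bc; rewrite ?subrr ?normr0//;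
    rewrite !ler_norml; case: (ger0P (a - b)) => ?; apply/andP; split; lra.
have cF : ccont2 F.
  move=> z e e0; have [D HD] := hG _ (Imcl z); have [d d0 K] := cder_cont HD e0.
  exists d => // w wz; have := K (cl w - cl z) (le_lt_trans (clip w z) wz).
  by rewrite subrKC.
have hF w : c < Im w -> cder F w =1 cder G w.
  move=> cw D; apply/propext; split=> H e e0; have [d d0 K] := H e e0;
    exists (Num.min d (Im w - c)); rewrite ?lt_min ?d0 ?subr_gt0// => h; rewrite lt_min => /andP[hd hc];
    have := K h hd; rewrite /F !clE// ?(ltW cw)// ImD;
    by have := Im_le h; rewrite ler_norml => /andP[+ _]; lra.
have [P hP] : exists P : R[i] -> R[i], forall w, c < Im w -> cder P w (F w).
  apply: holo_primitive cF _ => w cw; have [D HD] := hG w (lt_trans cc cw).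
  by exists D; rewrite hF.
by exists P => w cw; have := hP w cw; rewrite /F clE// ltW.
Qed.

Lemma line_E (eta : R) (v : R) : v +i* eta = (0 +i* eta) + 1 * v%:C.
Proof. by cx_ring. Qed.
Lemma vline_E (t : R) (v : R) : t +i* v = t%:C + (0 +i* 1) * v%:C.
Proof. by cx_ring. Qed.

Lemma holo_line_ccont H (c eta : R) : (forall w, c < Im w -> exists D, cder H w D) -> c < eta ->
  ccont (fun t => H (t +i* eta)).
Proof.
move=> h ce; have /choice[D hD] : forall t : R, exists D, cder H (t +i* eta) D by move=> t; exact: h.
apply: (@rder_ccont _ _ D) => t; rewrite -[D t]mulr1.
by apply: (rder_lineE (z := 0 +i* eta)) => // s; exact: line_E.
Qed.

Lemma exists_nat_ge (x : R) : exists N, forall n, (N <= n)%N -> x <= n%:R.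
Proof.
exists (Num.Def.archi_bound `|x|) => n hn.
apply: le_trans (ler_norm x) _; apply: le_trans (ltW (archi_boundP (normr_ge0 x))) _.
by rewrite ler_nat.
Qed.

Lemma tail_integral (f : R -> R[i]) (e : R) : cI f -> 0 < e ->
  exists T0 : R, forall b, T0 <= b -> cmod (itg (- b) b f - cint f) <= e.
Proof.
move=> hf e0; have mf := cI_meas hf.

have mI (b : R) : meas (\1_`[- b, b]%classic : R -> R) by exact: measurable_indic.
pose h n t : R := (1 - \1_`[- n%:R, n%:R]%classic t) * cmod (f t).
have [||||| _ hc] := @dct R h (fun=> 0) (fun t => cmod (f t)).
- by move=> n; apply: measurable_funM; [exact: measurable_funB|exact: meas_cmod].
- exact: measurable_cst.
- exact: cI_cmod.
- apply: aeT => t; apply/cvgrPdist_lt => d d0.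
  have [N0 hN0] := exists_nat_ge `|t|; exists N0 => // n /= /hN0 nt.
  by rewrite /h indicE mem_set ?subrr ?mul0r ?subrr ?normr0//= in_itv /= -ler_norml.
- apply: aeT => t n; rewrite /h normrM (ger0_norm (cmod_ge0 _)) ler_piMl//.
  by rewrite indicE; case: (t \in _); rewrite ?subrr ?normr0// subr0 normr1.
rewrite intg0 in hc; move/cvgrPdist_lt: hc => /(_ e e0) [N _ hN].
have := hN N (leqnn N); rewrite sub0r normrN => hh.
exists N%:R => b Nb; rewrite cmodC.
have icI : cI (fun s => (\1_`[- b, b]%classic s)%:C * f s).
  apply: (cI_bounded_mul (B := 1)) => //; first exact: cmeasC.
  by move=> x; rewrite cmod_real indicE; case: (x \in _); rewrite ?normr1 ?normr0.
rewrite /itg -cintB//.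
apply: le_trans (ltW (le_lt_trans (ler_norm _) hh)).
apply: cmod_cint_le => [||t]; first exact: cIB.
  apply: (rI_le (g := fun t => cmod (f t))); [|exact: cI_cmod|].
    by apply: measurable_funM; [exact: measurable_funB|exact: meas_cmod].
  move=> t; rewrite /h normrM (ger0_norm (cmod_ge0 _)) ler_piMl//.
  by rewrite indicE; case: (t \in _); rewrite ?subrr ?normr0// subr0 normr1.
rewrite -[X in X - _]mul1r -mulrBl cmodM ler_wpM2r// -CB cmod_real !indicE.
case: (boolP (t \in `[- b, b]%classic)) => [_|]; first by rewrite subrr normr0 subr_ge0; case: (t \in _).
move=> /negP tb; have -> : t \in `[- N%:R, N%:R]%classic = false.
  apply/negP => tN; apply: tb; move: tN; rewrite !inE /= !in_itv /= => /andP[? ?].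
  by apply/andP; split; lra.
by rewrite subr0 normr1.
Qed.

(* The second primitive makes the difference of the two horizontal integrals,
   averaged over T <= b <= 2T, a bounded quantity divided by T; no estimate on
   vertical segments is needed. *)
Lemma contour_shift H (c0 e1 e2 C0 : R) : c0 < e1 -> e1 <= e2 ->
  (forall w, c0 < Im w -> exists D, cder H w D) ->
  (forall eta, e1 <= eta <= e2 -> cI (fun t => H (t +i* eta)) /\
     intg (fun t => cmod (H (t +i* eta))) <= C0) ->
  cint (fun t => H (t +i* e1)) = cint (fun t => H (t +i* e2)).
Proof.
move=> c01 e12 hH hI; pose c1 := (c0 + e1) / 2; pose c2 := (c1 + e1) / 2.
have c01' : c0 < c1 by rewrite /c1; lra.
have c12 : c1 < c2 by rewrite /c2 /c1; lra.
have c2e : c2 < e1 by rewrite /c2 /c1; lra.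
have [Ga hGa] := primitive_halfplane c01' hH.
have [G2 hG2] : exists P : R[i] -> R[i], forall w, c2 < Im w -> cder P w (Ga w).
  by apply: (primitive_halfplane c12) => w cw; exists (H w); exact: hGa.
have FTC eta a b : e1 <= eta -> a < b ->
    itg a b (fun t => H (t +i* eta)) = Ga (b +i* eta) - Ga (a +i* eta).
  move=> h1 ab; rewrite (itg_FTC (f := fun t => Ga (t +i* eta)) (D := fun t => H (t +i* eta)) ab)//.
    move=> x; rewrite -[H _]mulr1; apply: (rder_lineE (z := 0 +i* eta)); first by move=> s; exact: line_E.
    by apply: hGa => /=; lra.
  by apply: (holo_line_ccont hH); lra.
have C00 : 0 <= C0.
  by apply: le_trans (proj2 (hI e1 _)); [apply: intg_ge0|rewrite lexx].
have bd eta a b : e1 <= eta <= e2 -> a < b -> cmod (Ga (b +i* eta) - Ga (a +i* eta)) <= C0.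
  move=> he ab; have /andP[he1 _] := he; rewrite -FTC//; have [ci h] := hI eta he.
  apply: le_trans h; apply: cmod_cint_le; last first.
  - move=> x; rewrite cmodM ler_piMl// cmod_real indicE; case: (x \in _); rewrite ?normr1 ?normr0//.
  - exact: cI_cmod.
  - by apply: cI_itg; apply: (holo_line_ccont hH); lra.
(* This is the integral over T <= b <= 2T of the integral of H along [-b, b] + i eta. Its derivative
   in eta is i times a difference of two increments of [Ga] along horizontal segments, each bounded
   by C0. *)
pose Ps (T eta : R) := G2 ((2 * T) +i* eta) - G2 (T +i* eta) - G2 ((- T) +i* eta) + G2 ((- (2 * T)) +i* eta).
have dv (t y : R) : e1 <= y -> rder (fun y => G2 (t +i* y)) y (Ga (t +i* y) * (0 +i* 1)).
  move=> hy; apply: (rder_lineE (z := t%:C)); first by move=> s; exact: vline_E.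
  by apply: hG2 => /=; lra.
have A (T : R) : 0 < T -> cmod (Ps T e2 - Ps T e1) <= 2 * C0 * (e2 - e1).
  move=> T0; apply: (@mean_value_ineq _ (Ps T) (fun y => (0 +i* 1) *
     ((Ga ((2 * T) +i* y) - Ga (T +i* y)) - (Ga ((- T) +i* y) - Ga ((- (2 * T)) +i* y))))) => // y hy.
    have /andP[hy1 _] := hy.
    have := rderD (rderD (rderD (dv (2 * T) y hy1) (rderZ (-1) (dv T y hy1)))
       (rderZ (-1) (dv (- T) y hy1))) (dv (- (2 * T)) y hy1).
    have -> : (fun t0 : R => G2 ((2 * T) +i* t0) + -1 * G2 (T +i* t0) + -1 * G2 ((- T) +i* t0) + G2 ((- (2 * T)) +i* t0)) = Ps T.
      by apply/funext => s; rewrite /Ps !mulN1r.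
    by congr rder; ring.
  rewrite cmodM cmod_imag normr1 mul1r; apply: le_trans (cmodB _ _) _.
  have := @bd y T (2 * T) hy; have := @bd y (- (2 * T)) (- T) hy => b1 b2.
  have /b1 g1 : - (2 * T) < - T by lra.
  have /b2 g2 : T < 2 * T by lra.
  lra.
(* For large T the averaged quantity is T times the full horizontal integral, up to e T; dividing by
   T compares the two contours. *)
have B eta : e1 <= eta <= e2 -> forall e, 0 < e -> exists T0, forall T, T0 <= T -> 0 < T ->
    cmod (Ps T eta - T%:C * cint (fun t => H (t +i* eta))) <= e * T.
  move=> he e e0; have /andP[he1 _] := he; have [ci _] := hI eta he.
  have [T0 hT0] := tail_integral ci e0; exists T0 => T hT Tp.
  set J := cint _ in hT0 *.
  pose ph (b : R) := G2 (b +i* eta) + G2 ((- b) +i* eta) + - J * b%:C.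
  have dp b : rder ph b (Ga (b +i* eta) - Ga ((- b) +i* eta) - J).
    have r1 : rder (fun b => G2 (b +i* eta)) b (Ga (b +i* eta) * 1).
      apply: (rder_lineE (z := 0 +i* eta)); first by move=> s; exact: line_E.
      by apply: hG2 => /=; lra.
    have r2 : rder (fun b => G2 ((- b) +i* eta)) b (Ga ((- b) +i* eta) * -1).
      apply: (@rder_lineE _ G2 (fun b => (- b) +i* eta) (0 +i* eta)).
        by move=> s; apply: cx_ext; rewrite mulN1r !ReImE /= ?add0r ?oppr0 ?addr0.
      by apply: hG2 => /=; lra.
    have := rderD (rderD r1 r2) (rderZ (- J) (rder_real b)); congr rder; ring.
  have -> : Ps T eta - T%:C * J = ph (2 * T) - ph T.
    rewrite /Ps /ph CM C_nat; ring.
  have -> : e * T = e * (2 * T - T) by ring.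
  apply: (mean_value_ineq (D := fun b => Ga (b +i* eta) - Ga ((- b) +i* eta) - J)).
  - lra.
  - by move=> x _; exact: dp.
  - move=> x /andP[x1 _]; rewrite -FTC//; first by apply: hT0; lra.
    lra.
apply/eqP; rewrite -subr_eq0; apply/eqP; apply: cmod_small => e e0.
have e3 : 0 < e / 3 by rewrite divr_gt0.
have h1 : e1 <= e1 <= e2 by rewrite lexx. have h2 : e1 <= e2 <= e2 by rewrite lexx e12.
have [T1 k1] := B _ h1 _ e3; have [T2 k2] := B _ h2 _ e3.
pose T := Num.max 1 (Num.max (Num.max T1 T2) (6 * C0 * (e2 - e1) / e)).
have Tp : 0 < T by rewrite /T lt_max ltr01.
have /k1 /(_ Tp) {}k1 : T1 <= T by rewrite /T !le_max lexx ?orbT.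
have /k2 /(_ Tp) {}k2 : T2 <= T by rewrite /T !le_max lexx ?orbT.
have k3 : 6 * C0 * (e2 - e1) <= e * T.
  have : 6 * C0 * (e2 - e1) / e <= T by rewrite /T !le_max lexx !orbT.
  by rewrite ler_pdivrMr// (mulrC T).
have kA := A T Tp.
set J1 := cint _ in k1 *; set J2 := cint _ in k2 *.
rewrite -(ler_pM2l Tp) -{1}(ger0_norm (ltW Tp)) -cmod_real -cmodM.
have -> : T%:C * (J1 - J2) = (Ps T e2 - T%:C * J2) - (Ps T e1 - T%:C * J1) - (Ps T e2 - Ps T e1).
  by ring.
apply: le_trans (cmodB _ _) _; apply: le_trans (lerD (cmodB _ _) (lexx _)) _.
lra.
Qed.

End contour_shift.

(** * The Cauchy kernel and its product integrals *)

Section cauchy_kernel.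
Variable R : realType.
Implicit Types (f g : R -> R[i]) (z w : R[i]) (t x : R).

(** The plus sign is that of the Hankel kernel: integrating against [ck z] is a Cauchy integral at
    the point -z, which lies in the lower half-plane when Im z > 0. *)
Definition ck z t : R[i] := (t%:C + z)^-1.

Lemma Im_shift z t : Im (t%:C + z) = Im z.
Proof. by rewrite ImD /= add0r. Qed.
Lemma ck_neq0 z t : Im z != 0 -> t%:C + z != 0.
Proof. by move=> h; apply: Im_neq0; rewrite Im_shift. Qed.
Lemma cmeas_ck z : cmeas (ck z : R -> R[i]).
Proof.
apply: cmeasV; apply: cmeasD; last exact: cmeas_cst.
by apply: cmeasC; exact: measurable_id.
Qed.
Lemma cmod_ck_le z t : 0 < Im z -> cmod (ck z t) <= (Im z)^-1.
Proof.
move=> h; rewrite cmodV lef_pV2 ?posrE// ?cmod_gt0 ?ck_neq0 ?gt_eqF//.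
by rewrite -(Im_shift z t) cmod_ge_Im.
Qed.
Lemma cmod_ck_sqr z t : cmod (ck z t) ^+ 2 = ((t + Re z) ^+ 2 + Im z ^+ 2)^-1.
Proof. by rewrite cmodV exprVn cmod_sqr ReD ImD /= add0r. Qed.

Lemma int_inv_sqr : rI (fun t => (t ^+ 2 + 1)^-1) /\ intg (fun t => (t ^+ 2 + 1)^-1) = pi :> R.
Proof.
have pos t : 0 < t ^+ 2 + 1 by rewrite ltr_wpDl// sqr_ge0.
have c1 : continuous (fun t : R => (t ^+ 2 + 1)^-1 : R^o).
  move=> t; apply: cvgV; first by rewrite gt_eqF.
  by apply: cvgD; [exact: exprn_continuous|exact: cvg_cst].
have m1 : meas (fun t : R => (t ^+ 2 + 1)^-1) by exact: continuous_measurable_fun.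
have e1 : eint (fun t => (t ^+ 2 + 1)^-1) = pi%:E :> \bar R.
  rewrite /eint ge0_symfun_integralT//=.
  - have -> : [set x : R | 0 <= x] = `[0, +oo[%classic by apply/seteqP; split => x /=; rewrite in_itv /= andbT.
    have -> : (\int[@lebesgue_measure R]_(x in `[0%R, +oo[) ((x ^+ 2 + 1)^-1)%:E =
        \int[mu]_(x in `[0%R, +oo[) ((oneDsqr x)^-1)%:E)%E.
      by apply: eq_integral => x _; rewrite /oneDsqr addrC.
    by rewrite integral0y_oneDsqr -EFinM; congr EFin; field.
  - by move=> t; rewrite invr_ge0 ltW.
  - by move=> t /=; rewrite sqrrN.
have i1 : rI (fun t => (t ^+ 2 + 1)^-1 : R).
  apply: rI_ge0 => //; first by move=> t; rewrite invr_ge0 ltW.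
  by rewrite e1 ltry.
by split => //; apply: EFin_inj; rewrite -eint_intg.
Qed.

Lemma l2_ck z : 0 < Im z -> l2 (ck z : R -> R[i]) /\ nsq (ck z : R -> R[i]) = pi / Im z.
Proof.
move=> h; have [i1 e1] := int_inv_sqr; have k0 : (Im z)^-1 != 0 by rewrite invr_eq0 gt_eqF.
have eq t : cmod (ck z t) ^+ 2 = (Im z) ^- 2 * (((Im z)^-1 * t + Re z / Im z) ^+ 2 + 1)^-1.
  have pos : (t + Re z) ^+ 2 + Im z ^+ 2 != 0 by rewrite gt_eqF// ltr_wpDl ?sqr_ge0// exprn_gt0.
  by rewrite cmod_ck_sqr; field; rewrite pos gt_eqF// addrC mulrC pos.
have i2 := rI_affine (Re z / Im z) k0 i1.
split.
  split; first exact: cmeas_ck.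
  by under eq_fun do rewrite eq; exact: rIZ.
rewrite /nsq; under eq_intg do rewrite eq.
rewrite intgZ// (intg_affine (Re z / Im z) k0 i1) e1 ger0_norm ?invr_ge0 ?(ltW h)// invrK.
by field; rewrite gt_eqF.
Qed.
Lemma nrm_ck z : 0 < Im z -> nrm (ck z : R -> R[i]) = Num.sqrt (pi / Im z).
Proof. by move=> h; rewrite /nrm (proj2 (l2_ck h)). Qed.
Lemma l2_ck_neg z : Im z < 0 -> l2 (ck z : R -> R[i]) /\ nrm (ck z : R -> R[i]) = Num.sqrt (pi / - Im z).
Proof.
move=> h; have h' : 0 < Im (conjc z) by rewrite Im_conj oppr_gt0.
have e t : ck z t = conjc (ck (conjc z) t).
  by rewrite /ck conjcV; congr _^-1; cx_ring.
have [l n] := l2_ck h'; split; first by apply: eq_l2 (l2_conj l) => t; rewrite e.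
by rewrite (eq_nrm e) nrm_conj nrm_ck// Im_conj.
Qed.

Lemma holo_inv_shift (P : R[i] -> Prop) (a : R[i]) : (forall w, P w -> w + a != 0) ->
  holo P (fun w => (w + a)^-1).
Proof. by move=> h; apply: holoV => //; apply: holoD; [exact: holo_id|exact: holo_cst]. Qed.

(** Both poles lie below the real line. The contour is moved up to height e2 = pi/e, where
    Cauchy-Schwarz bounds the integral by pi/e2 = e. *)
Lemma cauchy_pp (a b : R[i]) : 0 < Im a -> 0 < Im b -> cint (fun t => ck a t * ck b t) = 0.
Proof.
move=> ha hb; apply: cmod_small => e e0.
pose H w := (w + a)^-1 * (w + b)^-1; pose c0 := - Num.min (Im a) (Im b).
have c00 : c0 < 0 by rewrite oppr_lt0 lt_min ha.
have nz w (d : R[i]) : c0 < Im w -> - Im d <= c0 -> w + d != 0.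
  by move=> h1 h2; apply: Im_neq0; rewrite ImD gt_eqF//; lra.
have a0 : - Im a <= c0 by rewrite lerN2 ge_min lexx.
have b0 : - Im b <= c0 by rewrite lerN2 ge_min lexx orbT.
have hH w : c0 < Im w -> exists D, cder H w D.
  move=> h; apply: (@holoM _ (fun w => c0 < Im w)) h; apply: holo_inv_shift => x hx; exact: nz.
have HE eta t : H (t +i* eta) = ck (a + (0 +i* eta)) t * ck (b + (0 +i* eta)) t.
  by rewrite /H /ck; congr (_^-1 * _^-1); cx_ring.
have pa eta : 0 <= eta -> 0 < Im (a + (0 +i* eta)) by rewrite ImD /=; lra.
have pb eta : 0 <= eta -> 0 < Im (b + (0 +i* eta)) by rewrite ImD /=; lra.
have bdI eta : 0 <= eta -> cI (fun t => H (t +i* eta)) /\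
    intg (fun t => cmod (H (t +i* eta))) <= Num.sqrt (pi / (Im a + eta)) * Num.sqrt (pi / (Im b + eta)).
  move=> e1; have [l1 n1] := l2_ck (pa _ e1); have [l2' n2] := l2_ck (pb _ e1).
  split; first by under eq_fun do rewrite HE; exact: cI_mul.
  under eq_intg do rewrite HE cmodM.
  have := cauchy_schwarz l1 l2'; rewrite !nrm_ck ?pa ?pb// !ImD /=; exact.
have sq (x : R) : 0 < x -> forall y, x <= y -> Num.sqrt (pi / y) <= Num.sqrt (pi / x).
  move=> x0 y xy; rewrite ler_wsqrtr// ler_pM2l ?pi_gt0// lef_pV2 ?posrE//; lra.
pose e2 := pi / e.
have e20 : 0 < e2 by rewrite divr_gt0// pi_gt0.
have := @contour_shift R H c0 0 e2 (Num.sqrt (pi / Im a) * Num.sqrt (pi / Im b)) c00 (ltW e20) hH.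
have h0 (eta : R) : 0 <= eta <= e2 -> cI (fun t : R => H (t +i* eta)) /\
    intg (fun t : R => cmod (H (t +i* eta))) <= Num.sqrt (pi / Im a) * Num.sqrt (pi / Im b).
  move=> /andP[h1 _]; have [i1 i2] := bdI _ h1; split => //; apply: le_trans i2 _.
  by apply: ler_pM; rewrite ?sqrtr_ge0// sq//; lra.
move=> /(_ h0).
have -> : cint (fun t : R => H (t +i* 0)) = cint (fun t => ck a t * ck b t).
  by apply: eq_cint => t; rewrite HE !addr0.
move=> ->; have [i1 i2] := bdI _ (ltW e20).
apply: le_trans (cmod_cint i1) _; apply: le_trans i2 _.
have s2 : Num.sqrt (pi / e2) * Num.sqrt (pi / e2) = e.
  have [pn en] : (pi : R) != 0 /\ e != 0 by rewrite !gt_eqF ?pi_gt0.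
  rewrite -expr2 sqr_sqrtr; first by rewrite /e2 invf_div mulrC divfK.
  by rewrite divr_ge0 ?pi_ge0// ltW.
by rewrite -[leRHS]s2; apply: ler_pM; rewrite ?sqrtr_ge0// sq//; lra.
Qed.

(** Partial fractions replace a residue computation: the integrand is a combination of products with
    both poles on the same side, which vanish by [cauchy_pp], and of |ck (conj b)|^2, whose integral
    is known. *)
Lemma cauchy_pm (a b : R[i]) : 0 < Im a -> Im b < 0 ->
  cint (fun t => ck a t * ck b t) = (0 +i* (2 * pi)) / (a - b).
Proof.
move=> ha hb; have hbc : 0 < Im (conjc b) by rewrite Im_conj oppr_gt0.
have [la _] := l2_ck ha; have [lb _] := l2_ck_neg hb; have [lbc nbc] := l2_ck hbc.
have ab0 : a - b != 0 by apply: Im_neq0; rewrite ImB gt_eqF//; lra.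
have na t := ck_neq0 t (lt0r_neq0 ha).
have nb t : t%:C + b != 0 by apply: ck_neq0; rewrite lt_eqF.
have nbc' t := ck_neq0 t (lt0r_neq0 hbc).
pose d : R[i] := conjc b - b.
have dE : d = 0 +i* (2 * Im (conjc b)) by apply: cx_ext; rewrite /d !ReImE /=; ring.
have e t : ck a t * ck b t = ck a t * ck (conjc b) t +
   (d / (a - b) * (ck b t * ck (conjc b) t) + (- d / (a - b)) * (ck (conjc b) t * ck a t)).
  by rewrite /ck /d; field; rewrite na nb nbc' ab0.
have e2 t : ck b t * ck (conjc b) t = (cmod (ck (conjc b) t) ^+ 2)%:C.
  rewrite -mul_conj mulrC; congr (_ * _); rewrite /ck conjcV; congr _^-1.
  by cx_ring.
under eq_cint do rewrite e.
rewrite cintD; [|exact: cI_mul|by apply: cID; apply: cIZ; exact: cI_mul].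
rewrite cauchy_pp// add0r cintD; [|by apply: cIZ; exact: cI_mul|by apply: cIZ; exact: cI_mul].
rewrite !cintZ; [|exact: cI_mul|exact: cI_mul].
rewrite (cauchy_pp hbc ha) mulr0 addr0; under eq_cint do rewrite e2.
rewrite cintC -/(nsq _) nbc mulrAC; congr (_ / _).
rewrite dE; cx_eq; first by ring.
by field; rewrite lt_eqF.
Qed.

End cauchy_kernel.

(** * The Cauchy transform as a contraction of L2 *)

Section cauchy_transform.
Variable R : realType.
Implicit Types (f g u : R -> R[i]) (z w : R[i]) (t x e : R).

Definition tpi : R[i] := 0 +i* (2 * pi).
Lemma tpi_neq0 : tpi != 0.
Proof. by apply: Im_neq0; rewrite /= mulf_neq0// gt_eqF ?pi_gt0. Qed.
Lemma cmod_tpiV : cmod tpi^-1 = (2 * pi)^-1.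
Proof. by rewrite cmodV cmod_imag ger0_norm// mulr_ge0// pi_ge0. Qed.

(* Locked: unification would otherwise unfold the integral. *)
Definition K f z : R[i] := locked (tpi^-1 * cint (fun t => f t * ck z t)).
Lemma KE f z : K f z = tpi^-1 * cint (fun t => f t * ck z t).
Proof. by rewrite /K -lock. Qed.

Lemma tpi_K f z : tpi * K f z = cint (fun t => f t * ck z t).
Proof. by rewrite KE mulrA mulfV ?tpi_neq0// mul1r. Qed.

Lemma K_bound f z : l2 f -> 0 < Im z -> cmod (K f z) <= (2 * pi)^-1 * (nrm f * Num.sqrt (pi / Im z)).
Proof.
move=> hf hz; rewrite KE cmodM cmod_tpiV ler_wpM2l ?invr_ge0 ?mulr_ge0 ?pi_ge0//.
by rewrite -nrm_ck//; apply: cmod_cint_mul => //; case: (l2_ck hz).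
Qed.
Lemma KB f g z : l2 f -> l2 g -> 0 < Im z -> K (fun t => f t - g t) z = K f z - K g z.
Proof.
move=> hf hg hz; have [l _] := l2_ck hz.
rewrite !KE -mulrBr -cintB; [|exact: cI_mul|exact: cI_mul].
by congr (_ * _); apply: eq_cint => t; rewrite mulrBl.
Qed.
Lemma KD f g z : l2 f -> l2 g -> 0 < Im z -> K (fun t => f t + g t) z = K f z + K g z.
Proof.
move=> hf hg hz; have [l _] := l2_ck hz.
rewrite !KE -mulrDr -cintD; [|exact: cI_mul|exact: cI_mul].
by congr (_ * _); apply: eq_cint => t; rewrite mulrDl.
Qed.
Lemma KZ c f z : l2 f -> 0 < Im z -> K (fun t => c * f t) z = c * K f z.
Proof.
move=> hf hz; have [l _] := l2_ck hz.
rewrite !KE mulrCA -(cintZ c (cI_mul hf l)).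
by congr (_ * _); apply: eq_cint => t; rewrite mulrA.
Qed.
Lemma K_cvg (F : nat -> R -> R[i]) f z : (forall n, l2 (F n)) -> l2 f -> 0 < Im z ->
  nrm (fun x => F n x - f x) @[n --> \oo] --> 0 ->
  cmod (K (F n) z - K f z) @[n --> \oo] --> 0.
Proof.
move=> hF hf hz h; apply: (cvg0_le _ (cvgZ0 ((2 * pi)^-1 * Num.sqrt (pi / Im z)) h)) => n.
apply/andP; split => //; rewrite -KB//; apply: le_trans (K_bound (l2B (hF n) hf) hz) _.
by rewrite -mulrA (mulrC (nrm _)).
Qed.

Lemma K_cder f z : l2 f -> 0 < Im z -> exists D, cder (K f) z D.
Proof.
move=> hf hz; have [l _] := l2_ck hz.
pose y := Im z; have y0 : 0 < y by [].
exists (- tpi^-1 * cint (fun t => f t * (ck z t * ck z t))) => e e0.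
pose M := (2 * pi)^-1 * (nrm f * (2 / y ^+ 2 * nrm (ck z : R -> R[i]))).
have M0 : 0 <= M by rewrite !mulr_ge0// ?invr_ge0 ?mulr_ge0 ?pi_ge0// ?exprn_ge0// ltW.
have M1 : 0 < M + 1 by rewrite ltr_wpDl.
exists (Num.min (y / 2) (e / (M + 1))); first by rewrite lt_min !divr_gt0.
move=> h; rewrite lt_min => /andP[h1 h2].
have Imh : y / 2 < Im (z + h).
  by rewrite ImD; have := Im_le h; rewrite ler_norml => /andP[+ _]; rewrite -/y; lra.
have y2 : 0 < y / 2 by rewrite divr_gt0.
have hzh : 0 < Im (z + h) by exact: lt_trans y2 Imh.
have [l' _] := l2_ck hzh.
have lc : l2 (fun t => ck z t * ck z t) by apply: l2_bmul l; [exact: cmeas_ck|move=> t; exact: cmod_ck_le].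
have lc3 : l2 (fun t => (ck z t * ck (z + h) t) * ck z t).
  apply: (l2_bmul (B := (Im z)^-1 * (Im (z + h))^-1)) l.
    by apply: cmeasM; exact: cmeas_ck.
  by move=> t; rewrite cmodM; apply: ler_pM => //; exact: cmod_ck_le.
have eq : K f (z + h) - K f z - (- tpi^-1 * cint (fun t => f t * (ck z t * ck z t))) * h
   = tpi^-1 * (h ^+ 2 * cint (fun t => f t * ((ck z t * ck (z + h) t) * ck z t))).
  rewrite !KE -!mulrBr mulNr mulNr opprK mulrAC -mulrA -mulrDr; congr (_ * _).
  rewrite -[in RHS]cintZ; last exact: cI_mul.
  rewrite -[in LHS]cintZ; last exact: cI_mul.
  rewrite -cintB; [|exact: cI_mul|exact: cI_mul].
  rewrite -cintD; [|by apply: cIB; exact: cI_mul|by apply: cIZ; exact: cI_mul].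
  apply: eq_cint => t; have n1 := ck_neq0 t (lt0r_neq0 hz); have n2 := ck_neq0 t (lt0r_neq0 hzh).
  move: n1 n2; rewrite /ck addrA; move: (t%:C + z) => A n1 n2.
  by field; rewrite n1 n2.
rewrite eq cmodM cmod_tpiV cmodM cmodX.
have hb : cmod (cint (fun t => f t * (ck z t * ck (z + h) t * ck z t))) <= nrm f * (2 / y ^+ 2 * nrm (ck z : R -> R[i])).
  apply: le_trans (cmod_cint_mul hf lc3) _; rewrite ler_wpM2l//.
  apply: nrm_bmul => //; first by apply: cmeasM; exact: cmeas_ck.
  move=> t; rewrite cmodM.
  have -> : 2 / y ^+ 2 = y^-1 * (y / 2)^-1 by field; rewrite gt_eqF.
  apply: ler_pM => //; first exact: cmod_ck_le.
  apply: le_trans (cmod_ck_le t hzh) _; rewrite lef_pV2 ?posrE//; exact: ltW.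
apply: (@le_trans _ _ (cmod h * (cmod h * M))).
  rewrite /M !mulrA -[_ * _ * (2 * pi)^-1]mulrC -!mulrA ler_wpM2l ?invr_ge0 ?mulr_ge0 ?pi_ge0//.
  do 2 (apply: ler_wpM2l => //).
  by move: hb; rewrite -!mulrA.
rewrite mulrC ler_wpM2r//; apply: (@le_trans _ _ (e / (M + 1) * M)).
  by rewrite ler_wpM2r// ltW.
by rewrite mulrAC ler_pdivrMr// ler_wpM2l ?(ltW e0)// lerDl.
Qed.

Definition Kl e f : R -> R[i] := fun r => K f (r +i* e).

Lemma cmeas_Kl e f : l2 f -> 0 < e -> cmeas (Kl e f).
Proof.
move=> hf e0; apply: ccont_cmeas; apply: (@holo_line_ccont _ (K f) 0) => //.
by move=> w hw; exact: K_cder.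
Qed.

(** Cauchy-Schwarz for sqrt w and sqrt w g. *)
Lemma jensen (w g : R -> R) : (forall t, 0 <= w t) -> rI w -> meas g ->
  rI (fun t => w t * g t ^+ 2) -> rI (fun t => w t * `|g t|) /\
  intg (fun t => w t * `|g t|) ^+ 2 <= intg w * intg (fun t => w t * g t ^+ 2).
Proof.
move=> w0 iw mg iwg; have mw := rI_meas iw.
have ms : meas (fun t => Num.sqrt (w t)).
  under eq_fun do rewrite -powR12_sqrt//.
  exact: (measurableT_comp (measurable_powR _) mw).
have c1 t : cmod (Num.sqrt (w t))%:C = Num.sqrt (w t) by rewrite cmod_real ger0_norm// sqrtr_ge0.
have c2 t : cmod (Num.sqrt (w t) * g t)%:C = Num.sqrt (w t) * `|g t|.
  by rewrite cmod_real normrM ger0_norm// sqrtr_ge0.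
have l1 : l2 (fun t => (Num.sqrt (w t))%:C).
  split; first exact: cmeasC.
  by under eq_fun do rewrite c1 sqr_sqrtr//.
have l2' : l2 (fun t => (Num.sqrt (w t) * g t)%:C).
  split; first by apply: cmeasC; exact: measurable_funM.
  by under eq_fun do rewrite c2 exprMn sqr_sqrtr// real_normK ?num_real//.
have e t : cmod (Num.sqrt (w t))%:C * cmod (Num.sqrt (w t) * g t)%:C = w t * `|g t|.
  by rewrite c1 c2 mulrA -expr2 sqr_sqrtr.
split; first by have := rI_mul l1 l2'; apply: eq_rI.
have := cauchy_schwarz l1 l2'; rewrite (eq_intg e) => h.
have p0 : 0 <= intg (fun t => w t * `|g t|) by apply: intg_ge0 => t; rewrite mulr_ge0.
apply: (@le_trans _ _ ((nrm (fun t => (Num.sqrt (w t))%:C) * nrm (fun t => (Num.sqrt (w t) * g t)%:C)) ^+ 2)).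
  by rewrite ler_pXn2r ?nnegrE ?mulr_ge0.
rewrite exprMn !nrm_sqr /nsq; under eq_intg do rewrite c1 sqr_sqrtr//.
by under [X in _ * X <= _]eq_intg do rewrite c2 exprMn sqr_sqrtr// real_normK ?num_real//.
Qed.

Local Notation RR := (measurableTypeR R * measurableTypeR R)%type.
Lemma cmeas2_1 f : cmeas f -> cmeas (fun p : RR => f p.1).
Proof. by move=> mf; exact: (@cmeas_comp _ _ (measurableTypeR R) RR R f fst mf (measurable_fst)). Qed.
Lemma cmeas2_2 f : cmeas f -> cmeas (fun p : RR => f p.2).
Proof. by move=> mf; exact: (@cmeas_comp _ _ (measurableTypeR R) RR R f snd mf (measurable_snd)). Qed.
Lemma cmeas2_ck z : cmeas (fun p : RR => ck (z + (p.2 : R)%:C) (p.1 : R)).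
Proof.
apply: cmeasV; apply: cmeasD; first by apply: (@cmeas2_1 (fun x => x%:C)); apply: cmeasC; exact: measurable_id.
apply: cmeasD; first exact: cmeas_cst.
by apply: (@cmeas2_2 (fun x => x%:C)); apply: cmeasC; exact: measurable_id.
Qed.

(** A crude bound by [jensen] and Tonelli for integrable f. It provides finite norms, bounded along
    e, 2e, 4e and so on; [nrm_Kl_cI] improves it to [nrm f]. *)
Lemma l2_Kl_cI f e : l2 f -> cI f -> 0 < e ->
  l2 (Kl e f) /\ nrm (Kl e f) <= (2 * pi)^-1 * (intg (fun t => cmod (f t)) * Num.sqrt (pi / e)).
Proof.
move=> hf cf e0; have iF := cI_cmod cf.
have N0 : 0 <= intg (fun t => cmod (f t)) by exact: intg_ge0.
have p2 : 0 <= (2 * pi)^-1 :> R by rewrite invr_ge0 mulr_ge0 ?pi_ge0.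
apply: nrm_eint; [exact: cmeas_Kl|by rewrite !mulr_ge0 ?sqrtr_ge0|].
have c0 : 0 < Im (0 +i* e) by [].
have ze r : (r +i* e : R[i]) = (0 +i* e) + r%:C by cx_eq; rewrite ?add0r ?addr0.
have Imr r : 0 < Im (r +i* e) by [].
pose G (p : RR) := cmod (f p.1) * cmod (ck ((0 +i* e) + (p.2 : R)%:C) (p.1 : R)) ^+ 2.
have GE t r : G (t, r) = cmod (f t) * cmod (ck (r +i* e) t) ^+ 2 by rewrite ze.
have mG : meas G.
  apply: measurable_funM; first exact: meas_cmod (cmeas2_1 (proj1 hf)).
  exact: meas_sqr (cmeas2_ck _).
have iG r : rI (fun t => G (t, r)).
  apply: (rI_le (g := fun t => (e^-1) ^+ 2 * cmod (f t))).
  - exact: (measurableT_comp mG (measurable_pair2 r)).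
  - exact: rIZ.
  move=> t; rewrite GE ger0_norm; last by rewrite mulr_ge0// sqr_ge0.
  rewrite mulrC ler_wpM2r// ler_pXn2r ?nnegrE ?invr_ge0 ?(ltW e0)//.
  exact: cmod_ck_le.
have pt r : cmod (Kl e f r) ^+ 2 <= (2 * pi) ^- 2 * intg (fun t => cmod (f t)) * intg (fun t => G (t, r)).
  have mck : meas (fun t => cmod (ck (r +i* e) t)) by apply: meas_cmod; exact: cmeas_ck.
  have [i1 h1] := @jensen (fun t => cmod (f t)) (fun t => cmod (ck (r +i* e) t)) (fun t => cmod_ge0 _) iF mck
    (eq_rI (fun t => GE t r) (iG r)).
  have [lc _] := l2_ck (Imr r).
  have h2 : cmod (Kl e f r) <= (2 * pi)^-1 * intg (fun t => cmod (f t) * `|cmod (ck (r +i* e) t)|).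
    rewrite /Kl !KE cmodM cmod_tpiV ler_wpM2l//.
    apply: cmod_cint_le => //; first exact: cI_mul.
    by move=> t; rewrite cmodM ger0_norm.
  apply: (@le_trans _ _ (((2 * pi)^-1 * intg (fun t => cmod (f t) * `|cmod (ck (r +i* e) t)|)) ^+ 2)).
    by rewrite ler_pXn2r ?nnegrE// mulr_ge0// intg_ge0// => t; rewrite mulr_ge0.
  rewrite exprMn exprVn -mulrA ler_wpM2l ?invr_ge0 ?sqr_ge0//; apply: le_trans h1 _.
  by apply: eq_ler; congr (_ * _); apply: eq_intg => t; rewrite GE.
have mI : meas (fun r => intg (fun t => G (t, r))).
  apply: measurableT_comp => //.
  apply: (@measurable_fun_fubini_tonelli_G _ _ _ _ _ mu (fun p : RR => (G p)%:E)).
    exact/measurable_EFinP.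
  by move=> p; rewrite lee_fin /G mulr_ge0// sqr_ge0.
pose c := (2 * pi) ^- 2 * intg (fun t => cmod (f t)).
have c00 : 0 <= c by rewrite mulr_ge0 ?invr_ge0 ?sqr_ge0.
apply: (@le_trans _ _ (eint (fun r => c * intg (fun t => G (t, r)))%R)).
  apply: le_eint => //.
  - by move=> r; rewrite sqr_ge0.
  - by apply: meas_sqr; exact: cmeas_Kl.
  - exact: measurable_funM.
rewrite eintZ//; last by move=> r; apply: intg_ge0 => t; rewrite /G mulr_ge0// sqr_ge0.
have -> : eint (fun r => intg (fun t => G (t, r))) = (\int[mu]_r \int[mu]_t (G (t, r))%:E)%E.
  by apply: eq_integral => r _; rewrite -eint_intg.
rewrite -tonelli//; last by move=> p; rewrite /G mulr_ge0// sqr_ge0.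
have -> : (\int[mu]_t \int[mu]_r (G (t, r))%:E)%E = eint (fun t => pi / e * cmod (f t)).
  apply: eq_integral => t _.
  have ht : 0 < Im (t%:C + (0 +i* e)) by rewrite Im_shift.
  have [[_ lt] nt] := l2_ck ht.
  have := eint_intg (rIZ (cmod (f t)) lt); rewrite intgZ// -/(nsq _) nt Im_shift [Im _]/= mulrC => <-.
  apply: eq_integral => r _; rewrite GE; congr EFin; congr (_ * _).
  by rewrite /ck ze; congr (cmod _^-1 ^+ 2); ring.
rewrite eint_intg; last exact: rIZ.
rewrite intgZ// -EFinM lee_fin /c !exprMn sqr_sqrtr ?divr_ge0 ?pi_ge0 ?(ltW e0)//.
by apply: eq_ler; rewrite exprVn exprMn; ring.
Qed.

(* Written f^# in comments: the inner products of K_e f and K_n f involve f and f^# only. *)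
Definition shp f : R -> R[i] := fun t => conjc (f (- t)).

Lemma l2_shp f : l2 f -> l2 (shp f).
Proof. by move=> h; exact: (l2_conj (l2_refl h)). Qed.
Lemma nrm_shp f : l2 f -> nrm (shp f) = nrm f.
Proof. by move=> h; rewrite (nrm_conj (fun t => f (- t))) nrm_refl. Qed.
Lemma cI_shp f : cI f -> cI (shp f).
Proof. by move=> h; exact: (cI_conj (cI_refl h)). Qed.

Lemma eint_mul_le f g : l2 f -> l2 g -> (eint (fun t => cmod (f t * g t)%R) <= (nrm f * nrm g)%:E)%E.
Proof.
move=> hf hg; have i1 := rI_mul hf hg.
have -> : (fun t => cmod (f t * g t)) = (fun t => cmod (f t) * cmod (g t)) by apply/funext => t; rewrite cmodM.
by rewrite eint_intg// lee_fin cauchy_schwarz.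
Qed.

(** The kernel 1/(t + r + ie) is symmetric in t and r, so [Kl e] is its own transpose; the
    integrability of f justifies exchanging the integrals. *)
Lemma K_dual f g e : l2 f -> cI f -> l2 g -> 0 < e ->
  cint (fun r => Kl e f r * g r) = cint (fun t => f t * K g (t +i* e)).
Proof.
move=> hf cf hg e0.
pose F (p : RR) : R[i] := f p.1 * (ck ((0 +i* e) + (p.2 : R)%:C) (p.1 : R) * g p.2).
have mF : cmeas F.
  apply: cmeasM; first exact: cmeas2_1 (proj1 hf).
  by apply: cmeasM; [exact: cmeas2_ck|exact: cmeas2_2 (proj1 hg)].
have FE t r : F (t, r) = f t * (g r * ck (t +i* e) r).
  rewrite /F /= mulrC [in LHS]mulrC (mulrC (g r)) /ck; congr (_ * (_^-1 * _)).
  by cx_ring.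
have FE2 t r : F (t, r) = g r * (f t * ck (r +i* e) t).
  have -> : F (t, r) = f t * (ck ((0 +i* e) + (r : R)%:C) t * g r) by [].
  have -> : (0 +i* e) + (r : R)%:C = r +i* e by cx_eq; rewrite ?add0r ?addr0.
  by ring.
have Imt t : 0 < Im (t +i* e : R[i]) by [].
have hb t : (eint (fun r => cmod (F (t, r))) <= (Num.sqrt (pi / e) * nrm g * cmod (f t))%:E)%E.
  have [lt _] := l2_ck (Imt t).
  have -> : (fun r => cmod (F (t, r))) = (fun r => cmod (f t) * cmod (g r * ck (t +i* e) r)).
    by apply/funext => r; rewrite FE cmodM.
  rewrite eintZ//; last by apply: meas_cmod; apply: cmeasM; [case: hg|exact: cmeas_ck].
  rewrite (mulrC _ (cmod _)) EFinM; apply: lee_wpmul2l; first by rewrite lee_fin.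
  by have := eint_mul_le hg lt; rewrite nrm_ck// mulrC.
have [iF fub] := cfubini mF (rIZ (Num.sqrt (pi / e) * nrm g) (cI_cmod cf)) hb.
have [lK _] := l2_Kl_cI hf cf e0.
have e1 r : cint (fun t => F (t, r)) = tpi * (Kl e f r * g r).
  under eq_cint do rewrite FE2.
  have [lr _] := l2_ck (Imt r); rewrite (cintZ (g r) (cI_mul hf lr)).
  by rewrite /Kl mulrA tpi_K mulrC.
have e2 t : cint (fun r => F (t, r)) = tpi * (f t * K g (t +i* e)).
  under eq_cint do rewrite FE.
  have [lr _] := l2_ck (Imt t); rewrite (cintZ (f t) (cI_mul hg lr)).
  by rewrite mulrCA tpi_K.
move: fub; under eq_cint do rewrite e2; under [in RHS]eq_cint do rewrite e1.
rewrite cintZ; last first.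
  have := cIZ tpi^-1 iF; apply: eq_cI => t.
  by rewrite e2 mulrA mulVf ?mul1r// tpi_neq0.
rewrite cintZ; last exact: cI_mul.
by move=> /(mulfI tpi_neq0) ->.
Qed.

(** Bundled because these two facts are first available for integrable f and reach all of [l2] only
    in [Kdual_l2], after the contraction bound. *)
Definition Kdual f := forall e, 0 < e -> l2 (Kl e f) /\
  forall g, l2 g -> cint (fun r => Kl e f r * g r) = cint (fun t => f t * K g (t +i* e)).

Lemma Kdual_cI f : l2 f -> cI f -> Kdual f.
Proof.
by move=> hf cf e e0; split=> [|g hg]; [case: (l2_Kl_cI hf cf e0)|exact: K_dual].
Qed.

(** Transposition moves the transform onto conj (ck z), where [cauchy_pm] evaluates it; the two
    heights add up, hence the point z + i n. *)
Lemma K_conj_Kl f n z : l2 f -> Kdual f -> 0 < n -> 0 < Im z ->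
  K (fun r => conjc (Kl n f r)) z = - K (shp f) (z + (0 +i* n)).
Proof.
move=> hf cf n0 hz; have [lz _] := l2_ck hz; have [lK dK] := cf n n0.
rewrite !KE.
have -> : cint (fun r => conjc (Kl n f r) * ck z r) = conjc (cint (fun r => Kl n f r * conjc (ck z r))).
  rewrite -cint_conj; last by apply: cI_mul => //; exact: l2_conj.
  by apply: eq_cint => r; rewrite [in RHS]conjcM conjcK2.
rewrite (dK _ (l2_conj lz)).
have Imt t : 0 < Im (t +i* n : R[i]) by [].
have hzn : 0 < Im (z + (0 +i* n)) by rewrite ImD /= addr_gt0.
have Imz : Im (conjc z) < 0 by rewrite Im_conj oppr_lt0.
have kc t : K (fun r => conjc (ck z r)) (t +i* n) = - conjc (ck (z + (0 +i* n)) (- t)).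
  rewrite !KE; have -> : cint (fun r => conjc (ck z r) * ck (t +i* n) r) = cint (fun r => ck (t +i* n) r * ck (conjc z) r).
    apply: eq_cint => r; rewrite mulrC; congr (_ * _); rewrite /ck conjcV; congr _^-1.
    by apply: cx_ext; rewrite !ReImE ?oppr0 ?add0r.
  rewrite cauchy_pm// mulrA mulVf ?tpi_neq0// mul1r /ck conjcV -invrN; congr _^-1.
  by cx_ring.
under eq_cint do rewrite kc mulrN -[f _]conjcK2 -conjcM -conjcN.
have [lzn _] := l2_ck hzn.
have ci : cI (fun t => shp f t * ck (z + (0 +i* n)) t) by apply: cI_mul => //; exact: l2_shp.
rewrite -(cint_refl ci) -cint_conj; last first.
  have := cI_conj (cIN (cI_refl ci)); apply: eq_cI => t.
  by rewrite /shp opprK.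
rewrite -mulrN -cintN; last exact: (cI_refl ci).
congr (_ * _); apply: eq_cint => t.
by rewrite conjcK2 /shp opprK.
Qed.

(** The inner product depends on e + n only. This drives both the contraction bound and the Cauchy
    property in [Kl_cauchy]. *)
Lemma ip_Kl f e n : l2 f -> Kdual f -> Kdual (shp f) -> 0 < e -> 0 < n ->
  cint (fun r => Kl e f r * conjc (Kl n f r)) = - cint (fun t => f t * Kl (e + n) (shp f) t).
Proof.
move=> hf cf cf' e0 n0; have [lK _] := cf n n0; have [_ dK] := cf e e0.
rewrite (dK _ (l2_conj lK)).
under eq_cint => t do rewrite K_conj_Kl// mulrN.
have ze t : (t +i* e : R[i]) + (0 +i* n) = t +i* (e + n) by cx_eq; rewrite ?addr0.
under eq_cint do rewrite ze.
rewrite cintN//; apply: cI_mul => //.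
by case: (cf' _ (addr_gt0 e0 n0)).
Qed.

Lemma nsq_cint f : l2 f -> (nsq f)%:C = cint (fun t => f t * conjc (f t)).
Proof. by move=> hf; rewrite /nsq -cintC; apply: eq_cint => t; rewrite mul_conj. Qed.

(** If a 0 exceeds N by d, then a n^2 / N >= a n + d as long as a n >= N + d, so a grows at least
    linearly and cannot be bounded. *)
Lemma bounded_growth (N B : R) (a : nat -> R) : 0 <= N -> (forall n, a n <= B) ->
  (forall n, a n ^+ 2 <= N * a n.+1) -> N < a 0%N -> False.
Proof.
move=> N0 aB aS a0.
have Npos : 0 < N.
  rewrite lt_neqAle N0 andbT eq_sym; apply/negP => /eqP N00.
  have := aS 0%N; rewrite N00 mul0r; have : 0 < a 0%N by rewrite -N00.
  by move=> p; rewrite leNgt exprn_gt0.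
pose d := a 0%N - N; have d0 : 0 < d by rewrite subr_gt0.
have grow n : N + d * n.+1%:R <= a n.
  elim: n => [|n IH]; first by rewrite mulr1 /d subrKC.
  have h := aS n; rewrite -(ler_pM2l Npos); apply: le_trans h.
  have q0 : 0 <= d * n.+1%:R by rewrite mulr_ge0// ltW.
  have q1 : d <= d * n.+1%:R by rewrite ler_peMr ?(ltW d0)// ler1n.
  apply: (@le_trans _ _ ((N + d * n.+1%:R) ^+ 2)).
    rewrite (_ : n.+2%:R = n.+1%:R + 1 :> R); last by rewrite -addn1 natrD.
    rewrite (mulrDr d) mulr1; move: q0 q1; move: (d * _) => q q0 q1.
    by have := ltW Npos; nra.
  by rewrite ler_pXn2r ?nnegrE ?addr_ge0// (le_trans _ IH)// addr_ge0.
have [M hM] := exists_nat_ge (B / d); have := hM M (leqnn M); rewrite ler_pdivrMr// => h1.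
have := le_trans (grow M) (aB M); rewrite (_ : M.+1%:R = M%:R + 1 :> R); last by rewrite -addn1 natrD.
by move: h1; rewrite (mulrDr d) mulr1 mulrC; move: (d * _) => q h1; lra.
Qed.

(* ||K_e f||^2 <= ||f|| ||K_{2e} f^#||, and K_e f is bounded in norm for large e:
   iterating the inequality forces ||K_e f|| <= ||f||. *)
Lemma nrm_Kl_cI f e : l2 f -> cI f -> 0 < e -> nrm (Kl e f) <= nrm f.
Proof.
move=> hf cf e0; rewrite leNgt; apply/negP => lt.
pose N := nrm f; have N0 : 0 <= N by exact: nrm_ge0.
pose B := (2 * pi)^-1 * (intg (fun t => cmod (f t)) * Num.sqrt (pi / e)).
have step (g : R -> R[i]) d : l2 g -> cI g -> 0 < d -> nrm g = N ->
    nrm (Kl d g) ^+ 2 <= N * nrm (Kl (2 * d) (shp g)).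
  move=> hg cg d0 gN; have [lg _] := l2_Kl_cI hg cg d0.
  have d2 : 0 < 2 * d by rewrite mulr_gt0.
  have [lg2 _] := l2_Kl_cI (l2_shp hg) (cI_shp cg) d2.
  have := f_equal (@cmod R) (ip_Kl hg (Kdual_cI hg cg) (Kdual_cI (l2_shp hg) (cI_shp cg)) d0 d0).
  rewrite -(nsq_cint lg) cmod_real (ger0_norm (nsq_ge0 _)) -nrm_sqr cmodN => ->.
  by rewrite -gN (_ : d + d = 2 * d); [exact: cmod_cint_mul|ring].
pose h n := iter n shp f.
have hh n : [/\ l2 (h n), cI (h n), nrm (h n) = N & intg (fun t => cmod (h n t)) = intg (fun t => cmod (f t))].
  elim: n => [//|n [h1 h2 h3 h4]]; split; [exact: l2_shp|exact: cI_shp|by rewrite nrm_shp|].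
  rewrite -h4 -(intg_refl (cI_cmod h2)); apply: eq_intg => t /=.
  by rewrite /shp cmod_conj.
pose a n := nrm (Kl (2 ^+ n * e) (h n)).
have en n : 0 < 2 ^+ n * e by rewrite mulr_gt0// exprn_gt0.
have aB n : a n <= B.
  have [h1 h2 _ h4] := hh n; have [_ hb] := l2_Kl_cI h1 h2 (en n).
  apply: le_trans hb _; rewrite h4 ler_wpM2l ?invr_ge0 ?mulr_ge0 ?pi_ge0//.
  rewrite ler_wpM2l ?intg_ge0// ler_wsqrtr// ler_pM2l ?pi_gt0// lef_pV2 ?posrE//.
  by rewrite ler_peMl ?(ltW e0)// exprn_ege1// ler1n.
have aS n : a n ^+ 2 <= N * a n.+1.
  have [h1 h2 h3 _] := hh n; have := step _ _ h1 h2 (en n) h3.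
  by rewrite mulrA -exprS.
have a0 : N < a 0%N by rewrite /a expr0 mul1r.
exact: (bounded_growth N0 aB aS a0).
Qed.

Definition trunc (n : nat) f : R -> R[i] := fun t => (\1_`[- n%:R, n%:R]%classic t)%:C * f t.

Lemma trunc_le n f t : cmod (trunc n f t) <= cmod (f t).
Proof.
by rewrite cmodM ler_piMl// cmod_real indicE; case: (_ \in _); rewrite ?normr1 ?normr0.
Qed.
Lemma cmeas_indic (A : set R) : measurable A -> cmeas (fun t => (\1_A t)%:C : R[i]).
Proof. by move=> mA; apply: cmeasC; exact: measurable_indic. Qed.
Lemma l2_trunc n f : l2 f -> l2 (trunc n f).
Proof.
move=> hf; apply: (l2_dom _ hf) => [|t]; last exact: trunc_le.
by apply: cmeasM; [exact: cmeas_indic|case: hf].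
Qed.
Lemma cI_trunc n f : l2 f -> cI (trunc n f).
Proof.
move=> hf; apply: cI_mul => //; split; first exact: cmeas_indic.
have nn : - n%:R <= n%:R :> R by rewrite ge0_cp.
have [i1 _] := intg_indic nn; apply: eq_rI i1 => t.
rewrite cmod_real indicE; case: (_ \in _); rewrite ?normr1 ?normr0 ?expr1n ?expr0n//.
Qed.
Lemma trunc_cvg_pt f t : cmod (trunc n f t - f t) @[n --> \oo] --> 0.
Proof.
have [N hN] := exists_nat_ge `|t|; apply/seq_cvg0P => // e e0; exists N => n /hN nt.
by rewrite /trunc indicE mem_set ?mul1r ?subrr ?cmod0//= in_itv /= -ler_norml.
Qed.
Lemma trunc_cvg f : l2 f -> nrm (fun t => trunc n f t - f t) @[n --> \oo] --> 0.
Proof.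
move=> hf; apply: (l2_dct _ _ hf) => //; [by move=> n; case: (l2_trunc n hf)|by case: hf| |].
  by apply: aeT => t; exact: trunc_cvg_pt.
by move=> n x; exact: trunc_le.
Qed.
Lemma nrm_trunc n f : l2 f -> nrm (trunc n f) <= nrm f.
Proof. by move=> hf; apply: nrm_dom => //; [exact: l2_trunc|move=> t; exact: trunc_le]. Qed.

Lemma Kl_contract f e : l2 f -> 0 < e -> l2 (Kl e f) /\ nrm (Kl e f) <= nrm f.
Proof.
move=> hf e0; apply: (@l2_fatou _ (fun n => Kl e (trunc n f))).
- exact: cmeas_Kl.
- by move=> n; case: (l2_Kl_cI (l2_trunc n hf) (cI_trunc n hf) e0).
- by apply: aeT => r; apply: K_cvg => //; [move=> n; exact: l2_trunc|exact: trunc_cvg].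
- move=> n; apply: le_trans (nrm_trunc n hf); apply: nrm_Kl_cI => //; [exact: l2_trunc|exact: cI_trunc].
Qed.

End cauchy_transform.

(** * The Hardy space and boundary values of the Cauchy transform *)

Section hardy_space.
Variable R : realType.
Implicit Types (f g u : R -> R[i]) (z w : R[i]) (t x e n : R).

Lemma nrm_KlB f g e : l2 f -> l2 g -> 0 < e ->
  nrm (fun r => Kl e f r - Kl e g r) <= nrm (fun r => f r - g r).
Proof.
move=> hf hg e0; rewrite (eq_nrm (g := Kl e (fun t => f t - g t))).
  by case: (Kl_contract (l2B hf hg) e0).
by move=> r; rewrite /Kl KB.
Qed.

Lemma cint_mul_cvg (F G : nat -> R -> R[i]) f g : (forall k, l2 (F k)) -> (forall k, l2 (G k)) ->
  l2 f -> l2 g -> nrm (fun t => F k t - f t) @[k --> \oo] --> 0 ->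
  nrm (fun t => G k t - g t) @[k --> \oo] --> 0 ->
  cmod (cint (fun t => F k t * G k t) - cint (fun t => f t * g t)) @[k --> \oo] --> 0.
Proof.
move=> hF hG hf hg cF cG.
apply: (cvg0_le _ (cvgD0 (cvgM0 cF cG) (cvgD0 (cvgZ0 (nrm g) cF) (cvgZ0 (nrm f) cG)))) => k.
apply/andP; split => //.
have [dF dG] := (l2B (hF k) hf, l2B (hG k) hg).
rewrite -cintB; [|exact: cI_mul|exact: cI_mul].
have -> : cint (fun t => F k t * G k t - f t * g t) =
   cint (fun t => (F k t - f t) * (G k t - g t)) +
   (cint (fun t => g t * (F k t - f t)) + cint (fun t => f t * (G k t - g t))).
  rewrite -cintD; [|exact: cI_mul|exact: cI_mul].
  rewrite -cintD; [|exact: cI_mul|by apply: cID; exact: cI_mul].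
  by apply: eq_cint => t; ring.
apply: le_trans (cmodD _ _) _; apply: lerD; first exact: cmod_cint_mul.
by apply: le_trans (cmodD _ _) _; apply: lerD; exact: cmod_cint_mul.
Qed.

Lemma cmod_cvg_unique (a b : R[i]) (s : nat -> R[i]) : cmod (s k - a) @[k --> \oo] --> 0 ->
  cmod (s k - b) @[k --> \oo] --> 0 -> a = b.
Proof.
move=> ha hb; apply/eqP; rewrite -subr_eq0; apply/eqP; apply: cmod_small => e e0.
have e2 : 0 < e / 2 by rewrite divr_gt0.
have [N hN] := (seq_cvg0P (fun k => cmod_ge0 (s k - a))).1 ha _ e2.
have [M hM] := (seq_cvg0P (fun k => cmod_ge0 (s k - b))).1 hb _ e2.
have := cmod_tri (s (N + M)%N) a b; rewrite (cmodC a (s (N + M)%N)).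
have := hN (N + M)%N (leq_addr _ _); have := hM (N + M)%N (leq_addl _ _); lra.
Qed.

Lemma Kdual_l2 f : l2 f -> Kdual f.
Proof.
move=> hf e e0; have [lK _] := Kl_contract hf e0; split => // g hg.
have lKg : l2 (fun t => K g (t +i* e)) by case: (Kl_contract hg e0).
have ht k := l2_trunc k hf.
have cst h : nrm (fun t : R => h t - h t) @[k --> \oo] --> 0.
  by under eq_nrm do rewrite subrr; rewrite nrm0; exact: cvg_cst.
apply: (@cmod_cvg_unique _ _ (fun k => cint (fun r => Kl e (trunc k f) r * g r))).
  apply: (cint_mul_cvg (G := fun=> g)) => //; first by move=> k; case: (Kl_contract (ht k) e0).
  apply: (cvg0_le _ (trunc_cvg hf)) => k; rewrite nrm_ge0 /=; exact: nrm_KlB.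
under eq_cvg do rewrite (K_dual (ht _) (cI_trunc _ hf) hg e0).
by apply: (cint_mul_cvg (G := fun=> (fun t => K g (t +i* e)))) => //; exact: trunc_cvg.
Qed.

(** All Cauchy integrals of u at points of the lower half-plane vanish. [hardy_L2_plus] and
    [L2_plus_hardy] show that this is the space [L2_plus]; in this form it is visibly linear and
    closed. *)
Definition hardy u := l2 u /\ forall z, 0 < Im z -> K u z = 0.

Lemma hardy_l2 u : hardy u -> l2 u. Proof. by case. Qed.
Lemma hardyD u v : hardy u -> hardy v -> hardy (fun t => u t + v t).
Proof. by move=> [a b] [c d]; split=> [|z hz]; [exact: l2D|rewrite KD// b// d// addr0]. Qed.
Lemma hardyZ c u : hardy u -> hardy (fun t => c * u t).
Proof. by move=> [a b]; split=> [|z hz]; [exact: l2Z|rewrite KZ// b// mulr0]. Qed.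
Lemma hardyB u v : hardy u -> hardy v -> hardy (fun t => u t - v t).
Proof. by move=> [a b] [c d]; split=> [|z hz]; [exact: l2B|rewrite KB// b// d// subr0]. Qed.
Lemma hardy0 : hardy (fun=> 0).
Proof.
split=> [|z hz]; first exact: l2_0.
by rewrite KE; under eq_cint do rewrite mul0r; rewrite cint0 mulr0.
Qed.
Lemma eq_hardy u v : u =1 v -> hardy u -> hardy v.
Proof. by move=> /funext ->. Qed.
Lemma hardy_lim (F : nat -> R -> R[i]) u : (forall k, hardy (F k)) -> l2 u ->
  nrm (fun t => F k t - u t) @[k --> \oo] --> 0 -> hardy u.
Proof.
move=> hF hu h; split => // z hz.
have := K_cvg (fun k => hardy_l2 (hF k)) hu hz h.
under eq_cvg do rewrite (proj2 (hF _) z hz).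
by move=> /cmod_cvg_unique; apply; rewrite subrr cmod0; exact: cvg_cst.
Qed.

Lemma hardy_Kl f e : l2 f -> 0 < e -> hardy (Kl e f).
Proof.
move=> hf e0; have [lK dK] := Kdual_l2 hf e0; split => // z hz.
have [lz _] := l2_ck hz; rewrite KE (dK _ lz).
rewrite (eq_cint (g := fun=> 0)) ?cint0 ?mulr0// => t.
by rewrite KE (cauchy_pp hz (_ : 0 < Im (t +i* e)))// !mulr0.
Qed.

(* s |-> ||K_{s/2} f||^2 is midpoint convex and bounded, hence monotone. *)
Lemma convex_bounded_mono (M : R -> R) (B : R) : (forall s, 0 < s -> M s <= B) ->
  (forall a b, 0 < a -> 0 < b -> 2 * M ((a + b) / 2) <= M a + M b) ->
  forall a b, 0 < a -> a <= b -> M b <= M a.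
Proof.
move=> MB Mc a b a0; rewrite le_eqVlt => /predU1P[-> //|ab]; rewrite leNgt; apply/negP => lt.
pose d := b - a; pose de := M b - M a; have de0 : 0 < de by rewrite subr_gt0.
have d0 : 0 < d by rewrite subr_gt0.
have pos k : 0 < a + k%:R * d by rewrite ltr_wpDr// mulr_ge0// ltW.
have nS k : k.+1%:R = k%:R + 1 :> R by rewrite -addn1 natrD.
have inc k : de <= M (a + k.+1%:R * d) - M (a + k%:R * d).
  elim: k => [|k IH]; first by rewrite mul0r addr0 mul1r /d subrKC.
  have := Mc _ _ (pos k) (pos k.+2).
  have -> : (a + k%:R * d + (a + k.+2%:R * d)) / 2 = a + k.+1%:R * d by rewrite !nS; field.
  lra.
have grow k : M a + k%:R * de <= M (a + k%:R * d).
  elim: k => [|k IH]; first by rewrite !mul0r !addr0.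
  by have := inc k; rewrite [in X in X -> _]nS [k.+1%:R * de](_ : _ = k%:R * de + de) ?nS; [lra|ring].
have [N hN] := exists_nat_ge ((B - M a) / de + 1).
have := hN N (leqnn N); rewrite -lerBrDr ler_pdivrMr// mulrBl mul1r => h1.
have := grow N; have := MB _ (pos N); lra.
Qed.

Lemma nsqB_ip f g : l2 f -> l2 g ->
  nsq (fun t => f t - g t) = nsq f + nsq g - 2 * Re (cint (fun t => f t * conjc (g t))).
Proof.
move=> hf hg; have ci := cI_mul hf (l2_conj hg); have [ir _] := ci.
have [[_ i1] [_ i2]] := (hf, hg).
rewrite Re_cint /nsq -intgD// -intgZ// -intgB; [|exact: rID|exact: rIZ].
by apply: eq_intg => t; rewrite !cmod_sqr !ReImE; ring.
Qed.

(** With M (a + b) = Re <K_a f, K_b f>, well defined by [ip_Kl], the squared distance is M (2a) + M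
    (2b) - 2 M (a + b). M is nonincreasing and bounded, so it has a limit at 0 and the combination
    tends to 0. *)
Lemma Kl_cauchy f : l2 f -> forall e, 0 < e -> exists2 s0, 0 < s0 &
  forall a b, 0 < a <= s0 -> 0 < b <= s0 -> nrm (fun t => Kl a f t - Kl b f t) <= e.
Proof.
move=> hf e e0; pose M s := Re (- cint (fun t => f t * Kl s (shp f) t)).
have df := Kdual_l2 hf; have df' := Kdual_l2 (l2_shp hf).
have ip (a b : R) : 0 < a -> 0 < b -> Re (cint (fun r => Kl a f r * conjc (Kl b f r))) = M (a + b).
  by move=> a0 b0; rewrite (ip_Kl hf df df').
have nsqE (a : R) : 0 < a -> nsq (Kl a f) = M (a + a).
  by move=> a0; have [l _] := df a a0; rewrite -ip// -(nsq_cint l).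
clearbody M; have dist (a b : R) : 0 < a -> 0 < b ->
    nsq (fun t => Kl a f t - Kl b f t) = M (a + a) + M (b + b) - 2 * M (a + b).
  move=> a0 b0; have [[la _] [lb _]] := (df a a0, df b b0).
  by rewrite nsqB_ip// !nsqE// ip.
have half (s : R) : s = s / 2 + s / 2 by field.
have MB (s : R) : 0 < s -> M s <= nsq f.
  move=> s0; have s2 : 0 < s / 2 by rewrite divr_gt0.
  rewrite {1}(half s) -nsqE// -!nrm_sqr ler_pXn2r ?nnegrE//.
  by case: (Kl_contract hf s2).
have Mc (a b : R) : 0 < a -> 0 < b -> 2 * M ((a + b) / 2) <= M a + M b.
  move=> a0 b0; have a2 : 0 < a / 2 by rewrite divr_gt0. have b2 : 0 < b / 2 by rewrite divr_gt0.
  have := nsq_ge0 (fun t => Kl (a / 2) f t - Kl (b / 2) f t).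
  by rewrite dist// -(half a) -(half b) -(mulrDl a b 2^-1) subr_ge0.
have mono := convex_bounded_mono MB Mc.
pose v k := M (2^-1 ^+ k).
have nd : nondecreasing_seq v.
  apply/nondecreasing_seqP => k; apply: mono; first exact: half_pow_gt0.
  by rewrite exprS ler_piMl ?ltW ?half_pow_gt0// invf_lt1 ?ltr1n.
have cv : cvgn v.
  by apply: nondecreasing_is_cvgn => //; exists (nsq f) => _ [k _ <-]; apply: MB; exact: half_pow_gt0.
have e2 : 0 < e ^+ 2 / 2 by rewrite divr_gt0// exprn_gt0.
move/cvgrPdist_lt : (cv) => /(_ _ e2) [N _ hN].
have := hN N (leqnn N) => /(le_lt_trans (ler_norm _)) {}hN.
have ML s : 0 < s -> M s <= limn v.
  move=> s0; have [k /ltW ks] := half_pow_small s0.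
  apply: le_trans (nondecreasing_cvgn_le nd cv k); apply: mono => //; exact: half_pow_gt0.
exists (2^-1 ^+ N / 2); first by rewrite divr_gt0// half_pow_gt0.
move=> a b /andP[a0 a1] /andP[b0 b1]; rewrite nrm_leP ?(ltW e0)// dist//.
have := ML _ (addr_gt0 a0 a0); have := ML _ (addr_gt0 b0 b0).
have : v N <= M (a + b) by apply: mono; rewrite ?addr_gt0//; lra.
move: hN; rewrite /v; lra.
Qed.

(** For nonnegative d, convergence to 0 from the right at 0. *)
Definition small_cvg (d : R -> R) := forall e, 0 < e -> exists2 s0, 0 < s0 &
  forall a, 0 < a <= s0 -> d a <= e.

Lemma Kl_boundary f : l2 f -> exists g, [/\ hardy g, nrm g <= nrm f &
  small_cvg (fun a => nrm (fun t => Kl a f t - g t))].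
Proof.
move=> hf; have hl a : 0 < a -> l2 (Kl a f) by move=> a0; case: (Kl_contract hf a0).
have p k := @half_pow_gt0 R k.
have [g lg cg] : exists2 g, l2 g & nrm (fun t => Kl (2^-1 ^+ k) f t - g t) @[k --> \oo] --> 0.
  apply: (@l2_complete _ (fun k => Kl (2^-1 ^+ k) f)) => [k|e e0]; first exact: hl.
  have [s0 s00 h] := Kl_cauchy hf (divr_gt0 e0 (ltr0Sn _ 1)); have [N hN] := half_pow_small s00.
  exists N => m k Nm Nk; apply: (@le_lt_trans _ _ (e / 2)); last lra.
  by apply: h; rewrite p /= (le_trans _ (ltW hN))// ler_wiXn2l ?invr_ge0 ?invf_le1 ?ler1n.
have hg : hardy g by apply: hardy_lim cg => // k; exact: hardy_Kl.
exists g; split => //.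
  apply/ler_addgt0Pr => e e0; have [N hN] := (seq_cvg0P (fun k => nrm_ge0 _)).1 cg _ e0.
  have := hN N (leqnn N); have := nrm_dist lg (hl _ (p N)); rewrite nrm_sym.
  have [_ ] := Kl_contract hf (p N); have := ler_norm (nrm g - nrm (Kl (2^-1 ^+ N) f)); lra.
move=> e e0; have e2 : 0 < e / 2 by rewrite divr_gt0.
have [s0 s00 h] := Kl_cauchy hf e2; exists s0 => // a ha.
have [N1 hN1] := half_pow_small s00.
have [N2 hN2] := (seq_cvg0P (fun k => nrm_ge0 _)).1 cg _ e2.
have /andP[a0 _] := ha.
apply: le_trans (nrm_tri (hl _ a0) lg (hl _ (p (N1 + N2)%N))) _.
rewrite (_ : e = e / 2 + e / 2); last by field.
apply: lerD; last by apply: ltW; apply: hN2; exact: leq_addl.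
apply: h => //; rewrite p /= (le_trans _ (ltW hN1))// ler_wiXn2l ?invr_ge0 ?invf_le1 ?ler1n//.
exact: leq_addr.
Qed.

Lemma K_shp f w : l2 f -> 0 < Im w -> K (shp f) w = conjc (K f (- conjc w)).
Proof.
move=> hf hw; have [lw _] := l2_ck hw.
have ci : cI (fun t => shp f t * ck w t) by apply: cI_mul => //; exact: l2_shp.
have hw' : 0 < Im (- conjc w) by rewrite ImN Im_conj opprK.
have [lw' _] := l2_ck hw'.
rewrite !KE conjcM -cint_conj; last exact: cI_mul.
rewrite -(cint_refl ci) conjcV.
have -> : conjc (tpi R) = - tpi R by rewrite /tpi; cx_eq; rewrite ?oppr0.
rewrite invrN mulNr -mulrN -cintN; last first.
  have := cI_conj (cI_mul hf lw'); apply: eq_cI => t //.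
congr (_ * _); apply: eq_cint => t; rewrite /shp opprK conjcM -mulrN; congr (_ * _).
rewrite /ck conjcV -invrN; congr _^-1.
by cx_ring.
Qed.

(* The analytic extension of a Hardy function from its boundary values. *)
Definition Ext u z : R[i] := - conjc (K (fun t => conjc (u t)) (- conjc z)).

(** The limit n -> 0 of [K_conj_Kl]: conj (Kl n f) tends to conj g, and the transform of [shp f] is
    a reflected conjugate of that of f. So the analytic function K f is recovered from its boundary
    values. *)
Lemma K_Ext f g z : l2 f -> l2 g -> small_cvg (fun a => nrm (fun t => Kl a f t - g t)) ->
  0 < Im z -> K f z = Ext g z.
Proof.
move=> hf hg cg hz; pose w := - conjc z.
have hw : 0 < Im w by rewrite ImN Im_conj opprK.
have e1 : K (fun t => conjc (g t)) w = - K (shp f) w.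
  pose a k : R := 2^-1 ^+ k.
  have a0 k : 0 < a k by exact: half_pow_gt0.
  apply: (@cmod_cvg_unique _ _ (fun k => K (fun t => conjc (Kl (a k) f t)) w)).
    apply: K_cvg => //; [by move=> k; apply: l2_conj; case: (Kl_contract hf (a0 k))|exact: l2_conj|].
    apply/seq_cvg0P => [k|e e0]; first exact: nrm_ge0.
    have [s0 s00 h] := cg _ (divr_gt0 e0 (ltr0Sn _ 1)); have [N hN] := half_pow_small s00.
    exists N => k Nk; apply: (@le_lt_trans _ _ (e / 2)); last lra.
    rewrite -nrm_conj; apply: le_trans (h (a k) _).
      by apply: eq_ler; apply: eq_nrm => t; rewrite conjcB !conjcK2.
    by rewrite a0 /= (le_trans _ (ltW hN))// ler_wiXn2l ?invr_ge0 ?invf_le1 ?ler1n.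
  have [D hD] := K_cder (l2_shp hf) hw.
  apply/seq_cvg0P => [k|e e0]; first exact: cmod_ge0.
  have [d d0 h] := cder_cont hD e0; have [N hN] := half_pow_small d0.
  exists N => k Nk; rewrite (K_conj_Kl hf (Kdual_l2 hf) (a0 k) hw) opprK addrC -opprB cmodN cmodC.
  rewrite cmodC; have := h (0 +i* a k); rewrite cmod_imag (ger0_norm (ltW (a0 k))).
  apply.
  by apply: le_lt_trans hN; rewrite /a ler_wiXn2l ?invr_ge0 ?invf_le1 ?ler1n.
rewrite /Ext -/w e1 K_shp// conjcN opprK conjcK2; congr (K f _).
by rewrite /w; apply: cx_ext; rewrite !ReImE ?opprK.
Qed.

End hardy_space.

(** * Lebesgue points and convergence of Poisson integrals *)

Section poisson.
Variable R : realType.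
Implicit Types (f g u : R -> R[i]) (z w : R[i]) (t x e n r : R).

(** The inequality |u| <= 1 + u^2 makes u locally integrable. *)
Lemma lebesgue_pt_sqr (u : R -> R) : meas u -> rI (fun x => u x ^+ 2) ->
  {ae mu, forall x, lebesgue_pt u x}.
Proof.
move=> mu' iu; apply: lebesgue_differentiation; split => //; first exact: openT.
move=> A _ cA; have mA := compact_measurable cA; have finA := compact_finite_measure cA.
apply: (@le_lt_trans _ _ (\int[mu]_(x in A) (1 + (u x ^+ 2)%:E))%E).
  apply: ge0_le_integral => //.
  - apply/measurable_EFinP; apply: measurableT_comp => //; exact: measurable_funTS.
  - apply: emeasurable_funD => //; apply/measurable_EFinP; apply: measurable_funX; exact: measurable_funTS.
  - by move=> x _; rewrite -EFinD lee_fin; have := sqr_ge0 (`|u x| - 1); have := sqr_ge0 `|u x|; rewrite -(real_normK (num_real (u x))); nra.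
rewrite ge0_integralD//; last 2 first.
- by move=> x _; rewrite lee_fin sqr_ge0.
- by apply/measurable_EFinP; apply: measurable_funX; exact: measurable_funTS.
rewrite integral_cst// mul1e lte_add_pinfty//.
have [_ fo] := integrableP _ _ _ iu; apply: le_lt_trans fo.
rewrite [leRHS](_ : _ = (\int[mu]_x ((u x) ^+ 2)%:E)%E); last first.
  by apply: eq_integral => x _; rewrite /= ger0_norm// sqr_ge0.
apply: ge0_subset_integral => //; last by move=> x _; rewrite lee_fin sqr_ge0.
by apply/measurable_EFinP; apply: measurable_funX.
Qed.

Definition ib r n t : R := \1_(ball r n : set R) t.

Lemma ibE r n t : ib r n t = (`|r - t| < n)%R%:R.
Proof. by rewrite /ib indicE; congr (nat_of_bool _)%:R; apply/idP/idP; rewrite inE. Qed.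
Lemma ib_ge0 r n t : 0 <= ib r n t. Proof. by rewrite ibE ler0n. Qed.
Lemma meas_ib r n : meas (ib r n).
Proof. by apply: measurable_indic; exact: measurable_ball. Qed.
Hint Resolve ib_ge0 meas_ib : core.

Lemma lebesgue_pt_eint (u : R -> R) (x e : R) : lebesgue_pt u x -> meas u -> 0 < e ->
  exists2 d, 0 < d & forall h, 0 < h <= d -> (eint (fun t => (ib x h t * `|u t - u x|)%R) <= (e * h)%:E)%E.
Proof.
move=> L mu' e0; have e2 : 0 < e / 2 by rewrite divr_gt0.
have /fine_cvgP[L1 /cvgrPdist_lt/(_ _ e2) L2] := L.
have : \forall h \near 0^'+, (davg u x h <= (e / 2)%:E)%E.
  near=> h; have h1 : davg u x h \is a fin_num by near: h.
  rewrite -(fineK h1) lee_fin; have : `|0 - fine (davg u x h)| < e / 2 by near: h.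
  by rewrite sub0r normrN => /ltW; exact: le_trans (ler_norm _).
move=> [d /= d0 hd].
exists (d / 2); first by rewrite divr_gt0.
move=> h /andP[h0 hle]; have hd' : `|0 - h| < d by rewrite sub0r normrN gtr0_norm//; lra.
have := hd h hd' h0; rewrite /davg /iavg lebesgue_measure_ball ?(ltW h0)//.
have -> : (\int[mu]_(y in ball x h) `|((center (u x) \o u) y)%:E| =
   eint (fun t => (ib x h t * `|u t - u x|)%R))%E.
  rewrite integral_mkcond; apply: eq_integral => t _.
  by rewrite /patch /ib indicE; case: ifP => /=; rewrite ?mul1r ?mul0r.
have h2 : 0 < h *+ 2 by rewrite pmulrn_lgt0.
rewrite inver gt_eqF// lee_pdivrMl// => /le_trans; apply.
by rewrite -EFinM lee_fin (_ : h *+ 2 * (e / 2) = e * h)// -mulr_natr; field.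
Unshelve. all: by end_near. Qed.

(** Lebesgue points of a complex-valued function, with the mean over the ball multiplied out. *)
Definition lpt f r := forall e, 0 < e -> exists2 d, 0 < d & forall h, 0 < h <= d ->
  (eint (fun t => (ib r h t * cmod (f t - f r))%R) <= (e * h)%:E)%E.

Lemma ae_lpt f : l2 f -> {ae mu, forall r, lpt f r}.
Proof.
move=> hf; have [[mR mI] _] := hf.
have sq (p : R[i] -> R) : meas (fun x => p (f x)) -> (forall z, `|p z| <= cmod z) ->
    {ae mu, forall x, lebesgue_pt (fun t => p (f t)) x}.
  move=> mp hp; apply: lebesgue_pt_sqr => //; case: hf => _ l; apply: (rI_le _ l); first exact: measurable_funX.
  by move=> x; rewrite normrX ler_pXn2r ?nnegrE.
apply: (aeS (aeI (sq _ mR (@Re_le R)) (sq _ mI (@Im_le R)))) => r [L1 L2] e e0.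
have e2 : 0 < e / 2 by rewrite divr_gt0.
have [d1 d10 h1] := lebesgue_pt_eint L1 mR e2; have [d2 d20 h2] := lebesgue_pt_eint L2 mI e2.
exists (Num.min d1 d2); first by rewrite lt_min d10.
move=> h /andP[h0]; rewrite le_min => /andP[hd1 hd2].
have mm (p : R[i] -> R) : meas (fun x => p (f x)) ->
    meas (fun t => ib r h t * `|p (f t) - p (f r)|).
  by move=> mp; apply: measurable_funM => //; apply: measurableT_comp => //; exact: measurable_funB.
apply: (@le_trans _ _ (eint (fun t => (ib r h t * `|Re (f t) - Re (f r)| + ib r h t * `|Im (f t) - Im (f r)|)%R))).
  apply: le_eint.
  - by move=> t; rewrite mulr_ge0.
  - apply: measurable_funM => //; apply: meas_cmod; apply: cmeasB; [by case: hf|exact: cmeas_cst].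
  - by apply: measurable_funD; exact: mm.
  - by move=> t; rewrite -mulrDr ler_wpM2l// -ReB -ImB; exact: cmod_le_ReIm.
rewrite eintD; [|by move=> t; rewrite mulr_ge0|by move=> t; rewrite mulr_ge0|exact: mm|exact: mm].
by rewrite (_ : e * h = e / 2 * h + e / 2 * h) ?EFinD ?leeD ?h1 ?h2 ?h0//; field.
Qed.

(** The Poisson kernel without its factor 1/pi; its total mass is pi, by [pk_int]. *)
Definition pk e t : R := e / (t ^+ 2 + e ^+ 2).

Lemma pk_den e t : 0 < e -> 0 < t ^+ 2 + e ^+ 2.
Proof. by move=> e0; rewrite ltr_wpDl ?sqr_ge0// exprn_gt0. Qed.
Lemma pk_ge0 e t : 0 < e -> 0 <= pk e t.
Proof. by move=> e0; rewrite divr_ge0 ?(ltW (pk_den _ e0)) ?ltW. Qed.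
Lemma meas_pk e r : meas (fun t => pk e (t - r)).
Proof.
rewrite /pk; apply: measurable_funM => //; apply: measurable_funV => [|t]; last first.
  by rewrite addr_ge0 ?sqr_ge0.
by apply: measurable_funD => //; apply: measurable_funX; exact: measurable_funB.
Qed.

Section majorant.
Variables (F : R -> R) (r d a : R).
Hypotheses (mF : meas F) (F0 : forall t, 0 <= F t) (d0 : 0 < d) (a0 : 0 <= a)
  (hF : forall h, 0 < h <= d -> (eint (fun t => (ib r h t * F t)%R) <= (a * h)%:E)%E).

(** Induction over dyadic rings: where |t - r| >= 2^N e the kernel is at most 1/(4^N e), and F has
    mass at most a 2^(N+1) e in the next ball, so each ring adds 2 * 2^-N a. The constant 5 - 4 *
    2^-N sums these on top of the initial a. *)
Lemma poisson_near e N : 0 < e -> 2 ^+ N * e <= d ->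
  (eint (fun t => (ib r (2 ^+ N * e) t * (pk e (t - r) * F t))%R) <= ((5 - 4 * 2^-1 ^+ N) * a)%:E)%E.
Proof.
move=> e0; have mm h : meas (fun t => ib r h t * (pk e (t - r) * F t)).
  by apply: measurable_funM => //; apply: measurable_funM => //; exact: meas_pk.
have pp h t : 0 <= ib r h t * (pk e (t - r) * F t) by rewrite mulr_ge0// mulr_ge0// pk_ge0.
have mi h : meas (fun t => ib r h t * F t) by exact: measurable_funM.
elim: N => [|N IH] hN.
  rewrite mul1r in hN *.
  apply: (@le_trans _ _ (eint (fun t => (e^-1 * (ib r e t * F t))%R))).
    apply: le_eint => // [|t]; first exact: measurable_funM.
    rewrite [leRHS]mulrCA ler_wpM2l// ler_wpM2r// /pk ler_pdivrMr ?pk_den//.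
    by rewrite expr2 mulrDr mulKf ?gt_eqF// lerDr mulr_ge0 ?sqr_ge0 ?invr_ge0 ?ltW.
  rewrite eintZ ?invr_ge0 ?(ltW e0)//; last by move=> t; rewrite mulr_ge0.
  apply: le_trans (lee_wpmul2l _ (hF _)) _; rewrite ?lee_fin ?invr_ge0 ?(ltW e0) ?e0//.
  by rewrite expr0 [a * e]mulrC mulKf ?gt_eqF//; lra.
have p2 : (0 : R) < 2 ^+ N by rewrite exprn_gt0.
have hN' : 2 ^+ N * e <= d by apply: le_trans hN; rewrite ler_pM2r// exprS ler_peMl// ?ler1n// ltW.
pose c := (2 ^+ N * (2 ^+ N * e))^-1.
have c0 : 0 < c by rewrite invr_gt0 !mulr_gt0.
apply: (@le_trans _ _ (eint (fun t => (ib r (2 ^+ N * e) t * (pk e (t - r) * F t) +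
    c * (ib r (2 ^+ N.+1 * e) t * F t))%R))).
  apply: le_eint => // [|t]; first by apply: measurable_funD => //; exact: measurable_funM.
  have pF : 0 <= pk e (t - r) * F t by rewrite mulr_ge0// pk_ge0.
  rewrite !ibE; case: (ltP `|r - t| (2 ^+ N.+1 * e)) => h1; last first.
    by rewrite !mul0r mulr0 addr0 mulr_ge0// ler0n.
  case: ltP => h2; first by rewrite lerDl !mulr_ge0// ?ltW ?ler0n.
  rewrite mul0r add0r !mul1r ler_wpM2r// /pk /c ler_pdivrMr ?pk_den// mulrC ler_pdivlMr ?mulr_gt0//.
  rewrite -normrN opprB in h2; rewrite -(real_normK (num_real (t - r))).
  have : (2 ^+ N * e) ^+ 2 <= `|t - r| ^+ 2.
    by apply: lerXn2r => //; rewrite nnegrE ?mulr_ge0 ?(ltW p2) ?(ltW e0).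
  have := sqr_ge0 e; nra.
rewrite eintD//; last 2 first.
- by move=> t; rewrite mulr_ge0 ?(ltW c0)// mulr_ge0.
- exact: measurable_funM.
rewrite eintZ ?(ltW c0)//; last by move=> t; rewrite mulr_ge0.
apply: le_trans (leeD (IH hN') (lee_wpmul2l _ (hF _))) _; first by rewrite lee_fin ltW.
  by rewrite hN mulr_gt0 ?exprn_gt0.
rewrite -EFinM -EFinD lee_fin /c [X in _ + X <= _](_ : _ = 2 * 2^-1 ^+ N * a).
  by rewrite exprS; lra.
by rewrite exprVn exprS; field; rewrite !gt_eqF.
Qed.

(** Rings are used up to the last radius 2^N e <= d. Beyond it d <= 2 |t - r|, so (t - r)^2 + d^2 <=
    5 (t - r)^2 and the kernel is at most 5 e / ((t - r)^2 + d^2). *)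
Lemma poisson_majorant e A : 0 < e <= d ->
  (eint (fun t => (((t - r) ^+ 2 + d ^+ 2)^-1 * F t)%R) <= A%:E)%E ->
  (eint (fun t => (pk e (t - r) * F t)%R) <= (5 * a + 5 * e * A)%:E)%E.
Proof.
move=> /andP[e0 ed] hA.
have ex : exists n : nat, d < 2 ^+ n * e.
  have [n] := half_pow_small (divr_gt0 e0 d0); rewrite ltr_pdivlMr// => h; exists n.
  by move: h; rewrite exprVn mulrC ltr_pdivrMr ?exprn_gt0// mulrC.
case: (ex_minnP ex) => [[|N]] hN minN; first by move: hN; rewrite mul1r ltNge ed.
have hN' : 2 ^+ N * e <= d by rewrite leNgt; apply/negP => /minN; rewrite ltnn.
have md : meas (fun t => ((t - r) ^+ 2 + d ^+ 2)^-1).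
  apply: measurable_funV => [|t]; last by rewrite addr_ge0 ?sqr_ge0.
  by apply: measurable_funD => //; apply: measurable_funX; exact: measurable_funB.
have mp : meas (fun t => pk e (t - r) * F t) by apply: measurable_funM => //; exact: meas_pk.
have pp t : 0 <= pk e (t - r) * F t by rewrite mulr_ge0// pk_ge0.
have dp t : 0 <= ((t - r) ^+ 2 + d ^+ 2)^-1 * F t by rewrite mulr_ge0// invr_ge0 addr_ge0 ?sqr_ge0.
apply: (@le_trans _ _ (eint (fun t => (ib r (2 ^+ N * e) t * (pk e (t - r) * F t) +
    5 * e * (((t - r) ^+ 2 + d ^+ 2)^-1 * F t))%R))).
  apply: le_eint => // [|t]; first by apply: measurable_funD; apply: measurable_funM => //; exact: measurable_funM.
  rewrite ibE; case: ltP => h; first by rewrite mul1r lerDl mulr_ge0// mulr_ge0// ltW.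
  rewrite mul0r add0r mulrA ler_wpM2r// /pk -ler_pdivrMr ?invr_gt0 ?pk_den//.
  rewrite invrK mulrAC ler_pdivrMr ?pk_den// [5 * e]mulrC -mulrA ler_pM2l//.
  rewrite -normrN opprB in h; rewrite -(real_normK (num_real (t - r))).
  have : d <= 2 * `|t - r| by move: hN; rewrite exprS; lra.
  have := sqr_ge0 e; nra.
rewrite eintD; last 4 first.
- by move=> t; rewrite mulr_ge0.
- by move=> t; rewrite mulr_ge0// mulr_ge0// ltW.
- exact: measurable_funM.
- by apply: measurable_funM => //; exact: measurable_funM.
rewrite eintZ//; [|by rewrite mulr_ge0// ltW|exact: measurable_funM].
apply: le_trans (leeD (poisson_near e0 hN') (lee_wpmul2l _ hA)) _; first by rewrite lee_fin mulr_ge0// ltW.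
rewrite -EFinM -EFinD lee_fin lerD2r ler_wpM2r//; have := half_pow_gt0 R N; lra.
Qed.

End majorant.

Lemma pk_ck e r t : pk e (t - r) = e * cmod (ck (- r +i* e) t) ^+ 2.
Proof. by rewrite cmod_ck_sqr. Qed.

Lemma pk_int e r : 0 < e -> rI (fun t => pk e (t - r)) /\ intg (fun t => pk e (t - r)) = pi.
Proof.
move=> e0; have [[_ l] n] := @l2_ck _ (- r +i* e) e0; split.
  by apply: eq_rI (rIZ e l) => t; rewrite pk_ck.
under eq_intg do rewrite pk_ck.
by rewrite intgZ// -/(nsq _) n /=; field; rewrite gt_eqF.
Qed.

Lemma poisson_cvg f r : l2 f -> lpt f r ->
  small_cvg (fun e => cmod (cint (fun t => (pk e (t - r))%:C * f t) - pi%:C * f r)).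
Proof.
(* [poisson_majorant] with a/10 yields a/2 + 5 e A, and e <= a / (10 (A + 1)) bounds the second term
   by a/2. *)
move=> hf L a a0; have a10 : 0 < a / 10 by rewrite divr_gt0.
have [d d0 hd] := L _ a10.
pose F t := cmod (f t - f r); have cF : cmeas (fun t => f t - f r).
  by apply: cmeasB; [case: hf|exact: cmeas_cst].
have mF : meas F by exact: meas_cmod.
have [lk _] := @l2_ck _ (- r +i* d) d0.
have rA : rI (fun t => ((t - r) ^+ 2 + d ^+ 2)^-1 * F t).
  have iA : rI (fun t => d^-1 * (cmod (f t) * cmod (ck (- r +i* d) t)) +
      cmod (f r) * cmod (ck (- r +i* d) t) ^+ 2).
    by apply: rID; apply: rIZ; [exact: rI_mul|case: lk].
  apply: rI_le iA _ => [|t].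
    apply: measurable_funM => //; apply: measurable_funV => [|t]; last by rewrite addr_ge0 ?sqr_ge0.
    by apply: measurable_funD => //; apply: measurable_funX; exact: measurable_funB.
  have -> : ((t - r) ^+ 2 + d ^+ 2)^-1 = cmod (ck (- r +i* d) t) ^+ 2 by rewrite cmod_ck_sqr.
  have := @cmod_ck_le _ (- r +i* d) t d0; set c := cmod (ck _ _) => /= hc.
  have c0 : 0 <= c by exact: cmod_ge0.
  have F1 : F t <= cmod (f t) + cmod (f r) by exact: cmodB.
  have [F0 f0] : 0 <= F t /\ 0 <= cmod (f t) by split; exact: cmod_ge0.
  rewrite ger0_norm ?mulr_ge0 ?sqr_ge0//; apply: le_trans (ler_wpM2l (sqr_ge0 c) F1) _.
  rewrite mulrDr [_ * cmod (f r)]mulrC lerD2r expr2 -mulrA ler_pM//; first by rewrite mulr_ge0.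
  by rewrite mulrC.
pose A := intg (fun t => ((t - r) ^+ 2 + d ^+ 2)^-1 * F t).
have A0 : 0 <= A by apply: intg_ge0 => t; rewrite mulr_ge0 ?cmod_ge0// invr_ge0 addr_ge0 ?sqr_ge0.
exists (Num.min d (a / (10 * (A + 1)))).
  by rewrite lt_min d0 divr_gt0// mulr_gt0// ltr_wpDl.
move=> e /andP[e0]; rewrite le_min => /andP[ed].
rewrite ler_pdivlMr; last by rewrite mulr_gt0// ltr_wpDl.
move=> hA; have ee : 0 < e <= d by rewrite e0.
have hm := poisson_majorant mF (fun t => cmod_ge0 _) d0 (ltW a10) hd ee (eq_ler (eint_intg rA)).
have [rp ip] := pk_int r e0; have [lke _] := @l2_ck _ (- r +i* e) e0.
have ci : cI (fun t => (pk e (t - r))%:C * f t).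
  have iA : rI (fun t => cmod (ck (- r +i* e) t) * cmod (f t)) by apply: rI_mul.
  apply: cI_le iA _ => [|t].
    by apply: cmeasM; [apply: cmeasC; exact: meas_pk|case: hf].
  rewrite cmodM cmod_real ger0_norm ?pk_ge0// ler_wpM2r// pk_ck expr2 mulrA ler_piMl//.
  by rewrite -ler_pdivlMl// mulr1; exact: (@cmod_ck_le _ (- r +i* e)).
have -> : cint (fun t => (pk e (t - r))%:C * f t) - pi%:C * f r =
    cint (fun t => (pk e (t - r))%:C * (f t - f r)).
  rewrite -ip -cintC mulrC -cintZ; last exact: cIC.
  rewrite -cintB//; last by apply: cIZ; exact: cIC.
  by apply: eq_cint => t; rewrite mulrBr [f r * _]mulrC.
have ci' : cI (fun t => (pk e (t - r))%:C * (f t - f r)).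
  apply: eq_cI (cIB ci (cIZ (f r) (cIC rp))) => t; by rewrite mulrBr [f r * _]mulrC.
apply: le_trans (cmod_cint ci') _; apply: eint_le_intg; first exact: cI_cmod.
apply: le_trans (_ : (eint (fun t => (pk e (t - r) * F t)%R) <= _)%E).
  apply: eq_ler; apply: eq_integral => t _.
  by rewrite cmodM cmod_real ger0_norm ?pk_ge0.
apply: le_trans hm _; rewrite lee_fin -/A; nra.
Qed.

End poisson.

(** * Nontrivial identification of the Hardy spaces, and the Hankel operator *)

Section boundary.
Variable R : realType.
Implicit Types (f g u : R -> R[i]) (z w : R[i]) (t x e n r : R).

(** [Ext u z] is the Cauchy integral of u at z and [K u (- conjc z)] the one at the conjugate point;
    the difference of the two kernels is the Poisson kernel. For u in [hardy] the second integral
    vanishes. *)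
Lemma poisson_split u r e : l2 u -> 0 < e -> Ext u (r +i* e) - K u (- conjc (r +i* e)) =
  pi^-1%:C * cint (fun t => (pk e (t - r))%:C * u t).
Proof.
move=> hu e0; pose z := r +i* e; have hz : 0 < Im (- conjc z) by rewrite ImN Im_conj opprK.
have [lz _] := l2_ck hz.
have nz : Im (- z) < 0 by rewrite ImN oppr_lt0.
have [lz' _] := l2_ck_neg nz.
have E1 : Ext u z = (tpi R)^-1 * cint (fun t => u t * ck (- z) t).
  rewrite /Ext KE conjcM -cint_conj; last by apply: cI_mul => //; exact: l2_conj.
  rewrite conjcV (_ : conjc (tpi R) = - tpi R); last first.
    by rewrite /tpi; cx_eq; rewrite ?oppr0.
  rewrite invrN mulNr opprK; congr (_ * _); apply: eq_cint => t.
  rewrite conjcM conjcK2; congr (_ * _); rewrite /ck conjcV; congr _^-1.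
  by cx_eq; rewrite ?opprK ?oppr0 ?add0r ?sub0r ?opprK.
rewrite -/z E1 KE -mulrBr -cintB; [|exact: cI_mul|exact: cI_mul].
rewrite -[in RHS]cintZ; last first.
  apply: cI_le (rI_mul lz hu) _ => [|t].
    by apply: cmeasM; [apply: cmeasC; exact: meas_pk|case: hu].
  rewrite cmodM cmod_real ger0_norm ?pk_ge0// ler_wpM2r// pk_ck expr2 mulrA.
  rewrite (_ : - conjc z = - r +i* e); last by apply: cx_ext; rewrite !ReImE ?opprK.
  by rewrite ler_piMl// -ler_pdivlMl// mulr1; exact: (@cmod_ck_le _ (- r +i* e)).
rewrite -cintZ; last by apply: cIB; exact: cI_mul.
apply: eq_cint => t; rewrite [in RHS]mulrA -[in RHS](CM) mulrC -mulrBr -mulrA [RHS]mulrC; congr (_ * _).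
have p0 : pi != 0 :> R by rewrite gt_eqF// pi_gt0.
have d0 : (t - r) ^+ 2 + e ^+ 2 != 0 by rewrite gt_eqF// pk_den.
have n1 : t%:C - z != 0 by apply: Im_neq0; rewrite ImB /= sub0r oppr_eq0 gt_eqF.
have n2 : t%:C - conjc z != 0 by apply: Im_neq0; rewrite ImB Im_conj /= sub0r opprK gt_eqF.
have den : (t%:C - z) * (t%:C - conjc z) = ((t - r) ^+ 2 + e ^+ 2)%:C.
  by cx_ring.
have num : t%:C - conjc z - (t%:C - z) = (0 +i* (2 * e)).
  by cx_ring.
rewrite /ck (_ : (t%:C - z)^-1 - (t%:C - conjc z)^-1 =
  (t%:C - conjc z - (t%:C - z)) / ((t%:C - z) * (t%:C - conjc z))); last by field; rewrite ?n1 ?n2.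
rewrite num den /tpi (_ : (0 +i* (2 * pi))^-1 = 0 +i* - (2 * pi)^-1); last first.
  apply: (mulfI (_ : 0 +i* (2 * pi) != 0)); first exact: tpi_neq0.
  rewrite mulfV; last exact: tpi_neq0.
  have p2 : 2 * pi != 0 :> R by rewrite mulf_neq0.
  cx_eq; last by rewrite mul0r mulr0 addr0.
  by rewrite mulr0 sub0r mulrN opprK mulfV.
rewrite -CV /pk; move: ((t - r) ^+ 2 + e ^+ 2) d0 => D d0.
cx_eq; last by ring.
by move: (pi : R) p0 => p p0; field; rewrite d0 p0.
Qed.

Lemma Ext_poisson u r e : hardy u -> 0 < e ->
  Ext u (r +i* e) = pi^-1%:C * cint (fun t => (pk e (t - r))%:C * u t).
Proof.
move=> [hu ku] e0; rewrite -poisson_split// ku ?subr0//.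
by rewrite ImN Im_conj opprK.
Qed.

Lemma Ext_boundary u : hardy u ->
  {ae mu, forall r, small_cvg (fun e => cmod (Ext u (r +i* e) - u r))}.
Proof.
move=> hu; apply: (aeS (ae_lpt (hardy_l2 hu))) => r L a a0.
have pa : 0 < a * pi by rewrite mulr_gt0 ?pi_gt0.
have [d d0 h] := poisson_cvg (hardy_l2 hu) L pa; exists d => // e /andP[e0 ed].
rewrite Ext_poisson// [u r](_ : _ = pi^-1%:C * (pi%:C * u r)); last first.
  by rewrite mulrA -CM mulVf ?mul1r// gt_eqF// pi_gt0.
rewrite -mulrBr cmodM cmod_real ger0_norm ?invr_ge0 ?pi_ge0// ler_pdivrMl ?pi_gt0// (mulrC pi a).
by apply: h; rewrite e0.
Qed.

Lemma small_cvg_at_right (d : R -> R) : (forall e, 0 <= d e) -> small_cvg d ->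
  d e @[e --> 0^'+] --> 0.
Proof.
move=> d0 h; apply/cvgrPdist_le => a a0; have [s s0 hs] := h a a0.
near=> e; rewrite sub0r normrN ger0_norm//; apply: hs; apply/andP; split.
  by near: e; exact: nbhs_right_gt.
by near: e; exact: nbhs_right_le.
Unshelve. all: by end_near. Qed.

Lemma at_right_small_cvg (d : R -> R) : d e @[e --> 0^'+] --> 0 -> small_cvg d.
Proof.
move=> /cvgrPdist_le h a a0; have [s /= s0 hs] := h a a0; exists (s / 2); first by rewrite divr_gt0.
move=> e /andP[e0 es]; apply: le_trans (ler_norm _) _; rewrite -normrN -sub0r; apply: hs => //=.
by rewrite sub0r normrN gtr0_norm//; lra.
Qed.

Lemma boundary_valueP (F : R[i] -> R[i]) f : boundary_value F f <->
  {ae mu, forall r, small_cvg (fun e => cmod (F (r +i* e) - f r))}.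
Proof.
split => H; apply: (aeS H) => r.
  by move=> /cvg_cmodP h; apply: at_right_small_cvg; exact: h.
by move=> h; apply/cvg_cmodP; apply: small_cvg_at_right.
Qed.

Lemma Ext_cder u z : l2 u -> 0 < Im z -> exists D, cder (Ext u) z D.
Proof.
move=> hu hz; have hz' : 0 < Im (- conjc z) by rewrite ImN Im_conj opprK.
have [D hD] := K_cder (l2_conj hu) hz'; exists (conjc D) => e e0.
have [d d0 h] := hD e e0; exists d => // k hk; rewrite /Ext.
have := h (- conjc k); rewrite cmodN cmod_conj => /(_ hk); rewrite -(cmod_conj (_ - _ - _)).
rewrite !conjcB conjcM conjcN conjcK2 -opprD -conjcD mulrN opprK.
rewrite -[X in X <= _]cmodN; congr (cmod _ <= _); ring.
Qed.

Lemma Ext_line u e : l2 u -> 0 < e ->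
  l2 (fun r => Ext u (r +i* e)) /\ nrm (fun r => Ext u (r +i* e)) <= nrm u.
Proof.
move=> hu e0; have [l n] := Kl_contract (l2_conj hu) e0; rewrite nrm_conj in n.
have E r : Ext u (r +i* e) = - conjc (Kl e (fun t => conjc (u t)) (- r)).
  rewrite /Ext /Kl; congr (- conjc (K _ _)).
  by apply: cx_ext; rewrite !ReImE ?opprK.
split; first by apply: eq_l2 (l2N (l2_conj (l2_refl l))) => r; rewrite E.
by rewrite (eq_nrm E) nrmN nrm_conj (nrm_refl l).
Qed.

Lemma hardy_L2_plus u : hardy u -> L2_plus u.
Proof.
move=> hu; have lu := hardy_l2 hu; split; first exact/L2P.
exists (Ext u); split.
- by move=> z hz; have [D hD] := Ext_cder lu hz; exact: cder_derivable hD.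
- exists (nrm u) => e e0; have [l n] := Ext_line lu e0.
  by rewrite L2normE// lee_fin.
- by apply/boundary_valueP; exact: Ext_boundary.
Qed.

Lemma small_of_sqrt (A c a : R) : 0 <= A -> 0 <= c -> 0 < a ->
  exists2 x0, 0 < x0 & forall x, x0 <= x -> A * Num.sqrt (c / x) <= a.
Proof.
move=> A0 c0 a0; have p0 : 0 < A ^+ 2 * c / a ^+ 2 + 1.
  by apply: ltr_wpDl => //; rewrite divr_ge0 ?sqr_ge0// mulr_ge0 ?sqr_ge0.
exists (A ^+ 2 * c / a ^+ 2 + 1) => // x hx; have x0 := lt_le_trans p0 hx.
have -> : A * Num.sqrt (c / x) = Num.sqrt (A ^+ 2 * (c / x)).
  by rewrite [in RHS]sqrtrM ?sqr_ge0// sqrtr_sqr ger0_norm.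
have -> : a = Num.sqrt (a ^+ 2) by rewrite sqrtr_sqr gtr0_norm.
rewrite ler_wsqrtr// mulrA ler_pdivrMr// -ler_pdivrMl ?exprn_gt0// mulrC; lra.
Qed.

(** The contour for H(w)/(w + z) is moved between the heights s m and e0, where H is bounded in L2.
    As s m tends to 0, H on the line converges weakly to f by [weak_limit], and the kernel converges
    in norm. *)
Lemma K_line (H : R[i] -> R[i]) f (M e0 : R) : holo (fun w => 0 < Im w) H -> 0 < e0 ->
  (forall e, 0 < e <= e0 -> l2 (fun r => H (r +i* e)) /\ nrm (fun r => H (r +i* e)) <= M) ->
  cmeas f -> {ae mu, forall r, small_cvg (fun e => cmod (H (r +i* e) - f r))} ->
  l2 f /\ forall z, 0 < Im z -> K f z = K (fun r => H (r +i* e0)) (z + (0 +i* e0)).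
Proof.
move=> hH e00 hM mf bF; have [l0 n0] : l2 (fun r => H (r +i* e0)) /\ nrm (fun r => H (r +i* e0)) <= M.
  by apply: hM; rewrite e00 lexx.
have M0 : 0 <= M by exact: le_trans (nrm_ge0 _) n0.
have [m0 hm0] := half_pow_small e00; pose s m := 2^-1 ^+ (m0 + m) : R.
have sp m : 0 < s m <= e0.
  by rewrite half_pow_gt0 (le_trans _ (ltW hm0))// ler_wiXn2l ?invr_ge0 ?invf_le1 ?ler1n ?leq_addr.
have lF m : l2 (fun r => H (r +i* s m)) by case: (hM _ (sp m)).
have nF m : nrm (fun r => H (r +i* s m)) <= M by case: (hM _ (sp m)).
have ssm e : 0 < e -> exists N, forall m, (N <= m)%N -> s m <= e.
  move=> /half_pow_small[N hN]; exists N => m Nm; apply: le_trans (ltW hN).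
  by rewrite ler_wiXn2l ?invr_ge0 ?invf_le1 ?ler1n// (leq_trans Nm) ?leq_addl.
have cv : {ae mu, forall r, cmod (H (r +i* s m) - f r) @[m --> \oo] --> 0}.
  apply: (aeS bF) => r h; apply/seq_cvg0P => // e e1; have [d d0 hd] := h _ (divr_gt0 e1 (ltr0Sn _ 1)).
  have [N hN] := ssm _ d0; exists N => m /hN sm; apply: (@le_lt_trans _ _ (e / 2)); last lra.
  by apply: hd; rewrite sm andbT; case/andP: (sp m).
have [lf _] := l2_fatou mf lF cv nF; split => //.
move=> z z0; have [lz _] := l2_ck z0.
pose G w := H w * (w + z)^-1.
have Gl e r : G (r +i* e) = H (r +i* e) * ck (z + (0 +i* e)) r.
  by rewrite /G /ck; congr (_ * _^-1); cx_ring.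
have hG : holo (fun w => 0 < Im w) G.
  apply: holoM => //; apply: holo_inv_shift => v hv.
  by apply: Im_neq0; rewrite ImD gt_eqF// addr_gt0.
have zz e : 0 < e -> Im z <= Im (z + (0 +i* e)) by move=> h; rewrite ImD /= lerDl ltW.
have bd e : 0 < e <= e0 -> cI (fun r => G (r +i* e)) /\ intg (fun r => cmod (G (r +i* e))) <= M * Num.sqrt (pi / Im z).
  move=> ee; have [lH nH] := hM e ee; have e1 : 0 < e by case/andP: ee.
  have ze := lt_le_trans z0 (zz e e1); have [lk _] := l2_ck ze; split.
    by apply: eq_cI (cI_mul lH lk) => r; rewrite Gl.
  under eq_intg do rewrite Gl cmodM.
  apply: le_trans (cauchy_schwarz lH lk) _; rewrite nrm_ck//; apply: ler_pM => //.
  by rewrite ler_wsqrtr// ler_wpM2l ?pi_ge0// lef_pV2 ?posrE// zz.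
have shift m : K (fun r => H (r +i* s m)) (z + (0 +i* s m)) = K (fun r => H (r +i* e0)) (z + (0 +i* e0)).
  have /andP[s0 s1] := sp m; rewrite !KE; congr (_ * _).
  rewrite -(eq_cint (Gl (s m))) -(eq_cint (Gl e0)); apply: (contour_shift s0 s1 hG) => e /andP[e1 e2].
  by apply: bd; rewrite e2 (lt_le_trans s0).
apply: (mulfI (tpi_neq0 R)); rewrite tpi_K -(shift 0%N).
apply: (cmod_cvg_unique (weak_limit mf lF cv nF lz)); rewrite (shift 0%N); set C := Num.sqrt (pi / Im z) / Im z.
have C0 : 0 <= C by rewrite divr_ge0 ?sqrtr_ge0 ?(ltW z0).
have nk m : l2 (fun r => ck z r - ck (z + (0 +i* s m)) r) /\ nrm (fun r => ck z r - ck (z + (0 +i* s m)) r) <= s m * C.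
  have /andP[s0 _] := sp m; have ze := lt_le_trans z0 (zz _ s0); have [lk _] := l2_ck ze.
  split; first exact: l2B.
  have E r : ck z r - ck (z + (0 +i* s m)) r = (0 +i* s m) * ck (z + (0 +i* s m)) r * ck z r.
    have n1 := ck_neq0 r (lt0r_neq0 z0); have n2 := ck_neq0 r (lt0r_neq0 ze).
    by rewrite /ck; move: n1 n2; move: (0 +i* s m) => v n1 n2; field; rewrite n1 n2.
  rewrite (eq_nrm E); apply: le_trans (nrm_bmul (B := s m / Im z) _ _ lz) _.
  - by apply: cmeasM; [exact: cmeas_cst|exact: cmeas_ck].
  - move=> r; rewrite cmodM cmod_imag ger0_norm ?(ltW s0)// ler_wpM2l ?(ltW s0)//.
    by apply: le_trans (cmod_ck_le _ ze) _; rewrite lef_pV2 ?posrE// zz.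
  by rewrite nrm_ck// /C mulrA mulrAC.
have MC : 0 < M * C + 1 by rewrite ltr_wpDl// mulr_ge0.
apply/seq_cvg0P => // e e1; have [N hN] := ssm _ (divr_gt0 e1 MC); exists N => m /hN sm.
rewrite -(shift m) tpi_K; have [lk nk'] := nk m.
have /andP[s0 _] := sp m; have [lk' _] := l2_ck (lt_le_trans z0 (zz _ s0)).
rewrite -cintB; [|exact: cI_mul|exact: cI_mul].
rewrite (eq_cint (g := fun r => H (r +i* s m) * (ck z r - ck (z + (0 +i* s m)) r))); last by move=> r; ring.
apply: le_lt_trans (cmod_cint_mul (lF m) lk) _; apply: le_lt_trans (ler_pM _ _ (nF m) nk') _ => //.
rewrite mulrCA; apply: (@lt_le_trans _ _ (s m * (M * C + 1))); last by rewrite -ler_pdivlMr.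
by rewrite ltr_pM2l// ltrDl.
Qed.

(** [K_line] expresses K u z by values of the extension at height x, which bounds it by a multiple
    of x^(-1/2); x is arbitrarily large. *)
Lemma L2_plus_hardy u : L2_plus u -> hardy u.
Proof.
move=> [/L2P lu [F [aF [M hM] /boundary_valueP bF]]].
have hF : holo (fun w => 0 < Im w) F by move=> w hw; exact: derivable_cder (aF w hw).
have lF e : 0 < e -> l2 (fun t => F (t +i* e)) /\ nrm (fun t => F (t +i* e)) <= M.
  by move=> e0; apply: L2norm_le; [apply: ccont_cmeas; exact: (holo_line_ccont hF)|exact: hM].
have M0 : 0 <= M by have [_] := lF 1 ltr01; exact: le_trans (nrm_ge0 _).
split => // z hz; apply: cmod_small => a a0; have p2 : 0 <= (2 * pi)^-1 :> R by rewrite invr_ge0 mulr_ge0 ?pi_ge0.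
have [x x0 hx] := small_of_sqrt (mulr_ge0 p2 M0) (pi_ge0 R) a0.
have [|_ ->//] := @K_line F u M x hF x0 _ (proj1 lu) bF; first by move=> e /andP[e0 _]; exact: lF.
have zx : x <= Im (z + (0 +i* x)) by rewrite ImD lerDr ltW.
have [l n] := lF x x0; apply: le_trans (K_bound l (lt_le_trans x0 zx)) _; apply: le_trans (hx _ zx).
by rewrite -mulrA ler_wpM2l// ler_wpM2r// sqrtr_ge0.
Qed.

(** The boundary function of K f on the real line, that is, the limit of [Kl a f] as a tends to 0.
    It is a choice in a class modulo null sets, hence linear only almost everywhere ([K0_lin]). *)
Definition K0 f : R -> R[i] := xget (fun=> 0) [set g | [/\ hardy g, nrm g <= nrm f &
  small_cvg (fun a => nrm (fun t => Kl a f t - g t))]].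

Lemma K0P f : l2 f -> [/\ hardy (K0 f), nrm (K0 f) <= nrm f &
  small_cvg (fun a => nrm (fun t => Kl a f t - K0 f t))].
Proof. by move=> /Kl_boundary [g hg]; rewrite /K0; case: xgetP => [x _ //|/(_ g)]. Qed.

Lemma hardy_K0 f : l2 f -> hardy (K0 f). Proof. by case/K0P. Qed.
Lemma l2_K0 f : l2 f -> l2 (K0 f). Proof. by move=> /hardy_K0/hardy_l2. Qed.
Lemma nrm_K0 f : l2 f -> nrm (K0 f) <= nrm f. Proof. by case/K0P. Qed.

Lemma K0_boundary f : l2 f ->
  {ae mu, forall r, small_cvg (fun e => cmod (K f (r +i* e) - K0 f r))}.
Proof.
move=> hf; have [hK _ cK] := K0P hf; apply: (aeS (Ext_boundary hK)) => r h a a0.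
have [d d0 hd] := h a a0; exists d => // e ed; rewrite (K_Ext hf (hardy_l2 hK) cK) ?hd//.
by case/andP: ed.
Qed.

Lemma small_cvg_unique (f : R -> R[i]) a b : small_cvg (fun e => cmod (f e - a)) ->
  small_cvg (fun e => cmod (f e - b)) -> a = b.
Proof.
move=> ha hb; apply/eqP; rewrite -subr_eq0; apply/eqP/cmod_small => e e0.
have e2 : 0 < e / 2 by rewrite divr_gt0.
have [s s0 hs] := ha _ e2; have [v v0 hv] := hb _ e2.
have m0 : 0 < Num.min s v by rewrite lt_min s0.
have := hs (Num.min s v); have := hv (Num.min s v).
rewrite m0 !ge_min !lexx orbT /= => /(_ isT) h1 /(_ isT) h2.
have := cmod_tri (f (Num.min s v)) a b; rewrite (cmodC a (f _)); lra.
Qed.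

Lemma small_cvgD (f g : R -> R[i]) a b c : small_cvg (fun e => cmod (f e - a)) ->
  small_cvg (fun e => cmod (g e - b)) -> small_cvg (fun e => cmod ((f e + c * g e) - (a + c * b))).
Proof.
move=> ha hb e e0; have e2 : 0 < e / 2 by rewrite divr_gt0.
have c1 : 0 < cmod c + 1 by rewrite ltr_wpDl ?cmod_ge0.
have [s s0 hs] := ha _ e2; have [v v0 hv] := hb _ (divr_gt0 e2 c1).
exists (Num.min s v); first by rewrite lt_min s0.
move=> x /andP[x0]; rewrite le_min => /andP[xs xv].
have := hs x; have := hv x; rewrite x0 xs xv => /(_ isT) h1 /(_ isT) h2.
rewrite (_ : f x + c * g x - (a + c * b) = (f x - a) + c * (g x - b)); last by ring.
apply: le_trans (cmodD _ _) _; rewrite (_ : e = e / 2 + e / 2); last by field.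
apply: lerD => //; rewrite cmodM; move: h1; rewrite ler_pdivlMr// => h1.
by apply: le_trans h1; rewrite mulrC ler_wpM2l// lerDl ler01.
Qed.

Lemma K0_lin f g c : l2 f -> l2 g ->
  {ae mu, forall r, K0 (fun t => f t + c * g t) r = K0 f r + c * K0 g r}.
Proof.
move=> hf hg; have hcg := l2Z c hg.
apply: (aeS (aeI (K0_boundary (l2D hf hcg)) (aeI (K0_boundary hf) (K0_boundary hg)))).
move=> r [h [h1 h2]]; apply: small_cvg_unique h _.
move=> e e0; have [d d0 hd] := small_cvgD c h1 h2 e0; exists d => // x xd.
by rewrite KD// ?KZ//; [exact: hd|case/andP: xd..].
Qed.

(** The pointwise limit that defines [hankel] exists almost everywhere by [K0_boundary]. Passing
    through f allows a symbol that is only almost everywhere equal to a measurable one. *)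
Lemma hankelE phi y f : l2 f -> {ae mu, forall x, phi x * y x = f x} ->
  {ae mu, forall r, hankel phi y r = K0 f r}.
Proof.
move=> hf E; apply: (aeS (K0_boundary hf)) => r h; rewrite /hankel.
apply: (@cvg_lim R[i]^o); first exact: norm_hausdorff.
apply/cvg_cmodP; apply: small_cvg_at_right => // e e0; have [d d0 hd] := h e e0.
exists d => // x xd; apply: le_trans (hd x xd).
rewrite KE -/(cint _) (cint_ae (g := fun t => f t * ck (r +i* x) t))//.
apply: (aeS E) => t <-; congr (_ / _).
by cx_eq; rewrite ?add0r.
Qed.

End boundary.

(** * Growth of absolutely continuous functions *)

Section absolute_continuity.
Variable R : realType.
Implicit Types (h : R -> R[i]) (psi : R -> R) (a b c e s t x y : R).

(** Supremum of the points where P holds; the local hypothesis carries P from just left of the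
    supremum to just right of it. *)
Lemma chain_induction (P : R -> Prop) a b : a <= b -> P a ->
  (forall s, a <= s <= b -> exists2 d, 0 < d & forall x y, a <= x -> x <= s -> s <= y -> y <= b ->
     s - d < x -> y < s + d -> P x -> P y) -> P b.
Proof.
move=> ab Pa loc; pose S := [set x | a <= x <= b /\ P x].
have Sa : S a by split; rewrite ?lexx.
have hS : has_sup S by split; [exists a|exists b => x [/andP[]]].
have as_ : a <= sup S by exact: sup_ubound hS.2 _ Sa.
have sb : sup S <= b by apply: ge_sup; [exists a|move=> x [/andP[]]].
have [|d d0 hd] := loc (sup S); first by rewrite as_.
have [x [/andP[ax xb] Px] hx] := sup_adherent d0 hS.
have xs : x <= sup S by apply: sup_ubound hS.2 _ _; split; rewrite ?ax.
pose y := Num.min b (sup S + d / 2).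
have sy : sup S <= y by rewrite le_min sb lerDl divr_ge0// ltW.
have yd : y < sup S + d by rewrite gt_min; apply/orP; right; lra.
have yb : y <= b by rewrite ge_min lexx.
have Py : P y by exact: hd hx yd Px.
have : y <= sup S by apply: sup_ubound hS.2 _ _; split=> //; rewrite yb (le_trans as_).
rewrite /y ge_min => /orP[bs|]; last lra.
by have -> : b = y by apply/eqP; rewrite eq_le yb andbT (le_trans bs).
Qed.

(** The primitive of psi that vanishes at -oo. *)
Definition cumul psi x : R := intg (fun t => (t <= x)%R%:R * psi t).

Lemma meas_in (I : interval R) : meas (fun t => (t \in I)%:R : R).
Proof.
rewrite (_ : (fun t => _) = \1_[set` I]); first exact: measurable_indic.
by apply/funext => t; rewrite indicE mem_setE.
Qed.

Lemma meas_le x : meas (fun t => (t <= x)%R%:R : R).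
Proof. by have := meas_in `]-oo, x]; under eq_fun do rewrite in_itv. Qed.

Lemma rI_cut psi x : rI psi -> rI (fun t => (t <= x)%R%:R * psi t).
Proof.
move=> h; apply: rI_le (rI_norm h) _ => [|t]; first by apply: measurable_funM; [exact: meas_le|exact: rI_meas].
by rewrite normrM ger0_norm ?ler0n// ler_piMl// lern1 leq_b1.
Qed.

Lemma meas_itv a b : meas (fun t => (a < t <= b)%R%:R : R).
Proof. by have := meas_in `]a, b]; under eq_fun do rewrite in_itv. Qed.

Lemma cumulB psi a b : rI psi -> a <= b ->
  rI (fun t => (a < t <= b)%R%:R * psi t) /\
  cumul psi b - cumul psi a = intg (fun t => (a < t <= b)%R%:R * psi t).
Proof.
move=> h ab.
have E t : (a < t <= b)%R%:R * psi t = (t <= b)%R%:R * psi t - (t <= a)%R%:R * psi t.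
  rewrite -mulrBl; congr (_ * _); case: (leP t a) => ta /=; last by rewrite subr0.
  by rewrite (le_trans ta ab) subrr.
have i := rIB (rI_cut b h) (rI_cut a h); split; first by apply: eq_rI i => t; rewrite E.
by rewrite /cumul -intgB; [apply: eq_intg => t; rewrite E|exact: rI_cut..].
Qed.

Lemma cumul_mono psi a b : rI psi -> (forall t, 0 <= psi t) -> a <= b -> cumul psi a <= cumul psi b.
Proof.
move=> h p ab; rewrite -subr_ge0; have [_ ->] := cumulB h ab.
by apply: intg_ge0 => t; rewrite mulr_ge0.
Qed.

Lemma cumulB_le psi (chi : R -> R) a b : rI psi -> rI chi -> a <= b ->
  (forall t, a < t <= b -> psi t <= chi t) -> cumul psi b - cumul psi a <= cumul chi b - cumul chi a.
Proof.
move=> h h' ab le; have [i ->] := cumulB h ab; have [i' ->] := cumulB h' ab.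
by apply: le_intg => // t; case: (boolP (a < t <= b)) => [/le|_]; rewrite ?mul1r ?mul0r.
Qed.

Lemma ae_neq s : {ae mu, forall t, t != s}.
Proof.
exists [set s]; split; [exact: measurable_set1|exact: lebesgue_measure_set1|].
by move=> t /=; move/negP; rewrite negbK => /eqP.
Qed.

Lemma intg_itv a b : a <= b ->
  rI (fun t => (a < t <= b)%R%:R) /\ intg (fun t => (a < t <= b)%R%:R) = b - a.
Proof.
move=> ab; have [i e] := intg_indic ab.
have E : {ae mu, forall t, (a < t <= b)%R%:R = \1_`[a, b]%classic t :> R}.
  apply: (aeS (ae_neq a)) => t ta; rewrite indicE; congr (nat_of_bool _)%:R.
  by rewrite lt_neqAle eq_sym ta; apply/idP/idP; rewrite inE /= in_itv.
by split; [apply: rI_ae E i; exact: meas_itv|rewrite (intg_ae E)].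
Qed.

(** Continuity of [cumul psi]: the intervals shrink to the null set {s}. *)
Lemma cumul_small psi s e : rI psi -> (forall t, 0 <= psi t) -> 0 < e ->
  exists2 d, 0 < d & cumul psi (s + d) - cumul psi (s - d) <= e.
Proof.
move=> h p e0; pose d (k : nat) : R := 2^-1 ^+ k; have d0 k : 0 < d k by exact: half_pow_gt0.
have sd k : s - d k <= s + d k by have := d0 k; lra.
have i k := proj1 (cumulB h (sd k)).
pose F (k : nat) t := (s - d k < t <= s + d k)%R%:R * psi t.
have m1 k : meas (F k) by apply: rI_meas; exact: i.
have m2 : meas (fun _ : R => 0 : R) by exact: measurable_cst.
have cF : {ae mu, forall t, F k t @[k --> \oo] --> 0}.
  apply: (aeS (ae_neq s)) => t ts; apply/seq_cvg0P => [k|c c0]; first by rewrite mulr_ge0.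
  have ts0 : 0 < `|t - s| by rewrite normr_gt0 subr_eq0.
  have [N hN] := half_pow_small ts0; exists N => k Nk.
  rewrite /F (_ : (_ < _ <= _) = false) ?mul0r//; apply/negP => /andP[h1 h2].
  have : `|t - s| <= d k by rewrite ler_norml; apply/andP; split; lra.
  by rewrite leNgt (le_lt_trans _ hN)// ler_wiXn2l ?invr_ge0 ?invf_le1 ?ler1n.
have bF : {ae mu, forall t, forall k, `|F k t| <= psi t}.
  by apply: aeT => t k; rewrite ger0_norm ?mulr_ge0// ler_piMl// lern1 leq_b1.
have [_] := dct m1 m2 h cF bF.
rewrite intg0 => /seq_cvg0P cv; have [|N hN] := cv _ _ e0.
  by move=> k; apply: intg_ge0 => t; rewrite mulr_ge0.
by exists (d N) => //; have [_ ->] := cumulB h (sd N); rewrite ltW// hN.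
Qed.

Lemma cumul_le_intg psi x : rI psi -> (forall t, 0 <= psi t) -> cumul psi x <= intg psi.
Proof. by move=> h p; apply: le_intg => // [|t]; [exact: rI_cut|rewrite ler_piMl// lern1 leq_b1]. Qed.

Lemma cumul_lim psi e : rI psi -> (forall t, 0 <= psi t) -> 0 < e ->
  exists2 X, 1 <= X & intg psi - cumul psi X <= e.
Proof.
move=> h p e0.
pose F (k : nat) t := psi t - (t <= k%:R)%R%:R * psi t.
have m1 k : meas (F k).
  by apply: measurable_funB; [exact: rI_meas|apply: rI_meas; exact: rI_cut].
have m2 : meas (fun _ : R => 0 : R) by exact: measurable_cst.
have F0 k t : 0 <= F k t by rewrite subr_ge0 ler_piMl// lern1 leq_b1.
have cF : {ae mu, forall t, F k t @[k --> \oo] --> 0}.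
  apply: aeT => t; apply/seq_cvg0P => // c c0.
  by have [N hN] := exists_nat_ge t; exists N => k /hN tk; rewrite /F tk mul1r subrr.
have bF : {ae mu, forall t, forall k, `|F k t| <= psi t}.
  by apply: aeT => t k; rewrite ger0_norm// gerBl mulr_ge0.
have [_] := dct m1 m2 h cF bF.
rewrite intg0 => /seq_cvg0P cv; have [|N hN] := cv _ _ e0.
  by move=> k; apply: intg_ge0.
exists N.+1%:R; first by rewrite ler1n.
have := hN N.+1 (leqnSn N); rewrite intgB//; last exact: rI_cut.
exact: ltW.
Qed.

(** At a Lebesgue point s, an interval (x, y] around s lies in the ball of radius 2 (y - x) about s,
    where |psi - psi s| has integral at most (e/2) * 2 (y - x). The choice d/4 keeps that radius
    below d. *)
Lemma cumul_der psi : rI psi -> {ae mu, forall s, forall e, 0 < e -> exists2 d, 0 < d &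
  forall x y, s - d < x -> x <= s -> s <= y -> y < s + d ->
    (psi s - e) * (y - x) <= cumul psi y - cumul psi x}.
Proof.
move=> h; have mp := rI_meas h.
have L : {ae mu, forall s, lebesgue_pt psi s}.
  by apply: lebesgue_differentiation; apply: open_integrable_locally => //; exact: openT.
apply: (aeS L) => s ls e e0.
have [d d0 hd] := lebesgue_pt_eint ls mp (divr_gt0 e0 (ltr0Sn _ 1)).
exists (d / 4); first by rewrite divr_gt0.
move=> x y xs1 xs sy ys; have xy : x <= y by lra.
move: (xy); rewrite le_eqVlt => /predU1P[->|xy']; first by rewrite !subrr mulr0.
have [i ->] := cumulB h xy; have [ii ei] := intg_itv xy.
pose f t := (x < t <= y)%R%:R * (psi t - psi s).
have fE t : f t = (x < t <= y)%R%:R * psi t - psi s * (x < t <= y)%R%:R by rewrite /f; ring.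
have rf : rI f by apply: eq_rI (rIB i (rIZ (psi s) ii)) => t; rewrite fE.
have E : intg f = intg (fun t => (x < t <= y)%R%:R * psi t) - psi s * (y - x).
  by rewrite (eq_intg fE) intgB ?intgZ ?ei//; exact: rIZ.
have : `|intg f| <= e * (y - x).
  apply: le_trans (norm_intg rf) _; apply: eint_le_intg; first exact: rI_norm.
  have hh : 0 < 2 * (y - x) <= d by apply/andP; split; lra.
  apply: le_trans (_ : (eint (fun t => (ib s (2 * (y - x)) t * `|psi t - psi s|)%R) <= _)%E); last first.
    by apply: le_trans (hd _ hh) _; rewrite lee_fin; lra.
  apply: le_eint => [t||| t]; first exact: normr_ge0.
  - by apply: measurableT_comp => //; exact: rI_meas rf.
  - apply: measurable_funM; first exact: meas_ib.
    by apply: measurableT_comp => //; exact: measurable_funB.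
  rewrite /f normrM ger0_norm ?ler0n// ler_wpM2r// ibE ler_nat.
  case: (boolP (x < t <= y)) => // /andP[h1 h2]; rewrite (_ : `|s - t| < _ = true)//.
  by apply/ltr_normlP; split; lra.
rewrite E ler_norml => /andP[h1 _]; lra.
Qed.

Lemma null_open (N : set R) d : mu.-negligible N -> 0 < d ->
  exists U, [/\ open U, N `<=` U, rI (\1_U : R -> R) & intg (\1_U) < d].
Proof.
move=> [A [mA A0 NA]] d0.
have fA : (mu A < +oo)%E by rewrite A0 ltry.
have [U [oU AU mUA]] := lebesgue_regularity_outer mA fA d0.
have mU : measurable U by exact: open_measurable.
have Ud : (mu U < d%:E)%E.
  apply: le_lt_trans mUA; rewrite -[in leLHS](setDUK AU) measureU//; last 2 first.
  - exact: measurableD.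
  - by rewrite setDIK.
  by rewrite [X in (X + _ <= _)%E]A0 add0e.
have e1 : eint (\1_U : R -> R) = mu U by rewrite /eint integral_indic// setIT.
have rU : rI (\1_U : R -> R).
  apply: rI_ge0 => [|t|]; [exact: measurable_indic|by rewrite indicE ler0n|].
  by rewrite e1; apply: lt_trans Ud _; rewrite ltry.
exists U; split => //; first exact: subset_trans NA AU.
by have := eint_intg rU; rewrite e1 => E; rewrite E lte_fin in Ud.
Qed.

(** The intervals contain s without starting there, so a differentiability property at the single
    point s suffices and the bounds can still be chained. *)
Definition straddle h (Psi : R -> R) s := forall e, 0 < e -> exists2 d, 0 < d &
  forall x y, s - d < x -> x <= s -> s <= y -> y < s + d ->
    cmod (h y - h x) <= Psi y - Psi x + e * (y - x).

(* Off a null set h grows at most like Psi; an open set of small measure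
   containing that null set contributes little by absolute continuity. *)
Lemma ac_bound h (Psi : R -> R) a b : a <= b -> abs_cont a b h ->
  {homo Psi : x y / x <= y} ->
  {ae mu, forall s, a <= s <= b -> straddle h Psi s} -> cmod (h b - h a) <= Psi b - Psi a.
Proof.
move=> ab ac mono [A0 [mA0 A00 sA0]]; apply/ler_addgt0Pr => e e0.
have e2 : 0 < e / 2 by rewrite divr_gt0.
have [d d0 hd] := ac _ e2.
have [U [oU NU rU iU]] : exists U, [/\ open U, A0 `<=` U, rI (\1_U : R -> R) & intg (\1_U) < d].
  by apply: null_open => //; exists A0; split.
have U0 t : 0 <= \1_U t :> R by rewrite indicE ler0n.
pose e1 := e / (2 * (b - a + 1)).
have ba1 : 0 < b - a + 1 by lra.
have e10 : 0 < e1 by rewrite divr_gt0// mulr_gt0.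
pose G := cumul (\1_U).
(* Invariant of the induction: the intervals [u i, v i] record the steps made inside U. Their total
   length is at most that of the part of U left of x, so absolute continuity controls the last
   sum. *)
pose P x := exists (n : nat) (u v : nat -> R), [/\
  forall i, (i < n)%N -> a <= u i /\ u i <= v i /\ v i <= x,
  forall i, (i.+1 < n)%N -> v i <= u i.+1,
  \sum_(i < n) (v i - u i) <= G x &
  cmod (h x - h a) <= Psi x - Psi a + e1 * (x - a) + \sum_(i < n) cmod (h (v i) - h (u i))].
have Pb : P b.
  apply: (chain_induction ab).
    exists 0%N, (fun=> a), (fun=> a); split => //.
      by rewrite big_ord0; apply: intg_ge0 => t; rewrite mulr_ge0.
    by rewrite big_ord0 !subrr cmod0 mulr0 !addr0.
  move=> s sab; have [Us|nUs] := pselect (U s).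
    have /nbhs_ballP[r /= r0 hr] := open_nbhs_nbhs (conj oU Us).
    exists r => // x y ax xs sy yb xr yr [n [u [v [h1 h2 h3 h4]]]].
    have xy : x <= y by exact: le_trans sy.
    have GG : y - x <= G y - G x.
      have [i ->] := cumulB rU xy; have [ii <-] := intg_itv xy.
      apply: le_intg => // t; case: (boolP (x < t <= y)) => [/andP[t1 t2]|_]; last by rewrite mul0r.
      rewrite mul1r indicE mem_set//; apply: hr; apply/ltr_normlP; split; lra.
    exists n.+1, (fun i => if (i < n)%N then u i else x), (fun i => if (i < n)%N then v i else y); split.
    - move=> i; rewrite ltnS leq_eqVlt => /predU1P[->|il]; first by rewrite ltnn.
      by rewrite il; have [? [? ?]] := h1 i il; do !split => //; exact: le_trans xy.
    - move=> i; rewrite ltnS => il; rewrite il; case: ltnP => il2; first exact: h2.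
      by have [_ []] := h1 i il.
    - rewrite big_ord_recr /= ltnn (eq_bigr (fun i : 'I_n => v i - u i)); last by move=> i _; rewrite ltn_ord.
      lra.
    - rewrite big_ord_recr /= ltnn (eq_bigr (fun i : 'I_n => cmod (h (v i) - h (u i)))); last first.
        by move=> i _; rewrite ltn_ord.
      have := cmod_tri (h x) (h y) (h a); have := mono _ _ xy.
      have : e1 * (x - a) <= e1 * (y - a) by rewrite ler_pM2l//; lra.
      lra.
  have st : straddle h Psi s.
    have : ~ A0 s by move=> /NU.
    by move=> nA; have : ~ ~ (a <= s <= b -> straddle h Psi s); [move=> H; apply: nA; exact: sA0|move=> /contrapT; exact].
  have [r r0 hr] := st _ e10; exists r => // x y ax xs sy yb xr yr [n [u [v [h1 h2 h3 h4]]]].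
  have xy : x <= y by exact: le_trans sy.
  exists n, u, v; split => //.
  - by move=> i /h1 [? [? ?]]; do !split => //; exact: le_trans xy.
  - by apply: le_trans h3 _; exact: cumul_mono.
  - have := cmod_tri (h x) (h y) (h a); have := hr x y xr xs sy yr; lra.
have [n [u [v [h1 h2 h3 h4]]]] := Pb.
have := hd n u v h1 h2 (le_lt_trans (le_trans h3 (cumul_le_intg _ rU U0)) iU).
have : e1 * (b - a) <= e / 2.
  by rewrite /e1 mulrAC ler_pdivrMr ?mulr_gt0//; nra.
lra.
Qed.

(** Serves sums, negation, products and Lipschitz functions alike. *)
Lemma ac_dom h k1 k2 (c : R) a b : abs_cont a b k1 -> abs_cont a b k2 -> 0 <= c ->
  (forall x y, a <= x -> x <= y -> y <= b ->
    cmod (h y - h x) <= c * (cmod (k1 y - k1 x) + cmod (k2 y - k2 x) + (y - x))) ->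
  abs_cont a b h.
Proof.
move=> a1 a2 c0 dom e e0.
have c1 : 0 < 3 * (c + 1) by rewrite mulr_gt0// ltr_wpDl.
have e3 : 0 < e / (3 * (c + 1)) by rewrite divr_gt0.
have [d1 d10 h1] := a1 _ e3; have [d2 d20 h2] := a2 _ e3.
exists (Num.min (e / (3 * (c + 1))) (Num.min d1 d2)); first by rewrite !lt_min e3 d10.
move=> n u v uv vu; rewrite !lt_min => /and3P[l0 l1 l2].
have := h1 n u v uv vu l1; have := h2 n u v uv vu l2 => s2 s1.
apply: (@le_lt_trans _ _ (c * (\sum_(i < n) cmod (k1 (v i) - k1 (u i)) +
   \sum_(i < n) cmod (k2 (v i) - k2 (u i)) + \sum_(i < n) (v i - u i)))).
  rewrite -!big_split /= mulr_sumr; apply: ler_sum => i _; have [? [? ?]] := uv i (ltn_ord i).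
  exact: dom.
have : (c + 1) * (3 * (e / (3 * (c + 1)))) = e by field; rewrite gt_eqF// ltr_wpDl.
have s0 : 0 <= \sum_(i < n) cmod (k1 (v i) - k1 (u i)) by exact: sumr_ge0.
have s0' : 0 <= \sum_(i < n) cmod (k2 (v i) - k2 (u i)) by exact: sumr_ge0.
have s0'' : 0 <= \sum_(i < n) (v i - u i) by rewrite sumr_ge0// => i _; have [_ []] := uv i (ltn_ord i); rewrite subr_ge0.
nra.
Qed.

Lemma ac_refl h a b : abs_cont a b h -> abs_cont (- b) (- a) (fun x => h (- x)).
Proof.
move=> ac e e0; have [d d0 hd] := ac e e0; exists d => // n u v uv vu ls.
have lt i : (i < n)%N -> (n - i.+1 < n)%N by move=> h1; rewrite ltn_subrL (leq_ltn_trans _ h1).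
have := hd n (fun i => - v (n - i.+1)%N) (fun i => - u (n - i.+1)%N).
have rv (F : nat -> R) : \sum_(i < n) F (n - i.+1)%N = \sum_(i < n) F i.
  by rewrite [RHS](reindex_inj rev_ord_inj).
rewrite (rv (fun i => - u i - - v i)) (rv (fun i => cmod (h (- u i) - h (- v i)))).
rewrite (eq_bigr (fun i : 'I_n => v i - u i)); last by move=> i _; rewrite opprK addrC.
have -> : \sum_(i < n) cmod (h (- v i) - h (- u i)) = \sum_(i < n) cmod (h (- u i) - h (- v i)).
  by apply: eq_bigr => i _; exact: cmodC.
apply => // i il.
  by have [? [? ?]] := uv _ (lt i il); do !split; lra.
rewrite lerN2; have := vu (n - i.+2)%N; rewrite -subSn// subSS; apply.
by rewrite ltn_subrL (leq_ltn_trans _ il).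
Qed.

End absolute_continuity.

(** * Calculus for derivatives and absolutely continuous functions *)

Section real_derivatives.
Variable R : realType.
Implicit Types (f g h : R -> R[i]) (a b x : R).

Lemma rder_cont f x D : rder f x D -> forall e : R, 0 < e -> exists2 d : R, 0 < d &
  forall h : R, `|h| < d -> cmod (f (x + h) - f x) < e.
Proof.
move=> hf e e0; have [d d0 hd] := hf 1 ltr01; have c1 : 0 < cmod D + 1 by rewrite ltr_wpDl ?cmod_ge0.
exists (Num.min d (e / (cmod D + 1))); first by rewrite lt_min d0 divr_gt0.
move=> h; rewrite lt_min ltr_pdivlMr// => /andP[/hd h1 h2].
rewrite (_ : f (x + h) - f x = (f (x + h) - f x - D * h%:C) + D * h%:C); last by rewrite subrK.
apply: le_lt_trans (cmodD _ _) _; rewrite cmodM cmod_real; lra.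
Qed.

Lemma rderM f g x D E : rder f x D -> rder g x E -> rder (fun t => f t * g t) x (D * g x + f x * E).
Proof.
move=> hf hg e e0; pose k := cmod (g x) + 1 + cmod (f x) + cmod D.
have [f0 g0 D0] : [/\ 0 <= cmod (f x), 0 <= cmod (g x) & 0 <= cmod D] by split.
have k0 : 0 < k by rewrite /k; lra.
have e1 : 0 < e / k by rewrite divr_gt0.
have [d1 d10 h1] := hf _ e1; have [d2 d20 h2] := hg _ e1.
have m0 : 0 < Num.min 1 (e / k) by rewrite lt_min ltr01.
have [d3 d30 h3] := rder_cont hg m0.
exists (Num.min d1 (Num.min d2 d3)); first by rewrite !lt_min d10 d20.
move=> h; rewrite !lt_min => /and3P[/h1{}h1 /h2{}h2 /h3]; rewrite lt_min => /andP[h5 h4].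
rewrite (_ : _ - _ - _ = (f (x + h) - f x - D * h%:C) * g (x + h) + f x * (g (x + h) - g x - E * h%:C)
  + D * h%:C * (g (x + h) - g x)); last by ring.
have gx : cmod (g (x + h)) <= cmod (g x) + 1.
  by have := cmodB_ge (g (x + h)) (g x); lra.
apply: le_trans (cmodD _ _) _; apply: le_trans (lerD (cmodD _ _) (lexx _)) _; rewrite !cmodM cmod_real.
have ek : e / k * k = e by rewrite divfK// gt_eqF.
set u := cmod _ in h1; set v := cmod _ in h2; set w := cmod _ in h4.
have t1 : u * cmod (g (x + h)) <= e / k * `|h| * (cmod (g x) + 1) by apply: ler_pM => //; exact: cmod_ge0.
have t2 : cmod (f x) * v <= cmod (f x) * (e / k * `|h|) by apply: ler_wpM2l.
have t3 : cmod D * `|h| * w <= cmod D * `|h| * (e / k) by apply: ler_wpM2l; [apply: mulr_ge0|exact: ltW].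
apply: le_trans (lerD (lerD t1 t2) t3) _.
move: ek; set r := e / k => <-; rewrite /k; lra.
Qed.

Lemma rder_cder (u : R -> R) x : derivable u x 1 -> rder (fun t => (u t)%:C) x (derive1 u x)%:C.
Proof.
move=> du e e0; have := du; rewrite /derivable => /cvg_ex[l].
have -> : derive1 u x = 'D_1 u x by rewrite derive1E.
rewrite /derive => hl; rewrite (cvg_lim _ hl)//.
move/cvgrPdist_le : hl => /(_ e e0) [d d0 hd]; exists d => // h hh.
rewrite -CB -CM -CB cmod_real.
have [->|h0] := eqVneq h 0; first by rewrite addr0 subrr mulr0 subrr normr0 mulr0.
have := hd h; rewrite /ball_ /= sub0r normrN => /(_ hh h0) H.
have hn : 0 < `|h| by rewrite normr_gt0.
rewrite -ler_pdivrMr// -normfV -normrM -normrN; apply: le_trans H.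
apply: eq_ler; congr `|_|.
rewrite /GRing.scale /= mulr1 (addrC h x); by field.
Qed.

Lemma rder_ReIm f x (D E : R) : rder (fun t => (Re (f t))%:C) x D%:C -> rder (fun t => (Im (f t))%:C) x E%:C ->
  rder f x (D +i* E).
Proof.
move=> h1 h2; have := rderD h1 (rderZ (0 +i* 1) h2).
rewrite (_ : (fun t => _) = f); last first.
  by apply/funext => t; cx_ring.
by rewrite (_ : _ + _ = D +i* E)//; cx_ring.
Qed.

Lemma cderivable_rder f x : cderivable f x -> rder f x (cderive f x).
Proof. by move=> [h1 h2]; exact: (rder_ReIm (rder_cder h1) (rder_cder h2)). Qed.

Lemma rder_derive1 (u : R -> R) x (D : R) : is_derive x (1 : R) u D -> rder (fun t => (u t)%:C) x D%:C.
Proof. by move=> [d <-]; rewrite -derive1E; exact: rder_cder. Qed.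

Lemma rder_refl f x D : rder f (- x) D -> rder (fun t => f (- t)) x (- D).
Proof.
move=> hf e e0; have [d d0 hd] := hf e e0; exists d => // h hh.
have := hd (- h); rewrite normrN => /(_ hh); rewrite opprD mulNr CN mulrN//.
Qed.

Lemma rder_conj f x D : rder f x D -> rder (fun t => conjc (f t)) x (conjc D).
Proof.
move=> hf e e0; have [d d0 hd] := hf e e0; exists d => // h /hd; rewrite -cmod_conj !conjcB conjcM.
by rewrite (_ : conjc h%:C = h%:C)//; apply: cx_ext; rewrite !ReImE ?oppr0.
Qed.

Lemma ac_cst (c : R[i]) a b : abs_cont a b (fun=> c).
Proof.
move=> e e0; exists 1 => // n u v _ _ _; rewrite big1// => i _; by rewrite subrr cmod0.
Qed.

Lemma ac_lip f (L : R) a b : 0 <= L -> (forall x y, a <= x -> x <= y -> y <= b -> cmod (f y - f x) <= L * (y - x)) ->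
  abs_cont a b f.
Proof.
move=> L0 h; apply: (ac_dom (ac_cst 0 a b) (ac_cst 0 a b) L0) => x y ax xy yb.
by rewrite !subrr !cmod0 !add0r; exact: h.
Qed.

Lemma acD f g a b : abs_cont a b f -> abs_cont a b g ->
  abs_cont a b (fun x => f x + g x).
Proof.
move=> hf hg; apply: (ac_dom hf hg ler01) => x y ax xy yb; rewrite mul1r opprD addrACA.
by apply: le_trans (cmodD _ _) _; rewrite lerDl subr_ge0.
Qed.

Lemma acN f a b : abs_cont a b f -> abs_cont a b (fun x => - f x).
Proof.
move=> hf; apply: (ac_dom hf hf ler01) => x y ax xy yb; rewrite mul1r -opprD cmodN -addrA lerDl.
by rewrite addr_ge0 ?subr_ge0.
Qed.

Lemma acB f g a b : abs_cont a b f -> abs_cont a b g ->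
  abs_cont a b (fun x => f x - g x).
Proof. by move=> hf hg; apply: acD => //; exact: acN. Qed.

Lemma ccont_max f a b : a <= b -> ccont f -> exists2 c, a <= c <= b &
  forall x, a <= x <= b -> cmod (f x) <= cmod (f c).
Proof.
move=> ab cf; have cc : continuous (fun x => cmod (f x) : R^o).
  move=> x; apply/cvgrPdist_lt => e e0; have [d d0 hd] := cf x e e0.
  near=> y; apply: le_lt_trans (cmod_dist _ _) _; rewrite cmodC; apply: hd.
  by near: y; apply/nbhs_ballP; exists d => //= y; rewrite /ball /= distrC.
have [c] := EVT_max ab (continuous_subspaceT cc); rewrite in_itv /= => cab h; exists c => // x xab.
Unshelve. all: by end_near. Qed.

Lemma acM f g a b : a <= b -> ccont f -> ccont g -> abs_cont a b f ->
  abs_cont a b g -> abs_cont a b (fun x => f x * g x).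
Proof.
move=> ab cf cg hf hg; have [c1 _ m1] := ccont_max ab cf; have [c2 _ m2] := ccont_max ab cg.
have [p1 p2] : 0 <= cmod (f c1) /\ 0 <= cmod (g c2) by split.
apply: (ac_dom hf hg (addr_ge0 p1 p2)) => x y ax xy yb.
rewrite (_ : _ - _ = (f y - f x) * g y + f x * (g y - g x)); last by ring.
have yab : a <= y <= b by rewrite (le_trans ax). have xab : a <= x <= b by rewrite ax (le_trans xy).
apply: le_trans (cmodD _ _) _; rewrite !cmodM.
have [d1 d2] : 0 <= cmod (f y - f x) /\ 0 <= cmod (g y - g x) by split.
have := m1 x xab; have := m2 y yab; have : 0 <= y - x by rewrite subr_ge0.
nra.
Qed.

Lemma ac_ccont f : (forall a b, abs_cont a b f) -> ccont f.
Proof.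
move=> ac x e e0; have [d d0 hd] := ac (x - 1) (x + 1) e e0.
exists (Num.min 1 d); first by rewrite lt_min ltr01.
move=> y; rewrite lt_min => /andP[y1 yd].
have := hd 1%N (fun=> Num.min x y) (fun=> Num.max x y).
rewrite !big_ord1; have [xy|yx] := leP x y.
  rewrite ger0_norm ?subr_ge0// in y1 yd; apply => //; move=> i _; do !split; lra.
rewrite ltr0_norm ?subr_lt0// in y1 yd; rewrite cmodC; apply => //; last lra.
by move=> i _; do !split; lra.
Qed.

Lemma rder_straddle h s (D : R[i]) (Psi : R -> R) (p : R) : rder h s D -> cmod D <= p ->
  (forall e, 0 < e -> exists2 d, 0 < d & forall x y, s - d < x -> x <= s -> s <= y -> y < s + d ->
    (p - e) * (y - x) <= Psi y - Psi x) -> straddle h Psi s.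
Proof.
move=> hd Dp hp e e0; have e2 : 0 < e / 2 by rewrite divr_gt0.
have [d1 d10 h1] := hd _ e2; have [d2 d20 h2] := hp _ e2.
exists (Num.min d1 d2); first by rewrite lt_min d10.
have inc (t : R) : `|t| < d1 -> cmod (h (s + t) - h s) <= (p + e / 2) * `|t|.
  move=> /h1 H; have := cmodB_ge (h (s + t) - h s) (D * t%:C); rewrite cmodM cmod_real.
  have : cmod D * `|t| <= p * `|t| by rewrite ler_wpM2r.
  lra.
move=> x y x1 xs sy y1.
have [m1 m2] : Num.min d1 d2 <= d1 /\ Num.min d1 d2 <= d2 by rewrite !ge_min !lexx orbT.
have [xd1 xd2] : s - d1 < x /\ s - d2 < x by split; lra.
have [yd1 yd2] : y < s + d1 /\ y < s + d2 by split; lra.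
have := h2 x y xd2 xs sy yd2.
have := inc (x - s); rewrite subrKC cmodC ler0_norm ?subr_le0// => /(_ _) i1.
have := inc (y - s); rewrite subrKC ger0_norm ?subr_ge0// => /(_ _) i2.
have {}i1 := i1 ltac:(lra); have {}i2 := i2 ltac:(lra).
have := cmod_tri (h s) (h y) (h x); lra.
Qed.

(** [ac_bound] with the primitive of psi, for which [cumul_der] supplies the straddling lower bound
    at almost every point. *)
Lemma acb h psi a b : a <= b -> abs_cont a b h -> rI psi -> (forall t, 0 <= psi t) ->
  {ae mu, forall s, a <= s <= b -> exists2 D, rder h s D & cmod D <= psi s} ->
  cmod (h b - h a) <= cumul psi b - cumul psi a.
Proof.
move=> ab ac ip p0 hD; apply: ac_bound => //; first by move=> x y; exact: cumul_mono.
apply: (aeS (aeI hD (cumul_der ip))) => s [h1 h2] /h1 [D rD Dp].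
exact: rder_straddle rD Dp h2.
Qed.

End real_derivatives.

(** * Variation of constants for the Schrodinger equation *)

Section schrodinger.
Variable R : realType.
Implicit Types (f g h : R -> R[i]) (a b x y r : R) (q : R -> R).

(** [cs r] and [sn r] solve -y'' = r^2 y with data (1, 0) and (0, 1) at x = 0. The division by r
    gives |sn r x| <= x for x >= 0, uniformly as r -> 0. *)
Definition cs r x : R := cos (r * x).
Definition sn r x : R := sin (r * x) / r.

Lemma norm_cs r x : `|cs r x| <= 1. Proof. exact: cos_max. Qed.

Lemma norm_sn r x : `|sn r x| <= `|r|^-1.
Proof. by rewrite normrM normfV ler_piMl ?invr_ge0//; exact: sin_max. Qed.

Lemma rder_cs r x : r != 0 -> rder (fun t => (cs r t)%:C) x (- r ^+ 2 * sn r x)%:C.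
Proof.
move=> r0; apply: rder_derive1; rewrite /cs /sn (_ : - r ^+ 2 * _ = - sin (r * x) * r); last by field.
have d : is_derive x (1 : R) (fun y : R => r * y : R) r.
  by apply: is_derive_eq; rewrite /GRing.scale /= mulr1.
exact: (is_derive1_comp (is_derive_cos (r * x)) d).
Qed.

Lemma rder_sn r x : r != 0 -> rder (fun t => (sn r t)%:C) x (cs r x)%:C.
Proof.
move=> r0; have d : is_derive x (1 : R) (fun y : R => r * y : R) r.
  by apply: is_derive_eq; rewrite /GRing.scale /= mulr1.
have := rderZ r^-1%:C (rder_derive1 (is_derive1_comp (is_derive_sin (r * x)) d)).
rewrite -CM (_ : r^-1 * (cos (r * x) * r) = cs r x); last by rewrite /cs; field.
by rewrite (_ : (fun t => _) = (fun t => (sn r t)%:C))//; apply/funext => t; rewrite -CM mulrC.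
Qed.

Lemma sn_le r x : r != 0 -> 0 <= x -> `|sn r x| <= x.
Proof.
move=> r0 x0; have := @mean_value_ineq R (fun t => (sn r t)%:C) (fun t => (cs r t)%:C) 0 x 1 x0.
rewrite -CB cmod_real /sn mulr0 sin0 mul0r !subr0 mul1r; apply => t _; first exact: rder_sn.
by rewrite cmod_real norm_cs.
Qed.

Lemma csn_sqr r x : r != 0 -> cs r x ^+ 2 + r ^+ 2 * sn r x ^+ 2 = 1.
Proof. by move=> r0; rewrite -(cos2Dsin2 (r * x)) /cs /sn; field. Qed.

Definition sol q r f (f' : R -> R[i]) := [/\ forall x, rder f x (f' x),
  forall a b, abs_cont a b f' &
  {ae mu, forall x, rder f' x ((q x)%:C * f x - (r ^+ 2)%:C * f x)}].

Lemma solB q r f f' g g' : sol q r f f' -> sol q r g g' ->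
  sol q r (fun x => f x - g x) (fun x => f' x - g' x).
Proof.
have E (h k : R -> R[i]) : (fun x => h x - k x) = (fun x => h x + (- 1) * k x).
  by apply/funext => x; rewrite mulN1r.
move=> [f1 f2 f3] [g1 g2 g3]; split.
- by move=> x; have := rderD (f1 x) (rderZ (- 1) (g1 x)); rewrite mulN1r -E.
- by move=> a b; exact: acB.
- apply: (aeS (aeI f3 g3)) => x [h1 h2]; rewrite E.
  rewrite [X in rder _ x X](_ : _ = ((q x)%:C * f x - (r ^+ 2)%:C * f x) +
    (- 1) * ((q x)%:C * g x - (r ^+ 2)%:C * g x)); last by ring.
  exact: rderD h1 (rderZ (- 1) h2).
Qed.

Lemma sol_conj q r f f' : sol q r f f' -> sol q r (fun x => conjc (f x)) (fun x => conjc (f' x)).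
Proof.
move=> [f1 f2 f3]; split.
- by move=> x; exact: rder_conj.
- move=> a b; apply: (ac_dom (f2 a b) (f2 a b) ler01) => x y ax xy yb.
  by rewrite -conjcB cmod_conj mul1r -addrA lerDl addr_ge0 ?subr_ge0 ?cmod_ge0.
- apply: (aeS f3) => x /rder_conj; rewrite conjcB !conjcM.
  by rewrite !(_ : forall s : R, conjc s%:C = s%:C)// => s; apply: cx_ext; rewrite !ReImE ?oppr0.
Qed.

Lemma sol_ccont q r f f' : sol q r f f' -> ccont f /\ ccont f'.
Proof. by move=> [f1 f2 _]; split; [exact: rder_ccont f1|exact: ac_ccont]. Qed.


Lemma ac_rder f f' a b : a <= b -> (forall x, rder f x (f' x)) -> ccont f' -> abs_cont a b f.
Proof.
move=> ab hf cf; have [c _ hc] := ccont_max ab cf.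
apply: (ac_lip (L := cmod (f' c))); first exact: cmod_ge0.
move=> x y ax xy yb; apply: (mean_value_ineq (D := f')) => // t /andP[t1 t2]; apply: hc.
by rewrite (le_trans ax)// (le_trans t2).
Qed.

Lemma sol_ac q r f f' a b : a <= b -> sol q r f f' -> abs_cont a b f.
Proof. by move=> ab s; have [_ cf] := sol_ccont s; case: s => f1 _ _; exact: ac_rder cf. Qed.

Lemma ac_csn r a b : r != 0 -> a <= b -> abs_cont a b (fun t => (cs r t)%:C) /\
  abs_cont a b (fun t => (sn r t)%:C) .
Proof.
move=> r0 ab; have cC := rder_ccont (fun x => rder_cs x r0); have sC := rder_ccont (fun x => rder_sn x r0).
split; last exact: (ac_rder ab (fun x => rder_sn x r0)).
apply: (ac_rder ab (fun x => rder_cs x r0)); apply: (rder_ccont (D := fun x => ((- r ^+ 2)%:C * (cs r x)%:C))).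
move=> x; have := rderZ (- r ^+ 2)%:C (rder_sn x r0).
by rewrite (_ : (fun t => _) = (fun t => (- r ^+ 2 * sn r t)%:C))//; apply/funext => t; rewrite -CM.
Qed.

(** Variation of constants: f = nn cs + dd sn and f' = nn cs' + dd sn' ([nd_f], [nd_f']). Both
    coefficients are constant when q = 0, and they stay meaningful as r -> 0, with limits f - x f'
    and f'. *)
Definition nn r f f' x : R[i] := f x * (cs r x)%:C - f' x * (sn r x)%:C.
Definition dd r f f' x : R[i] := f' x * (cs r x)%:C + (r ^+ 2)%:C * (sn r x)%:C * f x.

Lemma csn_sqrC r x : r != 0 -> (cs r x)%:C ^+ 2 + (r ^+ 2)%:C * (sn r x)%:C ^+ 2 = 1 :> R[i].
Proof. by move=> r0; rewrite !expr2 -!CM -CD -!expr2 csn_sqr. Qed.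

Lemma nd_f r f f' x : r != 0 -> f x = nn r f f' x * (cs r x)%:C + dd r f f' x * (sn r x)%:C.
Proof. by move=> r0; rewrite -[LHS]mulr1 -(csn_sqrC x r0) /nn /dd; ring. Qed.
Lemma nd_f' r f f' x : r != 0 -> f' x = dd r f f' x * (cs r x)%:C - (r ^+ 2)%:C * (sn r x)%:C * nn r f f' x.
Proof. by move=> r0; rewrite -[LHS]mulr1 -(csn_sqrC x r0) /nn /dd; ring. Qed.

Lemma nn0 r f f' : nn r f f' 0 = f 0.
Proof. by rewrite /nn /cs /sn mulr0 cos0 sin0 mul0r mulr0 subr0 mulr1. Qed.
Lemma dd0 r f f' : dd r f f' 0 = f' 0.
Proof. by rewrite /dd /cs /sn mulr0 cos0 sin0 mul0r mulr0 mul0r addr0 mulr1. Qed.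

Section integrable_potential.
Variable q : R -> R.
Hypotheses (rq0 : rI (fun x => `|q x|)) (rq1 : rI (fun x => `|x| * `|q x|)).
Let P0 := cumul (fun x => `|q x|).
Let P1 := cumul (fun x => `|x| * `|q x|).

Lemma cumulZ psi (c : R) x : rI psi -> cumul (fun t => c * psi t) x = c * cumul psi x.
Proof.
by move=> h; rewrite /cumul -intgZ; [apply: eq_intg => t; rewrite mulrCA|exact: rI_cut].
Qed.

Lemma P0_mono a b : a <= b -> P0 a <= P0 b. Proof. by move=> ab; apply: cumul_mono. Qed.
Lemma P1_mono a b : a <= b -> P1 a <= P1 b.
Proof. by move=> ab; apply: cumul_mono => // t; rewrite mulr_ge0. Qed.

Lemma P01 x b : 0 <= x -> x <= b -> x * (P0 b - P0 x) <= P1 b - P1 x.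
Proof.
move=> x0 xb; rewrite mulrBr -!cumulZ//; apply: cumulB_le => //; first exact: rIZ.
by move=> t /andP[xt _]; rewrite ler_wpM2r// (le_trans (ltW xt))// ler_norm.
Qed.

Section one_solution.
Variables (r : R) (f f' : R -> R[i]).
Hypotheses (r0 : r != 0) (hs : sol q r f f').
Let N := nn r f f'.
Let D := dd r f f'.

(** nn' = - q f sn and dd' = q f cs; the bounds |sn r s| <= s and |cs r s| <= 1 produce the weights
    |s| |q s| and |q s|, uniformly in r. *)
Lemma nd_bound a b M : 0 <= a -> a <= b -> (forall x, a <= x <= b -> cmod (f x) <= M) ->
  cmod (N b - N a) <= M * (P1 b - P1 a) /\ cmod (D b - D a) <= M * (P0 b - P0 a).
Proof.
move=> a0 ab hM; have M0 : 0 <= M by apply: le_trans (hM a _); rewrite ?cmod_ge0 ?lexx.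
have [c1 c2] := sol_ccont hs; have ac1 := sol_ac ab hs; have [f1 ac2 f3] := hs.
have [ac3 ac4] := ac_csn r0 ab.
have [c3 c4] := (rder_ccont (fun x => rder_cs x r0), rder_ccont (fun x => rder_sn x r0)).
split; rewrite mulrBr -!cumulZ//; apply: acb => //.
- by apply: acB; apply: acM.
- exact: rIZ.
- by move=> t; rewrite !mulr_ge0.
- apply: (aeS f3) => s h sab; have s0 : 0 <= s by case/andP: sab => /(le_trans a0).
  exists (- (q s)%:C * f s * (sn r s)%:C).
    have := rderD (rderM (f1 s) (rder_cs s r0)) (rderZ (- 1) (rderM h (rder_sn s r0))).
    rewrite (_ : (fun t => _) = N); last by apply/funext => t; rewrite mulN1r.
    by rewrite (_ : _ + _ = - (q s)%:C * f s * (sn r s)%:C)//; rewrite !CM !CN; ring.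
  rewrite !cmodM cmodN !cmod_real (ger0_norm s0).
  rewrite (_ : _ * _ * _ = cmod (f s) * (`|sn r s| * `|q s|)); last by ring.
  by apply: ler_pM; rewrite ?mulr_ge0 ?cmod_ge0 ?hM// ler_wpM2r// sn_le.
- apply: acD; first by apply: acM.
  apply: acM => //; first exact: (rder_ccont (fun x => rderZ (r ^+ 2)%:C (rder_sn x r0))).
  have := ac_dom ac4 ac4 (sqr_ge0 r); apply => x y ax xy yb.
  rewrite -mulrBr cmodM cmod_real ger0_norm ?sqr_ge0// ler_wpM2l ?sqr_ge0// -addrA lerDl.
  by rewrite addr_ge0 ?subr_ge0// cmod_ge0.
- exact: rIZ.
- by move=> t; rewrite mulr_ge0.
- apply: (aeS f3) => s h sab; exists ((q s)%:C * f s * (cs r s)%:C).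
    have := rderD (rderM h (rder_cs s r0)) (rderM (rderZ (r ^+ 2)%:C (rder_sn s r0)) (f1 s)).
    rewrite [X in rder _ s X](_ : _ = (q s)%:C * f s * (cs r s)%:C)//.
    by rewrite (CM (- r ^+ 2)) CN; ring.
  rewrite !cmodM !cmod_real -mulrA mulrCA; apply: ler_pM => //; rewrite ?cmod_ge0 ?mulr_ge0//.
    exact: hM.
  by rewrite ler_piMr//; exact: norm_cs.
Qed.

Lemma nd_bound2 a b p x M : 0 <= a -> a <= p <= b -> a <= x <= b ->
  (forall x, a <= x <= b -> cmod (f x) <= M) ->
  cmod (N x - N p) <= M * `|P1 p - P1 x| /\ cmod (D x - D p) <= M * `|P0 p - P0 x|.
Proof.
move=> a0 /andP[ap pb] /andP[ax xb] hM; have [px|xp] := leP p x.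
  have -> : `|P1 p - P1 x| = P1 x - P1 p by rewrite distrC ger0_norm// subr_ge0 P1_mono.
  have -> : `|P0 p - P0 x| = P0 x - P0 p by rewrite distrC ger0_norm// subr_ge0 P0_mono.
  apply: nd_bound => //; first exact: le_trans ap.
  by move=> y /andP[py yx]; apply: hM; rewrite (le_trans ap)// (le_trans yx).
have -> : `|P1 p - P1 x| = P1 p - P1 x by rewrite ger0_norm// subr_ge0 P1_mono// ltW.
have -> : `|P0 p - P0 x| = P0 p - P0 x by rewrite ger0_norm// subr_ge0 P0_mono// ltW.
rewrite cmodC (cmodC (D x)).
apply: nd_bound (ltW xp) _ => //; first exact: le_trans ax.
by move=> y /andP[xy yp]; apply: hM; rewrite (le_trans ax)// (le_trans yp).
Qed.

(** At a maximum point c of |f|, the deviation from the free solution with the coefficients at p is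
    at most |f c| / 4 and is absorbed. *)
Lemma piece a b p B : 0 <= a -> a <= p <= b ->
  (forall x, a <= x <= b -> cmod (N p * (cs r x)%:C + D p * (sn r x)%:C) <= B) ->
  (forall x, a <= x <= b -> `|P1 p - P1 x| + `|sn r x| * `|P0 p - P0 x| <= 4^-1) ->
  forall x, a <= x <= b -> cmod (f x) <= 2 * B.
Proof.
move=> a0 pab hB hP; have ab : a <= b by case/andP: pab => /le_trans; apply.
have [cf _] := sol_ccont hs; have [c cab hc] := ccont_max ab cf.
have [n1 d1] := nd_bound2 a0 pab cab hc.
have := hB c cab; have := hP c cab => p4 B4.
have B0 := le_trans (cmod_ge0 _) B4; have M0 := cmod_ge0 (f c).
have : cmod (f c) <= B + (cmod (N c - N p) + `|sn r c| * cmod (D c - D p)).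
  rewrite [f c](nd_f f f' c r0) -/(N c) -/(D c).
  rewrite (_ : N c * _ + D c * _ = (N p * (cs r c)%:C + D p * (sn r c)%:C) +
    ((N c - N p) * (cs r c)%:C + (sn r c)%:C * (D c - D p))); last by ring.
  apply: le_trans (cmodD _ _) _; apply: lerD => //; apply: le_trans (cmodD _ _) _.
  rewrite !cmodM !cmod_real lerD2r ler_piMr//; exact: norm_cs.
have : `|sn r c| * cmod (D c - D p) <= `|sn r c| * (cmod (f c) * `|P0 p - P0 c|) by apply: ler_wpM2l.
move=> h1 h2 x xab; apply: le_trans (hc x xab) _; nra.
Qed.

End one_solution.
End integrable_potential.
End schrodinger.

(** * Estimates for Jost solutions, uniform in the energy *)

Section jost.
Variable R : realType.
Implicit Types (f g h : R -> R[i]) (a b x y r s : R).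

Definition at_inf (N : R -> R[i]) (l : R[i]) := forall e, 0 < e -> exists X, forall x, X <= x -> cmod (N x - l) <= e.

(** Since exp (irx) = cs + ir sn, the normalisation at +oo says that the coefficients tend to 1 and
    ir. *)
Definition jost_sol q r f f' := [/\ sol q r f f', at_inf (nn r f f') 1 & at_inf (dd r f f') (0 +i* r)].

Lemma nnN r f f' x : nn (- r) f f' x = nn r f f' x.
Proof. by rewrite /nn /cs /sn !mulNr cosN sinN invrN mulrNN. Qed.
Lemma ddN r f f' x : dd (- r) f f' x = dd r f f' x.
Proof. by rewrite /dd /cs /sn !mulNr cosN sinN invrN mulrNN sqrrN. Qed.
Lemma solN q r f f' : sol q (- r) f f' -> sol q r f f'.
Proof. by rewrite /sol sqrrN. Qed.

Lemma wron_nd r f f' g g' x : r != 0 ->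
  f x * g' x - f' x * g x = nn r f f' x * dd r g g' x - dd r f f' x * nn r g g' x.
Proof.
move=> r0; rewrite (nd_f f f' x r0) (nd_f' f f' x r0) (nd_f g g' x r0) (nd_f' g g' x r0).
rewrite -[RHS]mulr1 -(csn_sqrC x r0); ring.
Qed.

(** The derivative of the Wronskian is (r^2 - s^2) f g. *)
Lemma wron q r s f f' g g' a b S : a <= b -> sol q r f f' -> sol q s g g' ->
  (forall x, a <= x <= b -> cmod (f x) <= S) -> (forall x, a <= x <= b -> cmod (g x) <= S) ->
  cmod ((f b * g' b - f' b * g b) - (f a * g' a - f' a * g a)) <= `|r ^+ 2 - s ^+ 2| * S ^+ 2 * (b - a).
Proof.
move=> ab hf hg Sf Sg; have [cf cf'] := sol_ccont hf; have [cg cg'] := sol_ccont hg.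
have [af ag] := (sol_ac ab hf, sol_ac ab hg); have [f1 af' f3] := hf; have [g1 ag' g3] := hg.
set K := _ * S ^+ 2; have K0 : 0 <= K by rewrite mulr_ge0 ?sqr_ge0.
rewrite mulrBr; apply: (@ac_bound _ (fun x => f x * g' x - f' x * g x) (fun x => K * x)) => //.
- by apply: acB; apply: acM.
- by move=> x y; exact: ler_wpM2l.
apply: (aeS (aeI f3 g3)) => x [h1 h2] xab.
have h := rderD (rderM (f1 x) h2) (rderZ (- 1) (rderM h1 (g1 x))).
rewrite (_ : (fun t => _) = (fun t => f t * g' t - f' t * g t)) in h; last first.
  by apply/funext => t; rewrite mulN1r.
apply: (rder_straddle (p := K) h) => [|e e0]; last first.
  by exists 1 => // u v _ us sv _; rewrite -mulrBr ler_wpM2r ?subr_ge0 ?(le_trans us)// gerBl ltW.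
rewrite [X in cmod X](_ : _ = (r ^+ 2 - s ^+ 2)%:C * (f x * g x)); last by rewrite CB; ring.
rewrite !cmodM cmod_real /K ler_wpM2l// expr2; apply: ler_pM => //; [exact: Sf|exact: Sg].
Qed.

Section potential.
Variable q : R -> R.
Hypotheses (rq0 : rI (fun x => `|q x|)) (rq1 : rI (fun x => `|x| * `|q x|)).
Let P0 := cumul (fun x => `|q x|).
Let P1 := cumul (fun x => `|x| * `|q x|).
Let T0 := intg (fun x => `|q x|).
Let T1 := intg (fun x => `|x| * `|q x|).

Lemma P0T x : P0 x <= T0. Proof. exact: cumul_le_intg. Qed.
Lemma P1T x : P1 x <= T1. Proof. by apply: cumul_le_intg => // t; rewrite mulr_ge0. Qed.

Lemma at_inf_le N l A B : at_inf N l -> (exists X, forall b, X <= b -> cmod (A - N b) <= B) -> cmod (A - l) <= B.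
Proof.
move=> hN [X hX]; apply/ler_addgt0Pr => e e0; have [Y hY] := hN e e0.
pose b := Num.max X Y; have [bX bY] : X <= b /\ Y <= b by rewrite !le_max !lexx orbT.
have := cmod_tri (N b) A l; have := hX b bX; have := hY b bY; lra.
Qed.

Lemma T01 x : 0 <= x -> x * (T0 - P0 x) <= T1 - P1 x.
Proof.
move=> x0; apply/ler_addgt0Pr => e e0; have x1 : 0 < x + 1 by lra.
have [b b1 hb] := cumul_lim rq0 (fun t => normr_ge0 _) (divr_gt0 e0 x1).
pose c := Num.max x b; have [xc bc] : x <= c /\ b <= c by rewrite !le_max !lexx orbT.
have := P01 rq0 rq1 x0 xc; have := P0_mono rq0 bc; have := P1T c; rewrite -/P0 -/P1 => h1 h2 h3.
move: hb; rewrite -/T0 -/(P0 b) ler_pdivlMr// => hb; have := P0T b; nra.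
Qed.

Section tail.
Variables (X0 : R).
Hypotheses (X00 : 0 <= X0) (hX0 : 2 * (T1 - P1 X0) <= 4^-1).

Lemma tail_piece r b x : r != 0 -> X0 <= x <= b -> `|P1 b - P1 x| + `|sn r x| * `|P0 b - P0 x| <= 4^-1.
Proof.
move=> r0 /andP[Xx xb]; have x0 := le_trans X00 Xx.
have := P1_mono rq1 xb; have := P0_mono rq0 xb; have := P1_mono rq1 Xx; rewrite -/P0 -/P1 => h1 h2 h3.
have -> : `|P1 b - P1 x| = P1 b - P1 x by rewrite ger0_norm// subr_ge0.
have -> : `|P0 b - P0 x| = P0 b - P0 x by rewrite ger0_norm// subr_ge0.
have := P01 rq0 rq1 x0 xb; rewrite -/P0 -/P1 => h4.
have : `|sn r x| * (P0 b - P0 x) <= x * (P0 b - P0 x) by rewrite ler_wpM2r ?subr_ge0// sn_le.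
have := P1T b; have := hX0; lra.
Qed.

(** Beyond X0 the moment of q is so small that [piece] applies up to any b; its base point b is sent
    to infinity, where the coefficients are known. *)
Lemma tail r f f' ni di : r != 0 -> sol q r f f' -> at_inf (nn r f f') ni -> at_inf (dd r f f') di ->
  forall x, X0 <= x -> [/\ cmod (f x) <= 2 * (cmod ni + cmod di / `|r|),
    cmod (nn r f f' x - ni) <= 2 * (cmod ni + cmod di / `|r|) * (T1 - P1 x) &
    cmod (dd r f f' x - di) <= 2 * (cmod ni + cmod di / `|r|) * (T0 - P0 x)].
Proof.
move=> r0 hs hn hd; set F := 2 * _.
have r1 : 0 < `|r|^-1 by rewrite invr_gt0 normr_gt0.
have hf x : X0 <= x -> cmod (f x) <= F.
  move=> Xx; apply/ler_addgt0Pr => e e0; pose e1 := e / (2 * (1 + `|r|^-1)).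
  have e10 : 0 < e1 by rewrite divr_gt0// mulr_gt0// addr_gt0.
  have ee : e1 * (2 * (1 + `|r|^-1)) = e by rewrite divfK// mulf_neq0// gt_eqF// addr_gt0.
  have [Y1 h1] := hn _ e10; have [Y2 h2] := hd _ e10.
  pose b := Num.max x (Num.max Y1 Y2).
  have [xb Y1b Y2b] : [/\ x <= b, Y1 <= b & Y2 <= b] by rewrite !le_max !lexx !orbT.
  have Xb : X0 <= b <= b by rewrite lexx (le_trans Xx).
  have xx : X0 <= x <= b by rewrite Xx.
  apply: le_trans (piece rq0 rq1 r0 hs (B := cmod ni + e1 + (cmod di + e1) / `|r|) X00 Xb _ _ xx) _; last first.
  - by rewrite /F -ee mulrDl; lra.
  - by move=> y yb; exact: tail_piece.
  move=> y _; apply: le_trans (cmodD _ _) _; rewrite !cmodM !cmod_real; apply: lerD.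
    have := h1 b Y1b; have := cmodB_ge (nn r f f' b) ni; have := norm_cs r y.
    have := cmod_ge0 (nn r f f' b); have := normr_ge0 (cs r y); nra.
  have := h2 b Y2b; have := cmodB_ge (dd r f f' b) di => h3 h4.
  by apply: ler_pM => //; [lra|exact: norm_sn].
have F0 : 0 <= F by apply: le_trans (hf X0 (lexx _)); exact: cmod_ge0.
have inc b x : X0 <= x -> x <= b -> cmod (nn r f f' x - nn r f f' b) <= F * (T1 - P1 x) /\
    cmod (dd r f f' x - dd r f f' b) <= F * (T0 - P0 x).
  move=> Xx xb; have [//|n1 d1] := nd_bound rq0 rq1 r0 hs (M := F) (le_trans X00 Xx) xb.
    by move=> y /andP[xy _]; apply: hf; exact: le_trans xy.
  rewrite cmodC (cmodC (dd r f f' x)); split; [apply: le_trans n1 _|apply: le_trans d1 _].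
    by rewrite ler_wpM2l// lerD2r; exact: P1T.
  by rewrite ler_wpM2l// lerD2r; exact: P0T.
move=> x Xx; split; first exact: hf.
  by apply: at_inf_le hn _; exists x => b xb; case: (inc b x Xx xb).
by apply: at_inf_le hd _; exists x => b xb; case: (inc b x Xx xb).
Qed.
End tail.

Section transport.
Variables (X0 : R).
Hypotheses (X01 : 1 <= X0).
Let X0p : 0 < X0 := lt_le_trans ltr01 X01.
(** [sg r] bounds |sn r x| on [0, X0] for small and large r alike. Weighting dd by it in [NN] makes
    the transport constants independent of r. *)
Definition sg r := Num.min X0 `|r|^-1.
Definition NN r f f' x := cmod (nn r f f' x) + sg r * cmod (dd r f f' x).

Lemma sg_ge0 r : 0 <= sg r. Proof. by rewrite le_min invr_ge0 normr_ge0 andbT ltW. Qed.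
Lemma sg_le r : sg r <= X0. Proof. by rewrite ge_min lexx. Qed.
Lemma sg_r r : r != 0 -> sg r * `|r| <= 1.
Proof. by move=> r0; rewrite -ler_pdivlMr ?normr_gt0// div1r ge_min lexx orbT. Qed.
Lemma sg_inv r : r != 0 -> 1 <= sg r * (1 + `|r|).
Proof.
move=> r0; rewrite /sg; case: (leP X0) => _; first by rewrite mulrDr mulr1 ler_wpDr// mulr_ge0// ltW.
by rewrite mulrDr mulr1 mulVf ?normr_eq0// lerDr invr_ge0.
Qed.
Lemma sn_sg r x : r != 0 -> 0 <= x <= X0 -> `|sn r x| <= sg r.
Proof. by move=> r0 /andP[x0 xX]; rewrite le_min norm_sn andbT (le_trans (sn_le r0 x0)). Qed.
Lemma NN_ge0 r f f' x : 0 <= NN r f f' x.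
Proof. by rewrite addr_ge0 ?mulr_ge0 ?sg_ge0 ?cmod_ge0. Qed.

(** On [0, X0] one has |sn r x| <= X0, so the smallness hypothesis allows [piece] with every base
    point; the coefficients then change by at most half of [NN]. *)
Lemma short_piece r f f' a b : r != 0 -> sol q r f f' -> 0 <= a -> a <= b -> b <= X0 ->
  P1 b - P1 a + X0 * (P0 b - P0 a) <= 4^-1 ->
  [/\ NN r f f' a <= 2 * NN r f f' b, NN r f f' b <= 2 * NN r f f' a &
   forall x, a <= x <= b -> cmod (f x) <= 2 * NN r f f' b].
Proof.
move=> r0 hs a0 ab bX hP.
have md (u c d w : R) : c <= u -> u <= d -> c <= w -> w <= d -> `|w - u| <= d - c.
  by move=> *; rewrite ler_norml; apply/andP; split; lra.
have dist x p : a <= x <= b -> a <= p <= b -> `|P1 p - P1 x| <= P1 b - P1 a /\ `|P0 p - P0 x| <= P0 b - P0 a.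
  move=> /andP[ax xb] /andP[ap pb]; split.
    exact: (md _ _ _ _ (P1_mono rq1 ax) (P1_mono rq1 xb) (P1_mono rq1 ap) (P1_mono rq1 pb)).
  exact: (md _ _ _ _ (P0_mono rq0 ax) (P0_mono rq0 xb) (P0_mono rq0 ap) (P0_mono rq0 pb)).
have base p : a <= p <= b -> forall x, a <= x <= b -> cmod (f x) <= 2 * NN r f f' p.
  move=> pab; apply: (piece rq0 rq1 r0 hs a0 pab) => x xab.
    apply: le_trans (cmodD _ _) _; rewrite !cmodM !cmod_real /NN [sg r * _]mulrC.
    apply: lerD; first by rewrite ler_piMr// norm_cs.
    rewrite ler_wpM2l// sn_sg//; move: xab => /andP[ax xb].
    by rewrite (le_trans a0 ax) (le_trans xb bX).
  have [d1 d0] := dist x p xab pab.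
  have hx : `|sn r x| <= X0 by case/andP: xab => ax xb; rewrite (le_trans (sn_le r0 (le_trans a0 ax)))// (le_trans xb).
  apply: le_trans hP; apply: lerD => //; apply: ler_pM => //.
have step p x : a <= p <= b -> a <= x <= b -> NN r f f' x <= 2 * NN r f f' p.
  move=> pab xab; have [n1 d1] := nd_bound2 rq0 rq1 r0 hs a0 pab xab (base p pab).
  have [D1 D0] := dist x p xab pab.
  have s0 := sg_ge0 r; have sX := sg_le r; have Np := NN_ge0 r f f' p.
  have h1 := cmodB_ge (nn r f f' x) (nn r f f' p); have h2 := cmodB_ge (dd r f f' x) (dd r f f' p).
  have h3 : 2 * NN r f f' p * `|P1 p - P1 x| <= 2 * NN r f f' p * (P1 b - P1 a) by rewrite ler_wpM2l// mulr_ge0.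
  have h4 : sg r * (2 * NN r f f' p * `|P0 p - P0 x|) <= X0 * (2 * NN r f f' p * (P0 b - P0 a)).
    by apply: ler_pM => //; rewrite ?mulr_ge0// ler_wpM2l// mulr_ge0.
  have h5 : 2 * NN r f f' p * (P1 b - P1 a + X0 * (P0 b - P0 a)) <= 2 * NN r f f' p * 4^-1 by rewrite ler_wpM2l// mulr_ge0.
  have h6 : sg r * (cmod (dd r f f' x) - cmod (dd r f f' p)) <= sg r * (2 * NN r f f' p * `|P0 p - P0 x|).
    by rewrite ler_wpM2l//; lra.
  rewrite {1}/NN; move: h3 h5; have -> : NN r f f' p = cmod (nn r f f' p) + sg r * cmod (dd r f f' p) by [].
  move: h4 h6 Np n1; have -> : NN r f f' p = cmod (nn r f f' p) + sg r * cmod (dd r f f' p) by [].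
  lra.
have aa : a <= a <= b by rewrite lexx. have bb : a <= b <= b by rewrite lexx andbT.
by split; [exact: step|exact: step|exact: base].
Qed.

(** Chain induction from 0 to X0: around any point a piece is short enough for [short_piece] and
    doubles the constant. The pieces depend on q only, so C serves all r and all solutions. *)
Lemma transport : exists2 C, 1 <= C & forall r f f', r != 0 -> sol q r f f' ->
  [/\ NN r f f' X0 <= C * NN r f f' 0, NN r f f' 0 <= C * NN r f f' X0 &
      forall x, 0 <= x <= X0 -> cmod (f x) <= C * NN r f f' X0].
Proof.
pose P X := exists2 C, 1 <= C & forall r f f', r != 0 -> sol q r f f' ->
  [/\ NN r f f' X <= C * NN r f f' 0, NN r f f' 0 <= C * NN r f f' X &
      forall x, 0 <= x <= X -> cmod (f x) <= C * NN r f f' X].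
apply: (@chain_induction _ P 0 X0 (ltW X0p)).
  exists 1 => // r f f' r0 hs; rewrite mul1r; split => // x /le_anti <-.
  by rewrite /NN nn0 lerDl mulr_ge0 ?sg_ge0 ?cmod_ge0.
move=> s _; have e8 : 0 < 8^-1 :> R by rewrite invr_gt0.
have e8' : 0 < 8^-1 / X0 by rewrite divr_gt0.
have [d1 d10 h1] := cumul_small s rq1 (fun t => mulr_ge0 (normr_ge0 _) (normr_ge0 _)) e8.
have [d2 d20 h2] := cumul_small s rq0 (fun t => normr_ge0 _) e8'.
exists (Num.min d1 d2); first by rewrite lt_min d10.
have [m1 m2] : Num.min d1 d2 <= d1 /\ Num.min d1 d2 <= d2 by rewrite !ge_min !lexx orbT.
move=> x y x0 xs sy yX xd yd [C C1 hC]; have xy := le_trans xs sy.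
have short : P1 y - P1 x + X0 * (P0 y - P0 x) <= 4^-1.
  have [l1 l2] : s - d1 <= x /\ s - d2 <= x by split; lra.
  have [l3 l4] : y <= s + d1 /\ y <= s + d2 by split; lra.
  have := P1_mono rq1 l1; have := P1_mono rq1 l3; have := P0_mono rq0 l2; have := P0_mono rq0 l4.
  rewrite -/P0 -/P1 => a1 a2 a3 a4.
  have : X0 * (P0 y - P0 x) <= X0 * (8^-1 / X0) by rewrite ler_wpM2l//; rewrite -/P0 in h2; lra.
  rewrite mulrCA mulfV ?mulr1; last by rewrite gt_eqF.
  rewrite -/P1 in h1; lra.
exists (2 * C); first lra.
move=> r f f' r0 hs; have [c1 c2 c3] := hC r f f' r0 hs.
have [k1 k2 k3] := short_piece r0 hs x0 xy yX short.
have := NN_ge0 r f f' 0; have Ny := NN_ge0 r f f' y; have Nx := NN_ge0 r f f' x.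
split; [nra|nra|] => u /andP[u0 uy].
have [ux|xu] := leP u x; first by have := c3 u; rewrite u0 ux => /(_ isT); nra.
have := k3 u; rewrite uy (ltW xu) => /(_ isT); nra.
Qed.
End transport.

End potential.
End jost.

(** * Cauchy data of the Jost solutions at the origin *)

Section jost_data.
Variable R : realType.
Implicit Types (r s x e : R).

(** Jost solutions enter the bounds on R only through their Cauchy data (a r, a' r) at x = 0.
    [jd_pert] and [jd_sym] stand in for continuity at r = 0: the data at r and at a smaller s are
    parallel up to O(|r|), and the data at r and -r are close. *)
Record jost_data (a a' : R -> R[i]) : Prop := JostData {
  jd_conj : forall r, r != 0 -> a (- r) = conjc (a r) /\ a' (- r) = conjc (a' r);
  jd_wron : forall r, r != 0 -> a r * a' (- r) - a' r * a (- r) = - (0 +i* (2 * r));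
  jd_up : exists2 C, 0 < C & forall r, r != 0 -> cmod (a r) <= C /\ cmod (a' r) <= C * (1 + `|r|);
  jd_pert : exists C d, [/\ 0 < C, 0 < d & forall r s, s != 0 -> `|s| <= `|r| -> `|r| <= d ->
    cmod (a r * a' s - a' r * a s) <= C * `|r|];
  jd_low : exists2 c, 0 < c & forall r, r != 0 -> c <= cmod (a r) + cmod (a' r);
  jd_sym : forall e, 0 < e -> exists2 d, 0 < d & forall r, r != 0 -> `|r| < d ->
    cmod (a r - a (- r)) <= e /\ cmod (a' r - a' (- r)) <= e }.

Section facts.
Variables (q : R -> R) (E E' : R -> R -> R[i]) (X0 C : R).
Hypotheses (rq0 : rI (fun x => `|q x|)) (rq1 : rI (fun x => `|x| * `|q x|)).
Let P0 := cumul (fun x => `|q x|).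
Let P1 := cumul (fun x => `|x| * `|q x|).
Let T0 := intg (fun x => `|q x|).
Let T1 := intg (fun x => `|x| * `|q x|).
Hypotheses (hE : forall r, r != 0 -> jost_sol q r (E r) (E' r)) (X01 : 1 <= X0)
  (hX0 : 2 * (T1 - P1 X0) <= 4^-1) (C1 : 1 <= C).
Hypothesis hC : forall r f f', r != 0 -> sol q r f f' ->
  [/\ NN X0 r f f' X0 <= C * NN X0 r f f' 0, NN X0 r f f' 0 <= C * NN X0 r f f' X0 &
      forall x, 0 <= x <= X0 -> cmod (f x) <= C * NN X0 r f f' X0].
Let X0p : 0 < X0 := lt_le_trans ltr01 X01.
Let X0n : 0 <= X0 := ltW X0p.

Lemma T0_ge0 : 0 <= T0. Proof. by apply: intg_ge0. Qed.

Lemma jost_tail r : r != 0 -> forall x, X0 <= x -> [/\ cmod (E r x) <= 4,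
  cmod (nn r (E r) (E' r) x - 1) <= 4 * (T1 - P1 x) & cmod (dd r (E r) (E' r) x - (0 +i* r)) <= 4 * (T0 - P0 x)].
Proof.
move=> r0 x Xx; have [hs hn hd] := hE r0; have := tail rq0 rq1 X0n hX0 r0 hs hn hd Xx.
by rewrite cmod1 cmod_imag mulfV ?normr_eq0// (_ : 2 * (1 + 1) = 4 :> R)//; lra.
Qed.

Lemma NN_X0 r : r != 0 -> 2^-1 <= NN X0 r (E r) (E' r) X0 <= 3 + 4 * T0 * X0.
Proof.
move=> r0; have [_ hn hd] := jost_tail r0 (lexx X0).
have h0 : 0 <= P0 X0 by apply: intg_ge0 => t; rewrite mulr_ge0.
have := sg_ge0 X01 r; have := sg_le X0 r; have := sg_r X0 r0 => s1 s2 s3.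
have := cmodB_ge (nn r (E r) (E' r) X0) 1; have := cmodB_ge 1 (nn r (E r) (E' r) X0).
rewrite cmod1 (cmodC 1) => k1 k2.
have := cmodB_ge (dd r (E r) (E' r) X0) (0 +i* r); rewrite cmod_imag => k3.
have := T0_ge0; have := hX0; have := cmod_ge0 (dd r (E r) (E' r) X0) => k4 k5 k6.
have k7 : sg X0 r * cmod (dd r (E r) (E' r) X0) <= sg X0 r * `|r| + X0 * (4 * T0).
  apply: le_trans (_ : sg X0 r * (`|r| + 4 * T0) <= _); first by apply: ler_wpM2l => //; lra.
  by rewrite mulrDr lerD2l ler_wpM2r//; lra.
have k8 : 0 <= sg X0 r * cmod (dd r (E r) (E' r) X0) by rewrite mulr_ge0.
rewrite /NN; apply/andP; split; lra.
Qed.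

Lemma NN_at0 r f f' : NN X0 r f f' 0 = cmod (f 0) + sg X0 r * cmod (f' 0).
Proof. by rewrite /NN nn0 dd0. Qed.

Lemma bound_at0 r f f' B : r != 0 -> sol q r f f' -> NN X0 r f f' X0 <= B ->
  cmod (f 0) <= C * B /\ cmod (f' 0) <= C * B * (1 + `|r|).
Proof.
move=> r0 hs hB; have [_ c2 _] := hC r0 hs; rewrite NN_at0 in c2.
have C0 : 0 <= C by rewrite (le_trans ler01).
have := sg_inv X01 r0; have := sg_ge0 X01 r => s0 s1.
have : C * NN X0 r f f' X0 <= C * B by rewrite ler_wpM2l.
have := cmod_ge0 (f 0); have := cmod_ge0 (f' 0); have := normr_ge0 r => k1 k2 k3 k4; split; first nra.
have : sg X0 r * cmod (f' 0) <= C * B by nra.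
move=> k5; have : sg X0 r * cmod (f' 0) * (1 + `|r|) <= C * B * (1 + `|r|) by rewrite ler_wpM2r//; lra.
by apply: le_trans; rewrite mulrAC -[leLHS]mul1r ler_wpM2r.
Qed.

Let K := C * (3 + 4 * T0 * X0).

Lemma K_gt0 : 0 < K.
Proof.
have C0 : 0 < C by exact: lt_le_trans ltr01 C1.
by apply: mulr_gt0 => //; apply: ltr_wpDr => //; rewrite !mulr_ge0// T0_ge0.
Qed.

Lemma jost_up r : r != 0 -> cmod (E r 0) <= K /\ cmod (E' r 0) <= K * (1 + `|r|).
Proof. by move=> r0; have [hs _ _] := hE r0; have /andP[_] := NN_X0 r0; exact: bound_at0. Qed.

Lemma jost_sup r x : r != 0 -> 0 <= x -> cmod (E r x) <= 4 + K.
Proof.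
move=> r0 x0; have k := K_gt0; have [xX|Xx] := leP x X0.
  have [hs _ _] := hE r0; have /andP[_ n1] := NN_X0 r0; have [_ _ c3] := hC r0 hs.
  have C0 : 0 <= C by rewrite (le_trans ler01).
  have xx : 0 <= x <= X0 by rewrite x0.
  by apply: le_trans (c3 x xx) _; rewrite -[leLHS]add0r lerD// ler_wpM2l.
by have [h _ _] := jost_tail r0 (ltW Xx); rewrite -[leLHS]addr0 lerD// ltW.
Qed.

Lemma jost_low r : r != 0 -> (2 * C * (1 + X0))^-1 <= cmod (E r 0) + cmod (E' r 0).
Proof.
move=> r0; have [hs _ _] := hE r0; have /andP[n1 _] := NN_X0 r0; have [c1 _ _] := hC r0 hs.
have C0 : 0 < C by rewrite (lt_le_trans ltr01).
have p0 : 0 < 2 * C * (1 + X0) by rewrite !mulr_gt0// ltr_wpDr// ltW.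
rewrite NN_at0 in c1; have := sg_le X0 r; have := cmod_ge0 (E r 0); have := cmod_ge0 (E' r 0) => k1 k2 k3.
rewrite -div1r ler_pdivrMr//.
have : sg X0 r * cmod (E' r 0) <= X0 * cmod (E' r 0) by rewrite ler_wpM2r.
have : C * (cmod (E r 0) + sg X0 r * cmod (E' r 0)) <= C * (cmod (E r 0) + X0 * cmod (E' r 0)).
  by rewrite ler_wpM2l ?(ltW C0)// lerD2l ler_wpM2r.
have : 0 <= C * (cmod (E' r 0) + X0 * cmod (E r 0)).
  by rewrite mulr_ge0 ?(ltW C0)// addr_ge0// mulr_ge0.
lra.
Qed.

(** Uniqueness: the difference of the two solutions has coefficients tending to 0, so it vanishes
    beyond X0 by [tail] and at 0 by transport. *)
Lemma jost_conj r : r != 0 -> E (- r) 0 = conjc (E r 0) /\ E' (- r) 0 = conjc (E' r 0).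
Proof.
move=> r0; have rN : - r != 0 by rewrite oppr_eq0.
have [h1 n1 d1] := hE r0; have [/solN h2 n2 d2] := hE rN.
have hs := solB h2 (sol_conj h1).
have zero (n m : R -> R[i]) l l' (p : R -> R[i]) : at_inf n l -> at_inf m l' -> l = conjc l' ->
    (forall x, p x = n x - conjc (m x)) -> at_inf p 0.
  move=> hn hm ll hp e e0; have [X hX] := hn _ (divr_gt0 e0 (ltr0Sn _ 1)); have [Y hY] := hm _ (divr_gt0 e0 (ltr0Sn _ 1)).
  exists (Num.max X Y) => x; rewrite ge_max => /andP[Xx Yx]; rewrite hp subr0.
  have := hX x Xx; have := hY x Yx; rewrite -cmod_conj conjcB -ll; have := cmod_tri l (n x) (conjc (m x)).
  rewrite (cmodC l); lra.
have cR (u : R) : conjc u%:C = u%:C by apply: cx_ext; rewrite !ReImE ?oppr0.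
have zn : at_inf (nn r (fun x => E (- r) x - conjc (E r x)) (fun x => E' (- r) x - conjc (E' r x))) 0.
  apply: (zero _ _ _ _ _ n2 n1) => [|x]; first by apply: cx_ext; rewrite !ReImE ?oppr0.
  by rewrite nnN /nn conjcB !conjcM !cR; ring.
have zd : at_inf (dd r (fun x => E (- r) x - conjc (E r x)) (fun x => E' (- r) x - conjc (E' r x))) 0.
  apply: (zero _ _ _ _ _ d2 d1) => [|x]; first by apply: cx_ext; rewrite !ReImE.
  by rewrite ddN /dd conjcD !conjcM !cR; ring.
have [_ t1 t2] := tail rq0 rq1 X0n hX0 r0 hs zn zd (lexx X0).
move: t1 t2; rewrite cmod0 mul0r addr0 mulr0 !mul0r !subr0 => t1 t2.
have N0 : NN X0 r (fun x => E (- r) x - conjc (E r x)) (fun x => E' (- r) x - conjc (E' r x)) X0 <= 0.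
  by rewrite /NN; have := sg_ge0 X01 r; nra.
have := bound_at0 r0 hs N0; rewrite mulr0 mul0r => -[b1 b2].
by split; apply/eqP; rewrite -subr_eq0 -cmod_eq0 eq_le cmod_ge0 andbT.
Qed.

(** The Wronskian is constant and is evaluated far out, where the coefficients are near 1 and ir,
    respectively 1 and -ir. *)
Lemma jost_wron r : r != 0 -> E r 0 * E' (- r) 0 - E' r 0 * E (- r) 0 = - (0 +i* (2 * r)).
Proof.
move=> r0; have rN : - r != 0 by rewrite oppr_eq0.
have [h1 n1 d1] := hE r0; have [h2 n2 d2] := hE rN.
apply/eqP; rewrite -subr_eq0; apply/eqP/cmod_small => e e0.
pose k := 4 + 2 * `|r|; have k0 : 0 < k by rewrite ltr_wpDr// mulr_ge0.
pose e1 := Num.min 1 (e / k); have e10 : 0 < e1 by rewrite lt_min ltr01 divr_gt0.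
have [Y1 i1] := n1 _ e10; have [Y2 i2] := d1 _ e10; have [Y3 i3] := n2 _ e10; have [Y4 i4] := d2 _ e10.
pose x := Num.max 0 (Num.max (Num.max Y1 Y2) (Num.max Y3 Y4)).
have [x0 x1 x2 x3 x4] : [/\ 0 <= x, Y1 <= x, Y2 <= x, Y3 <= x & Y4 <= x] by rewrite !le_max !lexx !orbT.
have := wron x0 h1 h2 (S := 4 + K); rewrite sqrrN subrr normr0 !mul0r => /(_ _ _)/le_trans w.
have {}w : cmod (E r x * E' (- r) x - E' r x * E (- r) x - (E r 0 * E' (- r) 0 - E' r 0 * E (- r) 0)) <= 0.
  by apply: w => // y /andP[y0 _]; exact: jost_sup.
have -> : E r 0 * E' (- r) 0 - E' r 0 * E (- r) 0 = E r x * E' (- r) x - E' r x * E (- r) x.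
  by apply/eqP; rewrite eq_sym -subr_eq0 -cmod_eq0 eq_le w cmod_ge0.
rewrite (wron_nd _ _ _ _ _ r0) -(nnN r (E (- r))) -(ddN r (E (- r))).
move: (i1 x x1) (i2 x x2) (i3 x x3) (i4 x x4); set n := nn r _ _ x; set d := dd r _ _ x.
set m := nn (- r) _ _ x; set p := dd (- r) _ _ x => a1 a2 a3 a4.
have -> : n * p - d * m - - (0 +i* (2 * r)) = (n - 1) * p + (p - (0 +i* (- r))) - (d - (0 +i* r)) * m - (0 +i* r) * (m - 1).
  have -> : 0 +i* (2 * r) = (0 +i* r) + (0 +i* r) by cx_ring.
  have -> : 0 +i* (- r) = - (0 +i* r) by cx_eq; rewrite ?oppr0.
  by move: n d m p (0 +i* r) {a1 a2 a3 a4} => n d m p v; ring.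
have := cmodB_ge p (0 +i* (- r)); rewrite cmod_imag normrN => b1.
have := cmodB_ge m 1; rewrite cmod1 => b2.
apply: le_trans (cmodB _ _) _; apply: le_trans (lerD (cmodB _ _) (lexx _)) _.
apply: le_trans (lerD (lerD (cmodD _ _) (lexx _)) (lexx _)) _; rewrite !cmodM cmod_imag.
have [e11 e12] : e1 <= 1 /\ e1 <= e / k by rewrite !ge_min !lexx orbT.
have : cmod (n - 1) * cmod p <= e1 * (1 + `|r|) by apply: ler_pM => //; lra.
have : cmod (d - (0 +i* r)) * cmod m <= e1 * 2 by apply: ler_pM => //; lra.
have : `|r| * cmod (m - 1) <= `|r| * e1 by apply: ler_wpM2l.
move: e12; rewrite ler_pdivlMr// /k; lra.
Qed.

(** The Wronskian is compared at 0 and at x = 1/|r|. At x both derivatives are at most 3 |r|; in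
    between it changes by at most |r^2 - s^2| (4 + K)^2 x <= (4 + K)^2 |r|. *)
Lemma jost_pert r s : s != 0 -> `|s| <= `|r| -> `|r| <= X0^-1 ->
  cmod (E r 0 * E' s 0 - E' r 0 * E s 0) <= ((4 + K) * 6 + (4 + K) ^+ 2) * `|r|.
Proof.
move=> s0 sr rX; have r0 : r != 0 by rewrite -normr_gt0 (lt_le_trans _ sr)// normr_gt0.
have rp : 0 < `|r| by rewrite normr_gt0.
pose x := `|r|^-1; have xX : X0 <= x by rewrite -[X0]invrK lef_pV2 ?posrE ?invr_gt0.
have x0 : 0 < x by rewrite invr_gt0.
have T1x : T1 - P1 x <= 8^-1 by have := P1_mono rq1 xX; have := hX0; rewrite -/P1; lra.
have T0x : T0 - P0 x <= 8^-1 * `|r|.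
  have := T01 rq0 rq1 (ltW x0); rewrite -/T0 -/T1 -/P0 -/P1 => /le_trans/(_ T1x).
  by rewrite mulrC -ler_pdivlMr// /x invrK.
have der u : u != 0 -> `|u| <= `|r| -> cmod (E' u x) <= 3 * `|r|.
  move=> u0 ur; have [_ hn hd] := jost_tail u0 xX.
  rewrite (nd_f' (E u) _ _ u0); set n := nn _ _ _ _ in hn *; set d := dd _ _ _ _ in hd *.
  have := cmodB_ge n 1; have := cmodB_ge d (0 +i* u); rewrite cmod1 cmod_imag => k1 k2.
  apply: le_trans (cmodB _ _) _; rewrite !cmodM !cmod_real.
  have : cmod d * `|cs u x| <= cmod d * 1 by rewrite ler_wpM2l// norm_cs.
  have : `|u ^+ 2| * `|sn u x| <= `|u|.
    rewrite normrX expr2 -mulrA ler_piMr// -ler_pdivlMl ?normr_gt0// mulr1; exact: norm_sn.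
  move=> k3; have : `|u ^+ 2| * `|sn u x| * cmod n <= `|u| * (3 / 2).
    by apply: ler_pM; rewrite ?mulr_ge0//; lra.
  lra.
have [h1 _ _] := hE r0; have [h2 _ _] := hE s0.
have SK : 0 <= 4 + K by have := K_gt0; lra.
have := wron (ltW x0) h1 h2 (S := 4 + K); rewrite subr0 => /(_ _ _) w.
have {w}w := w (fun y h => jost_sup r0 (proj1 (andP h))) (fun y h => jost_sup s0 (proj1 (andP h))).
have w2 : `|r ^+ 2 - s ^+ 2| * (4 + K) ^+ 2 * x <= (4 + K) ^+ 2 * `|r|.
  rewrite mulrAC mulrC ler_wpM2l ?sqr_ge0// /x ler_pdivrMr// -expr2.
  have s2 : s ^+ 2 <= r ^+ 2.
    rewrite -(real_normK (num_real s)) -(real_normK (num_real r)).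
    by apply: lerXn2r => //; rewrite nnegrE.
  by rewrite ger0_norm ?subr_ge0// (real_normK (num_real r)) gerBl sqr_ge0.
have := cmod_tri (E r x * E' s x - E' r x * E s x) (E r 0 * E' s 0 - E' r 0 * E s 0) 0; rewrite !subr0 cmodC.
move=> /le_trans; apply; rewrite mulrDl addrC; apply: lerD; last exact: le_trans w w2.
apply: le_trans (cmodB _ _) _; rewrite !cmodM.
have : cmod (E r x) * cmod (E' s x) <= (4 + K) * (3 * `|r|).
  by apply: ler_pM; rewrite ?cmod_ge0 ?jost_sup ?der// ltW.
have : cmod (E' r x) * cmod (E s x) <= 3 * `|r| * (4 + K).
  by apply: ler_pM; rewrite ?cmod_ge0 ?jost_sup ?der// ltW.
lra.
Qed.

(** The solutions for r and -r obey the same equation. At a fixed far point x the coefficients of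
    their difference are of order ep once |r| x < ep, and this is transported back to 0; L collects
    the constants. *)
Lemma jost_sym e : 0 < e -> exists2 d, 0 < d & forall r, r != 0 -> `|r| < d ->
    cmod (E r 0 - E (- r) 0) <= e /\ cmod (E' r 0 - E' (- r) 0) <= e.
Proof.
move=> e0; have T00 := T0_ge0; have C0 : 0 < C by rewrite (lt_le_trans ltr01).
pose k := 2 * C * (8 + 4 + X0 * (8 + 64 * T0 + 10 * T0 * 10)).
pose L := C * 2 * (20 + X0 * (20 + 40 * T0)).
have L0 : 0 < L by rewrite !mulr_gt0// ltr_wpDr// mulr_ge0// addr_ge0// mulr_ge0.
pose ep := e / L; have ep0 : 0 < ep by rewrite divr_gt0.
have [X hX1 hX] := cumul_lim rq1 (fun t => mulr_ge0 (normr_ge0 _) (normr_ge0 _)) ep0.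
pose x := Num.max X0 X; have [x1 x2] : X0 <= x /\ X <= x by rewrite !le_max !lexx orbT.
have x0 : 0 < x by exact: lt_le_trans x1.
have T1x : T1 - P1 x <= ep by have := P1_mono rq1 x2; rewrite -/P1 -/T1 in hX *; lra.
have T0x : x * (T0 - P0 x) <= ep by apply: le_trans (T01 rq0 rq1 (ltW x0)) T1x.
exists (Num.min 1 (ep / x)); first by rewrite lt_min ltr01 divr_gt0.
move=> r r0; rewrite lt_min ltr_pdivlMr// => /andP[r1 rx].
have rN : - r != 0 by rewrite oppr_eq0.
have [h1 _ _] := hE r0; have [/solN h2 _ _] := hE rN; have hs := solB h1 h2.
have [_ n1 d1] := jost_tail r0 x1; have [_ n2 d2] := jost_tail rN x1.
rewrite nnN in n2; rewrite ddN in d2.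
set f := fun x => E r x - E (- r) x; set f' := fun x => E' r x - E' (- r) x; rewrite -/f -/f' in hs.
have nE y : nn r f f' y = (nn r (E r) (E' r) y - 1) - (nn r (E (- r)) (E' (- r)) y - 1).
  by rewrite /nn /f /f'; ring.
have dE y : dd r f f' y = (dd r (E r) (E' r) y - (0 +i* r)) - (dd r (E (- r)) (E' (- r)) y - (0 +i* - r)) + (0 +i* (2 * r)).
  rewrite /dd /f /f' (_ : 0 +i* (2 * r) = (0 +i* r) - (0 +i* - r)); first by ring.
  by cx_ring.
have nx : cmod (nn r f f' x) <= 8 * ep by rewrite nE; apply: le_trans (cmodB _ _) _; lra.
have dx : x * cmod (dd r f f' x) <= 10 * ep.
  rewrite dE; apply: le_trans (ler_wpM2l (ltW x0) (cmodD _ _)) _.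
  rewrite mulrDr cmod_imag normrM ger0_norm//.
  have : x * cmod ((dd r (E r) (E' r) x - (0 +i* r)) - (dd r (E (- r)) (E' (- r)) x - (0 +i* - r))) <= x * (8 * (T0 - P0 x)).
    by rewrite ler_wpM2l ?(ltW x0)//; apply: le_trans (cmodB _ _) _; lra.
  lra.
have xx : X0 <= x <= x by rewrite x1 lexx.
have bnd : forall y, X0 <= y <= x -> cmod (f y) <= 2 * (18 * ep).
  apply: (piece rq0 rq1 r0 hs X0n xx) => y /andP[Xy yx]; last by apply: (tail_piece rq0 rq1 X0n hX0 r0); rewrite Xy.
  apply: le_trans (cmodD _ _) _; rewrite !cmodM !cmod_real.
  have y0 : 0 <= y by exact: le_trans Xy.
  have : cmod (nn r f f' x) * `|cs r y| <= cmod (nn r f f' x) by rewrite ler_piMr// norm_cs.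
  have : cmod (dd r f f' x) * `|sn r y| <= cmod (dd r f f' x) * x.
    by rewrite ler_wpM2l// (le_trans (sn_le r0 y0)).
  lra.
have [n3 d3] := nd_bound rq0 rq1 r0 hs X0n x1 bnd; rewrite -/P0 -/P1 in n3 d3.
have Nx : NN X0 r f f' X0 <= (20 + X0 * (20 + 40 * T0)) * ep.
  have k1 := cmodB_ge (nn r f f' X0) (nn r f f' x); have k2 := cmodB_ge (dd r f f' X0) (dd r f f' x).
  rewrite cmodC in n3; rewrite cmodC in d3.
  have h8 : P1 x - P1 X0 <= 8^-1 by have := hX0; have := P1T rq1 x; rewrite -/P1 -/T1; lra.
  have h9 : P0 x - P0 X0 <= T0.
    have := P0T rq0 x; have : 0 <= P0 X0 by apply: intg_ge0 => t; rewrite mulr_ge0.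
    by rewrite -/P0 -/T0; lra.
  have m1 : 2 * (18 * ep) * (P1 x - P1 X0) <= 2 * (18 * ep) * 8^-1 by rewrite ler_wpM2l//; lra.
  have m2 : 2 * (18 * ep) * (P0 x - P0 X0) <= 2 * (18 * ep) * T0 by rewrite ler_wpM2l//; lra.
  have m3 : cmod (dd r f f' x) <= 10 * ep.
    by apply: le_trans dx; rewrite ler_peMl// (le_trans X01).
  have s1 := sg_le X0 r; have s0 := sg_ge0 X01 r.
  have m4 : sg X0 r * cmod (dd r f f' X0) <= X0 * (10 * ep + 36 * ep * T0).
    by apply: ler_pM => //; lra.
  have m5 : 0 <= X0 * ep by rewrite mulr_ge0 ?(ltW ep0).
  have m6 : 0 <= X0 * ep * T0 by rewrite mulr_ge0.
  rewrite /NN; lra.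
have [b1 b2] := bound_at0 r0 hs Nx.
have eL : C * ((20 + X0 * (20 + 40 * T0)) * ep) * 2 = e.
  by rewrite -[RHS](divfK (lt0r_neq0 L0)) -/ep /L; ring.
have b0 : 0 <= C * ((20 + X0 * (20 + 40 * T0)) * ep) by apply: le_trans b1; exact: cmod_ge0.
split; first by apply: le_trans b1 _; lra.
by apply: le_trans b2 _; rewrite -eL ler_wpM2l//; lra.
Qed.
End facts.

Lemma jost_facts q E E' : rI (fun x => `|q x|) -> rI (fun x => `|x| * `|q x|) ->
  (forall r, r != 0 -> jost_sol q r (E r) (E' r)) -> jost_data (fun r => E r 0) (fun r => E' r 0).
Proof.
move=> rq0 rq1 hE; have e8 : 0 < 8^-1 :> R by rewrite invr_gt0.
have [X0 X01 hX] := cumul_lim rq1 (fun t => mulr_ge0 (normr_ge0 _) (normr_ge0 _)) e8.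
have hX0 : 2 * (intg (fun x => `|x| * `|q x|) - cumul (fun x => `|x| * `|q x|) X0) <= 4^-1 by lra.
have [C C1 hC] := transport rq0 rq1 X01.
have X0p : 0 < X0 by exact: lt_le_trans X01.
have Kp := K_gt0 q X01 C1.
split.
- by move=> r r0; exact: (jost_conj rq0 rq1 hE X01 hX0 C1 hC).
- by move=> r r0; exact: (jost_wron rq0 rq1 hE X01 hX0 C1 hC).
- by eexists; [exact: Kp|move=> r r0; exact: (jost_up rq0 rq1 hE X01 hX0 C1 hC)].
- exists ((4 + C * (3 + 4 * intg (fun x => `|q x|) * X0)) * 6 + (4 + C * (3 + 4 * intg (fun x => `|q x|) * X0)) ^+ 2), X0^-1.
  split; [|by rewrite invr_gt0|by move=> r s; exact: (jost_pert rq0 rq1 hE X01 hX0 C1 hC)].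
  by rewrite ltr_wpDr ?sqr_ge0// mulr_gt0// ltr_wpDr ?ltW.
- exists (2 * C * (1 + X0))^-1; last by move=> r; exact: (jost_low rq0 rq1 hE X01 hX0 C1 hC).
  by rewrite invr_gt0 !mulr_gt0 ?(lt_le_trans ltr01 C1)// ltr_wpDr// ltW.
- exact: (jost_sym rq0 rq1 hE X01 hX0 C1 hC).
Qed.

End jost_data.

(** * Bounds on the reflection coefficient *)

Section reflection_coefficient.
Variable R : realType.
Implicit Types (q : R -> R) (f : R -> R[i]) (e g : R -> R -> R[i]) (r s x : R).

Lemma ae_refl (P : R -> Prop) : {ae mu, forall x, P x} -> {ae mu, forall x, P (- x)}.
Proof.
move=> [A [mA A0 PA]]; exists ((fun x => -1 * x + 0) @^-1` A); split.
- by rewrite -[X in measurable X]setTI; exact: (measurable_affine (-1) 0).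
- by rewrite affine_measure// A0 mule0.
- by move=> x /= Px; apply: PA; rewrite mulN1r addr0.
Qed.

Lemma nd_limits r f f' : r != 0 ->
  (forall c, 0 < c -> exists X, forall x, X <= x -> cmod (f x / expi (r * x) - 1) <= c /\
     cmod (f' x / ((0 +i* r) * expi (r * x)) - 1) <= c) ->
  at_inf (nn r f f') 1 /\ at_inf (dd r f f') (0 +i* r).
Proof.
move=> r0 h; have rp : 0 < `|r| by rewrite normr_gt0.
have ir0 : 0 +i* r != 0 by apply: Im_neq0.
have eE x : expi (r * x) * ((cs r x)%:C - (0 +i* r) * (sn r x)%:C) = 1.
  rewrite (_ : _ - _ = conjc (expi (r * x))); last by apply: cx_ext; rewrite !ReImE /cs /sn /=; field.
  by rewrite mul_conj cmod_expi expr1n.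
have rs x : `|r| * `|sn r x| <= 1.
  by rewrite -ler_pdivlMl// mulr1 norm_sn.
have ir2 : (r ^+ 2)%:C = - (0 +i* r) * (0 +i* r) by cx_ring.
split=> c c0.
  have [X hX] := h (c / 2) (divr_gt0 c0 (ltr0Sn _ 1)); exists X => x /hX [h1 h2].
  set A := expi (r * x) in eE h1 h2 *; have A0 : A != 0 by exact: expi_neq0.
  have -> : nn r f f' x - 1 = (f x / A - 1) * (A * (cs r x)%:C) - (f' x / ((0 +i* r) * A) - 1) * (A * ((0 +i* r) * (sn r x)%:C)).
    by rewrite /nn -{1}(eE x) -/A; field; rewrite A0 ir0.
  apply: le_trans (cmodB _ _) _; rewrite !cmodM cmod_expi cmod_imag !cmod_real !mul1r.
  have : cmod (f x / A - 1) * `|cs r x| <= c / 2 * 1 by apply: ler_pM; rewrite ?cmod_ge0 ?norm_cs.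
  have : cmod (f' x / ((0 +i* r) * A) - 1) * (`|r| * `|sn r x|) <= c / 2 * 1 by apply: ler_pM; rewrite ?cmod_ge0 ?mulr_ge0.
  lra.
have [X hX] := h (c / (2 * `|r|)) (divr_gt0 c0 (mulr_gt0 (ltr0Sn _ 1) rp)); exists X => x /hX [h1 h2].
set A := expi (r * x) in eE h1 h2 *; have A0 : A != 0 by exact: expi_neq0.
have -> : dd r f f' x - (0 +i* r) = (f' x / ((0 +i* r) * A) - 1) * (A * ((0 +i* r) * (cs r x)%:C)) -
    (f x / A - 1) * (A * ((0 +i* r) * ((0 +i* r) * (sn r x)%:C))).
  have key : 0 +i* r = (0 +i* r) * (A * ((cs r x)%:C - (0 +i* r) * (sn r x)%:C)) by rewrite eE mulr1.
  by rewrite /dd ir2 [X in _ - X = _]key; field; rewrite A0 ir0.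
apply: le_trans (cmodB _ _) _; rewrite !cmodM cmod_expi cmod_imag !cmod_real !mul1r.
have k0 : 0 <= c / (2 * `|r|) by rewrite divr_ge0 ?mulr_ge0// ltW.
have : cmod (f' x / ((0 +i* r) * A) - 1) * (`|r| * `|cs r x|) <= c / (2 * `|r|) * (`|r| * 1).
  by apply: ler_pM; rewrite ?cmod_ge0 ?mulr_ge0// ler_wpM2l// norm_cs.
have : cmod (f x / A - 1) * (`|r| * (`|r| * `|sn r x|)) <= c / (2 * `|r|) * (`|r| * 1).
  by apply: ler_pM; rewrite ?cmod_ge0 ?mulr_ge0// ler_wpM2l.
have -> : c / (2 * `|r|) * (`|r| * 1) = c / 2 by field; rewrite gt_eqF.
lra.
Qed.

Lemma schrodinger_sol q r f : schrodinger_solution q r f -> sol q r f (cderive f).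
Proof.
move=> [h1 h2 h3]; split => //; first by move=> x; exact: cderivable_rder.
apply: (aeS h3) => x [/cderivable_rder d E]; rewrite (_ : _ - _ = cderive (cderive f) x)//.
by rewrite -E opprD opprK addrCA subrr addr0.
Qed.

Lemma sol_refl q r f f' : sol q r f f' -> sol (fun x => q (- x)) r (fun x => f (- x)) (fun x => - f' (- x)).
Proof.
move=> [h1 h2 h3]; split.
- by move=> x; exact: rder_refl.
- move=> a b; apply: acN; rewrite -{1}[a]opprK -{1}[b]opprK; exact: ac_refl.
- apply: (aeS (ae_refl h3)) => x /rder_refl/(rderZ (-1)).
  by rewrite mulN1r opprK (_ : (fun t => _) = (fun t => - f' (- t)))//; apply/funext => t; rewrite mulN1r.
Qed.

Lemma jost_right_sol q e : jost_right q e -> forall r, r != 0 -> jost_sol q r (e r) (cderive (e r)).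
Proof.
move=> he r r0; have [hs /cvg_cmodP/cvgrPdist_le l1 /cvg_cmodP/cvgrPdist_le l2] := he r r0.
have [n d] : at_inf (nn r (e r) (cderive (e r))) 1 /\ at_inf (dd r (e r) (cderive (e r))) (0 +i* r).
  apply: nd_limits => // c c0; have [M [_ h]] := l1 c c0; have [N [_ h']] := l2 c c0.
  exists (Num.max M N + 1) => x hx; have [xM xN] : M < x /\ N < x.
    have [] : M <= Num.max M N /\ N <= Num.max M N by rewrite !le_max !lexx orbT.
    by split; lra.
  by have := h x xM; have := h' x xN; rewrite !sub0r !normrN !ger0_norm ?cmod_ge0.
by split => //; exact: schrodinger_sol.
Qed.

(** The reflection x -> -x turns left Jost solutions into right ones for q (- x), so all estimates
    are made on the right only. *)
Lemma jost_left_sol q g : jost_left q g -> forall r, r != 0 ->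
  jost_sol (fun x => q (- x)) r (fun x => g r (- x)) (fun x => - cderive (g r) (- x)).
Proof.
move=> hg r r0; have [hs /cvg_cmodP/cvgrPdist_le l1 /cvg_cmodP/cvgrPdist_le l2] := hg r r0.
have [n d] : at_inf (nn r (fun x => g r (- x)) (fun x => - cderive (g r) (- x))) 1 /\
    at_inf (dd r (fun x => g r (- x)) (fun x => - cderive (g r) (- x))) (0 +i* r).
  apply: nd_limits => // c c0; have [M [_ h]] := l1 c c0; have [N [_ h']] := l2 c c0.
  exists (Num.max (- M) (- N) + 1) => x hx; have [xM xN] : - x < M /\ - x < N.
    have [] : - M <= Num.max (- M) (- N) /\ - N <= Num.max (- M) (- N) by rewrite !le_max !lexx orbT.
    by split; lra.
  have := h _ xM; have := h' _ xN; rewrite !sub0r !normrN !ger0_norm// mulrN opprK => k1 k2.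
  by split => //; rewrite mulNr -mulrN -invrN -mulNr.
by split => //; apply: sol_refl; exact: schrodinger_sol.
Qed.

(** Replaces u by p in the form u1 h2 + u2 h1; the determinant u1 p2 - u2 p1 measures the error. *)
Lemma bilinear_transfer (u1 u2 p1 p2 h1 h2 : R[i]) :
  (cmod p1 + cmod p2) * cmod (u1 * h2 + u2 * h1) <= (cmod u1 + cmod u2) * cmod (p1 * h2 + p2 * h1) +
    cmod (u1 * p2 - u2 * p1) * (cmod h1 + cmod h2).
Proof.
have e1 : p1 * (u1 * h2 + u2 * h1) = u1 * (p1 * h2 + p2 * h1) - (u1 * p2 - u2 * p1) * h1 by ring.
have e2 : p2 * (u1 * h2 + u2 * h1) = u2 * (p1 * h2 + p2 * h1) + (u1 * p2 - u2 * p1) * h2 by ring.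
have := cmodB (u1 * (p1 * h2 + p2 * h1)) ((u1 * p2 - u2 * p1) * h1); rewrite -e1 !cmodM.
have := cmodD (u2 * (p1 * h2 + p2 * h1)) ((u1 * p2 - u2 * p1) * h2); rewrite -e2 !cmodM.
lra.
Qed.

Section algebra.
Variables (a a' b b' : R -> R[i]).
Hypotheses (ja : jost_data a a') (jb : jost_data b b').
(** With a, a' from e and b, b' from the reflected g, w is 2ir times the scattering coefficient a at
    r, v is 2ir times the coefficient b at -r, and R = - v / w ([reflectionE]). *)
Let w r := a r * b' r + a' r * b r.
Let v r := a (- r) * b' r + a' (- r) * b r.

(** This is |a|^2 = 1 + |b|^2 for the scattering coefficients, multiplied by 4 r^2; it is the
    product of the two Wronskian identities. *)
Lemma wv_sqr r : r != 0 -> cmod (w r) ^+ 2 = cmod (v r) ^+ 2 + 4 * r ^+ 2.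
Proof.
move=> r0; apply: Cinj; rewrite CD -!mul_conj /w /v !conjcD !conjcM.
have [a1 a2] := jd_conj ja r0; have [b1 b2] := jd_conj jb r0.
have wa := jd_wron ja r0; have wb := jd_wron jb r0.
rewrite a1 a2 in wa *; rewrite b1 b2 in wb; rewrite !conjcK2.
have -> : (4 * r ^+ 2)%:C = - (- (0 +i* (2 * r))) * (- (0 +i* (2 * r))).
  by cx_ring.
by rewrite -{1}wa -wb; ring.
Qed.

Lemma w_neq0 r : r != 0 -> w r != 0.
Proof.
move=> r0; rewrite -cmod_gt0 lt_neqAle cmod_ge0 andbT; apply/eqP => E.
have := wv_sqr r0; rewrite -E expr0n /=; have := sqr_ge0 (cmod (v r)).
by have : 0 < r ^+ 2; [rewrite exprn_even_gt0|lra].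
Qed.

Lemma ratio_le1 r : r != 0 -> cmod (v r / w r) <= 1.
Proof.
move=> r0; have w0 : 0 < cmod (w r) by rewrite cmod_gt0 w_neq0.
rewrite cmod_div ler_pdivrMr// mul1r -(@ler_pXn2r _ 2) ?nnegrE//.
by rewrite wv_sqr// lerDl mulr_ge0 ?sqr_ge0.
Qed.

(** By [wv_sqr], |v/w|^2 = 1 - 4 r^2 / |w|^2, which is at most 1 - 4/B^2 when |w| <= B |r|. *)
Definition ratio (B : R) := Num.sqrt (1 - 4 / B ^+ 2).

Lemma ratio_lt1 B : 0 < B -> ratio B < 1.
Proof.
move=> B0; rewrite -sqrtr1 ltr_sqrt ?ltr01// gtrBl divr_gt0// exprn_gt0//.
Qed.

Lemma ratio_bound r B : r != 0 -> 0 < B -> cmod (w r) <= B * `|r| -> cmod (v r / w r) <= ratio B.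
Proof.
move=> r0 B0 h; have w0 : 0 < cmod (w r) by rewrite cmod_gt0 w_neq0.
have c0 : 0 <= cmod (v r / w r) by [].
rewrite -[leLHS](ger0_norm c0) -sqrtr_sqr; apply: ler_wsqrtr.
rewrite cmod_div expr_div_n ler_pdivrMr ?exprn_gt0//.
have W := wv_sqr r0; have h2 : cmod (w r) ^+ 2 <= (B * `|r|) ^+ 2.
  by apply: lerXn2r => //; rewrite nnegrE ?mulr_ge0// ltW.
have : 4 / B ^+ 2 * cmod (w r) ^+ 2 <= 4 / B ^+ 2 * (B * `|r|) ^+ 2 by rewrite ler_wpM2l// divr_ge0 ?sqr_ge0.
have -> : 4 / B ^+ 2 * (B * `|r|) ^+ 2 = 4 * r ^+ 2.
  by rewrite exprMn (real_normK (num_real r)); field; rewrite gt_eqF.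
lra.
Qed.

Lemma ratio_away d : 0 < d -> exists2 k, k < 1 & forall r, d <= `|r| -> cmod (v r / w r) <= k.
Proof.
move=> d0; have [C C0 hC] := jd_up ja; have [M M0 hM] := jd_up jb.
pose B := 2 * C * M * ((1 + d) / d).
have B0 : 0 < B by rewrite !mulr_gt0 ?invr_gt0// addr_gt0.
exists (ratio B); first exact: ratio_lt1.
move=> r dr; have rp : 0 < `|r| by exact: lt_le_trans dr.
have r0 : r != 0 by rewrite -normr_gt0.
apply: ratio_bound => //; have [c1 c2] := hC r r0; have [m1 m2] := hM r r0.
apply: le_trans (_ : 2 * C * M * (1 + `|r|) <= _).
  apply: le_trans (cmodD _ _) _; rewrite !cmodM.
  have : cmod (a r) * cmod (b' r) <= C * (M * (1 + `|r|)) by apply: ler_pM; rewrite ?cmod_ge0.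
  have : cmod (a' r) * cmod (b r) <= C * (1 + `|r|) * M by apply: ler_pM; rewrite ?cmod_ge0.
  lra.
rewrite /B -!mulrA !ler_pM2l// [d^-1 * _]mulrC mulrA ler_pdivlMr//; nra.
Qed.

(** [bilinear_transfer] twice, once for each of the two Jost solutions, leads from w r to w s; the
    determinants are O(|r|) by [jd_pert]. *)
Lemma w_transfer : exists B d, [/\ 0 < B, 0 < d & forall r s, s != 0 -> `|s| <= `|r| -> `|r| <= d ->
  cmod (w r) <= B * (`|r| + cmod (w s))].
Proof.
have [C C0 hC] := jd_up ja; have [M M0 hM] := jd_up jb.
have [Ca [da [Ca0 da0 pa]]] := jd_pert ja; have [Cb [db [Cb0 db0 pb]]] := jd_pert jb.
have [ca ca0 la] := jd_low ja; have [cb cb0 lb] := jd_low jb.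
pose d := Num.min 1 (Num.min da db).
have [d1 d2 d3] : [/\ d <= 1, d <= da & d <= db] by rewrite /d !ge_min !lexx !orbT.
have d0 : 0 < d by rewrite !lt_min ltr01 da0.
pose B1 := (3 * C + 3 * M * Ca) / ca.
have nn1 : 0 <= 3 * C /\ 0 <= 3 * M by split; rewrite mulr_ge0// ltW.
have nn2 : 0 <= 3 * M * Ca /\ 0 <= 3 * C * Cb by split; rewrite mulr_ge0 ?mulr_ge0// ltW.
have B10 : 0 < B1 by rewrite divr_gt0// ltr_wpDr ?mulr_gt0//; case: nn2.
pose B2 := (3 * M + 3 * C * Cb) / cb.
have B20 : 0 < B2 by rewrite divr_gt0// ltr_wpDr ?mulr_gt0//; case: nn2.
exists (B1 * (1 + B2)), d; split => //; first by rewrite mulr_gt0// addr_gt0.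
move=> r s s0 sr rd; have r0 : r != 0 by rewrite -normr_gt0 (lt_le_trans _ sr)// normr_gt0.
have up (f f' : R -> R[i]) (D u : R) : 0 < D -> u != 0 -> `|u| <= d -> cmod (f u) <= D /\ cmod (f' u) <= D * (1 + `|u|) ->
    cmod (f u) + cmod (f' u) <= 3 * D.
  move=> D0 u0 ud [h1 h2]; have : D * (1 + `|u|) <= D * 2 by rewrite ler_wpM2l ?(ltW D0)//; lra.
  lra.
have ar := up _ _ _ _ C0 r0 rd (hC r r0). have sd := le_trans sr rd.
have as_ := up _ _ _ _ C0 s0 sd (hC s s0).
have br := up _ _ _ _ M0 r0 rd (hM r r0). have bs := up _ _ _ _ M0 s0 sd (hM s s0).
have p1 := pa r s s0 sr (le_trans rd d2); have p2 := pb r s s0 sr (le_trans rd d3).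
set z := a s * b' r + a' s * b r.
have k1 : cmod (w r) <= B1 * (`|r| + cmod z).
  have := bilinear_transfer (a r) (a' r) (a s) (a' s) (b r) (b' r); rewrite -/(w r) -/z => t.
  have : ca * cmod (w r) <= (cmod (a s) + cmod (a' s)) * cmod (w r) by rewrite ler_wpM2r// la.
  have : (cmod (a r) + cmod (a' r)) * cmod z <= 3 * C * cmod z by rewrite ler_wpM2r ?cmod_ge0.
  have : cmod (a r * a' s - a' r * a s) * (cmod (b r) + cmod (b' r)) <= Ca * `|r| * (3 * M).
    by apply: ler_pM; rewrite ?addr_ge0 ?cmod_ge0.
  move=> h1 h2 h3; rewrite /B1 mulrAC ler_pdivlMr//.
  have : 0 <= 3 * C * `|r| by rewrite mulr_ge0//; case: nn1.
  have : 0 <= 3 * M * Ca * cmod z by rewrite mulr_ge0//; case: nn2.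
  lra.
have k2 : cmod z <= B2 * (`|r| + cmod (w s)).
  have := bilinear_transfer (b r) (b' r) (b s) (b' s) (a s) (a' s).
  rewrite (_ : b r * a' s + _ = z); last by rewrite /z; ring.
  rewrite (_ : b s * a' s + _ = w s); last by rewrite /w; ring.
  move=> t; have : cb * cmod z <= (cmod (b s) + cmod (b' s)) * cmod z by rewrite ler_wpM2r// lb.
  have : (cmod (b r) + cmod (b' r)) * cmod (w s) <= 3 * M * cmod (w s) by rewrite ler_wpM2r ?cmod_ge0.
  have : cmod (b r * b' s - b' r * b s) * (cmod (a s) + cmod (a' s)) <= Cb * `|r| * (3 * C).
    by apply: ler_pM; rewrite ?addr_ge0 ?cmod_ge0.
  move=> h1 h2 h3; rewrite /B2 mulrAC ler_pdivlMr//.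
  have : 0 <= 3 * M * `|r| by rewrite mulr_ge0//; case: nn1.
  have : 0 <= 3 * C * Cb * cmod (w s) by rewrite mulr_ge0//; case: nn2.
  lra.
apply: le_trans k1 _; rewrite -mulrA ler_wpM2l ?(ltW B10)// mulrDl mul1r.
have := cmod_ge0 (w s); lra.
Qed.

(** The two cases at zero energy. If w stays away from 0, then w - v tends to 0 by [jd_sym] and v/w
    tends to 1. Otherwise w s is small for some s arbitrarily close to 0, and [w_transfer] gives |w
    r| <= B |r|. *)
Lemma ratio_near :
  (exists k d, [/\ k < 1, 0 < d & forall r, r != 0 -> `|r| < d -> cmod (v r / w r) <= k]) \/
  (forall c, 0 < c -> exists2 d, 0 < d & forall r, r != 0 -> `|r| < d -> cmod (1 - v r / w r) <= c).
Proof.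
have [B [d [B0 d0 hB]]] := w_transfer.
have [[h dh] | H] := pselect (exists2 h, 0 < h & exists2 d', 0 < d' & forall s, s != 0 -> `|s| < d' -> h <= cmod (w s)).
  move=> [d' d'0 hd']; right => c c0; have [M M0 hM] := jd_up jb.
  have e0 : 0 < c * h / (3 * M) by rewrite divr_gt0 ?mulr_gt0.
  have [d1 d10 h1] := jd_sym ja e0; exists (Num.min 1 (Num.min d1 d')); first by rewrite !lt_min ltr01 d10.
  move=> r r0; rewrite !lt_min => /and3P[r1 /h1 rd /hd' hw]; have [s1 s2] := rd r0; have {}hw := hw r0.
  have w0 := w_neq0 r0; have wp : 0 < cmod (w r) by rewrite cmod_gt0.
  have -> : 1 - v r / w r = (w r - v r) / w r by rewrite mulrBl divff.
  have -> : w r - v r = (a r - a (- r)) * b' r + (a' r - a' (- r)) * b r by rewrite /w /v; ring.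
  rewrite cmod_div ler_pdivrMr//; apply: le_trans (cmodD _ _) _; rewrite !cmodM.
  have [m1 m2] := hM r r0.
  have : cmod (a r - a (- r)) * cmod (b' r) <= c * h / (3 * M) * (M * 2).
    apply: ler_pM => //; apply: le_trans m2 _; rewrite ler_wpM2l ?(ltW M0)//; lra.
  have : cmod (a' r - a' (- r)) * cmod (b r) <= c * h / (3 * M) * M by apply: ler_pM; rewrite ?cmod_ge0.
  have : c * h / (3 * M) * (3 * M) = c * h by rewrite divfK// gt_eqF// mulr_gt0.
  have : c * h <= c * cmod (w r) by rewrite ler_pM2l.
  lra.
left; exists (ratio B), d; split => //; first exact: ratio_lt1.
move=> r r0 rd; apply: ratio_bound => //; apply/ler_addgt0Pr => c c0.
have cB : 0 < c / B by rewrite divr_gt0.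
have [s [s0 sr ws]] : exists s, [/\ s != 0, `|s| <= `|r| & cmod (w s) <= c / B].
  apply: contrapT => N; apply: H; exists (c / B) => //; exists `|r|; first by rewrite normr_gt0.
  by move=> s s0 sr; rewrite leNgt; apply/negP => lt; apply: N; exists s; split => //; exact: ltW.
apply: le_trans (hB r s s0 sr (ltW rd)) _; rewrite mulrDr lerD2l -ler_pdivlMl// mulrC//.
Qed.

End algebra.

Section reflection.
Variables (q : R -> R) (e g : R -> R -> R[i]).
Hypotheses (rq0 : rI (fun x => `|q x|)) (rq1 : rI (fun x => `|x| * `|q x|)).
Hypotheses (he : jost_right q e) (hg : jost_left q g).
Let a r := e r 0.
Let a' r := cderive (e r) 0.
Let b r := g r (- 0).
Let b' r := - cderive (g r) (- 0).

Lemma jost_data_right : jost_data a a'.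
Proof. exact: (jost_facts rq0 rq1 (jost_right_sol he)). Qed.

Lemma jost_data_left : jost_data b b'.
Proof.
apply: (jost_facts (q := fun x => q (- x))) (jost_left_sol hg); first exact: (rI_refl rq0).
by apply: eq_rI (rI_refl rq1) => x; rewrite normrN.
Qed.

Lemma reflectionE r : r != 0 -> reflection e g r =
  - ((a (- r) * b' r + a' (- r) * b r) / (a r * b' r + a' r * b r)).
Proof.
move=> r0; have w0 := w_neq0 jost_data_right jost_data_left r0.
have ir : 0 +i* (2 * r) != 0 by apply: Im_neq0; rewrite /= mulf_neq0.
rewrite /reflection /scat_b /scat_a /wronskian !opprK /b' /b oppr0 /a /a' in w0 *.
have -> : 0 +i* (2 * - r) = - (0 +i* (2 * r)) by cx_eq; rewrite ?oppr0 ?mulrN.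
move: (e r 0) (cderive (e r) 0) (e (- r) 0) (cderive (e (- r)) 0) (g r 0) (cderive (g r) 0) w0 ir.
move=> p p' m m' u u'; move: (0 +i* (2 * r)) => c w0 c0.
have w1 : p * u' - p' * u != 0.
  by apply: contraNneq w0 => E; apply/eqP; rewrite -[LHS]opprK -[RHS]oppr0 -E; ring.
field; rewrite c0 /=; apply/andP; split => //.
Qed.

Theorem reflection_bounds :
  [/\ forall r, r != 0 -> cmod (reflection e g r) <= 1,
    forall d, 0 < d -> exists2 k, k < 1 & forall r, d <= `|r| -> cmod (reflection e g r) <= k &
    (exists k d, [/\ k < 1, 0 < d & forall r, r != 0 -> `|r| < d -> cmod (reflection e g r) <= k]) \/
    (forall c, 0 < c -> exists2 d, 0 < d & forall r, r != 0 -> `|r| < d -> cmod (reflection e g r + 1) <= c)].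
Proof.
have [ja jb] := (jost_data_right, jost_data_left); split.
- by move=> r r0; rewrite reflectionE// cmodN; exact: ratio_le1.
- move=> d d0; have [k k1 hk] := ratio_away ja jb d0; exists k => // r dr.
  have r0 : r != 0 by rewrite -normr_gt0 (lt_le_trans d0).
  by rewrite reflectionE// cmodN; exact: hk.
- have [[k [d [k1 d0 h]]]|h] := ratio_near ja jb; [left|right].
    by exists k, d; split => // r r0 rd; rewrite reflectionE// cmodN; exact: h.
  move=> c c0; have [d d0 hd] := h c c0; exists d => // r r0 rd.
  by rewrite reflectionE// addrC; exact: hd.
Qed.
End reflection.
End reflection_coefficient.

(** * Differentiating the solution of an operator equation in a parameter *)

Section smooth_solutions.
Variable R : realType.
Implicit Types (v w f g y : R -> R -> R[i]) (u : R -> R[i]) (x h e : R).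

Definition vd v w := forall x e, 0 < e -> exists2 d, 0 < d & forall h, `|h| < d ->
  nrm (fun r => v (x + h) r - v x r - h%:C * w x r) <= e * `|h|.

(** n-fold differentiability in x as a map into L2, all derivatives staying in [hardy]. The
    parameter x comes first here, unlike in [partial_x]. *)
Fixpoint vsm n v : Prop := (forall x, hardy (v x)) /\
  (if n is n'.+1 then exists2 w, vd v w & vsm n' w else True).

Lemma vsm_hardy n v x : vsm n v -> hardy (v x). Proof. by case: n => [|n] []. Qed.
Lemma vsm_l2 n v x : vsm n v -> l2 (v x). Proof. by move=> /vsm_hardy h; exact: hardy_l2. Qed.

Lemma vsmW n v : vsm n.+1 v -> vsm n v.
Proof.
elim: n v => [|n IH] v [h [w vw sw]]; first by split.
by split => //; exists w => //; exact: IH.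
Qed.

Lemma vd_lin f f' g g' (c : R[i]) : (forall x, l2 (f x)) -> (forall x, l2 (f' x)) -> (forall x, l2 (g x)) ->
  (forall x, l2 (g' x)) -> vd f f' -> vd g g' ->
  vd (fun x r => f x r + c * g x r) (fun x r => f' x r + c * g' x r).
Proof.
move=> lf lf' lg lg' hf hg x e e0; have c1 : 0 < 2 * (cmod c + 1) by rewrite mulr_gt0// ltr_wpDl ?cmod_ge0.
have e2 : 0 < e / 2 by rewrite divr_gt0.
have [d1 d10 h1] := hf x _ e2; have [d2 d20 h2] := hg x _ (divr_gt0 e0 c1).
exists (Num.min d1 d2); first by rewrite lt_min d10.
move=> h; rewrite lt_min => /andP[/h1{}h1 /h2{}h2].
have la : l2 (fun r => f (x + h) r - f x r - h%:C * f' x r) by apply: l2B; [exact: l2B|exact: l2Z].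
have lb : l2 (fun r => g (x + h) r - g x r - h%:C * g' x r) by apply: l2B; [exact: l2B|exact: l2Z].
rewrite (eq_nrm (g := fun r => (f (x + h) r - f x r - h%:C * f' x r) + c * (g (x + h) r - g x r - h%:C * g' x r))); last first.
  by move=> r; ring.
apply: le_trans (nrmD la (l2Z c lb)) _; rewrite nrmZ//.
have : cmod c * nrm (fun r => g (x + h) r - g x r - h%:C * g' x r) <= cmod c * (e / (2 * (cmod c + 1)) * `|h|).
  by rewrite ler_wpM2l ?cmod_ge0.
have : e / (2 * (cmod c + 1)) * (2 * (cmod c + 1)) = e by rewrite divfK// gt_eqF.
set b := e / _; have b0 : 0 < b by rewrite divr_gt0.
have : 0 <= b * `|h| by rewrite mulr_ge0// ltW.
move=> k1 k2 k3; have : cmod c * (b * `|h|) + b * `|h| = e / 2 * `|h|.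
  by rewrite -k2; field.
lra.
Qed.

Lemma vsm_lin n f g (c : R[i]) : vsm n f -> vsm n g -> vsm n (fun x r => f x r + c * g x r).
Proof.
elim: n f g => [|n IH] f g.
  by move=> [hf _] [hg _]; split=> // x; apply: hardyD => //; exact: hardyZ.
move=> sf sg; have [hf [f' vf sf']] := sf; have [hg [g' vg sg']] := sg.
split; first by move=> x; apply: hardyD => //; exact: hardyZ.
exists (fun x r => f' x r + c * g' x r); last exact: IH.
by apply: vd_lin => // x; [exact: vsm_l2 sf|exact: vsm_l2 sf'|exact: vsm_l2 sg|exact: vsm_l2 sg'].
Qed.

Section operator_family.
(** [Op l x] plays the l-th x-derivative of [Op 0 x]. Differentiability is assumed on each fixed u
    only, which together with the local bounds suffices for the product rule [Op_vd]; linearity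
    holds modulo null sets. *)
Variables (k : nat) (Op : nat -> R -> (R -> R[i]) -> R -> R[i]).
Hypothesis Oh : forall l x u, (l <= k)%N -> hardy u -> hardy (Op l x u).
Hypothesis Olin : forall l x (u v : R -> R[i]) (c : R[i]), (l <= k)%N -> hardy u -> hardy v ->
  {ae mu, forall r, Op l x (fun t => u t + c * v t) r = Op l x u r + c * Op l x v r}.
Hypothesis Obd : forall l x, (l <= k)%N -> exists2 C, 0 <= C & forall h u, `|h| <= 1 -> hardy u ->
  nrm (Op l (x + h) u) <= C * nrm u.
Hypothesis Ovd : forall l u, (l < k)%N -> hardy u -> vd (fun x => Op l x u) (fun x => Op l.+1 x u).
Hypothesis Oth : forall x, exists2 th, 0 <= th < 1 & exists2 d, 0 < d & forall h u, `|h| <= d -> hardy u ->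
  nrm (Op 0 (x + h) u) <= th * nrm u.

Let Ol2 l x u : (l <= k)%N -> hardy u -> l2 (Op l x u).
Proof. by move=> lk hu; apply: hardy_l2; exact: Oh. Qed.

Lemma Op_B l x (u v : R -> R[i]) : (l <= k)%N -> hardy u -> hardy v ->
  {ae mu, forall r, Op l x (fun t => u t - v t) r = Op l x u r - Op l x v r}.
Proof.
move=> lk hu hv; apply: (aeS (Olin x (-1) lk hu hv)) => r; rewrite !mulN1r => <-.
by congr (Op l x _ r); apply/funext => t; rewrite mulN1r.
Qed.

Lemma Op_strong_cont l x u e : (l < k)%N -> hardy u -> 0 < e -> exists2 d, 0 < d & forall h, `|h| < d ->
  nrm (fun r => Op l (x + h) u r - Op l x u r) <= e.
Proof.
move=> lk hu e0; have [d d0 hd] := Ovd lk hu x ltr01.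
have N0 := nrm_ge0 (Op l.+1 x u); have N1 : 0 < 1 + nrm (Op l.+1 x u) by rewrite ltr_wpDr.
exists (Num.min d (e / (1 + nrm (Op l.+1 x u)))); first by rewrite lt_min d0 divr_gt0.
move=> h; rewrite lt_min ltr_pdivlMr// => /andP[/hd{}hd he].
have lk' := ltnW lk; have lh := Ol2 (x + h) lk' hu; have l0 := Ol2 x lk' hu; have l1 := Ol2 x lk hu.
rewrite (eq_nrm (g := fun r => (Op l (x + h) u r - Op l x u r - h%:C * Op l.+1 x u r) + h%:C * Op l.+1 x u r)); last first.
  by move=> r; rewrite subrK.
apply: le_trans (nrmD _ _) _; [by apply: l2B; [exact: l2B|exact: l2Z]|exact: l2Z|].
rewrite nrmZ// cmod_real; lra.
Qed.

Lemma Op_vd l y y' : (l < k)%N -> (forall x, hardy (y x)) -> (forall x, hardy (y' x)) -> vd y y' ->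
  vd (fun x => Op l x (y x)) (fun x r => Op l.+1 x (y x) r + Op l x (y' x) r).
Proof.
move=> lk hy hy' vy x e e0; have lk' := ltnW lk.
have [C C0 hC] := Obd x lk'; have C1 : 0 < 3 * (C + 1) by rewrite mulr_gt0// ltr_wpDl.
have e3 : 0 < e / 3 by rewrite divr_gt0.
have [d1 d10 h1] := vy x _ (divr_gt0 e0 C1); have [d2 d20 h2] := Op_strong_cont x lk (hy' x) e3.
have [d3 d30 h3] := Ovd lk (hy x) x e3.
exists (Num.min 1 (Num.min d1 (Num.min d2 d3))); first by rewrite !lt_min ltr01 d10 d20.
move=> h; rewrite !lt_min => /and4P[hh1 /h1{}h1 /h2{}h2 /h3{}h3].
pose w r := y (x + h) r - y x r - h%:C * y' x r.
have hw : hardy w by apply: hardyB; [exact: hardyB|exact: hardyZ].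
have hyd : hardy (fun r => y (x + h) r - y x r) by exact: hardyB.
pose A r := Op l (x + h) w r; pose B r := Op l (x + h) (y' x) r - Op l x (y' x) r.
pose D r := Op l (x + h) (y x) r - Op l x (y x) r - h%:C * Op l.+1 x (y x) r.
have lA : l2 A by exact: Ol2. have lB : l2 B by apply: l2B; exact: Ol2.
have lD : l2 D by apply: l2B; [apply: l2B; exact: Ol2|apply: l2Z; exact: Ol2].
rewrite (nrm_ae (g := fun r => A r + (h%:C * B r + D r))); last first.
  apply: (aeS (aeI (Olin (x + h) (- h%:C) lk' hyd (hy' x)) (Op_B (x + h) lk' (hy (x + h)) (hy x)))) => r [E1 E2].
  rewrite /A /w (_ : (fun r => _) = (fun t => y (x + h) t - y x t + - h%:C * y' x t)); last first.
    by apply/funext => t; rewrite mulNr.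
  by rewrite E1 E2 /B /D; ring.
apply: le_trans (nrmD lA (l2D (l2Z _ lB) lD)) _.
apply: le_trans (lerD (lexx _) (nrmD (l2Z _ lB) lD)) _; rewrite nrmZ// cmod_real.
have a1 : nrm A <= C * (e / (3 * (C + 1)) * `|h|).
  by apply: le_trans (hC h w (ltW hh1) hw) _; rewrite ler_wpM2l.
have a2 : `|h| * nrm B <= `|h| * (e / 3) by rewrite ler_wpM2l.
have a3 : C * (e / (3 * (C + 1)) * `|h|) <= e / 3 * `|h|.
  rewrite mulrA ler_wpM2r// mulrCA -[leRHS]mulr1 -mulrA ler_wpM2l ?(ltW e0)//.
  by rewrite invfM mulrCA mulr1 ler_piMr ?invr_ge0// ler_pdivrMr ?ltr_wpDl// mul1r lerDl.
by rewrite -/D in h3; lra.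
Qed.

Lemma Op_vsm n l y : (l + n <= k)%N -> vsm n y -> vsm n (fun x => Op l x (y x)).
Proof.
elim: n l y => [|n IH] l y ln sy.
  by split => // x; apply: Oh; [rewrite addn0 in ln|exact: vsm_hardy sy].
have [hy [y' vy sy']] := sy; have lk : (l < k)%N by apply: leq_trans ln; rewrite addnS ltnS leq_addr.
split; first by move=> x; apply: Oh; [exact: ltnW|].
exists (fun x r => Op l.+1 x (y x) r + Op l x (y' x) r).
  by apply: Op_vd => // x; exact: vsm_hardy sy'.
have s1 : vsm n (fun x => Op l.+1 x (y x)) by apply: IH; [rewrite addSn -addnS|exact: vsmW].
have s2 : vsm n (fun x => Op l x (y' x)) by apply: IH => //; apply: leq_trans ln; rewrite addnS.
have := vsm_lin 1 s1 s2; rewrite (_ : (fun x r => _ + 1 * _) = (fun x r => Op l.+1 x (y x) r + Op l x (y' x) r))//.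
by apply/funext => x; apply/funext => r; rewrite mul1r.
Qed.

Lemma coercive x th u (f : R -> R[i]) : 0 <= th < 1 -> hardy u -> l2 f -> nrm (Op 0 x u) <= th * nrm u ->
  {ae mu, forall r, u r + Op 0 x u r = f r} -> nrm u <= nrm f / (1 - th).
Proof.
move=> /andP[t0 t1] hu lf hO E; have lO := Ol2 x (leq0n k) hu; have lu := hardy_l2 hu.
rewrite ler_pdivlMr ?subr_gt0//.
have : nrm u <= nrm f + nrm (Op 0 x u).
  rewrite -(nrmN (Op 0 x u)) (nrm_ae (g := fun r => f r + - Op 0 x u r)).
    by apply: nrmD => //; exact: l2N.
  by apply: (aeS E) => r <-; rewrite addrK.
lra.
Qed.

Lemma neumann x (f : R -> R[i]) : hardy f -> exists2 u, hardy u & {ae mu, forall r, u r + Op 0 x u r = f r}.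
Proof.
move=> hf; have [th /andP[t0 t1] [d d0 hd]] := Oth x.
have O0 u : hardy u -> nrm (Op 0 x u) <= th * nrm u.
  by move=> hu; have := hd 0 u; rewrite addr0 normr0; apply => //; exact: ltW.
pose F n := iter n (fun u r => f r - Op 0 x u r) (fun=> 0).
have k0 := leq0n k.
have hF n : hardy (F n) by elim: n => [|n IH]; [exact: hardy0|apply: hardyB => //; exact: Oh].
have step n : nrm (fun r => F n.+1 r - F n r) <= th ^+ n * nrm f.
  elim: n => [|n IH].
    rewrite expr0 mul1r; have h0 := O0 _ (hardy0 R); rewrite nrm0 mulr0 in h0.
    rewrite (eq_nrm (g := fun r => f r + - Op 0 x (fun=> 0) r)); last by move=> r; rewrite subr0.
    apply: le_trans (nrmD (hardy_l2 hf) (l2N (Ol2 x k0 (hardy0 R)))) _.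
    by rewrite nrmN gerDl.
  rewrite (nrm_ae (g := fun r => - Op 0 x (fun t => F n.+1 t - F n t) r)); last first.
    by apply: (aeS (Op_B x k0 (hF n.+1) (hF n))) => r ->; rewrite /F /=; ring.
  rewrite nrmN; apply: le_trans (O0 _ (hardyB (hF n.+1) (hF n))) _.
  by rewrite exprS -mulrA ler_wpM2l.
have cau m j : nrm (fun r => F (m + j)%N r - F m r) <= th ^+ m * nrm f / (1 - th).
  have -> : nrm (fun r => F (m + j)%N r - F m r) = nrm (fun r => \sum_(i < j) (F (m + i).+1 r - F (m + i)%N r)).
    have tele (a : nat -> R[i]) : a (m + j)%N - a m = \sum_(i < j) (a (m + i).+1 - a (m + i)%N).
      elim: j => [|j IH]; first by rewrite addn0 subrr big_ord0.
      by rewrite big_ord_recr /= -IH addnS; ring.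
    by apply: eq_nrm => r; exact: (tele (F ^~ r)).
  apply: le_trans (nrm_sum _ _) _; first by move=> i; apply: l2B; exact: hardy_l2.
  rewrite ler_pdivlMr ?subr_gt0//.
  have : (\sum_(i < j) nrm (fun r => F (m + i).+1 r - F (m + i)%N r)) * (1 - th) <= (\sum_(i < j) th ^+ (m + i) * nrm f) * (1 - th).
    by rewrite ler_wpM2r ?subr_ge0 ?(ltW t1)//; apply: ler_sum => i _; exact: step.
  move/le_trans; apply; have -> : (\sum_(i < j) th ^+ (m + i) * nrm f) * (1 - th) = th ^+ m * nrm f * (1 - th ^+ j).
    elim: j => [|j IH]; first by rewrite big_ord0 mul0r expr0 subrr mulr0.
    by rewrite big_ord_recr /= mulrDl IH exprD exprS; ring.
  by rewrite ler_piMr ?mulr_ge0 ?exprn_ge0// gerBl exprn_ge0.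
have th0 : th ^+ n @[n --> \oo] --> 0 by apply: cvg_expr; rewrite ger0_norm.
have [u lu cu] : exists2 u, l2 u & nrm (fun r => F n r - u r) @[n --> \oo] --> 0.
  apply: l2_complete => [n|e e0]; first exact: hardy_l2.
  pose c := nrm f / (1 - th) + 1; have c0 : 0 < c by rewrite ltr_wpDl// divr_ge0 ?subr_ge0 ?(ltW t1).
  have [N hN] := (seq_cvg0P (fun n => exprn_ge0 n t0)).1 th0 _ (divr_gt0 e0 c0).
  have small m j : (N <= m)%N -> nrm (fun r => F (m + j)%N r - F m r) < e.
    move=> /hN; rewrite ltr_pdivlMr// /c => h; apply: le_lt_trans (cau m j) _; rewrite -mulrA.
    by apply: le_lt_trans h; rewrite ler_wpM2l ?exprn_ge0// lerDl.
  exists N => m n Nm Nn; have [mn|nm] := leqP m n.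
    by rewrite nrm_sym -(subnKC mn); exact: small.
  by rewrite -(subnKC (ltnW nm)); exact: small.
have hu : hardy u by exact: hardy_lim hF lu cu.
exists u => //; have lO := Ol2 x k0 hu.
have l1 : l2 (fun r => u r + Op 0 x u r - f r) by apply: l2B; [exact: l2D|exact: hardy_l2].
have z0 : nrm (fun r => u r + Op 0 x u r - f r) <= 0.
  apply/ler_addgt0Pr => e e0; rewrite add0r; have e2 : 0 < e / 2 by rewrite divr_gt0.
  have [N hN] := (seq_cvg0P (fun n => nrm_ge0 _)).1 cu _ e2.
  have b1 := hN N (leqnn N); have b2 := hN N.+1 (leqnSn N).
  have lN := hardy_l2 (hF N); have lN1 := hardy_l2 (hF N.+1).
  rewrite (nrm_ae (g := fun r => (u r - F N.+1 r) + Op 0 x (fun t => u t - F N t) r)); last first.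
    by apply: (aeS (Op_B x k0 hu (hF N))) => r ->; rewrite /F /=; ring.
  apply: le_trans (nrmD (l2B lu lN1) (Ol2 x k0 (hardyB hu (hF N)))) _.
  have := O0 _ (hardyB hu (hF N)); rewrite (nrm_sym u (F N)) (nrm_sym u (F N.+1)).
  have := nrm_ge0 (fun r => F N r - u r); nra.
apply: (aeS (ae_nrm0 l1 _)) => [|r /eqP]; first by apply/eqP; rewrite eq_le z0 nrm_ge0.
by rewrite subr_eq0 => /eqP.
Qed.

(** Induction on n. The candidate z for the derivative solves the equation differentiated formally,
    with right side f' - Op 1 y, which is smooth of order n because y already is; the induction
    hypothesis then applies to z. *)
Theorem vsm_solution n y f : (n <= k)%N -> (forall x, hardy (y x)) -> vsm n f ->
  (forall x, {ae mu, forall r, y x r + Op 0 x (y x) r = f x r}) -> vsm n y.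
Proof.
elim: n y f => [|n IH] y f nk hy sf sol; first by split.
have [hf [f' vf sf']] := sf; have k0 := leq0n k; have kp : (0 < k)%N by exact: leq_trans nk.
have sy : vsm n y by apply: IH sol => //; [exact: ltnW|exact: vsmW].
pose g x r := f' x r + (-1) * Op 1 x (y x) r.
have sg : vsm n g by apply: vsm_lin => //; exact: Op_vsm.
have hz x : exists u, hardy u /\ {ae mu, forall r, u r + Op 0 x u r = g x r}.
  by have [u h1 h2] := neumann x (vsm_hardy x sg); exists u.
have [z hz'] := choice hz; have {hz hz'} [hz ez] : (forall x, hardy (z x)) /\ forall x, {ae mu, forall r, z x r + Op 0 x (z x) r = g x r}.
  by split => x; case: (hz' x).
split => //; exists z; last by apply: IH ez => //; exact: ltnW.
move=> x e e0; have [th tt [d0 d00 hd0]] := Oth x; have /andP[t0 t1] := tt.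
have t1' : 0 < 1 - th by rewrite subr_gt0.
pose e1 := e * (1 - th) / 3; have e10 : 0 < e1 by rewrite divr_gt0// mulr_gt0.
have [d1 d10 h1] := vf x _ e10; have [d2 d20 h2] := Ovd kp (hy x) x e10.
have [d3 d30 h3] := Op_strong_cont x kp (hz x) e10.
exists (Num.min d0 (Num.min d1 (Num.min d2 d3))); first by rewrite !lt_min d00 d10 d20.
move=> h; rewrite !lt_min => /and4P[hh0 /h1{}h1 /h2{}h2 /h3{}h3].
pose E r := y (x + h) r - y x r - h%:C * z x r.
have hyd : hardy (fun r => y (x + h) r - y x r) by exact: hardyB.
have hE : hardy E by apply: hardyB => //; exact: hardyZ.
pose A r := f (x + h) r - f x r - h%:C * f' x r.
pose B r := Op 0 (x + h) (y x) r - Op 0 x (y x) r - h%:C * Op 1 x (y x) r.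
pose D r := Op 0 (x + h) (z x) r - Op 0 x (z x) r.
have lA : l2 A by apply: l2B; [apply: l2B; exact: hardy_l2|apply: l2Z; exact: vsm_l2 sf'].
have lB : l2 B by apply: l2B; [apply: l2B; exact: Ol2|apply: l2Z; exact: Ol2].
have lD : l2 D by apply: l2B; exact: Ol2.
(* The remainder E of the first-order expansion of y solves the equation at x + h with a right side
   that is o(h) in three pieces; [coercive] carries this over to E. Hence the factor (1 - th)/3 in
   e1. *)
have eq : {ae mu, forall r, E r + Op 0 (x + h) E r = A r - B r - h%:C * D r}.
  have o1 := Olin (x + h) (- h%:C) k0 hyd (hz x); have o2 := Op_B (x + h) k0 (hy (x + h)) (hy x).
  apply: (aeS (aeI (aeI o1 o2) (aeI (ez x) (aeI (sol x) (sol (x + h)))))) => r [[E1 E2] [E3 [E4 E5]]].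
  have EE : Op 0 (x + h) E r = Op 0 (x + h) (y (x + h)) r - Op 0 (x + h) (y x) r - h%:C * Op 0 (x + h) (z x) r.
    rewrite /E (_ : (fun r => _) = (fun t => y (x + h) t - y x t + - h%:C * z x t)).
      by rewrite E1 E2 mulNr.
    by apply/funext => t; rewrite mulNr.
  rewrite EE /A /B /D -E5 -E4 (_ : f' x r = z x r + Op 0 x (z x) r + Op 1 x (y x) r).
    by rewrite /E; ring.
  by rewrite E3 /g; ring.
have lr : l2 (fun r => A r - B r - h%:C * D r) by apply: l2B; [exact: l2B|exact: l2Z].
have := coercive tt hE lr (hd0 h E (ltW hh0) hE) eq.
move/le_trans; apply; rewrite ler_pdivrMr//.
apply: le_trans (nrmB (l2B lA lB) (l2Z _ lD)) _; apply: le_trans (lerD (nrmB lA lB) (lexx _)) _.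
rewrite nrmZ// cmod_real; have : `|h| * nrm D <= `|h| * e1 by rewrite ler_wpM2l.
rewrite -/A in h1; rewrite -/B in h2; have : e1 * 3 = e * (1 - th) by rewrite /e1 divfK.
move=> ee hD; have : e * `|h| * (1 - th) = e1 * 3 * `|h| by rewrite ee; ring.
lra.
Qed.

End operator_family.

Lemma partial_x_vd v w : (forall x, l2 (v x)) -> (forall x, l2 (w x)) -> vd v w ->
  partial_x (fun r x => v x r) (fun r x => w x r).
Proof.
move=> lv lw hv x; split; first exact/L2P.
have key h : h != 0 -> L2norm (fun r => (v (x + h) r - v x r) / h%:C - w x r) =
    (`|h|^-1 * nrm (fun r => v (x + h) r - v x r - h%:C * w x r))%:E.
  move=> h0; have hC : h%:C != 0 by exact: C_neq0.
  have E r : (v (x + h) r - v x r) / h%:C - w x r = h%:C^-1 * (v (x + h) r - v x r - h%:C * w x r) by field.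
  have l : l2 (fun r => v (x + h) r - v x r - h%:C * w x r) by apply: l2B; [exact: l2B|exact: l2Z].
  rewrite (_ : (fun r => _) = (fun r => h%:C^-1 * (v (x + h) r - v x r - h%:C * w x r))); last exact/funext.
  by rewrite L2normE; [rewrite nrmZ// cmodV cmod_real|exact: l2Z].
apply/fine_cvgP; split.
  near=> h; rewrite key//; near: h; exact: nbhs_dnbhs_neq.
apply/cvgrPdist_le => e e0; have [d d0 hd] := hv x e e0.
near=> h; have h0 : h != 0 by near: h; exact: nbhs_dnbhs_neq.
have hp : 0 < `|h| by rewrite normr_gt0.
have hh : `|h| < d by near: h; exact: dnbhs0_lt.
rewrite /= key//= sub0r normrN ger0_norm ?mulr_ge0 ?invr_ge0//.
by rewrite ler_pdivrMl// mulrC; exact: hd.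
Unshelve. all: by end_near. Qed.

Lemma vsm_partial n v : vsm n v -> forall j, (j <= n)%N ->
  exists2 w, partial_x_iter j (fun r x => v x r) (fun r x => w x r) & vsm (n - j) w.
Proof.
move=> sv; elim=> [|j IH] jn; first by exists v; rewrite ?subn0.
have [w pw sw] := IH (ltnW jn); have E : (n - j = (n - j.+1).+1)%N by rewrite subnSK.
rewrite E in sw; have [hw [w' vw sw']] := sw; exists w' => //=.
exists (fun r x => w x r) => //; apply: partial_x_vd => // x; first exact: hardy_l2.
exact: vsm_l2 sw'.
Qed.

End smooth_solutions.

(** * The cubic phase in the upper half-plane *)

Section phase.
Variable R : realType.
Implicit Types (z w : R[i]) (x t s h : R) (f : R -> R[i]).

Definition cexp w : R[i] := (expR (Re w))%:C * expi (Im w).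

Lemma cexpD z w : cexp (z + w) = cexp z * cexp w.
Proof. by rewrite /cexp ReD ImD expRD expiD CM; ring. Qed.
Lemma cexp0 : cexp 0 = 1. Proof. by rewrite /cexp Re0 Im0 expR0 expi0 mulr1. Qed.
Lemma cmod_cexp w : cmod (cexp w) = expR (Re w).
Proof. by rewrite cmodM cmod_expi mulr1 cmod_real ger0_norm ?expR_ge0. Qed.
Lemma cexp_imag (y : R) : cexp (0 +i* y) = expi y. Proof. by rewrite /cexp /= expR0 mul1r. Qed.

Lemma rder_cexp_line w (u : R) : rder (fun s => cexp (w * s%:C)) u (w * cexp (w * u%:C)).
Proof.
have d a : is_derive u (1 : R) (fun y : R => a * y : R) a.
  by apply: is_derive_eq; rewrite /GRing.scale /= mulr1.
have d1 a := is_derive1_comp (is_derive_expR (a * u)) (d a).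
have d2 a := is_derive1_comp (is_derive_cos (a * u)) (d a).
have d3 a := is_derive1_comp (is_derive_sin (a * u)) (d a).
have re := rder_derive1 (d1 (Re w)).
have ri := rderD (rder_derive1 (d2 (Im w))) (rderZ (0 +i* 1) (rder_derive1 (d3 (Im w)))).
have := rderM re ri.
rewrite (_ : (fun t => _) = (fun s => cexp (w * s%:C))); last first.
  apply/funext => s; rewrite /cexp [w * _]mulrC !ReImE; congr (_%:C * _); first by rewrite mulrC.
  by cx_eq; rewrite ?mulr0 ?mul0r ?mul1r ?subr0 ?addr0 ?add0r mulrC.
rewrite (_ : _ + _ = w * cexp (w * u%:C))//.
rewrite /cexp [w * u%:C]mulrC !ReImE; cx_eq; rewrite !(mulrC u); ring.
Qed.

Lemma cexp_lip w : cmod (cexp w - 1) <= cmod w * expR `|Re w|.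
Proof.
have := @mean_value_ineq R (fun s => cexp (w * s%:C)) (fun s => w * cexp (w * s%:C)) 0 1 (cmod w * expR `|Re w|) ler01.
rewrite mulr1 mulr0 cexp0 subr0 mulr1; apply => s hs; first exact: rder_cexp_line.
move/andP: hs => [s0 s1]; rewrite cmodM cmod_cexp ler_wpM2l// ler_expR mulrC ReZ.
apply: le_trans (ler_norm _) _; rewrite normrM ger0_norm// ler_piMl//.
Qed.

Lemma cexp_quad w : cmod (cexp w - 1 - w) <= cmod w ^+ 2 * expR `|Re w|.
Proof.
have := @mean_value_ineq R (fun s => cexp (w * s%:C) + (- w) * s%:C) (fun s => w * cexp (w * s%:C) - w) 0 1
  (cmod w ^+ 2 * expR `|Re w|) ler01.
rewrite mulr1 !mulr0 cexp0 addr0 mulr1 subr0 mulr1 (_ : _ - w - 1 = cexp w - 1 - w); last by ring.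
apply => s hs; first by have := rderD (rder_cexp_line w s) (rderZ (- w) (rder_real s)); rewrite mulr1.
move/andP: hs => [s0 s1]; rewrite -[X in _ - X]mulr1 -mulrBr cmodM expr2 -mulrA ler_wpM2l//.
apply: le_trans (cexp_lip _) _; rewrite cmodM cmod_real [w * _]mulrC ReZ normrM ger0_norm//.
by apply: ler_pM; rewrite ?mulr_ge0 ?cmod_ge0 ?expR_ge0// ?ler_piMr// ler_expR ler_piMl.
Qed.

Lemma cexp_cder w : cder cexp w (cexp w).
Proof.
move=> e e0; pose K := expR (Re w) * expR 1; have K0 : 0 < K by rewrite mulr_gt0 ?expR_gt0.
exists (Num.min 1 (e / K)); first by rewrite lt_min ltr01 divr_gt0.
move=> h; rewrite lt_min ltr_pdivlMr// => /andP[h1 h2].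
rewrite cexpD (_ : _ - _ - _ = cexp w * (cexp h - 1 - h)); last by ring.
rewrite cmodM cmod_cexp; have q := cexp_quad h; have h0 := cmod_ge0 h.
have : expR `|Re h| <= expR 1 by rewrite ler_expR (le_trans (Re_le h))// ltW.
move=> q2; apply: le_trans (ler_wpM2l (expR_ge0 _) q) _.
have : cmod h ^+ 2 * expR `|Re h| <= cmod h ^+ 2 * expR 1 by rewrite ler_wpM2l ?sqr_ge0.
move=> /(ler_wpM2l (expR_ge0 (Re w)))/le_trans; apply.
have -> : expR (Re w) * (cmod h ^+ 2 * expR 1) = cmod h * K * cmod h by rewrite /K; ring.
by rewrite ler_wpM2r// ltW.
Qed.

Lemma cder_comp (F G : R[i] -> R[i]) z D E : cder G z D -> cder F (G z) E -> cder (fun v => F (G v)) z (E * D).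
Proof.
move=> hG hF e e0; have cD := cmod_ge0 D; have cE := cmod_ge0 E.
pose K := cmod D + 1 + cmod E; have K0 : 0 < K by rewrite /K; lra.
have [d1 d10 h1] := hF _ (divr_gt0 e0 K0).
pose e2 := Num.min 1 (e / K); have e20 : 0 < e2 by rewrite lt_min ltr01 divr_gt0.
have [e21 e22] : e2 <= 1 /\ e2 <= e / K by rewrite !ge_min !lexx orbT.
have [d2 d20 h2] := hG _ e20; have [d3 d30 h3] := cder_cont hG d10.
exists (Num.min d2 d3); first by rewrite lt_min d20.
move=> h; rewrite lt_min => /andP[/h2{}h2 /h3{}h3].
pose k := G (z + h) - G z; have := h1 k h3; rewrite {1}/k subrKC => {}h1.
have hk : cmod k <= (cmod D + 1) * cmod h.
  have := cmodB_ge k (D * h); rewrite -/k cmodM; rewrite -/k in h2; have := cmod_ge0 h; nra.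
have -> : F (G (z + h)) - F (G z) - E * D * h = (F (G (z + h)) - F (G z) - E * k) + E * (k - D * h) by ring.
apply: le_trans (cmodD _ _) _; rewrite cmodM.
have a1 : e / K * cmod k <= e / K * ((cmod D + 1) * cmod h) by rewrite ler_wpM2l// divr_ge0 ?ltW.
have a2 : cmod E * cmod (k - D * h) <= cmod E * (e / K * cmod h).
  rewrite ler_wpM2l//; apply: le_trans h2 _; rewrite ler_wpM2r//.
have eK : e / K * K = e by rewrite divfK// gt_eqF.
have : e / K * ((cmod D + 1) * cmod h) + cmod E * (e / K * cmod h) = e / K * K * cmod h by rewrite /K; ring.
rewrite eK; lra.
Qed.

Lemma holo_cexp (P : R[i] -> Prop) F : holo P F -> holo P (fun z => cexp (F z)).
Proof. by move=> hF z /hF [D hD]; exists (cexp (F z) * D); exact: cder_comp hD (cexp_cder _). Qed.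

Variable t : R.
Hypothesis t0 : 0 < t.

Definition Ex x z : R[i] := cexp ((0 +i* 1) * ((8 * t)%:C * z ^+ 3 + (2 * x)%:C * z)).

Lemma Ex_real x (r : R) : Ex x r%:C = expi (8 * t * r ^+ 3 + 2 * x * r).
Proof.
rewrite /Ex -cexp_imag; congr cexp; rewrite !exprS expr0 mulr1 -!CM -CD.
by cx_ring.
Qed.

Lemma ExD x h z : Ex (x + h) z = Ex x z * cexp (2%:R%:C * (0 +i* 1) * z * h%:C).
Proof. by rewrite /Ex -cexpD; congr cexp; rewrite mulrDr !CM CD; ring. Qed.

Lemma holo_Ex (P : R[i] -> Prop) x : holo P (Ex x).
Proof.
apply: holo_cexp; apply: holoM; first exact: holo_cst.
apply: holoD; apply: holoM; [exact: holo_cst| |exact: holo_cst|exact: holo_id].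
rewrite (_ : (fun v : R[i] => v ^+ 3) = (fun v => v * (v * v))).
  by apply: holoM; [|apply: holoM]; exact: holo_id.
by apply/funext => v; rewrite !exprS expr0 mulr1.
Qed.

(** Bounds exp (8 t (Im z)^3 - 2 x Im z), the non-Gaussian factor of |Ex|, on 0 <= Im z <= 1. *)
Definition CE x := expR (8 * t + 2 * `|x|).

Lemma cmod_Ex x z : 0 <= Im z <= 1 -> cmod (Ex x z) <= CE x * expR (- (24 * t * (Re z ^+ 2 * Im z))).
Proof.
move=> /andP[h0 h1]; rewrite cmod_cexp /CE -expRD ler_expR.
have -> : Re ((0 +i* 1) * ((8 * t)%:C * z ^+ 3 + (2 * x)%:C * z)) = - (24 * t * (Re z ^+ 2 * Im z)) + 8 * t * Im z ^+ 3 - 2 * x * Im z.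
  by rewrite !exprS expr0 mulr1 !ReImE /=; ring.
have : 8 * t * Im z ^+ 3 <= 8 * t * 1 by rewrite ler_wpM2l ?mulr_ge0 ?(ltW t0)// exprn_ile1.
have : - (2 * x * Im z) <= 2 * `|x|.
  apply: le_trans (ler_norm _) _; rewrite normrN !normrM (ger0_norm h0) ger0_norm//.
  by rewrite ler_piMr// mulr_ge0.
lra.
Qed.

Lemma cmod_Ex_le x z : 0 <= Im z <= 1 -> cmod (Ex x z) <= CE x.
Proof.
move=> h; apply: le_trans (cmod_Ex x h) _; rewrite ler_piMr ?expR_ge0// expR_le1 oppr_le0.
have /andP[i0 _] := h; apply: mulr_ge0; first by rewrite mulr_ge0// ltW.
by apply: mulr_ge0 => //; exact: sqr_ge0.
Qed.

Lemma pow_le_expR l (y : R) : 0 <= y -> y ^+ l <= l%:R ^+ l * expR y.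
Proof.
move=> y0; case: l => [|l]; first by rewrite !expr0 mul1r; have := expR_ge1Dx y; lra.
have l0 : 0 < l.+1%:R :> R by rewrite ltr0n.
have h : y / l.+1%:R <= expR (y / l.+1%:R).
  by move: (y / l.+1%:R) => v; have := expR_ge1Dx v; lra.
have : (y / l.+1%:R) ^+ l.+1 <= expR (y / l.+1%:R) ^+ l.+1.
  by apply: lerXn2r => //; rewrite nnegrE ?expR_ge0// divr_ge0// ltW.
by rewrite -expRM_natl mulrCA mulfV ?mulr1 ?gt_eqF// expr_div_n ler_pdivrMr ?exprn_gt0// mulrC.
Qed.

(** l^l comes from y^l <= l^l exp y, and 1 + 1/(96 t) is the maximum over v of 1 + v - 24 t v^2. *)
Definition Cph l := l%:R ^+ l * expR (1 + (96 * t)^-1).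

Lemma Cph_ge0 l : 0 <= Cph l. Proof. by rewrite mulr_ge0 ?exprn_ge0 ?expR_ge0. Qed.

(* With v = 2^-j |Re z| the growth of z^l is absorbed by exp (- 24 t v^2). *)
Lemma phase_power_bound l x (j : nat) (r : R) :
  cmod (r +i* 4^-1 ^+ j) ^+ l * cmod (Ex x (r +i* 4^-1 ^+ j)) <= CE x * Cph l * 2 ^+ (j * l).
Proof.
set z := _ +i* _; pose b : R := 2^-1 ^+ j; have b0 : 0 < b by exact: half_pow_gt0.
have b1 : b <= 1 by rewrite exprn_ile1// invf_le1 ?ler1n.
have eta : Im z = b ^+ 2 by rewrite /z /= /b -exprM mulnC exprM expr2 -invfM -natrM.
have h01 : 0 <= Im z <= 1 by rewrite eta sqr_ge0 /= exprn_ile1 ?(ltW b0).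
have zb : b * cmod z <= 1 + b * `|r|.
  have := cmod_le_ReIm z; rewrite eta (_ : Re z = r)// (ger0_norm (sqr_ge0 b)) => h.
  have : b * cmod z <= b * (`|r| + b ^+ 2) by rewrite ler_wpM2l ?(ltW b0).
  have : b * b ^+ 2 <= 1 by rewrite -exprS exprn_ile1 ?(ltW b0).
  lra.
have : (b * cmod z) ^+ l * cmod (Ex x z) <= CE x * Cph l.
  pose v := b * `|r|; have v0 : 0 <= v by rewrite mulr_ge0// ltW.
  have v1 : 0 <= 1 + v by rewrite addr_ge0.
  have p1 : (b * cmod z) ^+ l <= l%:R ^+ l * expR (1 + v).
    apply: le_trans (pow_le_expR l v1); apply: lerXn2r => //; rewrite nnegrE//.
    by rewrite mulr_ge0// ltW.
  have p2 := cmod_Ex x h01; have vv : Re z ^+ 2 * Im z = v ^+ 2.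
    by rewrite eta /v exprMn (real_normK (num_real r)) mulrC.
  rewrite vv in p2; apply: le_trans (ler_pM _ _ p1 p2) _; rewrite ?exprn_ge0 ?mulr_ge0 ?cmod_ge0 ?(ltW b0)//.
  have C0 : 0 <= CE x by exact: expR_ge0.
  rewrite (_ : _ * _ * (_ * _) = CE x * (l%:R ^+ l * expR (1 + v - 24 * t * v ^+ 2))); last first.
    by rewrite (expRD (1 + v)); move: (l%:R ^+ l) (expR _) (expR _) => a1 a2 a3; ring.
  rewrite /Cph; apply: ler_wpM2l => //; apply: ler_wpM2l; first exact: exprn_ge0.
  rewrite ler_expR.
  have : (v - (48 * t)^-1) ^+ 2 * (24 * t) = 24 * t * v ^+ 2 - v + (96 * t)^-1 by field; rewrite gt_eqF.
  have : 0 <= (v - (48 * t)^-1) ^+ 2 * (24 * t) by rewrite mulr_ge0 ?sqr_ge0 ?mulr_ge0 ?ltW.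
  lra.
rewrite exprMn => h; have -> : cmod z ^+ l * cmod (Ex x z) = (b ^+ l * cmod z ^+ l * cmod (Ex x z)) * 2 ^+ (j * l).
  by rewrite -[_ * 2 ^+ _]mulrC !mulrA exprM -exprMn /b exprVn mulfV ?expr1n ?mul1r ?expf_neq0.
by rewrite ler_wpM2r// exprn_ge0.
Qed.

End phase.

(** * A Plancherel inequality *)

Section plancherel.
Variable R : realType.
Implicit Types (p f : R -> R[i]) (e r s t : R).
Local Notation RR := (measurableTypeR R * measurableTypeR R)%type.

Definition four p r : R[i] := cint (fun s => p s * expi (- (2 * s * r))).

Lemma cI_expi p (v : R -> R) : cI p -> meas v -> cI (fun s => p s * expi (v s)).
Proof.
move=> hp mv; have me := cmeas_expi mv.
apply: (eq_cI (f := fun s => expi (v s) * p s)); first by move=> s; rewrite mulrC.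
by apply: (cI_bounded_mul (B := 1) me hp) => s; rewrite cmod_expi.
Qed.

Lemma exp_decay_rI a : 0 < a -> rI (fun r => expR (- (a * `|r|))).
Proof.
move=> a0; have a2 : a / 2 != 0 by rewrite gt_eqF// divr_gt0.
have [i _] := int_inv_sqr R; apply: (rI_le _ (rI_affine 0 a2 i)) => [|r].
  by apply: measurableT_comp => //; apply: measurableT_comp => //; apply: measurable_funM => //; exact: measurableT_comp.
rewrite ger0_norm ?expR_ge0// addr0 expRN lef_pV2 ?posrE ?expR_gt0//; last by rewrite ltr_wpDl ?sqr_ge0.
have -> : a * `|r| = 2%:R * (a / 2 * `|r|) by field.
have h0 : 0 <= a / 2 * `|r| by rewrite mulr_ge0 ?divr_ge0 ?(ltW a0).
rewrite expRM_natl; apply: le_trans (_ : (1 + a / 2 * `|r|) ^+ 2 <= _); last first.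
  by apply: lerXn2r; rewrite ?nnegrE ?expR_ge0 ?addr_ge0// expR_ge1Dx.
by rewrite exprMn -(real_normK (num_real r)) -exprMn; nra.
Qed.

Lemma half_exp w : Re w < 0 -> cI (fun r => (0 <= r)%R%:R%:C * cexp (w * r%:C)) /\
  cint (fun r => (0 <= r)%R%:R%:C * cexp (w * r%:C)) = - w^-1.
Proof.
move=> w0; have wn : w != 0 by apply: contraTneq w0 => ->; rewrite Re0 ltxx.
have a0 : 0 < - Re w by rewrite oppr_gt0.
pose h (r : R) := (0 <= r)%R%:R%:C * cexp (w * r%:C).
have dc r : rder (fun s => w^-1 * cexp (w * s%:C)) r (cexp (w * r%:C)).
  by have := rderZ w^-1 (rder_cexp_line w r); rewrite mulKf.
have cc : ccont (fun r => cexp (w * r%:C)) by exact: rder_ccont (rder_cexp_line w).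
have mh : cmeas h.
  apply: cmeasM; last exact: ccont_cmeas.
  apply: cmeasC; have := @meas_in R `[0, +oo[; under eq_fun do rewrite in_itv /= andbT.
  exact.
have hb r : cmod (h r) <= expR (- (- Re w * `|r|)).
  rewrite cmodM cmod_real cmod_cexp (mulrC w) ReZ; have [r0|r0] := leP 0 r; last by rewrite normr0 mul0r expR_ge0.
  by rewrite normr1 mul1r (ger0_norm r0) mulNr opprK mulrC.
have ih : cI h by exact: cI_le mh (exp_decay_rI a0) hb.
split => //; apply/eqP; rewrite -subr_eq0; apply/eqP/cmod_small => e e0; have e2 : 0 < e / 2 by rewrite divr_gt0.
have [T0 hT] := tail_integral ih e2.
have e3 : 0 < e / 2 * (- Re w) * cmod w by rewrite !mulr_gt0// cmod_gt0.
pose b := Num.max 1 (Num.max T0 (e / 2 * (- Re w) * cmod w)^-1).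
have [b1 bT be] : [/\ 1 <= b, T0 <= b & (e / 2 * (- Re w) * cmod w)^-1 <= b] by rewrite !le_max !lexx !orbT.
have b0 : 0 < b by exact: lt_le_trans b1.
have := hT b bT; rewrite (_ : itg (- b) b h = w^-1 * cexp (w * b%:C) - w^-1); last first.
  have -> : w^-1 * cexp (w * b%:C) - w^-1 = w^-1 * cexp (w * b%:C) - w^-1 * cexp (w * 0%:C).
    by rewrite mulr0 cexp0 mulr1.
  rewrite -(itg_FTC b0 dc cc); apply: eq_cint => r.
  rewrite /h mulrA -CM; congr (_%:C * _); rewrite !indicE -natrM mulnb; congr (nat_of_bool _)%:R.
  apply/idP/idP => [/andP[]|]; rewrite !inE /= !in_itv /=; first by move=> /andP[_ ->] ->.
  by move=> /andP[r0 rb]; rewrite r0 andbT inE /= in_itv /= rb andbT (le_trans _ r0)// oppr_le0 ltW.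
move=> h1; have h2 : cmod (w^-1 * cexp (w * b%:C)) <= e / 2.
  rewrite cmodM cmodV cmod_cexp (mulrC w) ReZ ler_pdivrMl ?cmod_gt0//.
  rewrite (_ : b * Re w = - (b * - Re w)); last by rewrite mulrN opprK.
  have c0 : 0 < b * - Re w by rewrite mulr_gt0.
  rewrite expRN; apply: le_trans (_ : (b * - Re w)^-1 <= _).
    by rewrite lef_pV2 ?posrE ?expR_gt0//; have := expR_ge1Dx (b * - Re w); lra.
  rewrite -[leLHS]mul1r ler_pdivrMr//.
  have : 1 <= b * (e / 2 * (- Re w) * cmod w) by rewrite -ler_pdivrMr// div1r.
  by move/le_trans; apply; apply: eq_ler; ring.
rewrite opprK (_ : cint _ + w^-1 = w^-1 * cexp (w * b%:C) - (w^-1 * cexp (w * b%:C) - w^-1 - cint h)); last by ring.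
by apply: le_trans (cmodB _ _) _; lra.
Qed.

(** The weight exp (-e|r|) turns into a Poisson kernel, so that the weighted Plancherel identity
    becomes a Poisson convolution, already controlled by the Cauchy transform. *)
Lemma laplace_ft e u : 0 < e -> cI (fun r => (expR (- (e * `|r|)))%:C * expi (2 * u * r)) /\
  cint (fun r => (expR (- (e * `|r|)))%:C * expi (2 * u * r)) = (pk (e / 2) u)%:C.
Proof.
move=> e0; have r1 : Re (- e +i* (2 * u)) < 0 by rewrite /= oppr_lt0.
have r2 : Re (- e +i* (- (2 * u))) < 0 by rewrite /= oppr_lt0.
have [i1 c1] := half_exp r1; have [i2 c2] := half_exp r2.
have E : {ae mu, forall r, (expR (- (e * `|r|)))%:C * expi (2 * u * r) =
    (0 <= r)%R%:R%:C * cexp ((- e +i* (2 * u)) * r%:C) + (0 <= - r)%R%:R%:C * cexp ((- e +i* (- (2 * u))) * (- r)%:C)}.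
  have X (v r : R) : cexp ((- e +i* v) * r%:C) = (expR (- (e * r)))%:C * expi (v * r).
    by rewrite /cexp ReM ImM ReC ImC !mulr0 subr0 add0r mulNr.
  apply: (aeS (ae_neq 0)) => r rn; rewrite oppr_ge0 !X.
  have [r0|r0|r0] := ltgtP r 0; last by rewrite r0 eqxx in rn.
    by rewrite mul0r add0r mul1r ltr0_norm//; congr (_ * expi _); ring.
  by rewrite mul0r addr0 mul1r gtr0_norm.
have me : cmeas (fun r => (expR (- (e * `|r|)))%:C * expi (2 * u * r)).
  apply: cmeasM; first by apply: cmeasC; apply: rI_meas; exact: exp_decay_rI.
  by apply: cmeas_expi; exact: measurable_funM.
have i2' := cI_refl i2; split; first exact: cI_ae me E (cID i1 i2').
rewrite (cint_ae E) cintD// (cint_refl i2) c1 c2.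
have d0 : u ^+ 2 + (e / 2) ^+ 2 != 0 by rewrite gt_eqF// pk_den// divr_gt0.
have n1 : - e +i* (2 * u) != 0 by apply: contraTneq r1 => ->; rewrite Re0 ltxx.
have n2 : - e +i* (- (2 * u)) != 0 by apply: contraTneq r2 => ->; rewrite Re0 ltxx.
have P : (- e +i* (2 * u)) * (- e +i* (- (2 * u))) = (4 * (u ^+ 2 + (e / 2) ^+ 2))%:C.
  by rewrite -[LHS]/(_ * conjc (- e +i* (2 * u))) mul_conj cmod_sqr -[Re _]/(- e) -[Im _]/(2 * u); congr (_%:C); field.
have S : - (- e +i* (2 * u)) - (- e +i* (- (2 * u))) = (2 * e)%:C.
  have S2 (z : R[i]) : - z - conjc z = (- 2 * Re z)%:C by apply: cx_ext; rewrite !ReImE; ring.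
  by rewrite -[LHS]/(- (- e +i* (2 * u)) - conjc (- e +i* (2 * u))) S2 -[Re _]/(- e); congr (_%:C); ring.
rewrite (_ : - _^-1 - _ = (- (- e +i* (2 * u)) - (- e +i* (- (2 * u)))) / ((- e +i* (2 * u)) * (- e +i* (- (2 * u))))); last by field; rewrite n1 n2.
by rewrite P S -CV -CM /pk; congr (_%:C); move: d0; move: (u ^+ 2 + _) => D d0; field.
Qed.

(** By [poisson_split] this convolution is pi times a difference of two functions of norm at most
    that of f; hence the factor 2. *)
Lemma nrm_pk_conv f e : l2 f -> 0 < e -> l2 (fun r => cint (fun t => (pk e (t - r))%:C * f t)) /\
  nrm (fun r => cint (fun t => (pk e (t - r))%:C * f t)) <= 2 * pi * nrm f.
Proof.
move=> hf e0; have [lK nK] := Kl_contract hf e0; have [lE nE] := Ext_line hf e0.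
have p0 : pi != 0 :> R by rewrite gt_eqF// pi_gt0.
have E r : cint (fun t => (pk e (t - r))%:C * f t) = pi%:C * (Ext f (r +i* e) - Kl e f (- r)).
  rewrite /Kl (_ : - r +i* e = - conjc (r +i* e)); last by apply: cx_ext; rewrite !ReImE ?opprK.
  by rewrite poisson_split// mulrA -CM mulfV// mul1r.
have lK' := l2_refl lK; split; first by apply: eq_l2 (l2Z pi%:C (l2B lE lK')) => r; rewrite E.
rewrite (eq_nrm E) nrmZ; last exact: l2B.
rewrite cmod_real ger0_norm ?pi_ge0// (mulrC 2) -mulrA ler_wpM2l ?pi_ge0//.
by apply: le_trans (nrmB lE lK') _; rewrite (nrm_refl lK); lra.
Qed.

Lemma cmeas2_expi : cmeas (fun q : RR => expi (2 * (q.2 : R) * (q.1 : R)) : R[i]).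
Proof.
apply: cmeas_expi; apply: measurable_funM; last exact: measurable_fst.
by apply: measurable_funM => //; exact: measurable_snd.
Qed.

Lemma rI_weight e (c : R) : 0 < e -> rI (fun r => expR (- (e * `|r|)) * c).
Proof. by move=> e0; apply: eq_rI (rIZ c (exp_decay_rI e0)) => r; rewrite mulrC. Qed.

Section transform.
Variable p : R -> R[i].
Hypotheses (cp : cI p) (lp : l2 p).
Let N1 := intg (fun s => cmod (p s)).

Lemma eint_dom (F : R -> R[i]) (c : R) (h : R -> R[i]) : cmeas F -> cI h -> 0 <= c ->
  (forall s, cmod (F s) <= c * cmod (h s)) -> (eint (fun s => cmod (F s)) <= (c * intg (fun s => cmod (h s)))%:E)%E.
Proof.
move=> mF ch c0 le; have ih := rIZ c (cI_cmod ch).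
rewrite -intgZ -?eint_intg//; last exact: cI_cmod.
by apply: le_eint => //; [exact: meas_cmod|exact: rI_meas].
Qed.

Lemma four_le r : cmod (four p r) <= N1.
Proof.
apply: cmod_cint_le (cI_cmod cp) _ => [|s]; last by rewrite cmodM cmod_expi mulr1.
by apply: cI_expi => //; apply: measurable_funN; exact: measurable_funM.
Qed.

(** Measurability in r is extracted from Fubini, for which the weight exp (-|r|) makes the kernel
    integrable; the weight is then divided out. *)
Lemma four_meas : cmeas (four p).
Proof.
pose F (q : RR) : R[i] := (expR (- (1 * `|q.1 : R|)))%:C * (p q.2 * expi (2 * (q.2 : R) * - (q.1 : R))).
have mF : cmeas F.
  apply: cmeasM; first by apply: (cmeas2_1 (f := fun r => (expR (- (1 * `|r|)))%:C)); apply: cmeasC; apply: rI_meas; exact: exp_decay_rI.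
  apply: cmeasM; first by apply: cmeas2_2; exact: cI_meas.
  apply: cmeas_expi; apply: measurable_funM; last by apply: measurable_funN; exact: measurable_fst.
  by apply: measurable_funM => //; exact: measurable_snd.
have [||i _] := @cfubini _ F (fun r => expR (- (1 * `|r|)) * N1) mF.
- exact: rI_weight.
- move=> r; apply: eint_dom => //; first by apply: (cmeas_comp mF); exact: measurable_pair1.
  by move=> s; rewrite !cmodM cmod_expi mulr1 cmod_real ger0_norm ?expR_ge0.
have E r : four p r = (expR (1 * `|r|))%:C * cint (fun s => F (r, s)).
  rewrite -cintZ; last first.
    rewrite /F /=; apply: cIZ; apply: cI_expi => //; apply: measurable_funM => //; exact: measurable_funM.
  apply: eq_cint => s; rewrite /F /= mulrA -CM -expRD subrr expR0 mul1r.
  by congr (_ * expi _); ring.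
rewrite (_ : four p = fun r => (expR (1 * `|r|))%:C * cint (fun s => F (r, s))); last exact/funext.
apply: cmeasM; last exact: cI_meas.
by apply: cmeasC; apply: measurableT_comp => //; apply: measurable_funM => //; exact: measurableT_comp.
Qed.

(** Fubini rewrites the left side as the inner product of p with its own Poisson convolution at
    height e/2; Cauchy-Schwarz and [nrm_pk_conv] conclude. *)
Lemma weighted_plancherel e : 0 < e ->
  intg (fun r => expR (- (e * `|r|)) * cmod (four p r) ^+ 2) <= 2 * pi * nsq p.
Proof.
move=> e0; have N0 : 0 <= N1 by apply: intg_ge0 => s; exact: cmod_ge0.
have mw : cmeas (fun r => (expR (- (e * `|r|)))%:C) by apply: cmeasC; apply: rI_meas; exact: exp_decay_rI.
have mlin (c : R) : meas (fun s : R => 2 * s * c) by apply: measurable_funM => //; exact: measurable_funM.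
have cif (v : R) : cI (fun s => p s * expi (- (2 * s * v))).
  by apply: cI_expi => //; apply: measurable_funN; exact: mlin.
pose W r := (expR (- (e * `|r|)))%:C * four p r.
have mW : cmeas W by apply: cmeasM => //; exact: four_meas.
have iW : cI W.
  apply: (cI_le mW (rI_weight N1 e0)) => r; rewrite cmodM cmod_real ger0_norm ?expR_ge0//.
  by rewrite ler_wpM2l ?expR_ge0// four_le.
pose g s := cint (fun t => (pk (e / 2) (t - s))%:C * p t).
have gE s : cint (fun r => W r * expi (2 * s * r)) = g s.
  pose F (q : RR) : R[i] := (expR (- (e * `|q.1 : R|)))%:C * (p q.2 * expi (2 * (s - (q.2 : R)) * (q.1 : R))).
  have mF : cmeas F.
    apply: cmeasM; first exact: (cmeas2_1 mw).
    apply: cmeasM; first by apply: cmeas2_2; exact: cI_meas.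
    apply: cmeas_expi; apply: measurable_funM; last exact: measurable_fst.
    by apply: measurable_funM => //; apply: measurable_funB => //; exact: measurable_snd.
  have [||_ Fu] := @cfubini _ F (fun r => expR (- (e * `|r|)) * N1) mF.
  - exact: rI_weight.
  - move=> r; apply: eint_dom => //; first by apply: (cmeas_comp mF); exact: measurable_pair1.
    by move=> u; rewrite !cmodM cmod_expi mulr1 cmod_real ger0_norm ?expR_ge0.
  rewrite (eq_cint (g := fun r => cint (fun t => F (r, t)))); last first.
    move=> r; rewrite /W /four mulrAC [_ * cint _]mulrC mulrC -mulrA -(cintZ _ (cif r)).
    apply: eq_cint => t; rewrite /F /= (_ : 2 * (s - t) * r = 2 * s * r + - (2 * t * r)); last by ring.
    by rewrite expiD (mulrA 2 s r); ring.
  rewrite Fu /g; apply: eq_cint => t; rewrite /F /=.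
  have [i c] := laplace_ft (s - t) e0.
  rewrite (eq_cint (g := fun r => p t * ((expR (- (e * `|r|)))%:C * expi (2 * (s - t) * r)))); last by move=> r; ring.
  have pks : pk (e / 2) (s - t) = pk (e / 2) (t - s) by rewrite /pk -(sqrrN (s - t)) opprB.
  by rewrite (cintZ _ i) c pks mulrC.
have [lg ng] := nrm_pk_conv lp (divr_gt0 e0 (ltr0Sn _ 1)).
pose F (q : RR) : R[i] := W q.1 * (conjc (p q.2) * expi (2 * (q.2 : R) * (q.1 : R))).
have mF : cmeas F.
  apply: cmeasM; first exact: (cmeas2_1 mW).
  apply: cmeasM; last exact: cmeas2_expi.
  by apply: (cmeas2_2 (f := fun s => conjc (p s))); apply: cmeas_conj; exact: cI_meas.
have [||_ Fu] := @cfubini _ F (fun r => cmod (W r) * N1) mF.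
- by apply: eq_rI (rIZ N1 (cI_cmod iW)) => r; rewrite mulrC.
- move=> r; apply: eint_dom => //; first by apply: (cmeas_comp mF); exact: measurable_pair1.
  by move=> u; rewrite !cmodM cmod_expi mulr1 cmod_conj.
have X : cint (fun r => W r * conjc (four p r)) = cint (fun s => conjc (p s) * g s).
  rewrite (eq_cint (g := fun r => cint (fun s => F (r, s)))); last first.
    move=> r; rewrite /four -(cint_conj (cif r)) -cintZ; last by apply: cI_conj; exact: cif.
    by apply: eq_cint => s; rewrite /F conjcM -expiN opprK.
  rewrite Fu; apply: eq_cint => s; rewrite -gE -cintZ; last by apply: cI_expi => //; exact: measurable_funM.
  by apply: eq_cint => r; rewrite /F /=; ring.
have -> : intg (fun r => expR (- (e * `|r|)) * cmod (four p r) ^+ 2) = Re (cint (fun r => W r * conjc (four p r))).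
  by rewrite Re_cint; apply: eq_intg => r; rewrite /W -mulrA mul_conj -CM.
apply: le_trans (le_trans (ler_norm _) (Re_le _)) _; rewrite X.
apply: le_trans (cmod_cint_mul (l2_conj lp) lg) _; rewrite nrm_conj -nrm_sqr expr2 mulrCA.
by rewrite ler_wpM2l ?nrm_ge0.
Qed.

Theorem plancherel : l2 (four p) /\ nrm (four p) <= Num.sqrt (2 * pi) * nrm p.
Proof.
pose F k r := (expR (- (2^-1 ^+ k.+1 * `|r|)))%:C * four p r.
have N0 : 0 <= N1 by apply: intg_ge0 => s; exact: cmod_ge0.
have a0 k : 0 < 2^-1 ^+ k.+1 :> R by exact: half_pow_gt0.
have mF k : cmeas (F k) by apply: cmeasM; [apply: cmeasC; apply: rI_meas; exact: exp_decay_rI|exact: four_meas].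
have sq k r : cmod (F k r) ^+ 2 = expR (- (2^-1 ^+ k * `|r|)) * cmod (four p r) ^+ 2.
  rewrite cmodM cmod_real ger0_norm ?expR_ge0// exprMn -expRM_natl; congr (expR _ * _).
  by rewrite exprS; field.
have lF k : l2 (F k).
  split => //; apply: (rI_le _ (rI_weight (N1 ^+ 2) (half_pow_gt0 R k))) => [|r].
    by apply: meas_sqr; exact: mF.
  rewrite sq ger0_norm ?mulr_ge0 ?expR_ge0 ?sqr_ge0// ler_wpM2l ?expR_ge0//.
  by apply: lerXn2r; rewrite ?nnegrE ?cmod_ge0 ?four_le.
have nF k : nrm (F k) <= Num.sqrt (2 * pi) * nrm p.
  rewrite nrm_leP; last by rewrite mulr_ge0 ?sqrtr_ge0 ?nrm_ge0.
  rewrite exprMn sqr_sqrtr ?mulr_ge0 ?pi_ge0// nrm_sqr /nsq (eq_intg (sq k)).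
  by apply: weighted_plancherel; exact: half_pow_gt0.
apply: (l2_fatou four_meas lF) nF; apply: aeT => r.
have B0 : 0 <= `|r| * N1 by rewrite mulr_ge0.
have h0 : `|r| * N1 * 2^-1 ^+ k @[k --> \oo] --> 0.
  by apply: cvgZ0; apply: cvg_expr; rewrite ger0_norm ?invr_ge0// invf_lt1 ?ltr1n.
apply: cvg0_le h0 => k; apply/andP; split; first exact: cmod_ge0.
rewrite (_ : F k r - four p r = ((expR (- (2^-1 ^+ k.+1 * `|r|)))%:C - 1) * four p r); last by rewrite /F; ring.
rewrite cmodM -CB cmod_real mulrAC; apply: ler_pM; rewrite ?normr_ge0 ?cmod_ge0 ?four_le//.
have hk : 2^-1 ^+ k.+1 <= 2^-1 ^+ k :> R by rewrite exprS ler_piMl ?exprn_ge0 ?invr_ge0// invf_le1 ?ler1n.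
apply: le_trans (ler_wpM2l (normr_ge0 r) hk).
have b0 : 0 <= 2^-1 ^+ k.+1 * `|r| by rewrite mulr_ge0// ltW.
rewrite ler0_norm ?subr_le0 ?expR_le1 ?oppr_le0// opprB mulrC.
have := expR_ge1Dx (- (`|r| * 2^-1 ^+ k.+1)); lra.
Qed.

End transform.
End plancherel.

(** * Series in L2 *)

Section l2_series.
Variable R : realType.
Implicit Types (f g : R -> R[i]) (F G : nat -> R -> R[i]).

Definition l2cvg F f := [/\ forall n, l2 (F n), l2 f &
  forall e, 0 < e -> exists N, forall n, (N <= n)%N -> nrm (fun r => F n r - f r) <= e].

Lemma l2cvg_lin F G f g c : l2cvg F f -> l2cvg G g ->
  l2cvg (fun n r => F n r + c * G n r) (fun r => f r + c * g r).
Proof.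
move=> [lF lf hF] [lG lg hG]; have lc n : l2 (fun r => c * G n r) by exact: l2Z.
split=> [n||e e0]; [exact: l2D|by apply: l2D => //; exact: l2Z|].
have c1 : 0 < cmod c + 1 by rewrite ltr_wpDl.
have [N1 h1] := hF _ (divr_gt0 e0 (ltr0Sn _ 1)); have [N2 h2] := hG _ (divr_gt0 (divr_gt0 e0 (ltr0Sn _ 1)) c1).
exists (maxn N1 N2) => n; rewrite geq_max => /andP[/h1{}h1 /h2{}h2].
have lB := l2B (lG n) lg.
rewrite (eq_nrm (g := fun r => (F n r - f r) + c * (G n r - g r))); last by move=> r; ring.
apply: le_trans (nrmD (l2B (lF n) lf) (l2Z c lB)) _; rewrite nrmZ//.
have : cmod c * nrm (fun r => G n r - g r) <= e / 2.
  apply: le_trans (_ : (cmod c + 1) * (e / 2 / (cmod c + 1)) <= _); last by rewrite mulrC divfK// gt_eqF.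
  by apply: ler_pM => //; rewrite lerDl.
by move: h1; lra.
Qed.

Lemma l2cvg_le F f M : l2cvg F f -> (forall n, nrm (F n) <= M) -> nrm f <= M.
Proof.
move=> [lF lf hF] h; apply/ler_addgt0Pr => e /hF[N hN]; have := hN N (leqnn N).
by have := nrm_dist (lF N) lf; rewrite ler_norml => /andP[a _] b; have := h N; lra.
Qed.

Lemma l2cvg_ae F G f g : (forall n, l2 (G n)) -> l2 g -> (forall n, {ae mu, forall r, F n r = G n r}) ->
  {ae mu, forall r, f r = g r} -> l2cvg F f -> l2cvg G g.
Proof.
move=> lG lg FG fg [lF lf hF]; split => // e /hF[N hN]; exists N => n /hN.
by rewrite (nrm_ae (g := fun r => G n r - g r))//; apply: (aeS (aeI (FG n) fg)) => r [-> ->].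
Qed.

Lemma l2cvg_unique F f g : l2cvg F f -> l2cvg F g -> {ae mu, forall r, f r = g r}.
Proof.
move=> hf hg; have [lF lf _] := hf; have [_ lg _] := hg; have h := l2cvg_lin (-1) hf hg.
have z : nrm (fun r => f r + -1 * g r) <= 0.
  by apply: (l2cvg_le h) => n; rewrite (eq_nrm (g := fun=> 0)) ?nrm0// => r; rewrite mulN1r subrr.
have l : l2 (fun r => f r + -1 * g r) by case: h.
apply: (aeS (ae_nrm0 l _)) => [|r]; first by apply/eqP; rewrite eq_le z nrm_ge0.
by rewrite mulN1r => /eqP; rewrite subr_eq0 => /eqP.
Qed.

Lemma l2cvg_hardy F f : l2cvg F f -> (forall n, hardy (F n)) -> hardy f.
Proof.
move=> [lF lf hF] h; apply: (hardy_lim h lf); apply/seq_cvg0P => // e e0.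
have e2 : 0 < e / 2 by rewrite divr_gt0.
by have [N hN] := hF _ e2; exists N => n /hN /le_lt_trans; apply; lra.
Qed.

Lemma summable_tail (a : nat -> R) S : (forall n, 0 <= a n) -> (forall M, \sum_(n < M) a n <= S) ->
  forall e, 0 < e -> exists N, forall m, \sum_(i < m) a (N + i)%N <= e.
Proof.
move=> a0 hS e e0; pose u k := \sum_(n < k) a n.
have st k : u k.+1 - u k = a k by rewrite /u big_ord_recr /= (addrC (bigop _ _ _)) addrK.
have cu : cvgn u.
  apply: (@cvg_of_summable _ u S) => n; apply: le_trans (hS n); apply: ler_sum => i _.
  by rewrite st ger0_norm.
have nu : nondecreasing_seq u.
  by apply/nondecreasing_seqP => n; rewrite -subr_ge0 st.
move/cvgrPdist_lt: (cu) => /(_ e e0)[N _ hN]; exists N => m.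
have := hN N (leqnn N); rewrite ltr_norml => /andP[_ h].
have := nondecreasing_cvgn_le nu cu (N + m)%N.
rewrite [u (N + m)%N]big_split_ord /= -/(u N); lra.
Qed.

Lemma ae_sum_lin (A B C D : nat -> R -> R[i]) (v w : R[i]) M :
  (forall n, {ae mu, forall r, D n r = A n r + v * B n r + w * C n r}) ->
  {ae mu, forall r, \sum_(n < M) A n r + v * (\sum_(n < M) B n r) + w * (\sum_(n < M) C n r) = \sum_(n < M) D n r}.
Proof.
move=> h; elim: M => [|M IH]; first by apply: aeT => r; rewrite !big_ord0 !mulr0 !addr0.
by apply: (aeS (aeI IH (h M))) => r [e1 e2]; rewrite !big_ord_recr /= -e1 e2; ring.
Qed.

(** A chosen limit of the partial sums, determined modulo null sets; [l2sumP] shows that it exists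
    when the norms are summable. *)
Definition l2sum F : R -> R[i] := xget (fun=> 0) [set f | l2cvg (fun M r => \sum_(n < M) F n r) f].

Lemma l2sumP F (a : nat -> R) S : (forall n, l2 (F n)) -> (forall n, nrm (F n) <= a n) ->
  (forall M, \sum_(n < M) a n <= S) -> l2cvg (fun M r => \sum_(n < M) F n r) (l2sum F).
Proof.
move=> lF Fa hS; rewrite /l2sum; case: xgetP => // /= H.
have a0 n : 0 <= a n by exact: le_trans (Fa n).
have lP M : l2 (fun r => \sum_(n < M) F n r) by apply: l2_sum.
have [e e0|f lf /seq_cvg0P cf] := l2_complete lP.
  have e2 : 0 < e / 3 by rewrite divr_gt0.
  have [N hN] := summable_tail a0 hS e2.
  have key m : nrm (fun r => \sum_(n < N + m) F n r - \sum_(n < N) F n r) <= e / 3.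
    rewrite (eq_nrm (g := fun r => \sum_(i < m) F (N + i)%N r)); last first.
      by move=> r; rewrite big_split_ord /= (addrC (bigop _ _ _)) addrK.
    by apply: le_trans (nrm_sum _ _) (le_trans _ (hN m)) => //; apply: ler_sum.
  exists N => m n Nm Nn; have := key (m - N)%N; have := key (n - N)%N; rewrite !subnKC// => k1 k2; rewrite nrm_sym in k1.
  by have := nrm_tri (lP m) (lP n) (lP N); lra.
exfalso; apply: (H f); split => // e e0; have [N hN] := cf (fun n => nrm_ge0 _) e e0.
by exists N => n /hN /ltW.
Qed.

End l2_series.

(** * Sums of block operators and their derivatives in x *)

Section block_series.
Variable R : realType.
Implicit Types (f u : R -> R[i]) (g : nat -> R -> R[i]) (x h r : R) (n l : nat).
Variable t : R.

(* Block 0 lives on the real line, block j.+1 on the line Im z = 4^-j. *)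
Definition hgt n : R := if n is j.+1 then 4^-1 ^+ j else 0.
Definition Lt n f : R -> R[i] := if n is j.+1 then Kl (4^-1 ^+ j) f else K0 f.

Lemma quarter_gt0 j : 0 < 4^-1 ^+ j :> R. Proof. by rewrite exprn_gt0// invr_gt0. Qed.

Lemma hgt_itv n : 0 <= hgt n <= 1.
Proof.
case: n => [|j] /=; first by rewrite lexx ler01.
by rewrite (ltW (quarter_gt0 j)) exprn_ile1// ?invr_ge0// invf_le1 ?ler1n.
Qed.

Lemma Lt_contract n f : l2 f -> hardy (Lt n f) /\ nrm (Lt n f) <= nrm f.
Proof.
case: n => [|j] lf /=; first by split; [exact: hardy_K0|exact: nrm_K0].
by have j0 := quarter_gt0 j; split; [exact: hardy_Kl|case: (Kl_contract lf j0)].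
Qed.

Lemma Lt_lin n f u c : l2 f -> l2 u ->
  {ae mu, forall r, Lt n (fun s => f s + c * u s) r = Lt n f r + c * Lt n u r}.
Proof.
case: n => [|j] lf lu /=; first exact: K0_lin.
have j0 : 0 < 4^-1 ^+ j :> R := quarter_gt0 j.
by apply: aeT => r; rewrite /Kl KD ?KZ//; exact: l2Z.
Qed.

(** The l-th x-derivative of the n-th block on its own line: each derivative of the phase produces a
    factor 2iz, with z = r + i hgt n. *)
Definition V g n l x r : R[i] :=
  (2%:R%:C * (0 +i* 1) * (r +i* hgt n)) ^+ l * Ex t x (r +i* hgt n) * g n r.

(** The quadratic bound involves the derivative of order l + 2, whose blocks need not be summable,
    and serves finitely many blocks. The linear bound costs order l + 1 only and serves the tail. *)
Lemma V_diff g n l x h r : `|h| <= 1 ->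
  cmod (V g n l (x + h) r + -1 * V g n l x r + - h%:C * V g n l.+1 x r) <= expR 2 * `|h| ^+ 2 * cmod (V g n l.+2 x r) /\
  cmod (V g n l (x + h) r + -1 * V g n l x r + - h%:C * V g n l.+1 x r) <= (expR 2 + 1) * `|h| * cmod (V g n l.+1 x r).
Proof.
move=> h1; pose a : R[i] := 2%:R%:C * (0 +i* 1) * (r +i* hgt n).
have ra : `|Re (a * h%:C)| <= 2.
  rewrite (_ : Re _ = - (2 * hgt n * h)); last first.
    by rewrite /a !ReImE /=; ring.
  have /andP[a0 a1] := hgt_itv n; rewrite normrN !normrM (ger0_norm a0) ger0_norm//.
  by have := normr_ge0 h; nra.
have eE : expR `|Re (a * h%:C)| <= expR 2 by rewrite ler_expR.
have -> : V g n l (x + h) r + -1 * V g n l x r + - h%:C * V g n l.+1 x r =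
    a ^+ l * Ex t x (r +i* hgt n) * g n r * (cexp (a * h%:C) - 1 - a * h%:C).
  by rewrite /V ExD -/a exprS; ring.
set W := a ^+ l * _ * _; have W0 := cmod_ge0 W.
have V1 : cmod (V g n l.+1 x r) = cmod W * cmod a by rewrite /V -/a -cmodM /W; congr cmod; rewrite exprS; ring.
have V2 : cmod (V g n l.+2 x r) = cmod W * cmod a ^+ 2.
  by rewrite /V -/a -cmodX -cmodM /W; congr cmod; rewrite !exprS expr0; ring.
have ah : cmod (a * h%:C) = cmod a * `|h| by rewrite cmodM cmod_real.
rewrite V1 V2 cmodM; split.
  apply: le_trans (ler_wpM2l W0 (cexp_quad _)) _; rewrite ah.
  rewrite (_ : expR 2 * `|h| ^+ 2 * (cmod W * cmod a ^+ 2) = cmod W * ((cmod a * `|h|) ^+ 2 * expR 2)); last by ring.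
  by apply: (ler_wpM2l W0); rewrite ler_wpM2l// sqr_ge0.
have k0 : 0 <= cmod a * `|h| by rewrite mulr_ge0.
apply: le_trans (_ : cmod W * (cmod a * `|h| * expR 2 + cmod a * `|h|) <= _); last first.
  by apply: eq_ler; ring.
apply: (ler_wpM2l W0); apply: le_trans (cmodB _ _) _; rewrite ah lerD2r.
by apply: le_trans (cexp_lip _) _; rewrite ah ler_wpM2l.
Qed.

Variables (k : nat) (c : nat -> nat -> R) (S : R).
Hypothesis c0 : forall n l, 0 <= c n l.
Hypothesis cS : forall l M, (l <= k)%N -> \sum_(n < M) c n l <= S.

(** The block bounds reach order k + 1 while their sums are controlled up to order k only: the
    quadratic bound of [V_diff] is used one order beyond summability. *)
Definition admissible g N := 0 <= N /\ forall n l x, (l <= k.+1)%N ->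
  l2 (V g n l x) /\ nrm (V g n l x) <= CE t x * c n l * N.

Definition bop g l x : R -> R[i] := l2sum (fun n => Lt n (V g n l x)).

Lemma bop_cvg g N l x : admissible g N -> (l <= k)%N ->
  l2cvg (fun M r => \sum_(n < M) Lt n (V g n l x) r) (bop g l x) /\ hardy (bop g l x) /\
  nrm (bop g l x) <= CE t x * S * N.
Proof.
move=> [N0 ad] lk; have {}ad n := ad n l x (leqW lk).
have hL n := Lt_contract n (ad n).1.
have lL n : l2 (Lt n (V g n l x)) by apply: hardy_l2; case: (hL n).
have bL n : nrm (Lt n (V g n l x)) <= CE t x * c n l * N.
  by apply: le_trans (ad n).2; case: (hL n).
have sL M : \sum_(n < M) CE t x * c n l * N <= CE t x * S * N.
  by rewrite -mulr_suml ler_wpM2r// -mulr_sumr ler_wpM2l ?expR_ge0// cS.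
have H := l2sumP lL bL sL; split => //; split.
  apply: (l2cvg_hardy H) => M; elim: M => [|M IH].
    by apply: (eq_hardy _ (hardy0 R)) => r; rewrite big_ord0.
  by apply: (eq_hardy _ (hardyD IH (hL M).1)) => r; rewrite big_ord_recr.
apply: (l2cvg_le H) => M; apply: le_trans (sL M).
by apply: le_trans (nrm_sum _ (fun n : 'I_M => lL n)) _; apply: ler_sum => n _.
Qed.

Lemma bop_lin g1 g2 g3 N1 N2 N3 l x (a : R[i]) : admissible g1 N1 -> admissible g2 N2 -> admissible g3 N3 ->
  (forall n r, g3 n r = g1 n r + a * g2 n r) -> (l <= k)%N ->
  {ae mu, forall r, bop g3 l x r = bop g1 l x r + a * bop g2 l x r}.
Proof.
move=> a1 a2 a3 E lk; have [H1 _] := bop_cvg x a1 lk; have [H2 _] := bop_cvg x a2 lk; have [H3 _] := bop_cvg x a3 lk.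
have [lF lf _] := l2cvg_lin a H1 H2.
apply: (l2cvg_unique H3); have [l3 l3' _] := H3.
apply: (l2cvg_ae l3 lf _ _ (l2cvg_lin a H1 H2)) => [M|]; last exact: aeT.
elim: M => [|M IH]; first by apply: aeT => r; rewrite !big_ord0 mulr0 addr0.
have lk1 : (l <= k.+1)%N by exact: leqW.
apply: (aeS (aeI IH (Lt_lin M a (a1.2 M l x lk1).1 (a2.2 M l x lk1).1))) => r [e1 e2].
rewrite !big_ord_recr /= (_ : V g3 M l x = fun s => V g1 M l x s + a * V g2 M l x s).
  by rewrite e2 -e1; ring.
by apply/funext => s; rewrite /V E; ring.
Qed.

Lemma bop_vd g N l : admissible g N -> (l < k)%N -> vd (bop g l) (bop g l.+1).
Proof.
move=> ad lk x e e0; have [N0 adm] := ad; have lk' := ltnW lk.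
have C0 : 0 <= CE t x by exact: expR_ge0.
pose A := expR 2 + 1 : R; have A0 : 0 < A by rewrite ltr_wpDl ?expR_ge0.
pose B := A * CE t x * N + 1; have B0 : 0 < B by rewrite ltr_wpDl ?mulr_ge0 ?(ltW A0).
(* Beyond N1 the linear bounds sum to at most (e/2) |h|; the first N1 blocks give a multiple of
   |h|^2, made small by the choice of h. *)
have [N1 hN1] := summable_tail (fun n => c0 n l.+1) (fun M => cS M lk) (divr_gt0 (divr_gt0 e0 (ltr0Sn _ 1)) B0).
pose D := \sum_(n < N1) c n l.+2; have D0 : 0 <= D by apply: sumr_ge0.
have D1 : 0 < B * (D + 1) by rewrite mulr_gt0// ltr_wpDl.
exists (Num.min 1 (e / 2 / (B * (D + 1)))); first by rewrite lt_min ltr01 !divr_gt0.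
move=> h; rewrite lt_min => /andP[/ltW h1]; rewrite ltr_pdivlMr// => hD.
pose W n r := V g n l (x + h) r + -1 * V g n l x r + - h%:C * V g n l.+1 x r.
have lV (m : nat) n y : (m <= k.+1)%N -> l2 (V g n m y) by move=> mk; case: (adm n m y mk).
have lW n : l2 (W n) by apply: l2D; [apply: l2D; [|apply: l2Z]|apply: l2Z]; apply: lV; exact: leqW.
have b1 n : nrm (W n) <= B * `|h| * c n l.+1.
  have p0 : 0 <= A * `|h| by rewrite mulr_ge0// ltW.
  apply: le_trans (nrm_le_mul p0 (lW n) (lV _ n x (leqW lk)) (fun r => (V_diff g n l x r h1).2)) _.
  have [_ nV] := adm n l.+1 x (leqW lk).
  apply: le_trans (ler_wpM2l p0 nV) _.
  rewrite (_ : A * `|h| * (CE t x * c n l.+1 * N) = (B - 1) * (`|h| * c n l.+1)); last by rewrite /B; ring.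
  by rewrite -[leRHS]mulrA; apply: ler_wpM2r; rewrite ?mulr_ge0// gerBl.
have b2 n : nrm (W n) <= B * `|h| ^+ 2 * c n l.+2.
  have p0 : 0 <= expR 2 * `|h| ^+ 2 by rewrite mulr_ge0 ?expR_ge0 ?sqr_ge0.
  apply: le_trans (nrm_le_mul p0 (lW n) (lV l.+2 n x lk) (fun r => (V_diff g n l x r h1).1)) _.
  have [_ nV] := adm n l.+2 x lk.
  apply: le_trans (ler_wpM2l p0 nV) _.
  rewrite (_ : expR 2 * `|h| ^+ 2 * (CE t x * c n l.+2 * N) = (expR 2 * CE t x * N) * (`|h| ^+ 2 * c n l.+2)); last by ring.
  rewrite -[leRHS]mulrA; apply: ler_wpM2r; first by apply: mulr_ge0; rewrite ?sqr_ge0.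
  rewrite /B /A.
  have : 0 <= CE t x * N by rewrite mulr_ge0.
  by nra.
have [H0 _] := bop_cvg x ad lk'; have [Hh _] := bop_cvg (x + h) ad lk'; have [H1 _] := bop_cvg x ad lk.
have H := l2cvg_lin (- h%:C) (l2cvg_lin (-1) Hh H0) H1.
rewrite (eq_nrm (g := fun r => bop g l (x + h) r + -1 * bop g l x r + - h%:C * bop g l.+1 x r)); last by move=> r; rewrite mulN1r mulNr.
apply: (l2cvg_le H) => M.
have lL n : l2 (Lt n (W n)) by apply: hardy_l2; case: (Lt_contract n (lW n)).
have hn n : {ae mu, forall r, Lt n (W n) r =
    Lt n (V g n l (x + h)) r + -1 * Lt n (V g n l x) r + - h%:C * Lt n (V g n l.+1 x) r}.
  have l1 := lV l n (x + h) (leqW lk'); have l2' := lV l n x (leqW lk').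
  apply: (aeS (aeI (Lt_lin n (-1) l1 l2') (Lt_lin n (- h%:C) (l2D l1 (l2Z (-1) l2')) (lV l.+1 n x (leqW lk))))) => r [E1 E2].
  by rewrite E2 E1.
rewrite (nrm_ae (ae_sum_lin M hn)).
have bnd m : nrm (Lt m (W m)) <= (if (m < N1)%N then B * `|h| ^+ 2 * c m l.+2 else B * `|h| * c m l.+1).
  by apply: le_trans (Lt_contract m (lW m)).2 _; case: ifP.
apply: le_trans (nrm_sum _ (fun n : 'I_M => lL n)) _.
(* The range is lengthened to N1 + M so that it splits at N1 whatever M is. *)
apply: (@le_trans _ _ (\sum_(n < N1 + M) (if (n < N1)%N then B * `|h| ^+ 2 * c n l.+2 else B * `|h| * c n l.+1))).
  rewrite addnC big_split_ord /= -[leLHS]addr0 lerD//; first by apply: ler_sum => n _.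
  by apply: sumr_ge0 => n _; apply: le_trans (bnd _).
rewrite big_split_ord /=.
rewrite (eq_bigr (fun n : 'I_N1 => B * `|h| ^+ 2 * c n l.+2)) => [|n _]; last by rewrite ltn_ord.
rewrite [X in _ + X](eq_bigr (fun n : 'I_M => B * `|h| * c (N1 + n)%N l.+1)) => [|n _]; last by rewrite ltnNge leq_addr.
rewrite -!mulr_sumr -/D.
have : B * `|h| * (\sum_(i < M) c (N1 + i)%N l.+1) <= B * `|h| * (e / 2 / B).
  by rewrite ler_wpM2l// mulr_ge0// ltW.
have -> : B * `|h| * (e / 2 / B) = e / 2 * `|h| by rewrite mulrC mulrA divfK// gt_eqF.
have : B * `|h| ^+ 2 * D <= e / 2 * `|h|.
  have n0 := normr_ge0 h; have : 0 <= B * `|h| by rewrite mulr_ge0// ltW.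
  move=> p; rewrite expr2 mulrA mulrAC ler_wpM2r//; lra.
lra.
Qed.

End block_series.

(** * Measurable versions bounded everywhere *)

Section measurable_versions.
Variable R : realType.
Implicit Types (f g : R -> R[i]) (F : nat -> R -> R[i]).

Lemma clip f (B : R) : 0 <= B -> cmeas f -> exists f', [/\ cmeas f', forall r, cmod (f' r) <= B &
  forall r, cmod (f r) <= B -> f' r = f r].
Proof.
move=> B0 mf; pose A := [set r | cmod (f r) <= B]; exists (fun r => (\1_A r)%:C * f r).
have mA : measurable A.
  have := meas_cmod mf measurableT (@measurable_itv R `]-oo, B]).
  by rewrite setTI (_ : _ @^-1` _ = A)//; apply/seteqP; split => r /=; rewrite in_itv.
split => [|r|r h]; first by apply: cmeasM => //; exact: cmeas_indic.
  rewrite indicE; case: (boolP (r \in A)); first by rewrite inE mul1r.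
  by rewrite mul0r cmod0.
by rewrite indicE mem_set// mul1r.
Qed.

Lemma nrm_bmul_ae f g (B : R) : 0 <= B -> cmeas f -> l2 g -> {ae mu, forall r, cmod (f r) <= B} ->
  nrm (fun r => f r * g r) <= B * nrm g.
Proof.
move=> B0 mf lg h; have [f' [m' b' e']] := clip B0 mf.
rewrite (nrm_ae (g := fun r => f' r * g r)); first exact: nrm_bmul.
by apply: (aeS h) => r /e' ->.
Qed.

End measurable_versions.

(** * Strict contractivity of the Hankel operator *)

Section contraction.
Variable R : realType.
Implicit Types (f u : R -> R[i]) (x h r : R) (z : R[i]).

(** The second and third parts of [reflection_bounds] in almost everywhere form, so that they pass
    to a measurable version of R. *)
Definition contractive f :=
  (forall d : R, 0 < d -> exists2 k : R, k < 1 & {ae mu, forall r, d <= `|r| -> cmod (f r) <= k}) /\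
  ((exists k d : R, [/\ k < 1, 0 < d & {ae mu, forall r, `|r| < d -> cmod (f r) <= k}]) \/
   forall c : R, 0 < c -> exists2 d : R, 0 < d & {ae mu, forall r, `|r| < d -> cmod (f r + 1) <= c}).

Lemma cmeas_Ex_real t x : cmeas (fun r : R => Ex t x r%:C).
Proof.
rewrite (_ : (fun r => _) = (fun r => expi (8 * t * r ^+ 3 + 2 * x * r))); last by apply/funext => r; exact: Ex_real.
by apply: cmeas_expi; apply: measurable_funD; apply: measurable_funM => //; exact: measurable_funX.
Qed.

Lemma cmod_Ex_real t x r : cmod (Ex t x r%:C) = 1. Proof. by rewrite Ex_real cmod_expi. Qed.

Lemma Ex_near1 t x r : 0 < t -> `|r| <= 1 -> cmod (Ex t x r%:C - 1) <= (8 * t + 2 * `|x|) * `|r|.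
Proof.
move=> t0 r1; rewrite Ex_real -cexp_imag; apply: le_trans (cexp_lip _) _.
rewrite -[Re _]/(0 : R) normr0 expR0 mulr1 cmod_imag; apply: le_trans (ler_normD _ _) _.
have : `|r ^+ 3| <= `|r| by rewrite normrX exprS ler_piMr// exprn_ile1.
have : 0 <= 8 * t by rewrite mulr_ge0// ltW.
move: (8 * t) (r ^+ 3) => a r3 a0 h; rewrite [leRHS]mulrDl; apply: lerD.
  by rewrite normrM (ger0_norm a0); exact: ler_wpM2l.
by rewrite normrM normrM ger0_norm.
Qed.

(* Multiplying by 1 / (r + i) keeps u analytic in the upper half-plane. *)
Lemma K0_hardy_mul u (c : R[i]) : hardy u -> {ae mu, forall r, K0 (fun s => c * ck (0 +i* 1) s * u s) r = 0}.
Proof.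
move=> [lu hu]; have i0 : 0 < Im (0 +i* 1 : R[i]) by rewrite /= ltr01.
have [li _] := l2_ck i0.
have l : l2 (fun s => c * ck (0 +i* 1) s * u s).
  apply: (l2_bmul (B := cmod c)) => //; first by apply: cmeasM; [exact: cmeas_cst|exact: cmeas_ck].
  by move=> s; rewrite cmodM ler_piMr//; apply: le_trans (cmod_ck_le _ i0) _; rewrite /= invr1.
apply: (aeS (K0_boundary l)) => r h; apply: (small_cvg_unique h) => e e0.
exists (1 / 2); first by rewrite divr_gt0.
move=> a /andP[a0 a1]; pose z := r +i* a; have z0 : 0 < Im z by [].
have [lz _] := l2_ck z0.
have zi : z - (0 +i* 1) != 0 by apply: Im_neq0; rewrite ImB /= subr_eq0; apply: contraTneq a1 => ->; lra.
rewrite subr0 KE (eq_cint (g := fun s => (c / (z - (0 +i* 1))) * (u s * ck (0 +i* 1) s - u s * ck z s))); last first.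
  move=> s; have n1 := ck_neq0 s (lt0r_neq0 i0); have n2 := ck_neq0 s (lt0r_neq0 z0).
  by rewrite -/z /ck; move: n1 n2 zi; clear; move: (0 +i* 1 : R[i]) z => i w n1 n2 zi; field; rewrite n1 n2 zi.
rewrite cintZ; last by apply: cIB; exact: cI_mul.
by rewrite cintB -?tpi_K ?hu//; [rewrite !mulr0 subrr !mulr0 cmod0 ltW|exact: cI_mul|exact: cI_mul].
Qed.

Variables (t : R) (rho : R -> R[i]).
Hypotheses (t0 : 0 < t) (mrho : cmeas rho) (rho1 : {ae mu, forall r, cmod (rho r) <= 1}).

Definition sym x r : R[i] := rho r * Ex t x r%:C.

Lemma cmeas_sym x : cmeas (sym x). Proof. by apply: cmeasM => //; exact: cmeas_Ex_real. Qed.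

Lemma sym_le1 x : {ae mu, forall r, cmod (sym x r) <= 1}.
Proof. by apply: (aeS rho1) => r; rewrite cmodM cmod_Ex_real mulr1. Qed.

Lemma l2_bmul_ae f u (B : R) : 0 <= B -> cmeas f -> l2 u -> {ae mu, forall r, cmod (f r) <= B} -> l2 (fun r => f r * u r).
Proof.
move=> B0 mf lu h; have [f' [m' b' e']] := clip B0 mf.
apply: (l2_ae (g := fun r => f' r * u r)); first by apply: cmeasM => //; case: lu.
  by apply: (aeS h) => r /e' ->.
exact: l2_bmul b' lu.
Qed.

Lemma l2_sym x u : l2 u -> l2 (fun r => sym x r * u r).
Proof. by move=> lu; apply: (l2_bmul_ae ler01 (cmeas_sym x) lu); exact: sym_le1. Qed.

(* If R(0) = -1, the bounded function (1/2) eps i / (r + i) is added to the symbol: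
   it does not change the operator and lowers the modulus of the symbol near 0. *)
Lemma sym_contraction x : contractive rho -> exists2 th, 0 <= th < 1 & exists2 d, 0 < d & forall h u, `|h| <= d -> hardy u ->
  nrm (K0 (fun r => sym (x + h) r * u r)) <= th * nrm u.
Proof.
case=> away near0; have fin th (b : R[i]) : 0 <= th < 1 -> (forall h, `|h| <= 1 ->
    {ae mu, forall r, cmod (sym (x + h) r + b * ck (0 +i* 1) r) <= th}) ->
    exists2 th, 0 <= th < 1 & exists2 d, 0 < d & forall h u, `|h| <= d -> hardy u ->
      nrm (K0 (fun r => sym (x + h) r * u r)) <= th * nrm u.
  move=> tt H; exists th => //; exists 1 => // h u h1 hu; have lu := hardy_l2 hu.
  have th0 : 0 <= th by case/andP: tt.
  have i0 : 0 < Im (0 +i* 1 : R[i]) by rewrite /= ltr01.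
  have mb : cmeas (fun r : R => b * ck (0 +i* 1) r) by apply: cmeasM; [exact: cmeas_cst|exact: cmeas_ck].
  have lb : l2 (fun r => b * ck (0 +i* 1) r * u r).
    apply: (l2_bmul (B := cmod b)) => // s; rewrite cmodM ler_piMr//.
    by apply: le_trans (cmod_ck_le _ i0) _; rewrite /= invr1.
  have ms : cmeas (fun r => sym (x + h) r + b * ck (0 +i* 1) r) by apply: cmeasD => //; exact: cmeas_sym.
  have l3 : l2 (fun r => (sym (x + h) r + b * ck (0 +i* 1) r) * u r).
    by apply: (l2_bmul_ae th0 ms lu); exact: H.
  have E := K0_lin (-1) l3 lb.
  rewrite (nrm_ae (g := K0 (fun r => (sym (x + h) r + b * ck (0 +i* 1) r) * u r))).
    by apply: le_trans (nrm_K0 l3) _; apply: nrm_bmul_ae => //; exact: H.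
  apply: (aeS (aeI E (K0_hardy_mul b hu))) => r [e1 e2]; rewrite e2 mulr0 addr0 in e1.
  by rewrite -e1; congr (K0 _ r); apply/funext => s; ring.
case: near0 => [[k [d [k1 d0 H]]]|H].
  have [k' k1' H'] := away _ d0; pose th := Num.max 0 (Num.max k k').
  apply: (fin th 0) => [|h _]; first by rewrite le_max lexx /= !gt_max ltr01 k1.
  apply: (aeS (aeI H H')) => r [h1 h2]; rewrite mul0r addr0 cmodM cmod_Ex_real mulr1 !le_max.
  by have [/h1 ->|/h2 ->] := ltP `|r| d; rewrite ?orbT.
pose L := 8 * t + 2 * (`|x| + 1); have L0 : 0 < L by rewrite addr_gt0// mulr_gt0// ltr_wpDl.
have s0 : 0 < 1 / 16 :> R by rewrite divr_gt0.
(* For |r| < d three quantities are at most 1/16: |rho r + 1|, |r|, and the distance of the phase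
   from 1, the last one uniformly in |h| <= 1. *)
have [d1 d10 H1] := H _ s0; pose d := Num.min (Num.min d1 (1 / 16)) (1 / 16 / L).
have d0 : 0 < d by rewrite !lt_min d10 s0 divr_gt0.
have [k k1 H2] := away _ d0; pose e := Num.min (1 / 2) ((1 - k) / 2).
have [e0 e1 e2] : [/\ 0 < e, e <= 1 / 2 & e <= (1 - k) / 2].
  by split; rewrite ?lt_min ?ge_min ?lexx ?orbT ?divr_gt0 ?subr_gt0.
(* Let s be the symbol and b the added function. Near 0, |s + b|^2 <= 1 - 3e/2 + e^2 <= (1 - e/4)^2
   since e <= 1/2; away from 0, |s + b| <= k + e <= (1 + k)/2. *)
pose th := Num.max (1 - e / 4) ((1 + k) / 2).
apply: (fin th (e%:C * (0 +i* 1))) => [|h h1].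
  by rewrite le_max gt_max; apply/andP; split; [apply/orP; left; lra|apply/andP; split; lra].
apply: (aeS (aeI (aeI H1 H2) rho1)) => r [[g1 g2] g3].
set b := e%:C * (0 +i* 1) * ck (0 +i* 1) r.
have i0 : 0 < Im (0 +i* 1 : R[i]) by rewrite /= ltr01.
have ci : cmod (ck (0 +i* 1) r) <= 1 by apply: le_trans (cmod_ck_le _ i0) _; rewrite /= invr1.
have cb : cmod b <= e.
  by rewrite /b !cmodM cmod_real cmod_imag normr1 mulr1 (ger0_norm (ltW e0)) ler_piMr// ltW.
have [rd|rd] := leP d `|r|.
  apply: le_trans (cmodD _ _) _; rewrite cmodM cmod_Ex_real mulr1 le_max; apply/orP; right.
  by have := g2 rd; lra.
rewrite le_max; apply/orP; left; move: rd; rewrite !lt_min => /andP[/andP[r1 r2] r3].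
have {}g1 := g1 r1; have r4 : `|r| <= 1 by lra.
have hx : `|x + h| <= `|x| + 1 by apply: le_trans (ler_normD _ _) _; rewrite lerD2l.
have E1 : cmod (Ex t (x + h) r%:C - 1) <= 1 / 16.
  apply: le_trans (Ex_near1 _ t0 r4) _; apply: le_trans (_ : L * `|r| <= _).
    by rewrite ler_wpM2r// /L lerD2l ler_wpM2l.
  by rewrite mulrC -ler_pdivlMr// ltW.
have P : cmod (sym (x + h) r + 1) <= 1 / 8.
  rewrite (_ : sym _ _ + 1 = rho r * (Ex t (x + h) r%:C - 1) + (rho r + 1)); last by rewrite /sym; ring.
  apply: le_trans (cmodD _ _) _; rewrite cmodM.
  have : cmod (rho r) * cmod (Ex t (x + h) r%:C - 1) <= 1 * (1 / 16) by apply: ler_pM.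
  lra.
have Bd : cmod (b - e%:C) <= e * (1 / 16).
  have n1 := ck_neq0 r (lt0r_neq0 i0).
  rewrite (_ : b - e%:C = e%:C * (- r%:C * ck (0 +i* 1) r)); last by rewrite /b /ck; field; rewrite n1.
  rewrite !cmodM cmodN !cmod_real (ger0_norm (ltW e0)); apply: ler_wpM2l; first exact: ltW.
  by apply: le_trans (ler_pM _ _ (lexx _) ci) _ => //; rewrite mulr1; lra.
set s := sym (x + h) r in P *; have s1 : cmod s <= 1 by rewrite cmodM cmod_Ex_real mulr1.
have X : Re (s * conjc b) <= - (3 / 4 * e).
  rewrite (_ : s * conjc b = - e%:C + ((s + 1) * conjc b - conjc (b - e%:C))); last first.
    by rewrite conjcB (_ : conjc e%:C = e%:C); [ring|apply: cx_ext; rewrite !ReImE ?oppr0].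
  rewrite ReD ReN ReC; have := le_trans (cmod_ge_Re _) (cmodB ((s + 1) * conjc b) (conjc (b - e%:C))).
  rewrite cmodM !cmod_conj; have : cmod (s + 1) * cmod b <= 1 / 8 * e by apply: ler_pM.
  lra.
have t1 : 0 <= 1 - e / 4 by lra.
rewrite -(@ler_pXn2r _ 2) ?nnegrE// cmod_sqr ReD ImD.
have -> : (Re s + Re b) ^+ 2 + (Im s + Im b) ^+ 2 = cmod s ^+ 2 + 2 * Re (s * conjc b) + cmod b ^+ 2.
  by rewrite !cmod_sqr ReM Re_conj Im_conj; ring.
have s2 : cmod s ^+ 2 <= 1 by rewrite exprn_ile1.
have b2 : cmod b ^+ 2 <= e ^+ 2 by apply: lerXn2r; rewrite ?nnegrE// ltW.
nra.
Qed.

End contraction.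

(** * Moving the contour of the Hankel operator *)

Section contour.
Variable R : realType.
Implicit Types (f u : R -> R[i]) (F G H : R[i] -> R[i]) (z : R[i]) (r e : R).

Lemma small_cvgM (f g : R -> R[i]) a b : small_cvg (fun e => cmod (f e - a)) -> small_cvg (fun e => cmod (g e - b)) ->
  small_cvg (fun e => cmod (f e * g e - a * b)).
Proof.
move=> hf hg e e0; have A1 : 0 < cmod a + 1 by rewrite ltr_wpDl.
have B1 : 0 < 2 * (cmod b + 1) by rewrite mulr_gt0// ltr_wpDl.
have [|d1 d10 h1] := hf (Num.min 1 (e / (2 * (cmod b + 1)))); first by rewrite lt_min ltr01 divr_gt0.
have [|d2 d20 h2] := hg (e / 2 / (cmod a + 1)); first by rewrite !divr_gt0.
exists (Num.min d1 d2); first by rewrite lt_min d10.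
move=> x /andP[x0]; rewrite le_min => /andP[x1 x2].
have := h1 x; rewrite x0 x1 le_min => /(_ isT) /andP[k1 k2]; have := h2 x; rewrite x0 x2 => /(_ isT) k3.
rewrite (_ : f x * g x - a * b = (f x - a) * b + f x * (g x - b)); last by ring.
apply: le_trans (cmodD _ _) _; rewrite !cmodM.
have fa : cmod (f x) <= cmod a + 1 by have := cmodD (f x - a) a; rewrite subrK; lra.
have X1 : cmod (f x - a) * cmod b <= e / 2.
  apply: le_trans (ler_wpM2r (cmod_ge0 b) k2) _; rewrite mulrAC ler_pdivrMr//.
  have := cmod_ge0 b; nra.
have X2 : cmod (f x) * cmod (g x - b) <= e / 2.
  apply: le_trans (ler_pM _ _ fa k3) _ => //.
  by rewrite mulrC divfK// gt_eqF.
lra.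
Qed.

Lemma cder_small_cvg F z : (exists D, cder F z D) -> small_cvg (fun e => cmod (F (z + (0 +i* e)) - F z)).
Proof.
move=> [D hD] e e0; have [d d0 hd] := cder_cont hD e0; exists (d / 2); first by rewrite divr_gt0.
move=> x /andP[x0 x1]; apply/ltW/hd; rewrite cmod_imag ger0_norm ?(ltW x0)//.
by apply: le_lt_trans x1 _; lra.
Qed.

Lemma holo_small_cvg F (c r : R) : holo (fun w => c < Im w) F -> c < 0 -> small_cvg (fun e => cmod (F (r +i* e) - F r%:C)).
Proof.
move=> hF c0 e e0; have [d d0 hd] := @cder_small_cvg F r%:C (hF r%:C c0) e e0; exists d => // x /hd.
by rewrite (_ : r%:C + (0 +i* x) = r +i* x)//; cx_eq; rewrite ?addr0 ?add0r.
Qed.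

(** Replacing t by t + i e0 in the kernel 1/(t + r) is the same as raising the evaluation point to
    height e0, hence [Kl e0]. *)
Lemma K0_shift H f (M e0 : R) : holo (fun w => 0 < Im w) H -> 0 < e0 ->
  (forall e, 0 < e <= e0 -> l2 (fun r => H (r +i* e)) /\ nrm (fun r => H (r +i* e)) <= M) ->
  cmeas f -> {ae mu, forall r, small_cvg (fun e => cmod (H (r +i* e) - f r))} ->
  l2 f /\ {ae mu, forall r, K0 f r = Kl e0 (fun s => H (s +i* e0)) r}.
Proof.
move=> hH e00 hM mf bF; have [lf key] := K_line hH e00 hM mf bF; split => //.
have [l0 _] : l2 (fun r => H (r +i* e0)) /\ nrm (fun r => H (r +i* e0)) <= M by apply: hM; rewrite e00 lexx.
apply: (aeS (K0_boundary lf)) => r h; apply: (small_cvg_unique h).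
move=> e e1; have [d d0 hd] := @cder_small_cvg (K (fun s => H (s +i* e0))) (r +i* e0) (K_cder (z := r +i* e0) l0 e00) e e1.
exists d => // x xd; have := hd x xd; have /andP[x0 _] := xd; rewrite key// /Kl.
by rewrite (_ : r +i* x + (0 +i* e0) = r +i* e0 + (0 +i* x))//; cx_ring.
Qed.

End contour.

(** * Fourier transforms of compactly supported functions at complex points *)

Section laplace.
Variable R : realType.
Implicit Types (f : R -> R[i]) (z : R[i]) (r s e : R).

(** Extends [four] from real to complex arguments; entire when f is integrable with support in some
    [0, S]. *)
Definition Lap f z : R[i] := cint (fun s => f s * cexp (- 2%:R%:C * (0 +i* 1) * s%:C * z)).

Definition supp f (S : R) := forall s, ~~ (0 <= s <= S) -> f s = 0.

Lemma Re_lap s z : Re (- 2%:R%:C * (0 +i* 1) * s%:C * z) = 2 * s * Im z.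
Proof. by rewrite !ReImE /=; ring. Qed.

Lemma cmeas_lap z : cmeas (fun s : R => cexp (- 2%:R%:C * (0 +i* 1) * s%:C * z)).
Proof.
apply: ccont_cmeas; have E s : - 2%:R%:C * (0 +i* 1) * s%:C * z = (- 2%:R%:C * (0 +i* 1) * z) * s%:C by ring.
rewrite (_ : (fun s => _) = (fun s : R => cexp ((- 2%:R%:C * (0 +i* 1) * z) * s%:C))).
  exact: rder_ccont (rder_cexp_line _).
by apply/funext => s; rewrite E.
Qed.

Lemma lap_cmod f (S B : R) z : supp f S -> S * `|Im z| <= B -> forall s,
  cmod (f s * cexp (- 2%:R%:C * (0 +i* 1) * s%:C * z)) <= expR (2 * B) * cmod (f s).
Proof.
move=> fS SB s; case: (boolP (0 <= s <= S)) => [/andP[s0 sS]|/fS ->]; last by rewrite mul0r cmod0 mulr0.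
rewrite cmodM cmod_cexp Re_lap mulrC ler_wpM2r// ler_expR -mulrA ler_wpM2l//; apply: le_trans SB.
apply: le_trans (_ : s * `|Im z| <= _); first by rewrite ler_wpM2l// ler_norm.
by rewrite ler_wpM2r.
Qed.

Lemma lap_cI f (S B : R) z : cI f -> supp f S -> S * `|Im z| <= B ->
  cI (fun s => f s * cexp (- 2%:R%:C * (0 +i* 1) * s%:C * z)).
Proof.
move=> cf fS SB; apply: (cI_le _ (rIZ (expR (2 * B)) (cI_cmod cf)) (lap_cmod fS SB)).
by apply: cmeasM; [exact: cI_meas|exact: cmeas_lap].
Qed.

Lemma Lap_le f (S B : R) z : cI f -> supp f S -> S * `|Im z| <= B ->
  cmod (Lap f z) <= expR (2 * B) * intg (fun s => cmod (f s)).
Proof.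
move=> cf fS SB; rewrite -intgZ; last exact: cI_cmod.
by apply: cmod_cint_le (lap_cmod fS SB); [exact: lap_cI SB|exact: rIZ (cI_cmod cf)].
Qed.

Lemma Lap_four f (S B e : R) : cmeas f -> supp f S -> S * `|e| <= B -> cI f -> l2 f ->
  l2 (fun r => Lap f (r +i* e)) /\ nrm (fun r => Lap f (r +i* e)) <= Num.sqrt (2 * pi) * (expR (2 * B) * nrm f).
Proof.
move=> mf fS SB cf lf; pose g s := f s * cexp (- 2%:R%:C * (0 +i* 1) * s%:C * (0 +i* e)).
have hg := lap_cmod (z := 0 +i* e) fS SB.
have lg : l2 g.
  apply: (l2_dom (g := fun s => (expR (2 * B))%:C * f s)); [|exact: l2Z|].
    by apply: cmeasM => //; exact: cmeas_lap.
  by move=> s; rewrite cmodM cmod_real ger0_norm ?expR_ge0//; exact: hg.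
have [l n] := plancherel (lap_cI (z := 0 +i* e) cf fS SB : cI g) lg.
have E r : four g r = Lap f (r +i* e).
  apply: eq_cint => s; rewrite /g -mulrA -cexp_imag -cexpD; congr (_ * cexp _).
  by cx_ring.
split; first exact: eq_l2 l.
rewrite -(eq_nrm E); apply: le_trans n _; rewrite ler_wpM2l ?sqrtr_ge0//.
by apply: nrm_le_mul hg => //; exact: expR_ge0.
Qed.

Lemma Lap_cder f (S : R) z : cI f -> 0 <= S -> supp f S -> exists D, cder (Lap f) z D.
Proof.
move=> cf S0 fS; pose g s := (- 2%:R%:C * (0 +i* 1) * s%:C) * f s.
have mg : cmeas g by apply: cmeasM; [apply: cmeasM; [exact: cmeas_cst|apply: cmeasC; exact: measurable_id]|exact: cI_meas].
have gS : supp g S by move=> s /fS h; rewrite /g h mulr0.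
have gf s : cmod (g s) <= 2 * S * cmod (f s).
  case: (boolP (0 <= s <= S)) => [/andP[s0 sS]|/fS h]; last by rewrite /g h mulr0 cmod0 mulr0.
  rewrite cmodM ler_wpM2r// !cmodM cmodN !cmod_real cmod_imag normr1 mulr1 !ger0_norm//.
  by rewrite ler_wpM2l.
have cg : cI g by exact: cI_le mg (rIZ (2 * S) (cI_cmod cf)) gf.
exists (Lap g z) => e e0; set B := S * `|Im z|.
pose C := expR (2 * B) * (4 * S ^+ 2 * expR (2 * S)) * intg (fun s => cmod (f s)) + 1.
have C0 : 0 < C.
  by rewrite ltr_wpDl// !mulr_ge0 ?expR_ge0 ?sqr_ge0//; exact: intg_ge0.
exists (Num.min 1 (e / C)); first by rewrite lt_min ltr01 divr_gt0.
move=> h; rewrite lt_min => /andP[h1]; rewrite ltr_pdivlMr// => hC.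
have c1 := lap_cI cf fS (lexx (S * `|Im (z + h)|)); have c2 := lap_cI cf fS (lexx B); have c3 := lap_cI cg gS (lexx B).
rewrite (_ : _ - _ - _ = cint (fun s => f s * cexp (- 2%:R%:C * (0 +i* 1) * s%:C * (z + h)) -
    f s * cexp (- 2%:R%:C * (0 +i* 1) * s%:C * z) - h * (g s * cexp (- 2%:R%:C * (0 +i* 1) * s%:C * z)))); last first.
  by rewrite cintB; [rewrite cintB// cintZ// (mulrC h)|exact: cIB|exact: cIZ].
pose K0 := expR (2 * B) * (4 * S ^+ 2 * expR (2 * S)).
apply: le_trans (cmod_cint_le (u := fun s => K0 * cmod h ^+ 2 * cmod (f s)) _ _ _) _.
- by apply: cIB; [exact: cIB|exact: cIZ].
- by apply: rIZ; exact: cI_cmod.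
- move=> s; pose v := - 2%:R%:C * (0 +i* 1) * s%:C * h.
  rewrite (_ : _ - _ - _ = f s * cexp (- 2%:R%:C * (0 +i* 1) * s%:C * z) * (cexp v - 1 - v)); last first.
    by rewrite mulrDr cexpD -/v /g /v; ring.
  case: (boolP (0 <= s <= S)) => [/andP[s0 sS]|/fS ->]; last by rewrite !mul0r cmod0 mulr0.
  have hv : cmod v <= 2 * S * cmod h.
    by rewrite !cmodM cmodN !cmod_real cmod_imag normr1 mulr1 !ger0_norm// ler_wpM2r// ler_wpM2l.
  rewrite cmodM (_ : K0 * _ * _ = (expR (2 * B) * cmod (f s)) * ((2 * S * cmod h) ^+ 2 * expR (2 * S))); last by rewrite /K0; ring.
  apply: ler_pM => //; first exact: (lap_cmod fS (lexx B)).
  apply: le_trans (cexp_quad v) _; apply: ler_pM; rewrite ?expR_ge0 ?sqr_ge0//.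
    by apply: lerXn2r; rewrite ?nnegrE// mulr_ge0// mulr_ge0.
  rewrite ler_expR; apply: le_trans (Re_le v) (le_trans hv _).
  by rewrite ler_piMr ?mulr_ge0// ltW.
rewrite intgZ; last exact: cI_cmod.
rewrite (_ : _ * _ * _ = (C - 1) * cmod h * cmod h); last by rewrite /C -/K0; ring.
apply: ler_wpM2r => //; move: hC; have := cmod_ge0 h; lra.
Qed.

End laplace.

(** * Dyadic blocks of the potential and the weighted moment *)

Section dyadic_blocks.
Variable R : realType.
Implicit Types (f p : R -> R[i]) (s u : R) (j n M : nat).

Definition lo j : R := if j is i.+1 then 4 ^+ i else 0.
Definition blk f j s : R[i] := (lo j < s <= 4 ^+ j)%R%:R%:C * f s.

Lemma lo_ge0 j : 0 <= lo j. Proof. by case: j => // j; exact: exprn_ge0. Qed.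
Lemma lo_le j : lo j <= 4 ^+ j.
Proof. by case: j => [|j]; rewrite ?expr0 ?ler01// ler_weXn2l// ler1n. Qed.

Lemma supp_blk f j : supp (blk f j) (4 ^+ j).
Proof.
move=> s h; rewrite /blk; case: (boolP (lo j < s <= 4 ^+ j)) => [/andP[a b]|_]; last by rewrite mul0r.
by move: h; rewrite b (le_trans (lo_ge0 j) (ltW a)).
Qed.

Lemma cmeas_blk f j : cmeas f -> cmeas (blk f j).
Proof. by move=> mf; apply: cmeasM => //; apply: cmeasC; exact: meas_itv. Qed.

Lemma cmod_blk f j s : cmod (blk f j s) = (lo j < s <= 4 ^+ j)%R%:R * cmod (f s).
Proof. by rewrite cmodM cmod_real ger0_norm. Qed.

Lemma blk_bounded f j B : 0 <= B -> cmeas f -> {ae mu, forall s, lo j < s <= 4 ^+ j -> cmod (f s) <= B} ->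
  [/\ cI (blk f j), l2 (blk f j), intg (fun s => cmod (blk f j s)) <= B * 4 ^+ j & nrm (blk f j) <= B * 2 ^+ j].
Proof.
move=> B0 mf h; have mb := cmeas_blk j mf.
have [f' [m' b' e']] := clip B0 mb.
have E : {ae mu, forall s, blk f j s = blk f' j s}.
  apply: (aeS h) => s hs; rewrite {2}/blk e'; last first.
    by rewrite cmod_blk; case: (boolP (lo j < s <= 4 ^+ j)) hs => [_ /(_ isT)|_ _]; rewrite ?mul1r ?mul0r.
  by rewrite /blk; case: (lo j < s <= 4 ^+ j); rewrite ?mul1r ?mul0r.
have [i0 e0] := intg_itv (lo_le j).
have le s : cmod (blk f' j s) <= B * (lo j < s <= 4 ^+ j)%R%:R by rewrite cmod_blk mulrC ler_wpM2r.
have le2 : 4 ^+ j - lo j <= 4 ^+ j by rewrite gerBl lo_ge0.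
have c' : cI (blk f' j) by apply: (cI_le (cmeas_blk j m') (rIZ B i0)) => s; exact: le.
have sq s : (B * (lo j < s <= 4 ^+ j)%R%:R) ^+ 2 = B ^+ 2 * (lo j < s <= 4 ^+ j)%R%:R :> R.
  by rewrite exprMn; congr (_ * _); case: (_ < _ <= _); rewrite ?expr1n ?expr0n.
have isq : rI (fun s => (B * (lo j < s <= 4 ^+ j)%R%:R) ^+ 2) by apply: eq_rI (rIZ (B ^+ 2) i0) => s; rewrite sq.
have l' : l2 (blk f' j) by exact: l2_le (cmeas_blk j m') isq le.
split; [exact: cI_ae mb E c'|exact: l2_ae mb E l'| |].
  rewrite (intg_ae (g := fun s => cmod (blk f' j s))); last by apply: (aeS E) => s ->.
  apply: le_trans (le_intg (cI_cmod c') (rIZ B i0) le) _; rewrite intgZ// e0; exact: ler_wpM2l.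
rewrite (nrm_ae E) nrm_leP; last by rewrite mulr_ge0.
have [_ r'] := l'; apply: le_trans (le_intg r' isq _) _.
  by move=> s; apply: lerXn2r (le s); rewrite ?nnegrE// mulr_ge0.
rewrite (eq_intg sq) intgZ// e0 exprMn; apply: ler_wpM2l; first exact: sqr_ge0.
by apply: le_trans le2 _; rewrite -exprM mulnC exprM expr2 -natrM.
Qed.

Lemma pow4 j : 4 ^+ j = 2 ^+ (j * 2) :> R. Proof. by rewrite mulnC exprM expr2 -natrM. Qed.

Lemma blk_sum f n s : \sum_(j < n.+1) blk f j s = (0 < s <= 4 ^+ n)%R%:R%:C * f s.
Proof.
elim: n => [|n IH]; first by rewrite big_ord_recr big_ord0 /= add0r.
rewrite big_ord_recr /= IH /blk /= -mulrDl -CD -natrD; congr (_%:R%:C * _).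
have h : 4 ^+ n <= 4 ^+ n.+1 :> R := lo_le n.+1; have h0 : 0 < 4 ^+ n :> R by rewrite exprn_gt0.
have [a|a] := leP s (4 ^+ n); first by rewrite (le_trans a h) andbT; case: (0 < s); rewrite ?andbF.
by rewrite andbF (lt_trans h0 a).
Qed.

Lemma Lap_sum f (r : R) : (forall j, cI (blk f j)) -> cI (fun s => (0 < s)%R%:R%:C * f s) ->
  cmod (\sum_(j < n.+1) Lap (blk f j) r%:C - cint (fun s => (0 < s)%R%:R%:C * f s * expi (- (2 * s * r)))) @[n --> \oo] --> 0.
Proof.
move=> cb cf; pose E s : R[i] := expi (- (2 * s * r)).
have EE s : cexp (- 2%:R%:C * (0 +i* 1) * s%:C * r%:C) = E s.
  by rewrite /E -cexp_imag; congr cexp; cx_ring.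
have mE : cmeas E by apply: cmeas_expi; apply: measurable_funN; apply: measurable_funM => //; exact: measurable_funM.
have S n : \sum_(j < n.+1) Lap (blk f j) r%:C = cint (fun s => (0 < s <= 4 ^+ n)%R%:R%:C * f s * E s).
  rewrite -(cint_sum (index_enum 'I_n.+1) (F := fun (j : 'I_n.+1) s => blk f j s * cexp (- 2%:R%:C * (0 +i* 1) * s%:C * r%:C))); last first.
    by move=> j; apply: (lap_cI (B := 0) (cb j) (@supp_blk f j)); rewrite normr0 mulr0.
  by apply: eq_cint => s; rewrite -mulr_suml blk_sum EE.
rewrite (_ : (fun n => _) = (fun n => cmod (cint (fun s => (0 < s <= 4 ^+ n)%R%:R%:C * f s * E s) - cint (fun s => (0 < s)%R%:R%:C * f s * E s)))); last first.
  by apply/funext => n; rewrite S.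
have cut s n : (0 < s <= 4 ^+ n)%R%:R%:C * f s = (s <= 4 ^+ n)%R%:R%:C * ((0 < s)%R%:R%:C * f s).
  by rewrite mulrA -CM -natrM mulnb andbC.
have [] // := @cdct _ (fun n s => (0 < s <= 4 ^+ n)%R%:R%:C * f s * E s) (fun s => (0 < s)%R%:R%:C * f s * E s)
  (fun s => cmod ((0 < s)%R%:R%:C * f s)).
- move=> n; apply: cmeasM => //; rewrite (_ : (fun s => _) = (fun s => (s <= 4 ^+ n)%R%:R%:C * ((0 < s)%R%:R%:C * f s))); last exact/funext.
  by apply: cmeasM; [apply: cmeasC; exact: meas_le|exact: cI_meas].
- by apply: cmeasM => //; exact: cI_meas.
- exact: cI_cmod.
- apply: aeT => s; apply/seq_cvg0P => // e e0; have [N hN] := exists_nat_ge s.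
  exists N => n /hN sn; rewrite cut (_ : s <= 4 ^+ n) ?mul1r ?subrr ?cmod0//; apply: le_trans sn _.
  by apply: le_trans (_ : 2 ^+ n <= _); [rewrite -natrX ler_nat ltnW// ltn_expl|apply: lerXn2r; rewrite ?nnegrE// ler_nat].
- apply: aeT => s n; rewrite cut !cmodM cmod_expi mulr1 cmod_real ger0_norm// ler_piMl ?mulr_ge0//.
  by rewrite lern1 leq_b1.
Qed.

Variables (q : R -> R) (alpha : R).
Hypotheses (a1 : 1 <= alpha) (mq : meas q) (iq : rI (fun x => `|q x| * (1 + `|x|) `^ alpha)).

Lemma weight_ge1 s : 1 <= (1 + `|s|) `^ alpha.
Proof.
apply: le_trans (_ : (1 + `|s|) `^ 0 <= _); first by rewrite powRr0.
by apply: ler_powR; [rewrite lerDl|exact: le_trans a1].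
Qed.

Lemma rI_q : rI q.
Proof. by apply: (rI_le mq iq) => x; rewrite ler_peMr//; exact: weight_ge1. Qed.

Definition tau j := intg (fun s => (lo j < s)%R%:R * `|q s|).

Lemma meas_gt (a : R) : meas (fun s => (a < s)%R%:R : R).
Proof.
rewrite (_ : (fun s => _) = (fun s => 1 - (s <= a)%R%:R)); first by apply: measurable_funB => //; exact: meas_le.
by apply/funext => s; rewrite ltNge; case: (s <= a); rewrite ?subrr ?subr0.
Qed.

Lemma rI_tail a : rI (fun s => (a < s)%R%:R * `|q s|).
Proof.
have iq' := rI_norm rI_q; apply: (rI_le _ iq') => [|s].
  by apply: measurable_funM; [exact: meas_gt|exact: rI_meas].
by rewrite normrM normr_id ger0_norm// ler_piMl// lern1 leq_b1.
Qed.

Lemma tau_ge0 j : 0 <= tau j. Proof. by apply: intg_ge0 => s; rewrite mulr_ge0. Qed.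

Lemma blk_dom f D j : 0 <= D -> cmeas f -> (forall s, cmod (f s) <= D * `|q s|) ->
  cI (blk f j) /\ intg (fun s => cmod (blk f j s)) <= D * tau j.
Proof.
move=> D0 mf h; have le s : cmod (blk f j s) <= D * ((lo j < s)%R%:R * `|q s|).
  rewrite cmod_blk mulrCA; apply: ler_pM => //; rewrite ler_nat.
  by case: (lo j < s); rewrite ?leq_b1.
have i := rIZ D (rI_tail (lo j)); have c : cI (blk f j) by exact: cI_le (cmeas_blk j mf) i le.
by split => //; rewrite /tau -intgZ; [apply: le_intg => //; exact: cI_cmod|exact: rI_tail].
Qed.

Lemma cI_pos f D : cmeas f -> (forall s, cmod (f s) <= D * `|q s|) -> cI (fun s => (0 < s)%R%:R%:C * f s).
Proof.
move=> mf h; apply: (cI_le _ (rIZ D (rI_norm rI_q))) => [|s]; first by apply: cmeasM => //; apply: cmeasC; exact: meas_gt.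
by rewrite cmodM cmod_real ger0_norm//; apply: le_trans (h s); rewrite ler_piMl// lern1 leq_b1.
Qed.

Variable kk : nat.
Hypotheses (k2 : (1 < kk)%N) (ka : kk%:R <= 2 * alpha).

Lemma geometric_weight n : \sum_(j < n.+1) 2 ^+ (j * kk) <= 2 * 2 ^+ (n * kk) :> R.
Proof.
elim: n => [|n IH]; first by rewrite big_ord_recr big_ord0 /= mul0n expr0; lra.
rewrite big_ord_recr /=; apply: le_trans (lerD IH (lexx _)) _.
rewrite mulSn exprD; have : 2 <= 2 ^+ kk :> R by rewrite -[leLHS]expr1; apply: ler_weXn2l; rewrite ?ler1n// ltnW.
have : 0 < 2 ^+ (n * kk) :> R by rewrite exprn_gt0.
by nra.
Qed.

Lemma pow_weight i s : 4 ^+ i < s -> 2 ^+ (i * kk) <= (1 + `|s|) `^ alpha.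
Proof.
move=> h; have s0 : 4 ^+ i <= 1 + `|s| by have := ler_norm s; lra.
have p0 : 0 <= 4 ^+ i :> R by exact: exprn_ge0.
apply: le_trans (_ : (4 ^+ i) `^ alpha <= _).
  (* The exponent kk/2 is at most alpha. *)
  rewrite (_ : 2 ^+ (i * kk) = (4 ^+ i) `^ (kk%:R / 2)); first by apply: ler_powR; [rewrite exprn_ege1 ?ler1n|have := ka; lra].
  rewrite (_ : 4 ^+ i = (2 ^+ i) `^ 2); last by rewrite powR_mulrn ?exprn_ge0// -exprM mulnC exprM expr2 -natrM.
  by rewrite -powRrM mulrC divfK// powR_mulrn ?exprn_ge0// -exprM.
by apply: ge0_ler_powR; rewrite ?nnegrE// ?addr_ge0//; apply: le_trans a1.
Qed.

(** Only the blocks starting left of s count. Their geometric sum is at most twice its last term,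
    and that term is 2^kk times a power bounded by [pow_weight], or 1 for the first block. *)
Lemma sum_weight M s : \sum_(j < M) 2 ^+ (j * kk) * (lo j < s)%R%:R <= 2 ^+ kk.+2 * (1 + `|s|) `^ alpha.
Proof.
have P1 := weight_ge1 s.
elim: M => [|M IH]; first by rewrite big_ord0 mulr_ge0 ?exprn_ge0// powR_ge0.
have [h|h] := ltP (lo M) s; last by rewrite big_ord_recr /= ltNge h mulr0 addr0.
apply: le_trans (_ : \sum_(j < M.+1) 2 ^+ (j * kk) <= _).
  by apply: ler_sum => j _; rewrite ler_piMr ?exprn_ge0// lern1 leq_b1.
apply: le_trans (geometric_weight M) _; rewrite -[kk.+2]addn2 exprD -mulrA mulrC -mulrA.
have b1 : 1 <= 2 ^+ kk :> R by rewrite exprn_ege1// ler1n.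
case: M h {IH} => [|i] /= h.
  rewrite mul0n expr0 mul1r; apply: le_trans (ler_pM _ _ b1 (_ : 2 <= _)); rewrite ?mul1r//.
  by lra.
rewrite mulSn exprD -mulrA ler_wpM2l ?exprn_ge0//.
by have := pow_weight h; lra.
Qed.

(** The moment of order alpha is spent here: exchanging sum and integral leaves |q| times the weight
    of [sum_weight]. *)
Lemma tau_sum M : \sum_(j < M) 2 ^+ (j * kk) * tau j <= 2 ^+ kk.+2 * intg (fun x => `|q x| * (1 + `|x|) `^ alpha).
Proof.
have [i e] : rI (fun s => \sum_(j < M) 2 ^+ (j * kk) * ((lo j < s)%R%:R * `|q s|)) /\
    intg (fun s => \sum_(j < M) 2 ^+ (j * kk) * ((lo j < s)%R%:R * `|q s|)) = \sum_(j < M) 2 ^+ (j * kk) * tau j.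
  elim: M => [|M [i e]].
    split; first by apply: eq_rI (rI0 R) => s; rewrite big_ord0.
    by rewrite big_ord0 -[RHS](intg0 R); apply: eq_intg => s; rewrite big_ord0.
  have i2 := rIZ (2 ^+ (M * kk)) (rI_tail (lo M)); rewrite big_ord_recr /= -e /tau -intgZ ?rI_tail// -intgD//.
  by split; [apply: eq_rI (rID i i2)|apply: eq_intg] => s; rewrite big_ord_recr.
rewrite -e -intgZ//; apply: le_intg => //; first exact: rIZ.
move=> s; rewrite (eq_bigr (fun j : 'I_M => 2 ^+ (j * kk) * (lo j < s)%R%:R * `|q s|)) => [|j _]; last by rewrite mulrA.
by rewrite -mulr_suml mulrCA mulrC; apply: ler_wpM2l => //; exact: sum_weight.
Qed.

(** Block j has length at most 4^j and contributes at most D 4^j tau j; 4^j <= 2^(j kk) because kk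
    >= 2, so [tau_sum] bounds the total. *)
Lemma tail_integrable p D : 0 <= D -> cmeas p ->
  (forall j, {ae mu, forall s, lo j < s <= 4 ^+ j -> cmod (p s) <= D * tau j}) -> cI (fun s => (0 < s)%R%:R%:C * p s).
Proof.
move=> D0 mp hp; have mm : cmeas (fun s => (0 < s)%R%:R%:C * p s) by apply: cmeasM => //; apply: cmeasC; exact: meas_gt.
have B j := blk_bounded (mulr_ge0 D0 (tau_ge0 j)) mp (hp j).
apply: cI_of_cmod => //; apply: rI_ge0 => [||]; [exact: meas_cmod|by []|].
pose SS := D * (2 ^+ kk.+2 * intg (fun x => `|q x| * (1 + `|x|) `^ alpha)).
apply: le_lt_trans (ltry SS).
have cs n : cI (fun s => \sum_(j < n.+1) blk p j s) by apply: cI_sum => j; case: (B j).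
apply: (fatou_le (f_ := fun n s => cmod (\sum_(j < n.+1) blk p j s))) => [n|//||n].
- by apply: meas_cmod; exact: cI_meas.
- apply: aeT => s; apply/cvgrPdist_le => e e0; have [N hN] := exists_nat_ge s.
  exists N => // n /= /hN sn; rewrite blk_sum (_ : s <= 4 ^+ n) ?andbT ?subrr ?normr0 ?(ltW e0)//; apply: le_trans sn _.
  by apply: le_trans (_ : 2 ^+ n <= _); [rewrite -natrX ler_nat ltnW// ltn_expl|apply: lerXn2r; rewrite ?nnegrE// ler_nat].
rewrite eint_intg; last exact: cI_cmod.
rewrite lee_fin /SS; apply: le_trans (ler_wpM2l D0 (tau_sum n.+1)); rewrite mulr_sumr.
elim: n => [|n IH].
  rewrite !big_ord_recr !big_ord0 /= !add0r; rewrite (eq_intg (g := fun s => cmod (blk p 0 s))); last first.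
    by move=> s; rewrite big_ord_recr big_ord0 /= add0r.
  by have [_ _ h _] := B 0%N; rewrite expr0 mulr1 in h; rewrite mul0n expr0 mul1r.
have [cb _ hb _] := B n.+1; rewrite [leRHS]big_ord_recr; apply: le_trans (lerD IH _).
  apply: le_trans (_ : intg (fun s => cmod (\sum_(j < n.+1) blk p j s) + cmod (blk p n.+1 s)) <= _).
    apply: le_intg => [||s]; [exact: cI_cmod|by apply: rID; exact: cI_cmod|].
    by rewrite big_ord_recr; exact: cmodD.
  by rewrite intgD; [exact: lexx|exact: cI_cmod|exact: cI_cmod].
apply: le_trans hb _; rewrite /= mulrAC -!mulrA; apply: ler_wpM2l => //.
have t0 := tau_ge0 n.+1; apply: ler_pM => //.
rewrite pow4.
by apply: ler_weXn2l; rewrite ?ler1n// leq_mul2l k2 orbT.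
Qed.

End dyadic_blocks.

(** * Block decomposition of the symbol *)

Section symbols.
Variable R : realType.
Implicit Types (u v : R -> R[i]) (U : R[i] -> R[i]) (z : R[i]) (r s x e N : R) (j n l : nat).
Local Notation ii := (0 +i* 1 : R[i]).

Lemma upper_ge1 z : 0 <= Im z -> 1 <= cmod (z + ii).
Proof. by move=> h; apply: le_trans (cmod_ge_Im _); rewrite ImD /= lerDr. Qed.

Lemma upper_ge z : 0 <= Im z -> cmod z <= cmod (z + ii).
Proof.
move=> h; rewrite -(@ler_pXn2r _ 2) ?nnegrE// !cmod_sqr !ReD !ImD /= addr0 lerD2l.
by rewrite ler_pXn2r ?nnegrE ?addr_ge0// lerDl.
Qed.

Lemma upper_inv_le1 z : 0 <= Im z -> cmod (z + ii)^-1 <= 1.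
Proof. by move=> /upper_ge1 h; rewrite cmodV invf_le1// (lt_le_trans ltr01). Qed.

Lemma ck_i r : ck ii r = (r%:C + ii)^-1. Proof. by []. Qed.

Variables (M : nat).

(* 1 - w0 z = z^2 / (z + i)^2 cancels the double pole of G_- at 0. *)
Definition w0 z : R[i] := (2%:R%:C * ii * z - 1) * (z + ii)^-1 ^+ 2.
Definition sgm z : R[i] := \sum_(m < M) w0 z ^+ m.
Definition Bs : R := \sum_(m < M) 3 ^+ m.

Lemma w0_le z : 0 <= Im z -> cmod (w0 z) <= 3 * cmod (z + ii)^-1.
Proof.
move=> h; have h1 := upper_ge1 h; have h2 := upper_ge h; have p0 : 0 < cmod (z + ii) by exact: lt_le_trans h1.
rewrite cmodM cmodX cmodV expr2 mulrA ler_wpM2r ?invr_ge0// ler_pdivrMr//; apply: le_trans (cmodB _ _) _.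
rewrite cmod1 !cmodM cmod_real cmod_imag normr1 mulr1 ger0_norm//; lra.
Qed.

Lemma w0_le3 z : 0 <= Im z -> cmod (w0 z) <= 3.
Proof. by move=> h; apply: le_trans (w0_le h) _; rewrite ler_piMr ?upper_inv_le1. Qed.

Lemma sgm_le z : 0 <= Im z -> cmod (sgm z) <= Bs.
Proof.
move=> h; apply: le_trans (cmod_sum _ _ _) _; apply: ler_sum => m _.
by rewrite cmodX; apply: lerXn2r; rewrite ?nnegrE// w0_le3.
Qed.

Lemma sgm_geometric z : z + ii != 0 -> 1 - w0 z ^+ M = z ^+ 2 * (z + ii)^-1 ^+ 2 * sgm z.
Proof.
move=> h; rewrite -opprB subrX1 -/(sgm z) -mulNr opprB; congr (_ * _).
rewrite /w0 (_ : 2%:R%:C * ii * z - 1 = (z + ii) ^+ 2 - z ^+ 2); first by field.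
have : ii ^+ 2 = -1 by apply: cx_ext; rewrite expr2 !ReImE /= ?ReN ?ImN /=; ring.
by rewrite C_nat sqrrD => ->; ring.
Qed.

(** T is the analytic extension of T_+, and p1 + p2 will be Q', with p1 dominated by |q| pointwise
    and p2 by the tail integral of |q|. *)
Variables (T : R[i] -> R[i]) (MT : R) (q : R -> R) (p1 p2 : R -> R[i]) (D : R).
Hypotheses (hT : holo (fun z => 0 < Im z) T) (bT : forall z, 0 < Im z -> cmod (T z) <= MT) (MT0 : 0 <= MT).
Variables (alpha : R) (kk : nat).
Hypotheses (a1 : 1 <= alpha) (mq : meas q) (iq : rI (fun x => `|q x| * (1 + `|x|) `^ alpha)).
Hypotheses (k2 : (1 < kk)%N) (ka : kk%:R <= 2 * alpha) (D1 : 1 <= D).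
Hypotheses (mp1 : cmeas p1) (mp2 : cmeas p2) (hp1 : forall s, cmod (p1 s) <= D * `|q s|).
Hypothesis hp2 : forall j, {ae mu, forall s, lo R j < s <= 4 ^+ j -> cmod (p2 s) <= D * tau q j}.

Let qC s := (q s)%:C.
Let D0 : 0 <= D. Proof. exact: le_trans D1. Qed.
Let t0 j : 0 <= tau q j. Proof. exact: tau_ge0. Qed.

Lemma blkq j : cI (blk qC j) /\ intg (fun s => cmod (blk qC j s)) <= D * tau q j.
Proof. by apply: (blk_dom a1 mq iq) => // s; rewrite cmod_real ler_peMl. Qed.

Lemma blk1 j : cI (blk p1 j) /\ intg (fun s => cmod (blk p1 j s)) <= D * tau q j.
Proof. exact: (blk_dom a1 mq iq). Qed.

Lemma blk2 j : [/\ cI (blk p2 j), l2 (blk p2 j), intg (fun s => cmod (blk p2 j s)) <= D * tau q j * 4 ^+ j &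
  nrm (blk p2 j) <= D * tau q j * 2 ^+ j].
Proof. by apply: blk_bounded => //; exact: mulr_ge0. Qed.

(** The j-th block of (1 - w0^M) G_-: by [sgm_geometric] the factor z^2 of 1 - w0^M clears the
    denominators 2iz and (2iz)^2 = - 4 z^2. *)
Definition Phi j z : R[i] := sgm z *
  (z * Lap (blk qC j) z * (2%:R%:C * ii)^-1 - (Lap (blk p1 j) z + Lap (blk p2 j) z) * 4^-1) * (z + ii)^-1 ^+ 2.
Definition F j z := T z * Phi j z.

(** The symbol without its phase, applied to u: the remainder rho w0^M on the real line as block 0,
    and each analytic block times the extension U of u on its own line. *)
Definition Fam (rho : R -> R[i]) U u n r : R[i] :=
  if n is j.+1 then F j (r +i* 4^-1 ^+ j) * U (r +i* 4^-1 ^+ j) else rho r * w0 r%:C ^+ M * u r.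

Let E2 : R := expR 2.
Let E21 : 1 <= E2. Proof. by rewrite -[X in X <= _]expR0 ler_expR. Qed.

Lemma Lap_blk f j e r (B : R) : cI (blk f j) -> 0 <= e <= 4^-1 ^+ j -> intg (fun s => cmod (blk f j s)) <= B ->
  cmod (Lap (blk f j) (r +i* e)) <= E2 * B.
Proof.
move=> cb /andP[e0 e1] hB; have S1 : 4 ^+ j * `|Im (r +i* e)| <= 1.
  rewrite [Im _]/= ger0_norm//; apply: le_trans (_ : 4 ^+ j * 4^-1 ^+ j <= _); first by rewrite ler_wpM2l.
  by rewrite -exprMn divff ?expr1n.
by apply: le_trans (Lap_le cb (@supp_blk R f j) S1) _; rewrite mulr1 ler_wpM2l ?expR_ge0.
Qed.

(* An analytic function U with boundary values u; both 1 and the elements of the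
   Hardy space qualify, the latter with N the norm. *)
Definition weight U u N := [/\ holo (fun z => 0 < Im z) U, cmeas u,
  {ae mu, forall r, small_cvg (fun e => cmod (U (r +i* e) - u r))},
  l2 (fun r => u r * ck ii r) /\ nrm (fun r => u r * ck ii r) <= N &
  forall e, 0 < e -> [/\ l2 (fun r => U (r +i* e) * (r +i* e + ii)^-1),
    nrm (fun r => U (r +i* e) * (r +i* e + ii)^-1) <= N &
    forall j, e <= 4^-1 ^+ j -> l2 (fun r => Lap (blk p2 j) (r +i* e) * U (r +i* e)) /\
      nrm (fun r => Lap (blk p2 j) (r +i* e) * U (r +i* e)) <= 2 * E2 * D * (4 ^+ j * tau q j) * N]].

Lemma holo_Lap f j (P : R[i] -> Prop) : cI (blk f j) -> holo P (Lap (blk f j)).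
Proof. by move=> h z _; apply: (@Lap_cder _ _ (4 ^+ j) z h) (@supp_blk R f j); exact: exprn_ge0. Qed.

Lemma holo_Phi j : holo (fun z => -1 < Im z) (Phi j).
Proof.
have hi : holo (fun z => -1 < Im z) (fun z : R[i] => (z + ii)^-1).
  by apply: holo_inv_shift => z h; apply: Im_neq0; rewrite ImD /= gt_eqF//; lra.
have [c1 _] := blkq j; have [c2 _] := blk1 j; have [c3 _ _ _] := blk2 j.
have hw : holo (fun z => -1 < Im z) w0.
  apply: holoM; last exact: holoX.
  apply: (@holoD _ _ _ (fun=> -1)); last exact: holo_cst.
  by apply: holoM; [exact: holo_cst|exact: holo_id].
apply: holoM; last exact: holoX.
apply: holoM.
  rewrite /sgm; elim: M => [|m IH].
    by rewrite (_ : (fun z => _) = (fun=> 0)); [exact: holo_cst|apply/funext => z; rewrite big_ord0].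
  rewrite (_ : (fun z => _) = (fun z => \sum_(i < m) w0 z ^+ i + w0 z ^+ m)); last by apply/funext => z; rewrite big_ord_recr.
  by apply: holoD => //; exact: holoX.
rewrite (_ : (fun z => _) = (fun z => z * Lap (blk qC j) z * (2%:R%:C * ii)^-1 + (Lap (blk p1 j) z + Lap (blk p2 j) z) * - 4^-1)); last first.
  by apply/funext => z; rewrite mulrN.
apply: holoD; apply: holoM; try exact: holo_cst.
  by apply: holoM; [exact: holo_id|exact: holo_Lap].
by apply: holoD; exact: holo_Lap.
Qed.

Lemma holo_F j : holo (fun z => 0 < Im z) (F j).
Proof. by apply: holoM => // z h; apply: holo_Phi; apply: lt_trans h; rewrite ltrN10. Qed.

(** The term with q spends one power of 1/(z + i) on its factor z. Both powers are kept for p2,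
    whose transform is larger by a factor 4^j. *)
Lemma Phi_le j z : 0 <= Im z -> cmod (Phi j z) <= Bs * ((cmod (Lap (blk qC j) z) + cmod (Lap (blk p1 j) z)) *
  cmod (z + ii)^-1 + cmod (Lap (blk p2 j) z) * cmod (z + ii)^-1 ^+ 2).
Proof.
move=> h; have h1 := upper_inv_le1 h; have h2 := upper_ge h; have p0 := cmod_ge0 (z + ii)^-1.
rewrite /Phi (cmodM _ ((z + ii)^-1 ^+ 2)) (cmodM (sgm z)) cmodX -mulrA; apply: ler_pM => //; [by rewrite mulr_ge0// sqr_ge0|exact: sgm_le|].
set X := cmod (_ - _); set a := Lap (blk qC j) z; set b1 := Lap (blk p1 j) z; set b2 := Lap (blk p2 j) z.
have hX : X <= cmod z * cmod a + cmod b1 + cmod b2.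
  apply: le_trans (cmodB _ _) _; rewrite !cmodM !cmodV -addrA; apply: lerD.
    rewrite (cmodM 2%:R%:C) cmod_real cmod_imag normr1 mulr1 ger0_norm//.
    by rewrite ler_piMr ?mulr_ge0// invf_le1// ler1n.
  apply: le_trans (_ : cmod (b1 + b2) * 1 <= _); last by rewrite mulr1 cmodD.
  by rewrite ler_wpM2l// -(C_nat R 4) cmod_real ger0_norm// invf_le1// ler1n.
have zz : cmod z * cmod (z + ii)^-1 <= 1.
  by rewrite cmodV ler_pdivrMr ?mul1r// (lt_le_trans ltr01)// upper_ge1.
apply: le_trans (ler_wpM2r (sqr_ge0 _) hX) _; set w := cmod (z + ii)^-1 in p0 h1 zz *.
rewrite mulrDl lerD2r mulrDl mulrDl; apply: lerD.
  by rewrite (_ : cmod z * cmod a * w ^+ 2 = cmod a * w * (cmod z * w)); [rewrite ler_piMr// mulr_ge0|ring].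
by rewrite expr2 mulrA ler_piMr// mulr_ge0.
Qed.

Definition CF := MT * Bs * (2 * E2 * D).

Lemma Bs_ge0 : 0 <= Bs. Proof. by apply: sumr_ge0 => m _; exact: exprn_ge0. Qed.
Lemma CF_ge0 : 0 <= CF. Proof. by rewrite !mulr_ge0 ?Bs_ge0 ?expR_ge0. Qed.

(** X will be the phase with its factors 2iz. The terms with q and p1 use its bound A; the term with
    p2 uses the bound B of X (z + i)^-2, which has to make up for 4^j. *)
Lemma F_line U u N j e (X : R -> R[i]) (A B : R) : weight U u N -> 0 < e <= 4^-1 ^+ j -> 0 <= A -> 0 <= B ->
  cmeas X -> (forall r, cmod (X r) <= A) -> (forall r, cmod (X r) * cmod (r +i* e + ii)^-1 ^+ 2 <= B) ->
  l2 (fun r => X r * (F j (r +i* e) * U (r +i* e))) /\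
  nrm (fun r => X r * (F j (r +i* e) * U (r +i* e))) <= CF * tau q j * (A + 4 ^+ j * B) * N.
Proof.
move=> [hU _ _ _ hw] /andP[e0 e1] A0 B0 mX hA hB; have [lG nG /(_ j e1)[lB nB]] := hw e e0.
have [c1 i1] := blkq j; have [c2 i2] := blk1 j.
have e01 : 0 <= e <= 4^-1 ^+ j by rewrite e1 ltW.
pose G r := U (r +i* e) * (r +i* e + ii)^-1; pose W r := Lap (blk p2 j) (r +i* e) * U (r +i* e).
pose cA := MT * Bs * A * (2 * (E2 * (D * tau q j))); pose cB := MT * Bs * B.
have mB0 : 0 <= MT * Bs by rewrite mulr_ge0 ?Bs_ge0.
have E0 : 0 <= E2 by exact: expR_ge0.
have cA0 : 0 <= cA by rewrite !mulr_ge0 ?Bs_ge0.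
have cB0 : 0 <= cB by rewrite mulr_ge0.
have mh H : holo (fun z => 0 < Im z) H -> cmeas (fun r : R => H (r +i* e)).
  by move=> hH; apply: ccont_cmeas; exact: holo_line_ccont hH e0.
have mV : cmeas (fun r => X r * (F j (r +i* e) * U (r +i* e))).
  by apply: cmeasM => //; apply: cmeasM; apply: mh => //; exact: holo_F.
have le r : cmod (X r * (F j (r +i* e) * U (r +i* e))) <= cA * cmod (G r) + cB * cmod (W r).
  have z0 : 0 <= Im (r +i* e) by exact: ltW.
  rewrite /G /W /F; move: (Phi_le j z0) (bT (z := r +i* e) e0) (Lap_blk r c1 e01 i1) (Lap_blk r c2 e01 i2) (hA r) (hB r).
  set w := cmod (r +i* e + ii)^-1; rewrite (cmodM (X r)) (cmodM (_ * _)) (cmodM (T _)) (cmodM (U _)) (cmodM (Lap _ _)) -/w.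
  move: (cmod_ge0 (Phi j (r +i* e))) (cmod_ge0 (T (r +i* e))) (cmod_ge0 (Lap (blk qC j) (r +i* e)))
    (cmod_ge0 (Lap (blk p1 j) (r +i* e))) (cmod_ge0 (Lap (blk p2 j) (r +i* e))) (cmod_ge0 (X r)) (cmod_ge0 (U (r +i* e)))
    (cmod_ge0 (r +i* e + ii)^-1); rewrite -/w.
  move: (cmod (Phi _ _)) (cmod (T _)) (cmod (Lap (blk qC j) _)) (cmod (Lap (blk p1 j) _)) (cmod (Lap (blk p2 j) _)) (cmod (X r)) (cmod (U _)) w.
  move=> f T' a b c X' U' w f0 T0 a0 b0 c0 X0 U0 w0' hf hT' ha hb hX hX'.
  have s1 : T' * f <= MT * (Bs * ((a + b) * w + c * w ^+ 2)) by apply: ler_pM.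
  apply: le_trans (_ : X' * (MT * (Bs * ((a + b) * w + c * w ^+ 2)) * U') <= _).
    by rewrite ler_wpM2l// ler_wpM2r.
  rewrite (_ : X' * (MT * (Bs * ((a + b) * w + c * w ^+ 2)) * U') =
    MT * Bs * (X' * (a + b)) * (U' * w) + MT * Bs * (X' * w ^+ 2) * (c * U')); last by ring.
  apply: lerD; apply: ler_wpM2r; rewrite ?mulr_ge0//; last exact: ler_wpM2l.
  rewrite /cA -[leRHS]mulrA; apply: ler_wpM2l => //; apply: ler_pM => //; first exact: addr_ge0.
  by rewrite mulr2n mulrDl mul1r lerD.
have lG' := l2Z cA%:C lG; have lB' := l2Z cB%:C lB.
pose Y (r : R) := (cmod (cA%:C * G r) + cmod (cB%:C * W r))%:C.
have lc f : l2 f -> l2 (fun r => (cmod (f r))%:C).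
  move=> lf; have [mf _] := lf; apply: (l2_dom _ lf) => [|r]; first by apply: cmeasC; exact: meas_cmod.
  by rewrite cmod_real ger0_norm.
have nc f : nrm (fun r => (cmod (f r))%:C) = nrm f.
  by rewrite /nrm /nsq; congr Num.sqrt; apply: eq_intg => r; rewrite cmod_real ger0_norm.
have lY : l2 Y by apply: (eq_l2 _ (l2D (lc _ lG') (lc _ lB'))) => r; rewrite -CD.
have leY r : cmod (X r * (F j (r +i* e) * U (r +i* e))) <= cmod (Y r).
  rewrite /Y cmod_real ger0_norm ?addr_ge0// (cmodM cA%:C) (cmodM cB%:C) !cmod_real !ger0_norm//; exact: le.
have lV := l2_dom mV lY leY; split => //; apply: le_trans (nrm_dom lV lY leY) _.
rewrite (eq_nrm (g := fun r => (cmod (cA%:C * G r))%:C + (cmod (cB%:C * W r))%:C)); last by move=> r; rewrite -CD.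
apply: le_trans (nrmD (lc _ lG') (lc _ lB')) _; rewrite !nc !nrmZ// !cmod_real !ger0_norm//.
apply: le_trans (lerD (ler_wpM2l cA0 nG) (ler_wpM2l cB0 nB)) _.
by apply: eq_ler; rewrite /cA /cB /CF; ring.
Qed.

Variables (t : R) (k : nat) (rho : R -> R[i]).
Hypotheses (ht : 0 < t) (kM : (k.+1 < M)%N) (mrho : cmeas rho) (rho1 : forall r, cmod (rho r) <= 1).

(** The terms with q and p1 cost 2^(j l), the term with p2 costs 4^j 2^(j (l - 2)) with truncated
    subtraction; both are at most 2^(j max(l, 2)). *)
Definition cc n l : R := if n is j.+1 then CF * 2 ^+ l * (Cph t l + Cph t (l - 2)) * (2 ^+ (j * maxn l 2) * tau q j)
  else 2 ^+ l * 3 ^+ M.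

Lemma cc_ge0 n l : 0 <= cc n l.
Proof.
case: n => [|j] /=; first by rewrite mulr_ge0.
apply: mulr_ge0; last by apply: mulr_ge0.
by apply: mulr_ge0; [rewrite mulr_ge0 ?CF_ge0|rewrite addr_ge0 ?Cph_ge0].
Qed.

(** Each factor w0 is at most 3 / |r + i|: l of them absorb r^l and one more remains as the decay
    that makes u = 1 square integrable. *)
Lemma w0_pow l r : (l < M)%N -> cmod r%:C ^+ l * cmod (w0 r%:C ^+ M) <= 3 ^+ M * cmod (ck ii r).
Proof.
move=> lM; have h : 0 <= Im r%:C by []; rewrite cmodX ck_i.
have h1 := upper_inv_le1 h; have h2 := upper_ge h; have g1 := upper_ge1 h; set b := cmod (_ + ii)^-1 in h1 *.
have b0 : 0 <= b := cmod_ge0 _; have h3 : cmod r%:C * b <= 1.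
  by rewrite /b cmodV ler_pdivrMr ?mul1r// (lt_le_trans ltr01).
apply: le_trans (_ : cmod r%:C ^+ l * (3 * b) ^+ M <= _).
  by rewrite ler_wpM2l ?exprn_ge0//; apply: lerXn2r; rewrite ?nnegrE ?mulr_ge0//; exact: w0_le.
rewrite exprMn mulrCA ler_wpM2l ?exprn_ge0// -(subnKC lM) exprD exprS mulrA mulrA mulrAC.
have x1 : cmod r%:C ^+ l * b ^+ l <= 1 by rewrite -exprMn exprn_ile1// mulr_ge0.
have x2 : b ^+ (M - l.+1) <= 1 by rewrite exprn_ile1.
rewrite [leLHS](_ : _ = (cmod r%:C ^+ l * b ^+ l) * b ^+ (M - l.+1) * b); last by ring.
by rewrite ler_piMl//; apply: mulr_ile1; rewrite ?mulr_ge0 ?exprn_ge0.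
Qed.

Lemma Fam_admissible U u N : 0 <= N -> weight U u N -> admissible t k cc (Fam rho U u) N.
Proof.
move=> N0 hw; split => // n l x lk; have CE1 : 1 <= CE t x.
  by rewrite -[X in X <= _]expR0 ler_expR addr_ge0// mulr_ge0// ltW.
have C0 : 0 <= CE t x by exact: le_trans CE1.
have hE (e : R) : cmeas (fun r => (2%:R%:C * ii * (r +i* e)) ^+ l * Ex t x (r +i* e)).
  apply: ccont_cmeas; apply: (@holo_line_ccont _ (fun z => (2%:R%:C * ii * z) ^+ l * Ex t x z) (e - 1)); last lra.
  move=> w _; apply: (holoM (P := fun=> True)) => //; last exact: holo_Ex.
  by apply: holoX; apply: holoM; [exact: holo_cst|exact: holo_id].
have X2 z : cmod ((2%:R%:C * ii * z) ^+ l * Ex t x z) = 2 ^+ l * (cmod z ^+ l * cmod (Ex t x z)).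
  rewrite (cmodM (_ ^+ l)) cmodX (cmodM (_ * _) z) (cmodM 2%:R%:C) cmod_real cmod_imag normr1 mulr1 ger0_norm// exprMn.
  by rewrite mulrA.
case: n => [|j]; last first.
  have P0 m : 0 <= Cph t m by exact: Cph_ge0.
  have w2 : 0 <= 2 ^+ l :> R by exact: exprn_ge0.
  pose A := 2 ^+ l * (CE t x * Cph t l * 2 ^+ (j * l)); pose B := 2 ^+ l * (CE t x * Cph t (l - 2) * 2 ^+ (j * (l - 2))).
  have A0 : 0 <= A by do ![apply: mulr_ge0 => //]; exact: exprn_ge0.
  have B0 : 0 <= B by do ![apply: mulr_ge0 => //]; exact: exprn_ge0.
  have e0 : 0 < (4^-1 ^+ j : R) <= 4^-1 ^+ j by apply/andP; split => //; exact: quarter_gt0.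
  have hA r : cmod ((2%:R%:C * ii * (r +i* 4^-1 ^+ j)) ^+ l * Ex t x (r +i* 4^-1 ^+ j)) <= A.
    by rewrite X2 ler_wpM2l//; exact: phase_power_bound.
  have hB r : cmod ((2%:R%:C * ii * (r +i* 4^-1 ^+ j)) ^+ l * Ex t x (r +i* 4^-1 ^+ j)) *
      cmod (r +i* 4^-1 ^+ j + ii)^-1 ^+ 2 <= B.
    set z := r +i* _; have z0 : 0 <= Im z by exact/ltW/quarter_gt0.
    rewrite X2 -mulrA ler_wpM2l//; apply: le_trans (phase_power_bound ht (l - 2) x j r); rewrite -/z mulrAC ler_wpM2r//.
    have h1 := upper_inv_le1 z0; have h3 : cmod z * cmod (z + ii)^-1 <= 1.
      by rewrite cmodV ler_pdivrMr ?mul1r ?upper_ge// (lt_le_trans ltr01)// upper_ge1.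
    move: h1 h3; move: (cmod_ge0 z) (cmod_ge0 (z + ii)^-1); move: (cmod z) (cmod (z + ii)^-1) => a b a0 b0 b1 ab.
    have ab0 : 0 <= a * b by exact: mulr_ge0.
    (* For l = 0 and l = 1 the difference l - 2 is 0, so both factors 1/(z + i) are simply bounded,
       together with |z| when l = 1. *)
    case: (l) => [|[|m]]; first by rewrite !expr0 mul1r exprn_ile1.
      by rewrite expr1 expr0 expr2 mulrA; apply: mulr_ile1.
    by rewrite subSS subSS subn0 -addn2 exprD -mulrA -exprMn ler_piMr ?exprn_ge0// exprn_ile1.
  have [lV nV] := F_line hw e0 A0 B0 (hE (4^-1 ^+ j)) hA hB.
  split; first exact: lV.
  apply: le_trans nV _; rewrite ler_wpM2r// /cc (_ : CF * tau q j * (A + 4 ^+ j * B) =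
    CE t x * (CF * 2 ^+ l * (Cph t l * 2 ^+ (j * l) + Cph t (l - 2) * (4 ^+ j * 2 ^+ (j * (l - 2)))) * tau q j)); last by rewrite /A /B; ring.
  rewrite ler_wpM2l// [leRHS]mulrA ler_wpM2r// -[leRHS]mulrA.
  apply: ler_wpM2l; first by rewrite mulr_ge0 ?CF_ge0.
  rewrite mulrDl; apply: lerD; apply: ler_wpM2l => //.
    by apply: ler_weXn2l; rewrite ?ler1n// leq_mul2l leq_maxl orbT.
  by rewrite pow4 -exprD -mulnDr -maxnE maxnC.
have lM : (l < M)%N by exact: leq_ltn_trans kM.
have [_ mu' _ [lu nu] _] := hw.
have le r : cmod (V t (Fam rho U u) 0 l x r) <= 2 ^+ l * 3 ^+ M * cmod (u r * ck ii r).
  rewrite /V cmodM -[r +i* hgt R 0]/(r%:C) X2 cmod_Ex_real mulr1 /Fam (cmodM (_ * _)) (cmodM (rho r)) (cmodM (u r)).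
  have := w0_pow r lM; move: (cmod_ge0 (w0 r%:C ^+ M)) (cmod_ge0 r%:C); move: (cmod (w0 _ ^+ M)) (cmod r%:C) => w b w0' b0 hb.
  rewrite [leLHS](_ : _ = 2 ^+ l * (cmod (rho r) * (b ^+ l * w)) * cmod (u r)); last by ring.
  rewrite [leRHS](_ : _ = 2 ^+ l * (1 * (3 ^+ M * cmod (ck ii r))) * cmod (u r)); last by ring.
  apply: ler_wpM2r => //; apply: ler_wpM2l; first exact: exprn_ge0.
  by apply: ler_pM => //; rewrite mulr_ge0 ?exprn_ge0.
have mr : cmeas (fun r : R => r%:C) by apply: cmeasC; exact: measurable_id.
have mV : cmeas (V t (Fam rho U u) 0 l x).
  apply: cmeasM; first exact: hE; apply: cmeasM => //; apply: cmeasM => //; apply: cmeasX.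
  apply: cmeasM; first by apply: cmeasB; [apply: cmeasM => //; exact: cmeas_cst|exact: cmeas_cst].
  by apply: cmeasX; apply: cmeasV; apply: cmeasD => //; exact: cmeas_cst.
have B0 : 0 <= 2 ^+ l * 3 ^+ M :> R by rewrite mulr_ge0.
have lV : l2 (V t (Fam rho U u) 0 l x).
  apply: (l2_dom mV (l2Z (2 ^+ l * 3 ^+ M)%:C lu)) => r; rewrite (cmodM _%:C) cmod_real ger0_norm//; exact: le.
split => //; apply: le_trans (nrm_le_mul B0 lV lu le) _; rewrite /cc.
by apply: le_trans (ler_wpM2l B0 nu) _; rewrite -mulrA ler_peMl// mulr_ge0.
Qed.

Lemma weight_hardy u : hardy u -> weight (Ext u) u (nrm u).
Proof.
move=> hu; have lu := hardy_l2 hu; have i0 : 0 < Im ii by rewrite /= ltr01.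
have inv (v : R -> R[i]) e : 0 <= e -> l2 v -> l2 (fun r => v r * (r +i* e + ii)^-1) /\ nrm (fun r => v r * (r +i* e + ii)^-1) <= nrm v.
  move=> e0 lv; have m : cmeas (fun r : R => (r +i* e + ii)^-1).
    by apply: cmeasV; apply: cmeasD; [exact: cmeas_ReIm|exact: cmeas_cst].
  have b r : cmod (r +i* e + ii)^-1 <= 1 by exact: upper_inv_le1.
  split; first by apply: (eq_l2 _ (l2_bmul m b lv)) => r; rewrite mulrC.
  by rewrite -[leRHS]mul1r -(eq_nrm (f := fun r => (r +i* e + ii)^-1 * v r)) => [|r]; [exact: nrm_bmul m b lv|rewrite mulrC].
split; [by move=> z; exact: Ext_cder|by case: lu|exact: Ext_boundary|exact: (inv u 0)|].
move=> e e0; have [lE nE] := Ext_line lu e0; have [l n] := inv _ _ (ltW e0) lE.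
split => //; first exact: le_trans nE.
move=> j ej; have [c2 _ i2 _] := blk2 j; have E0 : 0 <= E2 by exact: expR_ge0.
have b r : cmod (Lap (blk p2 j) (r +i* e)) <= E2 * (D * tau q j * 4 ^+ j) by apply: Lap_blk => //; rewrite ej (ltW e0).
have m : cmeas (fun r => Lap (blk p2 j) (r +i* e)).
  by apply: ccont_cmeas; exact: (holo_line_ccont (c := 0) (fun z h => @holo_Lap p2 j (fun=> True) c2 z I)).
split; first exact: l2_bmul m b lE.
apply: le_trans (nrm_bmul m b lE) _; apply: ler_pM => //; first by rewrite !mulr_ge0.
rewrite (_ : 2 * E2 * D * (4 ^+ j * tau q j) = 2 * (E2 * (D * tau q j * 4 ^+ j))); last by ring.
by rewrite ler_peMl ?ler1n// !mulr_ge0.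
Qed.

(** Here the product of U with the transform of p2 is square integrable by Plancherel; sqrt pi is
    the norm of 1/(r + i). *)
Lemma weight_one : weight (fun=> 1) (fun=> 1) (Num.sqrt pi).
Proof.
have inv e : 0 <= e -> l2 (fun r : R => 1 * (r +i* e + ii)^-1) /\ nrm (fun r : R => 1 * (r +i* e + ii)^-1) <= Num.sqrt pi.
  move=> e0; have h : 0 < Im (0 +i* (1 + e) : R[i]) by rewrite /= ltr_wpDr.
  have E r : ck (0 +i* (1 + e)) r = 1 * (r +i* e + ii)^-1.
    by rewrite mul1r /ck; congr _^-1; cx_ring.
  have [l _] := l2_ck h; split; first exact: eq_l2 l.
  rewrite -(eq_nrm E) nrm_ck// ler_wsqrtr// ler_pdivrMr// ler_peMr ?pi_ge0//=; lra.
split; [exact: holo_cst|exact: cmeas_cst| |exact: (inv 0)|].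
  by apply: aeT => r e e0; exists 1 => // a _; rewrite subrr cmod0 ltW.
move=> e e0; have [l n] := inv _ (ltW e0); split => // j ej; have [c2 l2' _ n2] := blk2 j.
have S1 : 4 ^+ j * `|e| <= 1.
  rewrite ger0_norm ?(ltW e0)//; apply: le_trans (_ : 4 ^+ j * 4^-1 ^+ j <= _); first by rewrite ler_wpM2l.
  by rewrite -exprMn divff ?expr1n.
have [lL nL] := Lap_four (cI_meas c2) (@supp_blk R p2 j) S1 c2 l2'.
have E r : Lap (blk p2 j) (r +i* e) = Lap (blk p2 j) (r +i* e) * 1 by rewrite mulr1.
split; first exact: eq_l2 lL.
rewrite -(eq_nrm E); apply: le_trans nL _; rewrite mulr1 sqrtrM//.
have E0 : 0 <= E2 by exact: expR_ge0.
have s2 : Num.sqrt 2 <= 2 :> R by rewrite -(@ler_pXn2r _ 2) ?nnegrE ?sqrtr_ge0// sqr_sqrtr// expr2; lra.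
have p0 : 0 <= Num.sqrt pi :> R by exact: sqrtr_ge0.
have j2 : 2 ^+ j <= 4 ^+ j :> R by apply: lerXn2r; rewrite ?nnegrE// ler_nat.
apply: le_trans (_ : 2 * Num.sqrt pi * (E2 * (D * tau q j * 4 ^+ j)) <= _); last by apply: eq_ler; ring.
apply: ler_pM; rewrite ?mulr_ge0 ?sqrtr_ge0//; first exact: ler_wpM2r.
by apply: ler_wpM2l => //; apply: le_trans n2 _; rewrite ler_wpM2l ?mulr_ge0.
Qed.

Lemma block_sum (d c : R) m : 0 <= d -> 0 <= c ->
  \sum_(n < m) (if nat_of_ord n is j.+1 then c * (2 ^+ (j * kk) * tau q j) else d) <=
  d + c * (2 ^+ kk.+2 * intg (fun x => `|q x| * (1 + `|x|) `^ alpha)).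
Proof.
move=> d0 c0; have := tau_sum a1 mq iq k2 ka; set S := 2 ^+ _ * _ => hS.
have S0 : 0 <= S by have := hS 0%N; rewrite big_ord0.
case: m => [|m]; first by rewrite big_ord0; apply: addr_ge0 => //; exact: mulr_ge0.
by rewrite big_ord_recl lerD2l [leLHS](_ : _ = \sum_(j < m) c * (2 ^+ (j * kk) * tau q j))// -mulr_sumr ler_wpM2l.
Qed.

Hypothesis kkk : (k <= kk)%N.

Lemma cc_sum : exists S, forall l m, (l <= k)%N -> \sum_(n < m) cc n l <= S.
Proof.
pose c l := CF * 2 ^+ l * (Cph t l + Cph t (l - 2)).
have c0 l : 0 <= c l by apply: mulr_ge0; [rewrite mulr_ge0 ?CF_ge0|rewrite addr_ge0 ?Cph_ge0].
pose S l := 2 ^+ l * 3 ^+ M + c l * (2 ^+ kk.+2 * intg (fun x => `|q x| * (1 + `|x|) `^ alpha)).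
have hS l m : (l <= k)%N -> \sum_(n < m) cc n l <= S l.
  move=> lk; have d0 : 0 <= 2 ^+ l * 3 ^+ M :> R by exact: mulr_ge0.
  apply: le_trans (block_sum m d0 (c0 l)); apply: ler_sum => -[[|j] jm] _ //=.
  apply: (ler_wpM2l (c0 l)); apply: ler_wpM2r => //; apply: ler_weXn2l; rewrite ?ler1n//.
  by rewrite leq_mul2l geq_max k2 (leq_trans lk kkk) orbT.
exists (\sum_(l < k.+1) S l) => l m lk; apply: le_trans (hS l m lk) _.
rewrite (bigD1 (Ordinal (lk : (l < k.+1)%N)))//= lerDl; apply: sumr_ge0 => i _.
by have := hS i 0%N; rewrite big_ord0; apply; rewrite -ltnS.
Qed.

Variable T0 : R -> R[i].
Hypotheses (mT0 : cmeas T0) (bT0 : forall r, cmod (T0 r) <= MT)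
  (cT0 : {ae mu, forall r, small_cvg (fun e => cmod (T (r +i* e) - T0 r))}).

(** Half-line transforms as they occur in G_-; the next hypothesis is the factorisation R = T_+ G_-
    multiplied by r^2. *)
Let four_pos p r := cint (fun s => (0 < s)%R%:R%:C * p s * expi (- (2 * s * r))).
Hypothesis hrho : {ae mu, forall r, rho r * r%:C ^+ 2 = T0 r *
  (r%:C * four_pos qC r * (2%:R%:C * ii)^-1 - (four_pos p1 r + four_pos p2 r) * 4^-1)}.

Definition Bd u n r : R[i] := if n is j.+1 then T0 r * Phi j r%:C * u r else rho r * w0 r%:C ^+ M * u r.

(** For l = 0 each block is brought back to the real line by [K0_shift]. *)
Lemma Lt_boundary U u N n x : 0 <= N -> weight U u N -> l2 (fun r => Ex t x r%:C * Bd u n r) /\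
  {ae mu, forall r, Lt n (V t (Fam rho U u) n 0 x) r = K0 (fun r => Ex t x r%:C * Bd u n r) r}.
Proof.
move=> N0 hw; have [_ ad] := Fam_admissible N0 hw; have [lV _] := ad n 0%N x (leq0n _).
case: n lV => [|j] lV.
  have E r : V t (Fam rho U u) 0 0 x r = Ex t x r%:C * Bd u 0 r by rewrite /V expr0 mul1r.
  split; first exact: eq_l2 lV.
  by apply: aeT => r; rewrite /= (_ : V t (Fam rho U u) 0 0 x = fun r => Ex t x r%:C * Bd u 0 r)//; exact/funext.
have [hU mu' bU _ _] := hw; have j0 := @quarter_gt0 R j.
have C0 : 0 <= CE t x by exact: expR_ge0.
have le1 : 4^-1 ^+ j <= 1 :> R by rewrite exprn_ile1// invf_le1// ler1n.
have [||||lf hf] := @K0_shift R (fun z => Ex t x z * (F j z * U z)) (fun r => Ex t x r%:C * Bd u j.+1 r)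
    (CF * tau q j * (CE t x + 4 ^+ j * CE t x) * N) (4^-1 ^+ j) _ j0.
- by apply: holoM; [exact: holo_Ex|apply: holoM => //; exact: holo_F].
- move=> e e01; have /andP[e0 e1] := e01; have bE r : cmod (Ex t x (r +i* e)) <= CE t x.
    by apply: cmod_Ex_le => //; rewrite /= ltW//= (le_trans e1).
  apply: (F_line (X := fun r => Ex t x (r +i* e)) hw e01 C0 C0 _ bE) => [|r].
    by apply: ccont_cmeas; apply: (holo_line_ccont (c := 0)) => // z h; exact: (@holo_Ex R t (fun=> True)).
  apply: le_trans (bE r); rewrite ler_piMr// exprn_ile1//.
  by apply: upper_inv_le1; exact: ltW.
- apply: cmeasM; first exact: cmeas_Ex_real.
  apply: cmeasM => //; apply: cmeasM => //; apply: ccont_cmeas.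
  by apply: (@holo_line_ccont _ _ (-1) 0 (@holo_Phi j)); rewrite ltrN10.
- apply: (aeS (aeI cT0 bU)) => r [h1 h2]; apply: small_cvgM; first exact: (@holo_small_cvg R (Ex t x) (-1) r (@holo_Ex R t _ x) (ltrN10 R)).
  by apply: small_cvgM h2; apply: small_cvgM h1 _; exact: holo_small_cvg (@holo_Phi j) (ltrN10 R).
split => //; apply: (aeS hf) => r ->; rewrite /= (_ : V _ _ _ _ _ = fun s => Ex t x (s +i* 4^-1 ^+ j) * (F j (s +i* 4^-1 ^+ j) * U (s +i* 4^-1 ^+ j)))//.
by apply/funext => s; rewrite /V expr0 mul1r.
Qed.

(** A square-integrable majorant common to all partial sums, for dominated convergence in
    [bop_symbol]. Its constant is finite by [block_sum], since 4^j tau j is summable. *)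
Lemma Bd_dom u : exists2 C, 0 <= C & forall m r, cmod (\sum_(n < m) Bd u n r) <= C * cmod (u r * ck ii r).
Proof.
have E0 : 0 <= E2 by exact: expR_ge0.
pose c := MT * Bs * (3 * (E2 * D)); have c0 : 0 <= c by rewrite !mulr_ge0 ?Bs_ge0.
have d0 : 0 <= 3 ^+ M :> R by exact: exprn_ge0.
exists (3 ^+ M + c * (2 ^+ kk.+2 * intg (fun x => `|q x| * (1 + `|x|) `^ alpha))).
  by have := block_sum 0 d0 c0; rewrite big_ord0.
move=> m r; apply: le_trans (ler_wpM2r (cmod_ge0 _) (block_sum m d0 c0)).
rewrite mulr_suml; apply: le_trans (cmod_sum _ _ _) _; apply: ler_sum => -[[|j] jm] _; rewrite [nat_of_ord _]/= (cmodM (u r)) /Bd.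
  rewrite (cmodM (rho r * _)) (cmodM (rho r)) mulrCA (mulrC _ (cmod (u r))); apply: ler_wpM2l => //.
  have := @w0_pow 0 r (leq_trans (ltn0Sn _) kM); rewrite expr0 mul1r; apply: le_trans.
  by rewrite ler_piMl.
have z0 : 0 <= Im r%:C by []; have e0 : 0 <= (0 : R) <= 4^-1 ^+ j by rewrite lexx exprn_ge0 ?invr_ge0.
have [cq iq'] := blkq j; have [c1 i1] := blk1 j; have [c2 _ i2 _] := blk2 j.
rewrite (cmodM (T0 r * _)) (cmodM (T0 r)) mulrCA (mulrC _ (cmod (u r))); apply: ler_wpM2l => //.
rewrite /c -!mulrA; apply: ler_pM => //; apply: le_trans (Phi_le j z0) _; apply: ler_wpM2l; first exact: Bs_ge0.
move: (Lap_blk r cq e0 iq') (Lap_blk r c1 e0 i1) (Lap_blk r c2 e0 i2) (upper_inv_le1 z0); rewrite ck_i.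
move: (cmod_ge0 (r%:C + ii)^-1) (cmod_ge0 (Lap (blk p2 j) r%:C)).
rewrite -[r +i* 0]/(r%:C); move: (cmod _^-1) (cmod (Lap (blk qC j) _)) (cmod (Lap (blk p1 j) _)) (cmod (Lap (blk p2 j) _)) => w a b d w0' d0' ha hb hd w1.
have t1 : 4 ^+ j * tau q j <= 2 ^+ (j * kk) * tau q j.
  apply: ler_wpM2r => //; rewrite pow4.
  by apply: ler_weXn2l; rewrite ?ler1n// leq_mul2l k2 orbT.
have t2 : tau q j <= 4 ^+ j * tau q j by rewrite ler_peMl// exprn_ege1// ler1n.
apply: le_trans (_ : (a + b + d) * w <= _).
  by rewrite [leRHS]mulrDl lerD2l expr2 mulrA ler_piMr// mulr_ge0.
rewrite [leRHS](_ : _ = 3 * (E2 * D) * (2 ^+ (j * kk) * tau q j) * w); last by ring.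
apply: ler_wpM2r => //.
apply: le_trans (_ : 3 * (E2 * D) * (4 ^+ j * tau q j) <= _); last by rewrite -!mulrA !ler_wpM2l.
have : E2 * (D * tau q j) <= E2 * D * (4 ^+ j * tau q j) by rewrite mulrA ler_wpM2l ?mulr_ge0.
by move: ha hb hd; rewrite (_ : E2 * (D * tau q j * 4 ^+ j) = E2 * D * (4 ^+ j * tau q j)); [lra|ring].
Qed.

(** rho = rho w0^M + rho (1 - w0^M): block 0 is the first term, and the other blocks recompose the
    second through [hrho] and [Lap_sum]. *)
Lemma Bd_cvg u : {ae mu, forall r, cmod (\sum_(n < m) Bd u n r - rho r * u r) @[m --> \oo] --> 0}.
Proof.
have cp1 := cI_pos a1 mq iq mp1 hp1.
have cq : cI (fun s => (0 < s)%R%:R%:C * qC s).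
  by apply: (cI_pos a1 mq iq (D := 1)) => [|s]; [exact: cmeasC|rewrite mul1r cmod_real].
have cp2 := tail_integrable a1 mq iq k2 ka D0 mp2 hp2.
apply: (aeS hrho) => r hr.
have La := Lap_sum r (fun j => (blkq j).1) cq; have L1 := Lap_sum r (fun j => (blk1 j).1) cp1.
have L2 : cmod (\sum_(j < n.+1) Lap (blk p2 j) r%:C - four_pos p2 r) @[n --> \oo] --> 0.
  by apply: Lap_sum cp2 => j; case: (blk2 j).
pose w := T0 r * sgm r%:C * (r%:C + ii)^-1 ^+ 2 * u r.
pose c1 := cmod (w * (r%:C * (2%:R%:C * ii)^-1)); pose c2 := cmod (w * 4^-1).
have n0 : r%:C + ii != 0 by apply: Im_neq0; rewrite ImD /= add0r oner_eq0.
have key m : cmod (\sum_(n < m.+2) Bd u n r - rho r * u r) <= c1 * cmod (\sum_(j < m.+1) Lap (blk qC j) r%:C - four_pos qC r) +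
    (c2 * cmod (\sum_(j < m.+1) Lap (blk p1 j) r%:C - four_pos p1 r) + c2 * cmod (\sum_(j < m.+1) Lap (blk p2 j) r%:C - four_pos p2 r)).
  have S : \sum_(j < m.+1) Bd u j.+1 r = w * (r%:C * (2%:R%:C * ii)^-1) * (\sum_(j < m.+1) Lap (blk qC j) r%:C) -
      w * 4^-1 * (\sum_(j < m.+1) Lap (blk p1 j) r%:C + \sum_(j < m.+1) Lap (blk p2 j) r%:C).
    elim: m.+1 => [|i IH]; first by rewrite !big_ord0 addr0 !mulr0 subr0.
    by rewrite !big_ord_recr /= IH /Phi /w; ring.
  have G := sgm_geometric n0.
  rewrite big_ord_recl [nat_of_ord _]/= (_ : \sum_(i < m.+1) _ = \sum_(j < m.+1) Bd u j.+1 r)// S.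
  rewrite (_ : rho r * u r = rho r * w0 r%:C ^+ M * u r + rho r * r%:C ^+ 2 * ((r%:C + ii)^-1 ^+ 2 * sgm r%:C * u r)); last first.
    by rewrite -{1}[rho r]mulr1 -{1}(subrK (w0 r%:C ^+ M) 1) G; ring.
  rewrite hr; set a := \sum_(j < _) Lap (blk qC j) _; set b := \sum_(j < _) Lap (blk p1 j) _; set d := \sum_(j < _) Lap (blk p2 j) _.
  rewrite [X in cmod X](_ : _ = w * (r%:C * (2%:R%:C * ii)^-1) * (a - four_pos qC r) -
    (w * 4^-1 * (b - four_pos p1 r) + w * 4^-1 * (d - four_pos p2 r))); last by rewrite /Bd /w; ring.
  apply: le_trans (cmodB _ _) _; rewrite (cmodM _ (a - _)) lerD2l; apply: le_trans (cmodD _ _) _.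
  by rewrite (cmodM _ (b - _)) (cmodM _ (d - _)).
have lim : cmod (\sum_(n < m.+2) Bd u n r - rho r * u r) @[m --> \oo] --> 0.
  apply: (cvg0_le (v := fun m => _)) => [m|]; first by apply/andP; split; [exact: cmod_ge0|exact: key].
  exact: (cvgD0 (cvgZ0 _ La) (cvgD0 (cvgZ0 _ L1) (cvgZ0 _ L2))).
apply/seq_cvg0P => // e e0; have [N hN] := (seq_cvg0P (fun m => cmod_ge0 _)).1 lim e e0.
by exists N.+2 => -[|[|m]]//; rewrite !ltnS => /hN.
Qed.

(** The same partial sums are computed twice: as operators on the shifted lines they tend to [bop],
    and as symbols on the real line they tend to sym u, with [K0] continuous in between. The case u
    = 1 gives the right side of the equation. *)
Lemma bop_symbol U u N x : 0 <= N -> weight U u N -> l2 (fun r => sym t rho x r * u r) /\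
  {ae mu, forall r, bop t (Fam rho U u) 0 x r = K0 (fun r => sym t rho x r * u r) r}.
Proof.
move=> N0 hw; have [S hS] := cc_sum; have [B _] := bop_cvg hS x (Fam_admissible N0 hw) (leq0n k).
have [_ mu' _ [lu nu] _] := hw; have [C C0 hC] := Bd_dom u.
pose X m r := \sum_(n < m) Ex t x r%:C * Bd u n r; pose Y r := sym t rho x r * u r.
have lX m : l2 (X m) by apply: l2_sum => n; case: (Lt_boundary n x N0 hw).
have mY : cmeas Y by apply: cmeasM => //; exact: cmeas_sym.
have dX m r : cmod (X m r) <= cmod (C%:C * (u r * ck ii r)).
  by rewrite /X -mulr_sumr (cmodM (Ex _ _ _)) cmod_Ex_real mul1r (cmodM C%:C) cmod_real ger0_norm.
have cX : {ae mu, forall r, cmod (X m r - Y r) @[m --> \oo] --> 0}.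
  apply: (aeS (Bd_cvg u)) => r; apply: cvg0_le => m; apply/andP; split; first exact: cmod_ge0.
  rewrite /X /Y /sym -mulr_sumr (_ : _ - _ = Ex t x r%:C * (\sum_(n < m) Bd u n r - rho r * u r)); last by ring.
  by rewrite (cmodM (Ex _ _ _)) cmod_Ex_real mul1r.
have lC := l2Z C%:C lu.
have [lY _] := l2_fatou mY lX cX (fun m => nrm_dom (lX m) lC (dX m)).
have lim := l2_dct (fun m => (lX m).1) mY lC cX dX lY; split => //.
apply: (l2cvg_unique B); have lK m := l2_K0 (lX m); have lKY := l2_K0 lY.
have cv : l2cvg (fun m => K0 (X m)) (K0 Y).
  split => // e e0; have [n hn] := (seq_cvg0P (fun m => nrm_ge0 _)).1 lim e e0.
  exists n => m /hn /ltW; apply: le_trans; rewrite (nrm_ae (g := K0 (fun r => X m r + -1 * Y r))).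
    rewrite (eq_nrm (f := fun r => X m r - Y r) (g := fun r => X m r + -1 * Y r)) => [|r]; last by rewrite mulN1r.
    exact: (nrm_K0 (l2D (lX m) (l2Z (-1) lY))).
  by apply: (aeS (K0_lin (-1) (lX m) lY)) => r ->; rewrite mulN1r.
have [lB _ _] := B; apply: (l2cvg_ae lB lKY _ _ cv) => [m|]; last exact: aeT.
elim: m => [|m IH].
  apply: (aeS (K0_lin (-1) (lX 0%N) (lX 0%N))) => r; rewrite big_ord0 (_ : (fun s => X 0%N s + -1 * X 0%N s) = X 0%N).
    by rewrite mulN1r subrr.
  by apply/funext => s; rewrite /X big_ord0 mulr0 addr0.
have [lb hb] := Lt_boundary m x N0 hw.
apply: (aeS (aeI (aeI IH hb) (K0_lin 1 (lX m) lb))) => r [[e1 e2] e3].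
rewrite big_ord_recr /= -e1 e2 (_ : X m.+1 = fun s => X m s + 1 * (Ex t x s%:C * Bd u m s)); first by rewrite e3 mul1r.
by apply/funext => s; rewrite /X big_ord_recr mul1r.
Qed.

Lemma Ext_lin u v c z : l2 u -> l2 v -> 0 < Im z -> Ext (fun r => u r + c * v r) z = Ext u z + c * Ext v z.
Proof.
move=> lu lv hz; have hz' : 0 < Im (- conjc z) by rewrite ImN Im_conj opprK.
rewrite /Ext (_ : (fun r => conjc (u r + c * v r)) = (fun r => conjc (u r) + conjc c * conjc (v r))); last first.
  by apply/funext => r; rewrite conjcD conjcM.
rewrite KD ?KZ//; [|exact: l2_conj|exact: l2_conj|by apply: l2Z; exact: l2_conj].
by rewrite conjcD conjcM conjcK2 opprD mulrN.
Qed.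

Lemma CE_shift x h : `|h| <= 1 -> CE t (x + h) <= CE t x * E2.
Proof.
move=> h1; rewrite -expRD ler_expR -addrA lerD2l.
by have := ler_normD x h; lra.
Qed.

Theorem symbol_solution_smooth (y : R -> R -> R[i]) : (forall x, hardy (y x)) ->
  (forall x, {ae mu, forall r, y x r + K0 (fun s => sym t rho x s * y x s) r = - K0 (sym t rho x) r}) ->
  contractive rho -> vsm k y.
Proof.
move=> hy eqy crho; have [S hS] := cc_sum.
have S0 : 0 <= S by have := hS 0%N 0%N; rewrite big_ord0; apply.
pose fam u := Fam rho (Ext u) u; pose one := Fam rho (fun=> 1) (fun=> 1).
have ad u : hardy u -> admissible t k cc (fam u) (nrm u).
  by move=> hu; exact: (Fam_admissible (nrm_ge0 _) (weight_hardy hu)).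
have ad1 : admissible t k cc one (Num.sqrt pi) by apply: Fam_admissible weight_one; exact: sqrtr_ge0.
have bv g N l x : admissible t k cc g N -> (l <= k)%N -> hardy (bop t g l x) /\ nrm (bop t g l x) <= CE t x * S * N.
  by move=> ag lk; have [_] := bop_cvg hS x ag lk.
have s1 n l : (l + n <= k)%N -> vsm n (bop t one l).
  elim: n l => [|n IH] l ln; (split; first by move=> x; case: (bv _ _ l x ad1 (leq_trans (leq_addr _ _) ln))) => //.
  exists (bop t one l.+1); last by apply: IH; rewrite addSn -addnS.
  by apply: (bop_vd cc_ge0 hS ad1); apply: leq_trans ln; rewrite addnS ltnS leq_addr.
have rho1' : {ae mu, forall r, cmod (rho r) <= 1} by exact: aeT.
have ident u x : hardy u -> {ae mu, forall r, bop t (fam u) 0 x r = K0 (fun r => sym t rho x r * u r) r}.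
  by move=> hu; case: (bop_symbol x (nrm_ge0 u) (weight_hardy hu)).
apply: (@vsm_solution R k (fun l x u => bop t (fam u) l x) _ _ _ _ _ k y
  (* This is the negative of [bop t one 0], written in the form to which [vsm_lin] applies. *)
  (fun x r => bop t one 0 x r + (-2) * bop t one 0 x r)) => //.
- by move=> l x u lk hu; case: (bv _ _ l x (ad u hu) lk).
- move=> l x u v c lk hu hv; apply: (@bop_lin R t k cc S hS _ _ _ _ _ _ l x c (ad u hu) (ad v hv) (ad _ (hardyD hu (hardyZ c hv))) _ lk) => -[|j] r.
    by rewrite /fam /Fam; ring.
  have j0 := @quarter_gt0 R j; rewrite /fam /Fam Ext_lin//; [by ring|exact: hardy_l2|exact: hardy_l2].
- move=> l x lk; exists (CE t x * E2 * S); first by rewrite !mulr_ge0 ?expR_ge0.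
  move=> h u h1 hu; have [_ n] := bv _ _ l (x + h) (ad u hu) lk; apply: le_trans n _.
  by rewrite !ler_wpM2r//; exact: CE_shift.
- move=> l u lk hu; exact (bop_vd cc_ge0 hS (ad u hu) lk).
- move=> x; have [th tt [d d0 hd]] := sym_contraction ht mrho rho1' x crho; exists th => //; exists d => // h u hd' hu.
  by rewrite (nrm_ae (ident u (x + h) hu)); exact: hd.
- by apply: vsm_lin; exact: s1.
- move=> x; have [_ i1] := bop_symbol x (sqrtr_ge0 _) weight_one.
  apply: (aeS (aeI (eqy x) (aeI (ident _ x (hy x)) i1))) => r [E [-> ->]]; rewrite E.
  rewrite (_ : (fun r => sym t rho x r * 1) = sym t rho x); last by apply/funext => s; rewrite mulr1.
  by move: (K0 _ r) => a; ring.
Qed.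

Lemma l2_symbol x : l2 (sym t rho x).
Proof. by have [l _] := bop_symbol x (sqrtr_ge0 _) weight_one; apply: eq_l2 l => r; rewrite mulr1. Qed.

End symbols.

(** * Measurable versions and splitting of Q' *)

Section potential_data.
Variable R : realType.
Implicit Types (f Q p : R -> R[i]) (q : R -> R) (s : R).

Lemma Rintegral_itv (i : interval R) (f : R -> R) :
  Rintegral mu [set` i] f = intg (fun u => (u \in i)%:R * f u).
Proof.
rewrite /intg /Rintegral [in LHS]integral_mkcond; congr fine; apply: eq_integral => u _.
by rewrite patchE mem_setE; case: (u \in i); rewrite ?mul1r ?mul0r.
Qed.

Lemma cintegral_pos f : cintegral `[0, +oo[ f = cint (fun s => (0 < s)%R%:R%:C * f s).
Proof.
have E (u : R -> R) : Rintegral mu `[0, +oo[ u = intg (fun s => (0 < s)%R%:R * u s).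
  rewrite Rintegral_itv; apply: intg_ae; apply: (aeS (ae_neq 0)) => s s0.
  by rewrite in_itv /= andbT le0r (negbTE s0).
by apply: cx_ext; rewrite ?Re_cint ?Im_cint [LHS]E; apply: eq_intg => s; rewrite ?ReZ ?ImZ.
Qed.

(** Q' is the limit of difference quotients of a continuous function, Q being extended by its value
    at 0 to negative s. *)
Lemma cmeas_cderive Q : (forall b : R, abs_cont 0 b Q) -> {ae mu, forall s, 0 < s -> cderivable Q s} ->
  exists2 p, cmeas p & {ae mu, forall s, 0 < s -> p s = cderive Q s}.
Proof.
move=> ac hQ; pose P s := Q (Num.max 0 s); pose F n s := n.+1%:R%:C * (P (s + n.+1%:R^-1) - P s).
have cP : ccont P.
  apply: ac_ccont => a b e e0; have [d d0 hd] := ac (Num.max 0 b) e e0; exists d => // n u v h1 h2 h3.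
  apply: (hd n (fun i => Num.max 0 (u i)) (fun i => Num.max 0 (v i))) => [i /h1[_ [uv vb]]|i /h2 h|].
  - by rewrite le_max lexx; do !split => //; rewrite ge_max !le_max ?lexx ?uv ?vb ?orbT.
  - by rewrite ge_max !le_max lexx h orbT.
  apply: le_lt_trans h3; apply: ler_sum => i _; have [_ [uv _]] := h1 i (ltn_ord i).
  by have [a1|a1] := leP 0 (u i); have [b1|b1] := leP 0 (v i); lra.
have mP := ccont_cmeas cP.
have mF n : cmeas (F n).
  apply: cmeasM; first exact: cmeas_cst; apply: cmeasB => //; apply: (cmeas_comp mP).
  by apply: measurable_funD.
have [|p mp hp] := @cmeas_ae_lim R F (fun s => (0 < s)%R%:R%:C * cderive Q s) mF.
  apply: (aeS (aeI hQ (ae_neq 0))) => s [hs sn]; apply/seq_cvg0P => // e e0.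
  have sm d : 0 < d -> exists N, forall n, (N <= n)%N -> n.+1%:R^-1 < d :> R.
    move=> d0; have [N hN] := exists_nat_ge d^-1; exists N => n /hN h.
    by rewrite invf_plt ?posrE//; apply: le_lt_trans h _; rewrite ltr_nat.
  have [s0|s0|s0] := ltgtP 0 s; last by rewrite s0 eqxx in sn.
    have [d d0 hd] := cderivable_rder (hs s0) (divr_gt0 e0 (ltr0Sn _ 1)).
    have [N hN] := sm _ d0; exists N => n /hN h; have n0 : 0 < n.+1%:R^-1 :> R by rewrite invr_gt0.
    rewrite mul1r /F /P !max_r ?ltW ?addr_gt0//.
    have nn : n.+1%:R%:C != 0 :> R[i] by apply: C_neq0; rewrite pnatr_eq0.
    have := hd n.+1%:R^-1; rewrite ger0_norm ?(ltW n0)// => /(_ h) le.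
    rewrite [X in cmod X](_ : _ = n.+1%:R%:C * (Q (s + n.+1%:R^-1) - Q s - cderive Q s * (n.+1%:R^-1)%:C)); last by rewrite CV; field.
    rewrite cmodM cmod_real ger0_norm//; apply: le_lt_trans (ler_wpM2l _ le) _ => //.
    by rewrite mulrCA divff ?pnatr_eq0// mulr1; lra.
  have s1 : 0 < - s by lra.
  have [N hN] := sm _ s1; exists N => n /hN h; have h' : s + n.+1%:R^-1 <= 0 by rewrite -lerBrDl sub0r ltW.
  by rewrite mul0r subr0 /F /P (max_l h') (max_l (ltW s0)) subrr mulr0 cmod0.
by exists p => //; apply: (aeS hp) => s -> s0; rewrite s0 mul1r.
Qed.

(** Where |p| <= 2 |C1| |q| everything goes to p1. Elsewhere the term with C1 is less than half of
    |p| and is absorbed, leaving |p| <= 2 |C2| times the tail integral, which is at most tau j on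
    block j. *)
Lemma split_potential q p (C1 C2 : R) : meas q -> rI (fun s => `|q s|) ->
  (forall a : R, rI (fun s => (a < s)%R%:R * `|q s|)) -> cmeas p ->
  {ae mu, forall s, 0 < s -> cmod (p s) <= C1 * `|q s| + C2 * Rintegral mu `[s, +oo[ (fun u => `|q u|)} ->
  exists p1 p2 D, [/\ 1 <= D, cmeas p1, cmeas p2, forall s, p s = p1 s + p2 s & (forall s, cmod (p1 s) <= D * `|q s|) /\
    forall j, {ae mu, forall s, lo R j < s <= 4 ^+ j -> cmod (p2 s) <= D * tau q j}].
Proof.
move=> mq iq it mp hp; pose A := [set s | cmod (p s) - 2 * `|C1| * `|q s| <= 0].
have mA : measurable A.
  have mf : meas (fun s => cmod (p s) - 2 * `|C1| * `|q s|).
    apply: measurable_funB; first exact: meas_cmod; apply: measurable_funM => //; exact: measurableT_comp.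
  have := mf measurableT _ (@measurable_itv R `]-oo, 0]).
  by rewrite setTI (_ : _ @^-1` _ = A)//; apply/seteqP; split => s /=; rewrite in_itv.
pose D := 1 + 2 * `|C1| + 2 * `|C2|; have [c1 c2] := (normr_ge0 C1, normr_ge0 C2).
have m1 : cmeas (fun s => (\1_A s)%:C * p s) by apply: cmeasM => //; exact: cmeas_indic.
exists (fun s => (\1_A s)%:C * p s), (fun s => p s - (\1_A s)%:C * p s), D.
have iA s : \1_A s = (cmod (p s) - 2 * `|C1| * `|q s| <= 0)%R%:R :> R.
  by rewrite indicE; congr (nat_of_bool _)%:R; apply/idP/idP; rewrite inE.
split => [||||]; [by rewrite /D; lra|by []|exact: cmeasB|by move=> s; rewrite addrC subrK|split => [s|j]].
  rewrite iA; have q0 := normr_ge0 (q s); have [h|h] := leP (cmod (p s) - 2 * `|C1| * `|q s|) 0; last first.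
    by rewrite mul0r cmod0 mulr_ge0// /D; lra.
  by rewrite mul1r; apply: (@le_trans _ _ (2 * `|C1| * `|q s|)); [lra|apply: ler_wpM2r => //; rewrite /D; lra].
apply: (aeS hp) => s h /andP[s0 _]; have {}h := h (le_lt_trans (lo_ge0 R j) s0).
have t0 : 0 <= tau q j by apply: intg_ge0 => u; rewrite mulr_ge0.
have D0 : 0 <= D by rewrite /D; lra.
rewrite iA; have [h'|h'] := leP (cmod (p s) - 2 * `|C1| * `|q s|) 0; first by rewrite mul1r subrr cmod0 mulr_ge0.
rewrite mul0r subr0; set m := Rintegral _ _ _ in h.
have mt : 0 <= m <= tau q j.
  rewrite /m Rintegral_itv intg_ge0/= => [|u]; last by rewrite mulr_ge0.
  have le u : (u \in `[s, +oo[)%:R * `|q u| <= (lo R j < u)%R%:R * `|q u|.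
    by rewrite in_itv /= andbT ler_wpM2r// ler_nat; case: (leP s u) => // su; rewrite (lt_le_trans s0 su).
  apply: (le_intg _ (it _) le); apply: (rI_le _ (it (lo R j))) => [|u]; last by rewrite ger0_norm ?mulr_ge0//; exact: le.
  apply: measurable_funM; [exact: meas_in|exact: measurableT_comp].
case/andP: mt => m0 mt; have b1 : C1 * `|q s| <= `|C1| * `|q s| by rewrite ler_wpM2r// ler_norm.
have b2 : C2 * m <= `|C2| * m by rewrite ler_wpM2r// ler_norm.
apply: (@le_trans _ _ (2 * `|C2| * m)); first by rewrite -mulrA; move: h' h; rewrite -mulrA; lra.
by apply: ler_pM => //; rewrite /D; lra.
Qed.

End potential_data.

(** * Assembly of the theorem *)

Theorem theorem8p2 (R : realType) (alpha : R) (q : R -> R)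
  (e g : R -> R -> R[i]) (T_plus Q : R -> R[i]) (C1 C2 t : R)
  (y : R -> R -> R[i]) :
  1 <= alpha ->
  measurable_fun setT q ->
  (\int[@lebesgue_measure R]_x
     (`|q x| * (1 + `|x|) `^ alpha)%:E < +oo)%E ->
  jost_right q e ->
  jost_left q g ->
  Hinf_plus T_plus ->
  (forall b : R, absolutely_continuous 0 b Q) ->
  {ae @lebesgue_measure R, forall s, 0 < s ->
     cderivable Q s /\
     cmod (cderive Q s) <=
       C1 * `|q s| + C2 * Rintegral (@lebesgue_measure R) `[s, +oo[
                            (fun u => `|q u|)} ->
  {ae @lebesgue_measure R, forall rho,
     reflection e g rho = T_plus rho * G_minus q Q rho} ->
  0 < t ->
  let phi (x rho : R) : R[i] :=
    reflection e g rho * expi (8 * t * rho ^+ 3 + 2 * x * rho) in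
  (forall x : R, L2_plus (y ^~ x) /\ hankel_equation (phi x) (y ^~ x)) ->
  forall k : nat, k%:Z <= Num.floor (2 * alpha) ->
  exists2 Dky : R -> R -> R[i],
    partial_x_iter k y Dky & forall x : R, L2_plus (Dky ^~ x).
Proof.
move=> a1 mq iq0 he hg [F [aF [M0 hM0] /boundary_valueP bF]] ac hQ hR t0 phi hy k hk.
have iq : rI (fun x => `|q x| * (1 + `|x|) `^ alpha).
  apply: rI_ge0 iq0 => [|x]; last by rewrite mulr_ge0// powR_ge0.
  apply: measurable_funM; first exact: measurableT_comp.
  by apply: (measurableT_comp (measurable_powR _)); apply: measurable_funD => //; exact: measurableT_comp.
have q0 := rI_norm (rI_q a1 mq iq).
have q1 : rI (fun x => `|x| * `|q x|).
  apply: (rI_le _ iq) => [|x]; first by apply: measurable_funM; [exact: normr_measurable|exact: rI_meas q0].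
  rewrite ger0_norm ?mulr_ge0// mulrC ler_wpM2l//; apply: (@le_trans _ _ (1 + `|x|)); first by rewrite lerDr.
  by rewrite -[leLHS]powRr1 ?addr_ge0// ler_powR// lerDl.
have hF : holo (fun z => 0 < Im z) F by move=> w hw; exact: derivable_cder (aF w hw).
pose MT := Num.max 0 M0; have MT0 : 0 <= MT by rewrite le_max lexx.
have bT z : 0 < Im z -> cmod (F z) <= MT by move=> h; rewrite le_max hM0 ?orbT.
have hp := @half_pow_gt0 R.
have lim : {ae mu, forall r, cmod (F (r +i* 2^-1 ^+ n) - T_plus r) @[n --> \oo] --> 0}.
  apply: (aeS bF) => r h; apply/seq_cvg0P => // d d0; have [s s0 hs] := h _ (divr_gt0 d0 (ltr0Sn _ 1)).
  have [N hN] := half_pow_small s0; exists N => n Nn; apply: (@le_lt_trans _ _ (d / 2)); last lra.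
  by apply: hs; rewrite hp /= (le_trans _ (ltW hN))// ler_wiXn2l ?invr_ge0 ?invf_le1 ?ler1n.
(* [T_plus] is given only as an almost everywhere limit; the extension F on the lines Im z = 2^-n
   provides a measurable version of it. *)
have [n|T1 mT1 eT1] := @cmeas_ae_lim R (fun n r => F (r +i* 2^-1 ^+ n)) _ _ lim.
  by apply: ccont_cmeas; exact: holo_line_ccont hF (hp n).
have [T0 [mT0 bT0 eT0]] := clip MT0 mT1.
have {eT1 eT0} TE : {ae mu, forall r, T0 r = T_plus r}.
  apply: (aeS (aeI eT1 bF)) => r [e1 h]; rewrite -e1 eT0// e1; apply/ler_addgt0Pr => d d0.
  have [s s0 hs] := h d d0; have := hs s; rewrite s0 lexx cmodC => /(_ isT) h1.
  by have := bT (r +i* s) s0; have := cmodB_ge (T_plus r) (F (r +i* s)); lra.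
have cT0 : {ae mu, forall r, small_cvg (fun d => cmod (F (r +i* d) - T0 r))}.
  by apply: (aeS (aeI TE bF)) => r [->].
have [|p mp ep] := cmeas_cderive ac; first by apply: (aeS hQ) => s h /h[].
have [|p1 [p2 [D [D1 m1 m2 pE [h1 h2]]]]] := @split_potential R q p C1 C2 mq q0 (rI_tail a1 mq iq) mp.
  by apply: (aeS (aeI hQ ep)) => s [h e1] s0; rewrite e1//; case: (h s0).
(* The term with p2 costs 4^j even without derivatives, so the order is raised to at least 2, which
   alpha >= 1 allows. *)
pose kk := maxn k 2; have k2 : (1 < kk)%N by rewrite leq_max orbT.
have ka : kk%:R <= 2 * alpha.
  have : k%:R <= 2 * alpha by move: hk; rewrite floor_ge_int.
  by rewrite /kk /maxn; case: ifP => // _ _; lra.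
have D0 : 0 <= D by exact: le_trans D1.
have c2 := tail_integrable a1 mq iq k2 ka D0 m2 h2.
have cq : cI (fun s => (0 < s)%R%:R%:C * (q s)%:C).
  by apply: (cI_pos a1 mq iq (D := 1)) => [|s]; [exact: cmeasC|rewrite mul1r cmod_real].
have c1 := cI_pos a1 mq iq m1 h1.
have m0 : cmeas (fun r : R => 0 +i* (2 * r)) by apply: cmeas_ReIm => //; exact: measurable_funM.
pose fp f := four (fun s : R => (0 < s)%R%:R%:C * f s).
(* A measurable version of the reflection coefficient, read off from its factorisation. *)
pose rho1 r := T0 r * ((0 +i* (2 * r))^-1 * fp (fun s => (q s)%:C) r + ((0 +i* (2 * r)) ^+ 2)^-1 * (fp p1 r + fp p2 r)).
have mrho1 : cmeas rho1.
  apply: cmeasM => //; apply: cmeasD; apply: cmeasM; [exact: cmeasV|exact: four_meas|by apply: cmeasV; exact: cmeasX|].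
  by apply: cmeasD; exact: four_meas.
have E1 : {ae mu, forall r, reflection e g r = rho1 r}.
  apply: (aeS (aeI hR TE)) => r [-> eT]; rewrite /rho1 eT /G_minus !cintegral_pos; congr (_ * (_ * _ + _ * _)).
    by apply: eq_cint => s; rewrite mulrA -(mulrA 2) (mulrC s) -?mulrA.
  have me : meas (fun s : R => - (2 * s * r)).
    by apply: measurable_funN; apply: measurable_funM => //; exact: measurable_funM.
  rewrite /fp /four -cintD; [|exact: cI_expi|exact: cI_expi]; apply: cint_ae; apply: (aeS ep) => s h.
  by have [s0|s0] := ltP 0 s; [rewrite -h// pE !mul1r mulrDl|rewrite !mul0r addr0].
have [b1 b2 b3] := reflection_bounds q0 q1 he hg; have n0 := ae_neq (0 : R).
(* [rho] is bounded by 1 everywhere and equals R off a null set, because |R| <= 1 for r != 0. *)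
have [rho [mrho brho erho]] := clip ler01 mrho1.
have E : {ae mu, forall r, r != 0 /\ rho r = reflection e g r}.
  by apply: (aeS (aeI n0 E1)) => r [r0 e1]; rewrite e1 erho// -e1 b1.
have hrho : {ae mu, forall r, rho r * r%:C ^+ 2 = T0 r *
    (r%:C * fp (fun s => (q s)%:C) r * (2%:R%:C * (0 +i* 1))^-1 - (fp p1 r + fp p2 r) * 4^-1)}.
  apply: (aeS (aeI E E1)) => r [[r0 ->] ->]; rewrite /rho1.
  have i2 : (0 +i* 1) ^+ 2 = -1 :> R[i] by rewrite expr2; cx_ring.
  have i0 : 0 +i* 1 != 0 :> R[i] by apply: Im_neq0; rewrite /= oner_eq0.
  have rC := C_neq0 r0; rewrite (_ : 0 +i* (2 * r) = 2 * r%:C * (0 +i* 1)); last first.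
    by rewrite -C_nat -CM; cx_ring.
  by rewrite C_nat exprMn i2; field; rewrite rC i0.
have crho : contractive rho.
  split; first by move=> d /b2[c c1' h]; exists c => //; apply: (aeS E) => r [_ ->]; exact: h.
  case: b3 => [[c [d [c1' d0 h]]]|h]; [left; exists c, d; split => //|right => c /h[d d0 h']; exists d => //];
  by apply: (aeS E) => r [r0 ->] rd; auto.
(* This fixes M = k + 2: block 0 has to absorb k + 1 factors r and keep one factor 1/(r + i). *)
have kM : (k.+1 < k.+2)%N by []; have kkk : (k <= kk)%N by exact: leq_maxl.
have phiE x : {ae mu, forall r, phi x r = sym t rho x r}.
  by apply: (aeS E) => r [_ eE]; rewrite /phi /sym eE Ex_real.
have hyh x : hardy (y ^~ x) by apply: L2_plus_hardy; case: (hy x).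
have lS x := l2_symbol hF bT MT0 a1 mq iq k2 ka D1 m1 m2 h1 h2 t0 kM mrho brho kkk mT0 bT0 cT0 hrho x.
have rho1' : {ae mu, forall r, cmod (rho r) <= 1} by exact: aeT.
have sm : vsm k (fun x r => y r x).
  apply: (symbol_solution_smooth hF bT MT0 a1 mq iq k2 ka D1 m1 m2 h1 h2 t0 kM mrho brho kkk mT0 bT0 cT0 hrho hyh _ crho) => x.
  have [_ hE] := hy x; have ly := hardy_l2 (hyh x).
  have i1 := hankelE (phi := phi x) (y := y ^~ x) (l2_sym t mrho rho1' x ly).
  have i2 := hankelE (phi := phi x) (y := fun=> 1) (lS x).
  apply: (aeS (aeI hE (aeI (i1 _) (i2 _)))) => [||r [e1 [e2 e3]]].
  - by apply: (aeS (phiE x)) => r ->.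
  - by apply: (aeS (phiE x)) => r ->; rewrite mulr1.
  by rewrite -e2 -e3.
have [w pw sw] := vsm_partial sm (leqnn k).
by exists (fun r x => w x r) => // x; apply: hardy_L2_plus; exact: vsm_hardy sw.
Qed.
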